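(* Assume the density $\rho=\rho(N)$ follows one of the regimes (SubConst1), (Sub1), (SubConst2), (Sub2), (Sub3), and $L=(N/\rho)^{1/d}$. Let $r_N\in(0,1)$ be the unique solution of $rG_L'(r)=N$ and $a_N:=r_NG_L'(r_N)+r_N^2G_L''(r_N)$. Let $(j_N)$ be integers with $1\le j_N\le N$ and $j_N^2=o(a_N)$. Then $$H_{N-j}(L)\sim\frac{e^{G_L(r_N)}}{r_N^{N-j}\sqrt{2\pi a_N}}\qquad(N\to\infty),$$ uniformly in $0\le j\le j_N$.
   Context: Fix an integer $d\ge1$ and a real $\theta>0$. $X$ is a random vector in $\mathbb R^d$ with density $\varphi$, a Schwartz function, with $\mathbb E X=0$ and covariance $\operatorname{Cov}(X)$; $\varphi^{*j}$ is the $j$-fold convolution. $W_{L,j}:=\theta L^d\sum_{k\in\mathbb Z^d}\varphi^{*j}(Lk)$; $G_L(z):=\sum_{j\ge1}W_{L,j}z^j/j$ for $|z|<1$; $H_n(L)$ is defined by $\sum_{n\ge0}H_n(L)z^n=e^{G_L(z)}$ (equivalently $H_n(L)=\frac1{n!}\sum_{\sigma\in\mathcal S_n}\prod_jW_{L,j}^{C_j(\sigma)}$, $C_j(\sigma)$ the number of $j$-cycles). $\alpha_c:=\frac{\theta}{2\pi\sqrt{\det\operatorname{Cov}(X)}}$, $\rho_c:=\theta\sum_{j\ge1}\varphi^{*j}(0)$. Regimes: (SubConst1) $d=1$, $\rho\to\rho_*\in(0,\infty)$; (Sub1) $d=1$, $\rho\to\infty$, $\rho=o(\sqrt N)$; (SubConst2)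 $d=2$, $\rho\to\rho_*\in(0,\infty)$; (Sub2) $d=2$, $\rho\to\infty$, $\rho/\log N\to\alpha\in[0,\alpha_c)$; (Sub3) $d\ge3$, $\rho\to\rho_*\in(0,\rho_c)$. *)

(* Defs.v *)
From Stdlib Require Import Reals ZArith List.
Open Scope R_scope.

Fixpoint Rn (d : nat) : Type :=
  match d with O => unit | S d' => (R * Rn d')%type end.
Fixpoint Zn (d : nat) : Type :=
  match d with O => unit | S d' => (Z * Zn d')%type end.

Fixpoint vzero (d : nat) : Rn d :=
  match d return Rn d with O => tt | S d' => (0, vzero d') end.

Fixpoint vsub (d : nat) : Rn d -> Rn d -> Rn d :=
  match d return Rn d -> Rn d -> Rn d with
  | O => fun _ _ => tt
  | S d' => fun x y => (fst x - fst y, vsub d' (snd x) (snd y))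
  end.

Fixpoint zscale (d : nat) (L : R) : Zn d -> Rn d :=
  match d return Zn d -> Rn d with
  | O => fun _ => tt
  | S d' => fun k => (L * IZR (fst k), zscale d' L (snd k))
  end.

(* i-th coordinate (0-based; 0 if i >= d) *)
Fixpoint coord (d : nat) : Rn d -> nat -> R :=
  match d return Rn d -> nat -> R with
  | O => fun _ _ => 0
  | S d' => fun x i => match i with O => fst x | S i' => coord d' (snd x) i' end
  end.

Fixpoint vupd (d : nat) : Rn d -> nat -> R -> Rn d :=
  match d return Rn d -> nat -> R -> Rn d with
  | O => fun x _ _ => x
  | S d' => fun x i t =>
      match i with O => (t, snd x) | S i' => (fst x, vupd d' (snd x) i' t) end
  end.

Definition partial (d i : nat) (f g : Rn d -> R) : Prop :=
  forall x, derivable_pt_lim (fun t => f (vupd d x i t)) (coord d x i) (g x).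

Definition monom (d : nat) (a : list nat) (x : Rn d) : R :=
  fold_right (fun i acc => coord d x i * acc) 1 a.

Definition schwartz (d : nat) (f : Rn d -> R) : Prop :=
  exists D : list nat -> Rn d -> R,
    D nil = f /\
    (forall l i, (i < d)%nat -> partial d i (D l) (D (i :: l))) /\
    (forall (l a : list nat), exists C, forall x, Rabs (monom d a x * D l x) <= C).

Fixpoint box_int (d : nat) (M : R) : (Rn d -> R) -> R -> Prop :=
  match d return (Rn d -> R) -> R -> Prop with
  | O => fun f I => I = f tt
  | S d' => fun f I =>
      exists g : R -> R,
        (forall x, -M <= x <= M -> box_int d' M (fun y => f (x, y)) (g x)) /\
        exists pr : Riemann_integrable g (-M) M, RiemannInt pr = I
  end.

Definition integral (d : nat) (f : Rn d -> R) (I : R) : Prop :=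
  forall eps, 0 < eps -> exists M0, forall M, M0 <= M ->
    exists J, box_int d M f J /\ Rabs (J - I) < eps.

Fixpoint cube_sum (d : nat) (M : nat) : (Zn d -> R) -> R :=
  match d return (Zn d -> R) -> R with
  | O => fun f => f tt
  | S d' => fun f =>
      sum_f_R0 (fun i => cube_sum d' M
                  (fun k => f ((Z.of_nat i - Z.of_nat M)%Z, k))) (2 * M)
  end.

(* sum over Z^d (of a nonnegative family), as the limit over growing cubes *)
Definition Zsum (d : nat) (f : Zn d -> R) (S : R) : Prop :=
  Un_cv (fun M => cube_sum d M f) S.

(* The five regimes.  psi j = phi^{*j}; cov = Cov(X). *)
Definition regime (d : nat) (theta : R) (psi : nat -> Rn d -> R)
    (cov : nat -> nat -> R) (rho : nat -> R) : Prop :=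
  (d = 1%nat /\ exists rs, 0 < rs /\ Un_cv rho rs) \/
  (d = 1%nat /\ cv_infty rho /\ Un_cv (fun N => rho N / sqrt (INR N)) 0) \/
  (d = 2%nat /\ exists rs, 0 < rs /\ Un_cv rho rs) \/
  (d = 2%nat /\ cv_infty rho /\
     exists alpha, 0 <= alpha <
        theta / (2 * PI * sqrt (cov 0%nat 0%nat * cov 1%nat 1%nat
                                 - cov 0%nat 1%nat * cov 1%nat 0%nat)) /\
     Un_cv (fun N => rho N / ln (INR N)) alpha) \/
  ((3 <= d)%nat /\ exists rs rhoc,
      infinite_sum (fun n => theta * psi (S n) (vzero d)) rhoc /\
      0 < rs < rhoc /\ Un_cv rho rs).

(* Main.v *)
(* A random size n with law [H_n r^n / e^{G(r)}] is a compound Poisson sum: cycles of length j come with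
   independent Poisson multiplicities of mean [lam_j = W_j r^j / j].  At [r = r_N] its mean is N and its
   variance is a_N, so the claim is a local limit theorem, uniform over the values N - j with
   j = o(sqrt a_N).  It follows by Fourier inversion on [-PI, PI]: with l of order 1/(1 - r) and
   A = L^d / l^(d/2) the variance is comparable to A l^2, the third moment to A l^3, and the
   characteristic function has modulus at most exp (- c A (l t)^2) for |t| <= 1/l and
   exp (- c A sqrt (l |t|)) beyond, so that A -> oo is all that is needed.

   These bounds only use W_j >= c L^d / j^(d/2) for large j and W_j <= C (1 + L / sqrt j)^d.  For the
   upper one, the lattice sum of phi is dominated by a periodic Fejer-type kernel; for the lower one, phi
   is minorised by a combination of sinc^2 kernels.  Both comparison functions are superpositions of plane
   waves, whose convolutions with phi are explicit through the characteristic function, and pointwise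
   inequalities survive convolution with phi.

   The regimes enter only through A -> oo.  In dimension 1 the mean gives rho >= c sqrt l; in dimension 2
   it gives rho >= beta (ln l - O(1)) for every beta < alpha_c; in dimension at least 3, rho_* < rho_c
   keeps l bounded. *)

From Stdlib Require Import Reals ZArith List Lra Lia Psatz ClassicalEpsilon.
From Coquelicot Require Import Coquelicot.
Require Import Defs.
Open Scope R_scope.

(** * Integrals over boxes and over the whole space *)

(** Fourier inversion or Poisson summation for [phi^{*j}] would require integrals over frequency
    space and interchanges of limits. Instead, convolution with [phi] acts only as a positive linear
    operator, on finite superpositions of plane waves and on a quadratic polynomial, so expectation
    under [phi] is the only d-dimensional integral and no Fubini argument enters. The price is that
    finitely many commensurable waves are periodic while [phi] is not. In the upper bound the period
    is the lattice spacing [L], where this is harmless; in the lower bound the period grows with [j]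
    and the quadratic polynomial pays for the distant copies. The sharp local limit constant matters
    in the plane, where it identifies [alpha_c]; elsewhere some positive constant suffices. The
    scale [l] and the parameter [A] hide the dimension from the analysis of the size distribution:
    about [1/|t|] consecutive cycle lengths already reveal the oscillation at [t], and shorter
    cycles carry larger weights, which produces the factor [sqrt (l |t|)]. *)

Fixpoint vadd (d : nat) : Rn d -> Rn d -> Rn d :=
  match d return Rn d -> Rn d -> Rn d with
  | O => fun _ _ => tt
  | S d' => fun x y => (fst x + fst y, vadd d' (snd x) (snd y))
  end.

Fixpoint vscal (d : nat) (c : R) : Rn d -> Rn d :=
  match d return Rn d -> Rn d with
  | O => fun _ => tt
  | S d' => fun x => (c * fst x, vscal d' c (snd x))
  end.

Fixpoint dot (d : nat) : Rn d -> Rn d -> R :=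
  match d return Rn d -> Rn d -> R with
  | O => fun _ _ => 0
  | S d' => fun x y => fst x * fst y + dot d' (snd x) (snd y)
  end.

Fixpoint norm1 (d : nat) : Rn d -> R :=
  match d return Rn d -> R with
  | O => fun _ => 0
  | S d' => fun x => Rabs (fst x) + norm1 d' (snd x)
  end.

Fixpoint inbox (d : nat) (M : R) : Rn d -> Prop :=
  match d return Rn d -> Prop with
  | O => fun _ => True
  | S d' => fun x => Rabs (fst x) <= M /\ inbox d' M (snd x)
  end.

Fixpoint prodf (d : nat) (p : R -> R) : Rn d -> R :=
  match d return Rn d -> R with
  | O => fun _ => 1
  | S d' => fun x => p (fst x) * prodf d' p (snd x)
  end.

(* A total counterpart of [box_int], equal to it for locally Lipschitz integrands. *)
Fixpoint bint (d : nat) (M : R) : (Rn d -> R) -> R :=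
  match d return (Rn d -> R) -> R with
  | O => fun f => f tt
  | S d' => fun f => RInt (fun x => bint d' M (fun y => f (x, y))) (- M) M
  end.

(** A regularity class that is stable under products and slices, and for which the integral of a
    slice is continuous in the remaining coordinate; iterated Riemann integrals therefore exist. *)
Definition locally_lipschitz (d : nat) (f : Rn d -> R) : Prop :=
  forall M, 0 <= M -> exists K, 0 <= K /\ forall x y, inbox d M x -> inbox d M y ->
    Rabs (f x - f y) <= K * norm1 d (vsub d x y).

Lemma norm1_ge0 d x : 0 <= norm1 d x.
Proof.
  induction d as [|d IH]; simpl. { lra. }
  generalize (Rabs_pos (fst x)) (IH (snd x)); lra.
Qed.

Lemma norm1_vsub_self d x : norm1 d (vsub d x x) = 0.
Proof.
  induction d as [|d IH]; simpl. { reflexivity. }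
  rewrite IH, Rminus_diag, Rabs_R0; ring.
Qed.

Lemma inbox_mono d M M' x : M <= M' -> inbox d M x -> inbox d M' x.
Proof.
  intros HM. induction d as [|d IH]; simpl; auto.
  intros [H1 H2]; split; auto; lra.
Qed.

Lemma inbox_exists d x : exists M, 0 <= M /\ inbox d M x.
Proof.
  induction d as [|d IH]; simpl. { exists 0; split; auto; lra. }
  destruct (IH (snd x)) as [M [H0 HM]].
  exists (Rmax M (Rabs (fst x))). split.
  { apply Rle_trans with M; auto; apply Rmax_l. }
  split. { apply Rmax_r. }
  apply inbox_mono with M; auto; apply Rmax_l.
Qed.

Lemma box_int_S d M f I : 0 <= M ->
  box_int (S d) M f I <->
  exists g : R -> R, (forall x, -M <= x <= M -> box_int d M (fun y => f (x, y)) (g x))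
    /\ is_RInt g (-M) M I.
Proof.
  intros HM. simpl. split.
  - intros [g [H1 [pr H2]]]. exists g; split; auto.
    rewrite <- H2, <- RInt_Reals. apply (@RInt_correct R_CompleteNormedModule).
    now apply ex_RInt_Reals_1.
  - intros [g [H1 H2]]. exists g; split; auto.
    assert (E : ex_RInt g (-M) M) by now exists I.
    exists (ex_RInt_Reals_0 _ _ _ E). rewrite <- RInt_Reals. now apply is_RInt_unique.
Qed.

Lemma box_int_le d M f g I J : 0 <= M ->
  (forall x, inbox d M x -> f x <= g x) -> box_int d M f I -> box_int d M g J -> I <= J.
Proof.
  intros HM. revert f g I J. induction d as [|d IH]; intros f g I J H.
  { simpl. intros -> ->. now apply H. }
  rewrite !box_int_S by auto. intros [u [Hu Iu]] [v [Hv Iv]].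
  apply (is_RInt_le u v (-M) M); auto. { lra. }
  intros x Hx. apply (IH (fun y => f (x, y)) (fun y => g (x, y))).
  - intros y Hy. apply H. simpl; split; auto. apply Rabs_le; lra.
  - apply Hu; lra.
  - apply Hv; lra.
Qed.

Lemma box_int_unique d M f I J : 0 <= M -> box_int d M f I -> box_int d M f J -> I = J.
Proof.
  intros HM H1 H2. apply Rle_antisym.
  - apply (box_int_le d M f f); auto; intros; lra.
  - apply (box_int_le d M f f); auto; intros; lra.
Qed.

Lemma box_int_lin d M f g I J a b : 0 <= M -> box_int d M f I -> box_int d M g J ->
  box_int d M (fun x => a * f x + b * g x) (a * I + b * J).
Proof.
  intros HM. revert f g I J. induction d as [|d IH]; intros f g I J.
  { simpl. now intros -> ->. }
  rewrite !box_int_S by auto. intros [u [Hu Iu]] [v [Hv Iv]].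
  exists (fun x => a * u x + b * v x). split.
  - intros x Hx. apply IH; auto.
  - apply (@is_RInt_plus R_NormedModule); now apply (@is_RInt_scal R_NormedModule).
Qed.

Lemma box_int_ext d M f g I : 0 <= M ->
  (forall x, inbox d M x -> f x = g x) -> box_int d M f I -> box_int d M g I.
Proof.
  intros HM. revert f g I. induction d as [|d IH]; intros f g I H.
  { simpl. intros ->. now apply H. }
  rewrite !box_int_S by auto. intros [u [Hu Iu]]. exists u; split; auto.
  intros x Hx. apply IH with (fun y => f (x, y)); auto.
  intros y Hy; apply H; simpl; split; auto. apply Rabs_le; lra.
Qed.

Lemma box_int_const d M c : 0 <= M -> box_int d M (fun _ => c) (c * (2 * M) ^ d).
Proof.
  intros HM. induction d as [|d IH].
  { simpl. ring. }
  rewrite box_int_S by auto. exists (fun _ => c * (2 * M) ^ d). split; auto.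
  replace (c * (2 * M) ^ S d) with (scal (M - - M) (c * (2 * M) ^ d)).
  - apply (@is_RInt_const R_NormedModule).
  - unfold scal; simpl; unfold mult; simpl; ring.
Qed.

Lemma locally_lipschitz_slice d f x :
  locally_lipschitz (S d) f -> locally_lipschitz d (fun y => f (x, y)).
Proof.
  intros H M HM. destruct (H (Rmax M (Rabs x))) as [K [K0 HK]].
  { apply Rle_trans with M; auto; apply Rmax_l. }
  exists K; split; auto. intros y z Hy Hz.
  assert (B : forall w, inbox d M w -> inbox (S d) (Rmax M (Rabs x)) (x, w)).
  { intros w Hw; split; simpl. { apply Rmax_r. } apply inbox_mono with M; auto; apply Rmax_l. }
  generalize (HK (x, y) (x, z) (B y Hy) (B z Hz)). simpl.
  rewrite Rminus_diag, Rabs_R0, Rplus_0_l. auto.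
Qed.

Lemma continuous_of_lipschitz (g : R -> R) (x e K : R) : 0 < e ->
  (forall y, Rabs (y - x) <= e -> Rabs (g y - g x) <= K * Rabs (y - x)) -> continuous g x.
Proof.
  intros He H. apply continuity_pt_filterlim. intros eps Heps.
  assert (K' : 0 < Rabs K + 1) by (generalize (Rabs_pos K); lra).
  exists (Rmin e (eps / (Rabs K + 1))). split.
  { apply Rmin_glb_lt; auto. now apply Rdiv_lt_0_compat. }
  intros y [_ Hy]. unfold Rdist in *; simpl in *. unfold Rdist in *.
  assert (h1 := Rlt_le_trans _ _ _ Hy (Rmin_l _ _)).
  assert (h2 := Rlt_le_trans _ _ _ Hy (Rmin_r _ _)).
  apply Rle_lt_trans with ((Rabs K + 1) * Rabs (y - x)).
  - apply Rle_trans with (K * Rabs (y - x)). { apply H; lra. }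
    apply Rmult_le_compat_r. { apply Rabs_pos. } generalize (Rle_abs K); lra.
  - apply Rmult_lt_compat_l with (r := Rabs K + 1) in h2; auto.
    replace ((Rabs K + 1) * (eps / (Rabs K + 1))) with eps in h2; auto. field; lra.
Qed.

(** The slice integral moves by at most [K * (2 * M) ^ d] times the displacement of the outer
    coordinate, hence is continuous and integrable. *)
Lemma box_int_bint d M f : 0 <= M -> locally_lipschitz d f -> box_int d M f (bint d M f).
Proof.
  intros HM. revert f. induction d as [|d IH]; intros f Hf.
  { reflexivity. }
  rewrite box_int_S by auto. exists (fun x => bint d M (fun y => f (x, y))).
  assert (Hb : forall x, box_int d M (fun y => f (x, y)) (bint d M (fun y => f (x, y)))).
  { intros x. apply IH. now apply locally_lipschitz_slice. }
  split; auto. simpl. apply (@RInt_correct R_CompleteNormedModule).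
  apply (@ex_RInt_continuous R_CompleteNormedModule).
  intros x Hx. rewrite Rmin_left, Rmax_right in Hx by lra.
  (* Two-sided continuity at the endpoints [-M] and [M] needs the Lipschitz bound on a slightly
     larger box. *)
  destruct (Hf (M + 1)) as [K [K0 HK]]. { lra. }
  apply continuous_of_lipschitz with (e := 1) (K := K * (2 * M) ^ d). { lra. }
  intros y Hy.
  assert (HB : forall w z, Rabs w <= M + 1 -> Rabs z <= M + 1 ->
     bint d M (fun v => f (w, v)) - bint d M (fun v => f (z, v)) <= K * Rabs (w - z) * (2 * M) ^ d).
  { intros w z Hw Hz.
    apply (box_int_le d M (fun v => 1 * f (w, v) + (-1) * f (z, v)) (fun _ => K * Rabs (w - z))); auto.
    - intros v Hv. assert (Hv' : inbox d (M + 1) v) by (apply inbox_mono with M; auto; lra).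
      generalize (HK (w, v) (z, v) (conj Hw Hv') (conj Hz Hv')). simpl.
      rewrite norm1_vsub_self. intros h.
      generalize (Rle_trans _ _ _ (Rle_abs _) h); intros; lra.
    - replace (bint d M (fun v => f (w, v)) - bint d M (fun v => f (z, v)))
        with (1 * bint d M (fun v => f (w, v)) + (-1) * bint d M (fun v => f (z, v))) by ring.
      apply box_int_lin; auto.
    - apply box_int_const; auto. }
  assert (Ax : Rabs x <= M + 1) by (apply Rabs_le; lra).
  assert (Ay : Rabs y <= M + 1).
  { apply Rabs_le. apply Rabs_le_between in Hy. lra. }
  apply Rabs_le. split.
  - generalize (HB x y Ax Ay). rewrite (Rabs_minus_sym x y). lra.
  - generalize (HB y x Ay Ax). lra.
Qed.

Lemma bint_mono d M M' f : 0 <= M <= M' -> locally_lipschitz d f -> (forall x, 0 <= f x) ->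
  bint d M f <= bint d M' f.
Proof.
  intros HM. revert f. induction d as [|d IH]; intros f Hf Pf.
  { simpl; lra. }
  assert (Hs : forall x, locally_lipschitz d (fun y => f (x, y)))
    by (intros; now apply locally_lipschitz_slice).
  assert (P0 : forall N x, 0 <= N -> 0 <= bint d N (fun y => f (x, y))).
  { intros N x HN. apply (box_int_le d N (fun _ => 0) (fun y => f (x, y))); auto.
    - generalize (box_int_const d N 0 HN). now rewrite Rmult_0_l.
    - apply box_int_bint; auto. }
  assert (EX : forall N, 0 <= N -> ex_RInt (fun x => bint d N (fun y => f (x, y))) (- N) N).
  { intros N HN. generalize (box_int_bint (S d) N f HN Hf). rewrite box_int_S by auto.
    intros [g [H1 H2]]. exists (bint (S d) N f).
    apply is_RInt_ext with g; auto. intros x Hx.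
    rewrite Rmin_left, Rmax_right in Hx by lra.
    apply (box_int_unique d N (fun y => f (x, y))); auto.
    - apply H1; lra.
    - apply box_int_bint; auto. }
  simpl.
  set (u := fun x => bint d M (fun y => f (x, y))).
  set (v := fun x => bint d M' (fun y => f (x, y))).
  assert (E1 : ex_RInt u (-M) M) by (apply EX; lra).
  assert (E2 : ex_RInt v (-M') M') by (apply EX; lra).
  assert (E3 : ex_RInt v (-M') M).
  { apply (@ex_RInt_Chasles_1 R_CompleteNormedModule) with M'; auto; lra. }
  assert (E4 : ex_RInt v M M').
  { apply (@ex_RInt_Chasles_2 R_CompleteNormedModule) with (-M'); auto; lra. }
  assert (E5 : ex_RInt v (-M') (-M)).
  { apply (@ex_RInt_Chasles_1 R_CompleteNormedModule) with M; auto; lra. }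
  assert (E6 : ex_RInt v (-M) M).
  { apply (@ex_RInt_Chasles_2 R_CompleteNormedModule) with (-M'); auto; lra. }
  rewrite <- (RInt_Chasles v (-M') M M'), <- (RInt_Chasles v (-M') (-M) M); auto.
  unfold plus; simpl.
  assert (0 <= RInt v (-M') (-M)).
  { apply RInt_ge_0; auto. { lra. } intros; apply P0; lra. }
  assert (0 <= RInt v M M').
  { apply RInt_ge_0; auto. { lra. } intros; apply P0; lra. }
  assert (RInt u (-M) M <= RInt v (-M) M).
  { apply RInt_le; auto. { lra. } intros x _. apply IH; auto. }
  lra.
Qed.

(** * Integrals over the whole space as limits over boxes *)

Lemma integral_le d f g I J : (forall x, f x <= g x) -> integral d f I -> integral d g J -> I <= J.
Proof.
  intros H Hf Hg. apply le_epsilon. intros e He.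
  destruct (Hf (e / 2)) as [M1 H1]. { lra. }
  destruct (Hg (e / 2)) as [M2 H2]. { lra. }
  set (M := Rmax 0 (Rmax M1 M2)).
  assert (A0 : 0 <= M) by apply Rmax_l.
  assert (A1 : M1 <= M) by (eapply Rle_trans; [apply Rmax_l | apply Rmax_r]).
  assert (A2 : M2 <= M) by (eapply Rle_trans; [apply Rmax_r | apply Rmax_r]).
  destruct (H1 M A1) as [u [Hu Du]]. destruct (H2 M A2) as [v [Hv Dv]].
  assert (u <= v) by (apply (box_int_le d M f g); auto).
  apply Rabs_def2 in Du. apply Rabs_def2 in Dv. lra.
Qed.

Lemma integral_unique d f I J : integral d f I -> integral d f J -> I = J.
Proof.
  intros H1 H2. apply Rle_antisym; apply (integral_le d f f); auto; intros; lra.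
Qed.

Lemma integral_ext d f g I : (forall x, f x = g x) -> integral d f I -> integral d g I.
Proof.
  intros H Hf e He. destruct (Hf e He) as [M0 H0]. exists (Rmax 0 M0). intros M HM.
  assert (A0 : 0 <= M) by (eapply Rle_trans; [apply Rmax_l | apply HM]).
  destruct (H0 M) as [J [HJ DJ]]. { eapply Rle_trans; [apply Rmax_r | apply HM]. }
  exists J; split; auto. apply box_int_ext with f; auto.
Qed.

Lemma integral_lin d f g I J a b : integral d f I -> integral d g J ->
  integral d (fun x => a * f x + b * g x) (a * I + b * J).
Proof.
  intros Hf Hg e He.
  set (k := Rabs a + Rabs b + 1).
  assert (Hk : 0 < k) by (unfold k; generalize (Rabs_pos a) (Rabs_pos b); lra).
  assert (Hek : 0 < e / k) by now apply Rdiv_lt_0_compat.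
  destruct (Hf (e / k)) as [M1 H1]; auto.
  destruct (Hg (e / k)) as [M2 H2]; auto.
  exists (Rmax 0 (Rmax M1 M2)). intros M HM.
  assert (A0 : 0 <= M) by (eapply Rle_trans; [apply Rmax_l | apply HM]).
  assert (A1 : M1 <= M) by (eapply Rle_trans; [| apply HM]; eapply Rle_trans; [apply Rmax_l | apply Rmax_r]).
  assert (A2 : M2 <= M) by (eapply Rle_trans; [| apply HM]; eapply Rle_trans; [apply Rmax_r | apply Rmax_r]).
  destruct (H1 M A1) as [u [Hu Du]]. destruct (H2 M A2) as [v [Hv Dv]].
  exists (a * u + b * v). split. { now apply box_int_lin. }
  replace (a * u + b * v - (a * I + b * J)) with (a * (u - I) + b * (v - J)) by ring.
  eapply Rle_lt_trans. { apply Rabs_triang. } rewrite !Rabs_mult.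
  assert (Rabs a * Rabs (u - I) <= Rabs a * (e / k)) by (apply Rmult_le_compat_l; [apply Rabs_pos | lra]).
  assert (Rabs b * Rabs (v - J) <= Rabs b * (e / k)) by (apply Rmult_le_compat_l; [apply Rabs_pos | lra]).
  assert (k * (e / k) = e) by (field; lra). unfold k in *. lra.
Qed.

(** For a nonnegative integrand the box integrals increase with the box, so their supremum is their
    limit. *)
Lemma integral_exists_of_bounded d f B : locally_lipschitz d f -> (forall x, 0 <= f x) ->
  (forall M, 0 <= M -> bint d M f <= B) -> exists I, integral d f I.
Proof.
  intros Hf Pf HB.
  destruct (completeness (fun v => exists M, 0 <= M /\ v = bint d M f)) as [I [UI LI]].
  - exists B. intros v [M [HM ->]]. auto.
  - exists (bint d 0 f), 0. split; auto; lra.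
  - exists I. intros e He.
    destruct (classic (exists M, 0 <= M /\ I - e < bint d M f)) as [[M0 [P0 H0]] | N].
    + exists M0. intros M HM. exists (bint d M f). split.
      { apply box_int_bint; auto; lra. }
      assert (bint d M f <= I) by (apply UI; exists M; split; auto; lra).
      assert (bint d M0 f <= bint d M f) by (apply bint_mono; auto; lra).
      apply Rabs_def1; lra.
    + exfalso. assert (I <= I - e); [| lra].
      apply LI. intros v [M [HM ->]]. apply Rnot_lt_le. intros H. apply N. now exists M.
Qed.

(** The Cauchy density up to the factor [PI]. Its products over the coordinates are the standard
    integrable majorant, and its sums over a lattice are comparable with trigonometric
    polynomials. *)
Definition cauchy_density (x : R) : R := / (1 + x ^ 2).

Lemma cauchy_density_pos x : 0 < cauchy_density x.
Proof. apply Rinv_0_lt_compat. generalize (pow2_ge_0 x); lra. Qed.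

Lemma is_RInt_cauchy_density M : is_RInt cauchy_density (-M) M (2 * atan M).
Proof.
  replace (2 * atan M) with (minus (atan M) (atan (- M))).
  2: { rewrite atan_opp. unfold minus, plus, opp; simpl. ring. }
  apply (@is_RInt_derive R_CompleteNormedModule atan cauchy_density).
  - intros x _. unfold cauchy_density. auto_derive; auto. rewrite Rmult_1_l. reflexivity.
  - intros x _. unfold cauchy_density. apply (@ex_derive_continuous R_AbsRing R_NormedModule).
    auto_derive. generalize (pow2_ge_0 x); simpl; lra.
Qed.

(** Each coordinate contributes [2 * atan M < PI <= 4], whence the factor [4 ^ d]. *)
Lemma box_int_cauchy_bound d M f J A : 0 <= M -> 0 <= A ->
  (forall x, f x <= A * prodf d cauchy_density x) -> box_int d M f J -> J <= A * 4 ^ d.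
Proof.
  intros HM. revert f J A. induction d as [|d IH]; intros f J A HA H.
  { simpl. intros ->. apply H. }
  rewrite box_int_S by auto. intros [g [Hg Ig]].
  apply Rle_trans with (A * 4 ^ d * (2 * atan M)).
  - apply (is_RInt_le g (fun x => A * 4 ^ d * cauchy_density x) (-M) M); auto. { lra. }
    + apply (@is_RInt_scal R_NormedModule), is_RInt_cauchy_density.
    + intros x Hx. replace (A * 4 ^ d * cauchy_density x) with (A * cauchy_density x * 4 ^ d) by ring.
      apply IH with (fun y => f (x, y)).
      * apply Rmult_le_pos; auto. apply Rlt_le, cauchy_density_pos.
      * intros y. rewrite Rmult_assoc. apply (H (x, y)).
      * apply Hg; lra.
  - simpl. replace (A * (4 * 4 ^ d)) with (A * 4 ^ d * 4) by ring.
    apply Rmult_le_compat_l. { apply Rmult_le_pos; auto; apply pow_le; lra. }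
    generalize (atan_bound M) PI_4; lra.
Qed.

Lemma locally_lipschitz_bounded d f M : 0 <= M -> locally_lipschitz d f ->
  exists B, 0 <= B /\ forall x, inbox d M x -> Rabs (f x) <= B.
Proof.
  intros HM Hf. destruct (inbox_exists d (vzero d)) as [M0 [P0 H0]].
  destruct (Hf (Rmax M M0)) as [K [K0 HK]]. { apply Rle_trans with M; auto; apply Rmax_l. }
  set (N := Rmax M M0).
  assert (ND : forall d' x y, inbox d' N x -> inbox d' N y -> norm1 d' (vsub d' x y) <= INR d' * (2 * N)).
  { induction d' as [|d' IH]; intros x y Hx Hy. { simpl; lra. }
    rewrite S_INR. simpl. destruct Hx as [x1 x2], Hy as [y1 y2].
    generalize (IH _ _ x2 y2). apply Rabs_le_between in x1. apply Rabs_le_between in y1.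
    assert (Rabs (fst x - fst y) <= 2 * N) by (apply Rabs_le; lra). lra. }
  exists (Rabs (f (vzero d)) + K * (INR d * (2 * N))).
  assert (NN : 0 <= N) by (apply Rle_trans with M; auto; apply Rmax_l).
  split.
  { apply Rplus_le_le_0_compat. { apply Rabs_pos. }
    repeat apply Rmult_le_pos; auto; try lra. apply pos_INR. }
  intros x Hx. assert (Hx' : inbox d N x) by (apply inbox_mono with M; auto; apply Rmax_l).
  assert (Hz : inbox d N (vzero d)) by (apply inbox_mono with M0; auto; apply Rmax_r).
  generalize (HK _ _ Hx' Hz) (ND d _ _ Hx' Hz). intros h1 h2.
  apply Rmult_le_compat_l with (r := K) in h2; auto.
  replace (f x) with (f (vzero d) + (f x - f (vzero d))) by ring.
  generalize (Rabs_triang (f (vzero d)) (f x - f (vzero d))). lra.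
Qed.

Lemma locally_lipschitz_const d c : locally_lipschitz d (fun _ => c).
Proof.
  intros M HM. exists 0; split; [lra|]. intros. rewrite Rminus_diag, Rabs_R0. lra.
Qed.

Lemma locally_lipschitz_lin d f g a b : locally_lipschitz d f -> locally_lipschitz d g ->
  locally_lipschitz d (fun x => a * f x + b * g x).
Proof.
  intros Hf Hg M HM. destruct (Hf M HM) as [K [K0 HK]], (Hg M HM) as [L [L0 HL]].
  exists (Rabs a * K + Rabs b * L). split.
  { apply Rplus_le_le_0_compat; apply Rmult_le_pos; auto; apply Rabs_pos. }
  intros x y Hx Hy. replace (a * f x + b * g x - (a * f y + b * g y)) with
    (a * (f x - f y) + b * (g x - g y)) by ring.
  eapply Rle_trans. { apply Rabs_triang. } rewrite !Rabs_mult.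
  generalize (Rmult_le_compat_l _ _ _ (Rabs_pos a) (HK x y Hx Hy))
    (Rmult_le_compat_l _ _ _ (Rabs_pos b) (HL x y Hx Hy)). lra.
Qed.

Lemma locally_lipschitz_mult d f g : locally_lipschitz d f -> locally_lipschitz d g ->
  locally_lipschitz d (fun x => f x * g x).
Proof.
  intros Hf Hg M HM. destruct (Hf M HM) as [K [K0 HK]], (Hg M HM) as [L [L0 HL]].
  destruct (locally_lipschitz_bounded d f M HM Hf) as [A [A0 HA]].
  destruct (locally_lipschitz_bounded d g M HM Hg) as [B [B0 HB]].
  exists (A * L + B * K). split.
  { apply Rplus_le_le_0_compat; apply Rmult_le_pos; auto. }
  intros x y Hx Hy. replace (f x * g x - f y * g y) with
    (f x * (g x - g y) + g y * (f x - f y)) by ring.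
  eapply Rle_trans. { apply Rabs_triang. } rewrite !Rabs_mult.
  generalize (Rmult_le_compat _ _ _ _ (Rabs_pos _) (Rabs_pos _) (HA x Hx) (HL x y Hx Hy))
    (Rmult_le_compat _ _ _ _ (Rabs_pos _) (Rabs_pos _) (HB y Hy) (HK x y Hx Hy)). lra.
Qed.

Lemma locally_lipschitz_comp d f (h : R -> R) c : 0 <= c ->
  (forall u v, Rabs (h u - h v) <= c * Rabs (u - v)) ->
  locally_lipschitz d f -> locally_lipschitz d (fun x => h (f x)).
Proof.
  intros Hc Hh Hf M HM. destruct (Hf M HM) as [K [K0 HK]].
  exists (c * K); split. { now apply Rmult_le_pos. }
  intros x y Hx Hy. eapply Rle_trans. { apply Hh. } rewrite Rmult_assoc.
  apply Rmult_le_compat_l; auto.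
Qed.

Lemma locally_lipschitz_dot d xi : locally_lipschitz d (dot d xi).
Proof.
  intros M HM. exists (norm1 d xi). split. { apply norm1_ge0. }
  intros x y _ _. induction d as [|d IH]; simpl.
  { rewrite Rminus_diag, Rabs_R0; lra. }
  replace (fst xi * fst x + dot d (snd xi) (snd x) - (fst xi * fst y + dot d (snd xi) (snd y)))
    with (fst xi * (fst x - fst y) + (dot d (snd xi) (snd x) - dot d (snd xi) (snd y))) by ring.
  eapply Rle_trans. { apply Rabs_triang. } rewrite Rabs_mult.
  generalize (IH (snd xi) (snd x) (snd y)) (Rabs_pos (fst xi)) (Rabs_pos (fst x - fst y))
    (norm1_ge0 d (snd xi)) (norm1_ge0 d (vsub d (snd x) (snd y))). nra.
Qed.

(** Monotonicity in the box is available for nonnegative integrands, so [f] is written as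
    [(|f| + f) - |f|]. *)
Lemma integral_exists_dominated d f A : locally_lipschitz d f ->
  (forall x, Rabs (f x) <= A * prodf d cauchy_density x) -> exists I, integral d f I.
Proof.
  intros Hf HA.
  assert (Habs : locally_lipschitz d (fun x => Rabs (f x))).
  { apply locally_lipschitz_comp with 1; auto; [lra|]. intros; rewrite Rmult_1_l.
    apply Rabs_triang_inv2. }
  assert (Pp : forall d' x, 0 < prodf d' cauchy_density x).
  { induction d'; simpl; intros; [lra|]. apply Rmult_lt_0_compat; auto. apply cauchy_density_pos. }
  assert (A0 : 0 <= A).
  { generalize (Rle_trans _ _ _ (Rabs_pos _) (HA (vzero d))) (Pp d (vzero d)). nra. }
  assert (E : forall g B, locally_lipschitz d g -> (forall x, 0 <= g x) ->
     (forall x, g x <= B * prodf d cauchy_density x) -> 0 <= B -> exists I, integral d g I).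
  { intros g B Hg Pg HB B0. apply integral_exists_of_bounded with (B * 4 ^ d); auto.
    intros M HM. apply (box_int_cauchy_bound d M g); auto. apply box_int_bint; auto. }
  destruct (E (fun x => Rabs (f x)) A) as [I1 H1]; auto. { intros; apply Rabs_pos. }
  destruct (E (fun x => 1 * Rabs (f x) + 1 * f x) (2 * A)) as [I2 H2].
  - now apply locally_lipschitz_lin.
  - intros x. generalize (Rle_abs (- f x)). rewrite Rabs_Ropp. lra.
  - intros x. generalize (Rle_abs (f x)) (HA x). lra.
  - lra.
  - exists (1 * I2 + (-1) * I1).
    apply integral_ext with (fun x => 1 * (1 * Rabs (f x) + 1 * f x) + (-1) * Rabs (f x)).
    { intros; ring. } now apply integral_lin.
Qed.

Lemma box_int_ge_on_subbox d M f J m x0 del : 0 <= del ->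
  (forall x, 0 <= f x) -> (forall x, inbox d del (vsub d x x0) -> m <= f x) ->
  inbox d (M - del) x0 -> 0 <= M -> box_int d M f J -> m * (2 * del) ^ d <= J.
Proof.
  intros Hdel Pf Hm Hx0 HM. revert f J x0 Pf Hm Hx0. induction d as [|d IH]; intros f J x0 Pf Hm Hx0.
  { simpl. intros ->. rewrite Rmult_1_r. now apply Hm. }
  rewrite box_int_S by auto. intros [g [Hg Ig]].
  destruct x0 as [a x0]. destruct Hx0 as [Ha Hx0]. simpl in Ha, Hx0.
  apply Rabs_le_between in Ha.
  assert (Pg : forall x, -M <= x <= M -> 0 <= g x).
  { intros x Hx. apply (box_int_le d M (fun _ => 0) (fun y => f (x, y))); auto.
    generalize (box_int_const d M 0 HM). now rewrite Rmult_0_l. }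
  assert (E1 : ex_RInt g (-M) M) by now exists J.
  assert (E2 : ex_RInt g (-M) (a + del)).
  { apply (@ex_RInt_Chasles_1 R_CompleteNormedModule) with M; auto; lra. }
  assert (E3 : ex_RInt g (a + del) M).
  { apply (@ex_RInt_Chasles_2 R_CompleteNormedModule) with (-M); auto; lra. }
  assert (E4 : ex_RInt g (-M) (a - del)).
  { apply (@ex_RInt_Chasles_1 R_CompleteNormedModule) with (a + del); auto; lra. }
  assert (E5 : ex_RInt g (a - del) (a + del)).
  { apply (@ex_RInt_Chasles_2 R_CompleteNormedModule) with (-M); auto; lra. }
  rewrite <- (is_RInt_unique _ _ _ _ Ig).
  rewrite <- (RInt_Chasles g (-M) (a + del) M), <- (RInt_Chasles g (-M) (a - del) (a + del)); auto.
  unfold plus; simpl.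
  assert (0 <= RInt g (-M) (a - del)) by (apply RInt_ge_0; auto; [lra|]; intros; apply Pg; lra).
  assert (0 <= RInt g (a + del) M) by (apply RInt_ge_0; auto; [lra|]; intros; apply Pg; lra).
  assert (m * (2 * del) ^ d * (2 * del) <= RInt g (a - del) (a + del)).
  { replace (m * (2 * del) ^ d * (2 * del)) with (scal (a + del - (a - del)) (m * (2 * del) ^ d)).
    2: { unfold scal; simpl; unfold mult; simpl; ring. }
    apply (is_RInt_le (fun _ => m * (2 * del) ^ d) g (a - del) (a + del)).
    - lra.
    - apply (@is_RInt_const R_NormedModule).
    - apply (@RInt_correct R_CompleteNormedModule); auto.
    - intros x Hx. apply (IH (fun y => f (x, y)) (g x) x0); auto.
      + intros y Hy. apply Hm. simpl. split; auto. apply Rabs_le; lra.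
      + apply Hg; lra. }
  replace (m * (2 * del * (2 * del) ^ d)) with (m * (2 * del) ^ d * (2 * del)) by ring. lra.
Qed.

Lemma integral_ge_on_subbox d f I m x0 del : 0 <= del ->
  (forall x, 0 <= f x) -> (forall x, inbox d del (vsub d x x0) -> m <= f x) ->
  integral d f I -> m * (2 * del) ^ d <= I.
Proof.
  intros Hdel Pf Hm Hf. apply le_epsilon. intros e He.
  destruct (Hf e He) as [M0 H0]. destruct (inbox_exists d x0) as [N [N0 HN]].
  set (M := Rmax M0 (N + del)).
  assert (A1 : N + del <= M) by apply Rmax_r.
  destruct (H0 M) as [J [HJ DJ]]. { apply Rmax_l. }
  apply Rabs_def2 in DJ.
  assert (m * (2 * del) ^ d <= J); [| lra].
  apply (box_int_ge_on_subbox d M f J m x0 del); auto.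
  - apply inbox_mono with N; auto; lra.
  - lra.
Qed.

(** * Comparison of integrals with sums over grid cells *)

Fixpoint in_cell (d : nat) (h : R) : Zn d -> Rn d -> Prop :=
  match d return Zn d -> Rn d -> Prop with
  | O => fun _ _ => True
  | S d' => fun i x => Rabs (fst x - h * IZR (fst i)) <= h / 2 /\ in_cell d' h (snd i) (snd x)
  end.

Lemma RInt_le_cells (g : R -> R) (G : nat -> R) (h c : R) n : 0 < h ->
  (forall i, (i <= n)%nat -> forall x, c + h * INR i <= x <= c + h * INR (S i) -> g x <= G i) ->
  ex_RInt g c (c + h * INR (S n)) -> RInt g c (c + h * INR (S n)) <= h * sum_f_R0 G n.
Proof.
  intros Hh. induction n as [|n IH]; intros HG E.
  - replace (h * sum_f_R0 G 0) with (RInt (fun _ => G O) c (c + h * INR 1)).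
    + apply RInt_le; auto.
      * simpl; lra.
      * exists (scal (c + h * INR 1 - c) (G O)). apply (@is_RInt_const R_NormedModule).
      * intros x Hx. apply HG; auto. simpl in *; lra.
    + rewrite RInt_const. unfold scal; simpl; unfold mult; simpl; ring.
  - assert (P : 0 <= INR (S n)) by apply pos_INR. rewrite (S_INR (S n)) in *.
    assert (E1 : ex_RInt g c (c + h * INR (S n))).
    { apply (@ex_RInt_Chasles_1 R_CompleteNormedModule) with (c + h * (INR (S n) + 1)); auto. nra. }
    assert (E2 : ex_RInt g (c + h * INR (S n)) (c + h * (INR (S n) + 1))).
    { apply (@ex_RInt_Chasles_2 R_CompleteNormedModule) with c; auto. nra. }
    rewrite <- (RInt_Chasles g c (c + h * INR (S n))); auto. unfold plus; simpl sum_f_R0.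
    assert (RInt g (c + h * INR (S n)) (c + h * (INR (S n) + 1)) <= h * G (S n)).
    { replace (h * G (S n)) with (RInt (fun _ => G (S n)) (c + h * INR (S n)) (c + h * (INR (S n) + 1))).
      - apply RInt_le; auto.
        + nra.
        + eexists. apply (@is_RInt_const R_NormedModule).
        + intros x Hx. apply HG; auto. rewrite (S_INR (S n)). lra.
      - rewrite RInt_const. unfold scal; simpl; unfold mult; simpl; ring. }
    assert (RInt g c (c + h * INR (S n)) <= h * sum_f_R0 G n).
    { apply IH; auto. }
    unfold plus in *; simpl in *. lra.
Qed.

(** The box of half-side [h * (I + 1/2)] is tiled exactly by the [2 * I + 1] cells per axis centred
    at grid points, so no boundary term appears. *)
Lemma box_int_le_cells d I h f (F : Zn d -> R) J : 0 < h ->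
  (forall i x, in_cell d h i x -> f x <= F i) ->
  box_int d (h * (INR I + / 2)) f J -> J <= h ^ d * cube_sum d I F.
Proof.
  intros Hh. assert (HM : 0 <= h * (INR I + / 2)) by (generalize (pos_INR I); nra).
  revert f F J. induction d as [|d IH]; intros f F J H.
  { simpl. intros ->. rewrite Rmult_1_l. now apply H. }
  rewrite box_int_S by auto. intros [g [Hg Ig]].
  assert (EM : h * (INR I + / 2) = - (h * (INR I + / 2)) + h * INR (S (2 * I))).
  { rewrite S_INR, mult_INR. simpl. field. }
  rewrite <- (is_RInt_unique _ _ _ _ Ig). rewrite EM at 2.
  replace (h ^ S d * cube_sum (S d) I F) with (h * sum_f_R0 (fun i => h ^ d * cube_sum d I
                  (fun k => F ((Z.of_nat i - Z.of_nat I)%Z, k))) (2 * I)).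
  2: { rewrite (sum_eq _ (fun i => cube_sum d I (fun k => F ((Z.of_nat i - Z.of_nat I)%Z, k)) * h ^ d)).
       - rewrite <- scal_sum. simpl. ring.
       - intros; ring. }
  apply RInt_le_cells; auto.
  - intros i Hi x Hx.
    assert (B1 : INR i <= INR (2 * I)) by now apply le_INR.
    rewrite mult_INR in B1; simpl in B1. rewrite S_INR in Hx. assert (P := pos_INR i).
    apply IH with (fun y => f (x, y)).
    + intros k y Hk. apply H. split; auto. simpl.
      rewrite minus_IZR, <- !INR_IZR_INZ. apply Rabs_le. lra.
    + apply Hg. nra.
  - rewrite <- EM. now exists J.
Qed.

(** * Elementary inequalities *)

Lemma nonneg_of_derive (f f' : R -> R) x : 0 <= x ->
  (forall t, 0 <= t -> is_derive f t (f' t)) -> (forall t, 0 <= t -> 0 <= f' t) ->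
  f 0 <= f x.
Proof.
  intros Hx Hd Hp. destruct (MVT_gen f 0 x f') as [c [Hc E]].
  - intros t Ht. rewrite Rmin_left in Ht by lra. apply Hd; lra.
  - intros t Ht. rewrite Rmin_left in Ht by lra.
    apply continuity_pt_filterlim, (@ex_derive_continuous R_AbsRing R_NormedModule).
    eexists; apply Hd; lra.
  - rewrite Rmin_left in Hc by lra. generalize (Hp c (proj1 Hc)). nra.
Qed.

Lemma lipschitz_of_derive (f f' : R -> R) B : (forall t, is_derive f t (f' t)) ->
  (forall t, Rabs (f' t) <= B) -> forall u v, Rabs (f u - f v) <= B * Rabs (u - v).
Proof.
  intros Hd Hb u v. destruct (MVT_gen f v u f') as [c [_ ->]].
  - intros; apply Hd.
  - intros t _. apply continuity_pt_filterlim, (@ex_derive_continuous R_AbsRing R_NormedModule).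
    eexists; apply Hd.
  - rewrite Rabs_mult. apply Rmult_le_compat_r; auto. apply Rabs_pos.
Qed.

Lemma cos_lipschitz u v : Rabs (cos u - cos v) <= 1 * Rabs (u - v).
Proof.
  apply lipschitz_of_derive with (fun t => - sin t).
  - intros; auto_derive; auto; ring.
  - intros; rewrite Rabs_Ropp. apply Rabs_le, SIN_bound.
Qed.

Lemma sin_lipschitz u v : Rabs (sin u - sin v) <= 1 * Rabs (u - v).
Proof.
  apply lipschitz_of_derive with cos.
  - intros; auto_derive; auto; ring.
  - intros; apply Rabs_le, COS_bound.
Qed.

Lemma Rabs_sin_le x : Rabs (sin x) <= Rabs x.
Proof. generalize (sin_lipschitz x 0). rewrite sin_0, !Rminus_0_r. lra. Qed.

Lemma one_minus_cos x : 1 - cos x = 2 * sin (x / 2) ^ 2.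
Proof. replace x with (2 * (x / 2)) at 1 by field. rewrite cos_2a_sin. ring. Qed.

Lemma cos_ge_quadratic x : 1 - x ^ 2 / 2 <= cos x.
Proof.
  generalize (one_minus_cos x) (Rabs_sin_le (x / 2)). intros E H.
  assert (sin (x / 2) ^ 2 <= (x / 2) ^ 2); [| nra].
  rewrite <- (pow2_abs (sin _)), <- (pow2_abs (x / 2)). apply pow_incr. split; auto. apply Rabs_pos.
Qed.

Lemma sin_ge_cubic x : 0 <= x -> x - x ^ 3 / 6 <= sin x.
Proof.
  intros Hx. assert (H := nonneg_of_derive (fun t => sin t - t + t ^ 3 / 6)
    (fun t => cos t - 1 + t ^ 2 / 2) x Hx). simpl in H. rewrite sin_0 in H.
  assert (0 - 0 + 0 * (0 * (0 * 1)) / 6 <= sin x - x + x * (x * (x * 1)) / 6); [| simpl; lra].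
  apply H.
  - intros; auto_derive; auto; field.
  - intros t _. generalize (cos_ge_quadratic t). simpl; lra.
Qed.

Lemma cos_le_quartic x : 0 <= x -> cos x <= 1 - x ^ 2 / 2 + x ^ 4 / 24.
Proof.
  intros Hx. assert (H := nonneg_of_derive (fun t => - cos t + 1 - t ^ 2 / 2 + t ^ 4 / 24)
    (fun t => sin t - t + t ^ 3 / 6) x Hx). simpl in H. rewrite cos_0 in H.
  assert (-1 + 1 - 0 * (0 * 1) / 2 + 0 * (0 * (0 * (0 * 1))) / 24
     <= - cos x + 1 - x * (x * 1) / 2 + x * (x * (x * (x * 1))) / 24); [| simpl; lra].
  apply H.
  - intros; auto_derive; auto; field.
  - intros t Ht. generalize (sin_ge_cubic t Ht). simpl; lra.
Qed.

Lemma sin_taylor x : Rabs (sin x - x) <= Rabs x ^ 3 / 6.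
Proof.
  assert (P : forall y, 0 <= y -> Rabs (sin y - y) <= y ^ 3 / 6).
  { intros y Hy. generalize (sin_ge_cubic y Hy) (Rabs_sin_le y) (Rle_abs (sin y)).
    rewrite (Rabs_right y) by lra. intros.
    assert (0 <= y ^ 3) by (apply pow_le; auto). apply Rabs_le; split; lra. }
  destruct (Rle_or_lt 0 x) as [H | H].
  - rewrite (Rabs_right x) by lra. auto.
  - rewrite (Rabs_left x) by lra. rewrite <- Rabs_Ropp.
    replace (- (sin x - x)) with (sin (- x) - - x) by (rewrite sin_neg; ring). apply P; lra.
Qed.

Lemma cos_taylor x : Rabs (cos x - 1 + x ^ 2 / 2) <= Rabs x ^ 3 / 6.
Proof.
  assert (P : forall y, 0 <= y -> Rabs (cos y - 1 + y ^ 2 / 2) <= y ^ 3 / 6).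
  { intros y Hy. assert (h1 := cos_ge_quadratic y). assert (h2 := cos_le_quartic y Hy).
    assert (h3 := COS_bound y). assert (0 <= y ^ 3) by (apply pow_le; auto).
    assert (0 <= y ^ 2) by (apply pow_le; auto).
    apply Rabs_le; split; [lra|].
    (* The quartic remainder is below the cubic one up to 4; beyond that, [y ^ 2 / 2 <= y ^ 3 / 6]
       suffices because [cos y <= 1]. *)
    destruct (Rle_or_lt y 4).
    - assert (y ^ 4 / 24 <= y ^ 3 / 6); [| lra].
      replace (y ^ 4) with (y * y ^ 3) by ring. nra.
    - replace (y ^ 3) with (y * y ^ 2) by ring. nra. }
  destruct (Rle_or_lt 0 x) as [H | H].
  - rewrite (Rabs_right x) by lra. auto.
  - rewrite (Rabs_left x) by lra. replace (x ^ 2) with ((- x) ^ 2) by ring.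
    rewrite <- cos_neg. apply P; lra.
Qed.

Lemma sin_ge_half x : Rabs x <= 1 -> Rabs x / 2 <= Rabs (sin x).
Proof.
  intros H. generalize (sin_taylor x) (Rabs_triang_inv x (x - sin x)) (Rabs_pos x).
  rewrite (Rabs_minus_sym x (sin x)). replace (x - (x - sin x)) with (sin x) by ring.
  intros. assert (Rabs x ^ 3 <= Rabs x); [| lra].
  replace (Rabs x ^ 3) with (Rabs x * Rabs x ^ 2) by ring. nra.
Qed.

Lemma unit_circle_angle a b : a ^ 2 + b ^ 2 = 1 -> exists t, cos t = a /\ sin t = b.
Proof.
  intros H. assert (Ha : -1 <= a <= 1) by nra.
  assert (E : sin (acos a) = Rabs b).
  { rewrite sin_acos by auto. rewrite <- sqrt_Rsqr_abs. f_equal. unfold Rsqr; nra. }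
  destruct (Rle_or_lt 0 b).
  - exists (acos a). rewrite E, cos_acos by auto. split; auto. apply Rabs_right; lra.
  - exists (- acos a). rewrite cos_neg, sin_neg, E, cos_acos by auto. split; auto.
    rewrite Rabs_left by auto. ring.
Qed.

Lemma exp_ge_1_plus x : 1 + x <= exp x.
Proof. destruct (Req_dec x 0) as [-> | H]. { rewrite exp_0; lra. } now apply Rlt_le, exp_ineq1. Qed.

(** * Coordinates, inner products and norms on [Rn] *)

Fixpoint sumn (n : nat) (f : nat -> R) : R :=
  match n with O => 0 | S n' => f O + sumn n' (fun i => f (S i)) end.

Lemma sumn_ext n f g : (forall i, (i < n)%nat -> f i = g i) -> sumn n f = sumn n g.
Proof.
  revert f g. induction n as [|n IH]; intros f g H; simpl; auto.
  rewrite (H O) by lia. f_equal. apply IH. intros; apply H; lia.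
Qed.

Lemma sumn_scal n f c : sumn n (fun i => c * f i) = c * sumn n f.
Proof.
  revert f. induction n as [|n IH]; intros f; simpl. { ring. }
  rewrite IH. ring.
Qed.

Lemma dot_sumn d x y : dot d x y = sumn d (fun i => coord d x i * coord d y i).
Proof. induction d as [|d IH]; simpl; auto. now rewrite IH. Qed.

Definition normsq d (x : Rn d) : R := dot d x x.

Lemma normsq_ge0 d x : 0 <= normsq d x.
Proof.
  unfold normsq. induction d as [|d IH]; simpl. { lra. }
  generalize (IH (snd x)). nra.
Qed.

Lemma dot_vsub_r d z x y : dot d z (vsub d x y) = dot d z x - dot d z y.
Proof. induction d as [|d IH]; simpl. { ring. } rewrite IH. ring. Qed.

Lemma dot_vscal_l d c x y : dot d (vscal d c x) y = c * dot d x y.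
Proof. induction d as [|d IH]; simpl. { ring. } rewrite IH. ring. Qed.

Lemma dot_vscal_r d c x y : dot d x (vscal d c y) = c * dot d x y.
Proof. induction d as [|d IH]; simpl. { ring. } rewrite IH. ring. Qed.

Lemma dot_vzero_r d z : dot d z (vzero d) = 0.
Proof. induction d as [|d IH]; simpl; auto. rewrite IH; ring. Qed.

Lemma normsq_vsub d x y : normsq d (vsub d x y) = normsq d x + (-2) * dot d x y + normsq d y.
Proof. unfold normsq. induction d as [|d IH]; simpl. { ring. } rewrite IH. ring. Qed.

Lemma normsq_vscal d c x : normsq d (vscal d c x) = c ^ 2 * normsq d x.
Proof. unfold normsq. rewrite dot_vscal_l, dot_vscal_r. ring. Qed.

Lemma norm1_vscal d c x : norm1 d (vscal d c x) = Rabs c * norm1 d x.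
Proof. induction d as [|d IH]; simpl. { ring. } rewrite IH, Rabs_mult. ring. Qed.

Lemma Rabs_dot_le d x y : Rabs (dot d x y) <= norm1 d x * norm1 d y.
Proof.
  induction d as [|d IH]; simpl. { rewrite Rabs_R0; lra. }
  eapply Rle_trans. { apply Rabs_triang. } rewrite Rabs_mult.
  generalize (IH (snd x) (snd y)) (Rabs_pos (fst x)) (Rabs_pos (fst y))
   (norm1_ge0 d (snd x)) (norm1_ge0 d (snd y)). nra.
Qed.

Lemma Rabs_dot_box d x y r : inbox d r y -> Rabs (dot d x y) <= norm1 d x * r.
Proof.
  induction d as [|d IH]; simpl. { intros _. rewrite Rabs_R0; lra. }
  intros [H1 H2]. eapply Rle_trans. { apply Rabs_triang. } rewrite Rabs_mult.
  generalize (IH (snd x) (snd y) H2) (Rabs_pos (fst x)) (Rabs_pos (fst y)). nra.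
Qed.

Lemma normsq_le_norm1_sq d x : normsq d x <= norm1 d x ^ 2.
Proof.
  unfold normsq. generalize (Rabs_dot_le d x x) (Rle_abs (dot d x x)). simpl. lra.
Qed.

Lemma norm1_le_coord d x : (1 <= d)%nat ->
  exists i, (i < d)%nat /\ norm1 d x <= INR d * Rabs (coord d x i).
Proof.
  induction d as [|d IH]; intros Hd. { lia. }
  destruct d as [|d].
  { exists O. split; [lia|]. simpl. lra. }
  destruct (IH (snd x)) as [i [Hi H]]. { lia. }
  rewrite S_INR. change (norm1 (S (S d)) x) with (Rabs (fst x) + norm1 (S d) (snd x)).
  assert (P := pos_INR (S d)).
  destruct (Rle_or_lt (Rabs (fst x)) (Rabs (coord (S d) (snd x) i))).
  - exists (S i). split; [lia|]. change (coord (S (S d)) x (S i)) with (coord (S d) (snd x) i). nra.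
  - exists O. split; [lia|]. change (coord (S (S d)) x O) with (fst x). nra.
Qed.

(** Cauchy-Schwarz against the vector of ones, by induction on the dimension. *)
Lemma norm1_sq_le d x : norm1 d x ^ 2 <= INR d * normsq d x.
Proof.
  unfold normsq. induction d as [|d IH]. { simpl; lra. }
  change (norm1 (S d) x) with (Rabs (fst x) + norm1 d (snd x)).
  change (dot (S d) x x) with (fst x * fst x + dot d (snd x) (snd x)).
  rewrite S_INR. assert (H := IH (snd x)). assert (P := pos_INR d).
  assert (Q := normsq_ge0 d (snd x)). unfold normsq in Q.
  assert (N := norm1_ge0 d (snd x)).
  replace (fst x * fst x) with (Rabs (fst x) ^ 2) by (rewrite pow2_abs; ring).
  assert (A := Rabs_pos (fst x)).
  set (a := Rabs (fst x)) in *. set (n := norm1 d (snd x)) in *.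
  set (q := dot d (snd x) (snd x)) in *.
  destruct (Rle_lt_or_eq_dec 0 (INR d) P) as [D | D].
  - assert (2 * a * n <= INR d * a ^ 2 + q).
    { assert (0 <= (INR d * a - n) ^ 2) by apply pow2_ge_0.
      assert (INR d * (2 * a * n) <= INR d * (INR d * a ^ 2 + q)) by nra.
      now apply Rmult_le_reg_l with (INR d). }
    nra.
  - rewrite <- D in H. assert (n = 0) by nra. nra.
Qed.

Lemma inbox_vsub_triangle d a b x y z :
  inbox d a (vsub d x y) -> inbox d b (vsub d y z) -> inbox d (a + b) (vsub d x z).
Proof.
  induction d as [|d IH]; simpl; auto. intros [A1 A2] [B1 B2]. split; [| eapply IH; eauto].
  replace (fst x - fst z) with ((fst x - fst y) + (fst y - fst z)) by ring.
  generalize (Rabs_triang (fst x - fst y) (fst y - fst z)). lra.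
Qed.

Lemma inbox_vsub_self d x r : 0 <= r -> inbox d r (vsub d x x).
Proof.
  intros H. induction d as [|d IH]; simpl; auto. split; auto. now rewrite Rminus_diag, Rabs_R0.
Qed.

Lemma norm1_le_box d x r : inbox d r x -> norm1 d x <= INR d * r.
Proof.
  induction d as [|d IH]. { simpl; lra. } intros [H1 H2]. rewrite S_INR. simpl.
  generalize (IH _ H2). lra.
Qed.

Lemma inbox_vupd d x i s : inbox d (Rabs s) (vsub d (vupd d x i (coord d x i + s)) x).
Proof.
  revert i. induction d as [|d IH]; intros i; simpl; auto.
  destruct i as [|i]; simpl.
  - split. { replace (fst x + s - fst x) with s by ring; lra. }
    apply inbox_vsub_self, Rabs_pos.
  - split; auto. rewrite Rminus_diag, Rabs_R0; apply Rabs_pos.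
Qed.

Lemma dot_vupd d xi x i s : (i < d)%nat ->
  dot d xi (vupd d x i (coord d x i + s)) = dot d xi x + coord d xi i * s.
Proof.
  revert i. induction d as [|d IH]; intros i Hi; [lia|]. destruct i as [|i]; simpl. { ring. }
  rewrite IH by lia. ring.
Qed.

Lemma prodf_pos d p x : (forall t, 0 < p t) -> 0 < prodf d p x.
Proof.
  intros H. induction d as [|d IH]; simpl. { lra. } apply Rmult_lt_0_compat; auto.
Qed.

Lemma prodf_ge1 d p x : (forall t, 1 <= p t) -> 1 <= prodf d p x.
Proof.
  intros H. induction d as [|d IH]; simpl. { lra. }
  generalize (H (fst x)) (IH (snd x)). nra.
Qed.

Lemma prodf_inv d p q x : (forall t, p t * q t = 1) -> prodf d p x * prodf d q x = 1.
Proof.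
  intros H. induction d as [|d IH]; simpl. { ring. }
  replace (p (fst x) * prodf d p (snd x) * (q (fst x) * prodf d q (snd x))) with
   ((p (fst x) * q (fst x)) * (prodf d p (snd x) * prodf d q (snd x))) by ring.
  rewrite H, IH. ring.
Qed.

(** The square of the Japanese bracket, and exactly the reciprocal of [cauchy_density]; polynomial
    decay is measured by powers of its product over the coordinates. *)
Definition japanese (t : R) : R := 1 + t ^ 2.

Lemma japanese_ge1 t : 1 <= japanese t.
Proof. unfold japanese. generalize (pow2_ge_0 t); lra. Qed.

Lemma prodf_japanese_cauchy d x : prodf d japanese x * prodf d cauchy_density x = 1.
Proof.
  apply prodf_inv. intros t. unfold japanese, cauchy_density. field.
  generalize (pow2_ge_0 t); lra.
Qed.

Lemma norm1_le_japanese d x : norm1 d x <= INR d * prodf d japanese x.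
Proof.
  induction d as [|d IH]. { simpl; lra. }
  rewrite S_INR. simpl.
  assert (H := IH (snd x)). assert (P := prodf_ge1 d japanese (snd x) japanese_ge1).
  assert (J := japanese_ge1 (fst x)). assert (D := pos_INR d).
  assert (Rabs (fst x) <= japanese (fst x)).
  { unfold japanese. rewrite <- pow2_abs. generalize (Rabs_pos (fst x)). nra. }
  assert (INR d * prodf d japanese (snd x) <= INR d * (japanese (fst x) * prodf d japanese (snd x))).
  { apply Rmult_le_compat_l; auto. nra. }
  nra.
Qed.

(** * Characteristic functions of densities *)

Lemma locally_lipschitz_norm1 d : locally_lipschitz d (norm1 d).
Proof.
  intros M HM. exists 1; split; [lra|]. intros x y _ _. rewrite Rmult_1_l.
  induction d as [|d IH]; simpl. { rewrite Rminus_diag, Rabs_R0; lra. }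
  replace (Rabs (fst x) + norm1 d (snd x) - (Rabs (fst y) + norm1 d (snd y))) with
   ((Rabs (fst x) - Rabs (fst y)) + (norm1 d (snd x) - norm1 d (snd y))) by ring.
  eapply Rle_trans. { apply Rabs_triang. }
  generalize (IH (snd x) (snd y)) (Rabs_triang_inv2 (fst x) (fst y)). lra.
Qed.

Lemma locally_lipschitz_normsq d : locally_lipschitz d (normsq d).
Proof.
  unfold normsq. induction d as [|d IH]. { apply (locally_lipschitz_const 0 0). }
  intros M HM. destruct (IH M HM) as [K [K0 HK]]. exists (K + 2 * M). split. { lra. }
  intros x y [Hx1 Hx2] [Hy1 Hy2]. simpl.
  replace (fst x * fst x + dot d (snd x) (snd x) - (fst y * fst y + dot d (snd y) (snd y)))
  with ((fst x + fst y) * (fst x - fst y) + (dot d (snd x) (snd x) - dot d (snd y) (snd y))) by ring.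
  eapply Rle_trans. { apply Rabs_triang. } rewrite Rabs_mult.
  generalize (HK _ _ Hx2 Hy2) (Rabs_triang (fst x) (fst y)) (Rabs_pos (fst x - fst y))
   (norm1_ge0 d (vsub d (snd x) (snd y))) (Rabs_pos (fst x + fst y)). nra.
Qed.

Definition eix (t : R) : C := (cos t, sin t).

Lemma Cmod_eix t : Cmod (eix t) = 1.
Proof.
  unfold Cmod, eix; simpl fst; simpl snd.
  replace (cos t ^ 2 + sin t ^ 2) with 1. { apply sqrt_1. }
  generalize (sin2_cos2 t). unfold Rsqr. lra.
Qed.

(** What the Schwartz hypothesis supplies: a global Lipschitz bound for local estimates, and decay
    beyond every power of the bracket for moments and for domination by Cauchy densities. *)
Record regular_density (d : nat) (phi : Rn d -> R) : Prop := {
  rd_dim : (1 <= d)%nat;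
  rd_ge0 : forall x, 0 <= phi x;
  rd_mass : integral d phi 1;
  rd_lip : exists K, 0 <= K /\ forall x y, Rabs (phi x - phi y) <= K * norm1 d (vsub d x y);
  rd_decay : forall k : nat, exists A, forall x, prodf d japanese x ^ k * phi x <= A }.

Section Expectation.

Variables (d : nat) (phi : Rn d -> R).
Hypothesis Hphi : regular_density d phi.

Let d_pos : (1 <= d)%nat := rd_dim d phi Hphi.
Let phi_ge0 : forall x, 0 <= phi x := rd_ge0 d phi Hphi.
Let phi_mass : integral d phi 1 := rd_mass d phi Hphi.
Let phi_lip := rd_lip d phi Hphi.
Let phi_decay := rd_decay d phi Hphi.

Definition isE (g : Rn d -> R) (v : R) : Prop := integral d (fun y => g y * phi y) v.

Lemma isE_unique g u v : isE g u -> isE g v -> u = v.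
Proof. apply integral_unique. Qed.

Lemma isE_ext f g v : (forall x, f x = g x) -> isE f v -> isE g v.
Proof. intros H. apply integral_ext. intros x. now rewrite H. Qed.

Lemma isE_le f g u v : (forall x, f x <= g x) -> isE f u -> isE g v -> u <= v.
Proof. intros H. apply integral_le. intros x. apply Rmult_le_compat_r; auto. Qed.

Lemma isE_lin f g u v a b : isE f u -> isE g v -> isE (fun x => a * f x + b * g x) (a * u + b * v).
Proof.
  intros H1 H2. apply integral_ext with (fun y => a * (f y * phi y) + b * (g y * phi y)).
  { intros; ring. } now apply integral_lin.
Qed.

Lemma isE_const c : isE (fun _ => c) c.
Proof.
  apply integral_ext with (fun y => c * phi y + 0 * phi y). { intros; ring. }
  generalize (integral_lin d phi phi 1 1 c 0 phi_mass phi_mass).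
  now replace (c * 1 + 0 * 1) with c by ring.
Qed.

Lemma isE_scal f u a : isE f u -> isE (fun x => a * f x) (a * u).
Proof.
  intros H. replace (a * u) with (a * u + 0 * u) by ring.
  apply isE_ext with (fun x => a * f x + 0 * f x). { intros; ring. } now apply isE_lin.
Qed.

Lemma isE_plus f g u v : isE f u -> isE g v -> isE (fun x => f x + g x) (u + v).
Proof.
  intros H1 H2. replace (u + v) with (1 * u + 1 * v) by ring.
  apply isE_ext with (fun x => 1 * f x + 1 * g x). { intros; ring. } now apply isE_lin.
Qed.

Lemma isE_sumn n f u : (forall i, (i < n)%nat -> isE (f i) (u i)) ->
  isE (fun x => sumn n (fun i => f i x)) (sumn n u).
Proof.
  revert f u. induction n as [|n IH]; intros f u H; simpl. { apply isE_const. }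
  apply isE_plus. { apply H; lia. } apply IH. intros; apply H; lia.
Qed.

Lemma phi_locally_lipschitz : locally_lipschitz d phi.
Proof.
  intros M _. destruct phi_lip as [K [K0 HK]]. exists K; split; auto.
Qed.

(** One spare power of the bracket is traded for the Cauchy product. *)
Lemma phi_le_cauchy k : exists A, 0 <= A /\
  forall x, prodf d japanese x ^ k * phi x <= A * prodf d cauchy_density x.
Proof.
  destruct (phi_decay (S k)) as [A HA]. exists A. split.
  { eapply Rle_trans; [| apply (HA (vzero d))]. apply Rmult_le_pos; auto.
    apply pow_le, Rlt_le, prodf_pos. intros t; generalize (japanese_ge1 t); lra. }
  intros x. assert (P := prodf_pos d cauchy_density x cauchy_density_pos).
  generalize (Rmult_le_compat_r _ _ _ (Rlt_le _ _ P) (HA x)). intros h.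
  eapply Rle_trans; [| apply h]. right. simpl.
  replace (prodf d japanese x * prodf d japanese x ^ k * phi x * prodf d cauchy_density x) with
    ((prodf d japanese x * prodf d cauchy_density x) * (prodf d japanese x ^ k * phi x)) by ring.
  rewrite prodf_japanese_cauchy. ring.
Qed.

Lemma isE_exists g B k : locally_lipschitz d g ->
  (forall x, Rabs (g x) <= B * prodf d japanese x ^ k) -> exists v, isE g v.
Proof.
  intros Hg HB. destruct (phi_le_cauchy k) as [A [A0 HA]].
  assert (P := fun x => prodf_ge1 d japanese x japanese_ge1).
  assert (B0 : 0 <= B).
  { generalize (HB (vzero d)) (Rabs_pos (g (vzero d))) (pow_R1_Rle _ k (P (vzero d))). nra. }
  apply integral_exists_dominated with (B * A).
  - apply locally_lipschitz_mult; auto. apply phi_locally_lipschitz.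
  - intros x. rewrite Rabs_mult, (Rabs_right (phi x)) by (apply Rle_ge; auto).
    apply Rle_trans with (B * prodf d japanese x ^ k * phi x).
    { apply Rmult_le_compat_r; auto. }
    rewrite !Rmult_assoc. apply Rmult_le_compat_l; auto.
Qed.

Lemma isE_cos_exists xi : exists v, isE (fun y => cos (dot d xi y)) v.
Proof.
  apply isE_exists with 1 O.
  - apply locally_lipschitz_comp with 1; [lra | apply cos_lipschitz | apply locally_lipschitz_dot].
  - intros x. simpl. rewrite Rmult_1_r. apply Rabs_le, COS_bound.
Qed.

Lemma isE_sin_exists xi : exists v, isE (fun y => sin (dot d xi y)) v.
Proof.
  apply isE_exists with 1 O.
  - apply locally_lipschitz_comp with 1; [lra | apply sin_lipschitz | apply locally_lipschitz_dot].
  - intros x. simpl. rewrite Rmult_1_r. apply Rabs_le, SIN_bound.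
Qed.

(** A choice of value, arbitrary where no expectation exists; it serves to define [chf], whose
    cosine and sine integrands do have expectations. *)
Definition expect (g : Rn d -> R) : R := epsilon (inhabits 0) (isE g).

Lemma expect_spec g : (exists v, isE g v) -> isE g (expect g).
Proof. apply epsilon_spec. Qed.

Definition chf (xi : Rn d) : C := (expect (fun y => cos (dot d xi y)), expect (fun y => sin (dot d xi y))).

Lemma isE_cos xi : isE (fun y => cos (dot d xi y)) (Re (chf xi)).
Proof. apply expect_spec, isE_cos_exists. Qed.

Lemma isE_sin xi : isE (fun y => sin (dot d xi y)) (Im (chf xi)).
Proof. apply expect_spec, isE_sin_exists. Qed.

Lemma isE_third_moment : exists v, isE (fun y => norm1 d y ^ 3) v.
Proof.
  apply isE_exists with (INR d ^ 3) 3%nat.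
  - apply locally_lipschitz_mult. { apply locally_lipschitz_norm1. }
    apply locally_lipschitz_mult. { apply locally_lipschitz_norm1. }
    apply locally_lipschitz_mult. { apply locally_lipschitz_norm1. } apply locally_lipschitz_const.
  - intros x. rewrite <- Rpow_mult_distr, Rabs_right.
    + apply pow_incr. split. { apply norm1_ge0. } apply norm1_le_japanese.
    + apply Rle_ge, pow_le, norm1_ge0.
Qed.

Lemma isE_normsq_exists : exists v, isE (normsq d) v.
Proof.
  apply isE_exists with (INR d ^ 2) 2%nat.
  - apply locally_lipschitz_normsq.
  - intros x. rewrite <- Rpow_mult_distr, Rabs_right by (apply Rle_ge, normsq_ge0).
    eapply Rle_trans. { apply normsq_le_norm1_sq. }
    apply pow_incr. split. { apply norm1_ge0. } apply norm1_le_japanese.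
Qed.

(** Total mass 1 forbids [phi] to vanish identically, and the Lipschitz bound keeps half of a
    positive value on a small box. *)
Lemma phi_positive_box : exists x0 del eta, 0 < del /\ 0 < eta /\
  forall x, inbox d del (vsub d x x0) -> eta <= phi x.
Proof.
  destruct (classic (exists x0, 0 < phi x0)) as [[x0 H0] | N].
  - destruct phi_lip as [K [K0 HK]].
    assert (D : 0 < INR d) by (apply lt_0_INR; lia).
    assert (KD : 0 < (K + 1) * INR d) by nra.
    exists x0, (phi x0 / (2 * ((K + 1) * INR d))), (phi x0 / 2).
    assert (0 < phi x0 / (2 * ((K + 1) * INR d))) by (apply Rdiv_lt_0_compat; lra).
    repeat split; auto; [lra|].
    intros x Hx. apply norm1_le_box in Hx.
    assert (E : INR d * (phi x0 / (2 * ((K + 1) * INR d))) * (K + 1) = phi x0 / 2) by (field; lra).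
    generalize (HK x x0) (norm1_ge0 d (vsub d x x0)). intros h hn.
    apply Rabs_le_between in h. nra.
  - exfalso. assert (1 <= 0); [| lra].
    apply (integral_le d phi (fun _ => 0)); auto.
    + intros x. apply Rnot_lt_le. intros H. apply N. now exists x.
    + apply integral_ext with (fun y => 0 * phi y + 0 * phi y). { intros; ring. }
      generalize (integral_lin d phi phi 1 1 0 0 phi_mass phi_mass).
      now replace (0 * 1 + 0 * 1) with 0 by ring.
Qed.

(* Among two points differing by [s] in the i-th coordinate, one has
   [|sin ((xi.y - alpha)/2)| >= |xi_i| s / 8], which persists on a small box around it. *)
Lemma chf_spread T : 0 < T -> exists c, 0 < c /\ forall xi alpha, inbox d T xi ->
  Re (eix (- alpha) * chf xi)%C <= 1 - c * normsq d xi.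
Proof.
  intros HT. destruct phi_positive_box as [x0 [del [eta [Hdel [Heta Heta_le]]]]].
  assert (D : 1 <= INR d) by (apply (le_INR 1); auto).
  (* The bound [s <= 1 / T] puts the half-angle [xi_i s / 2] in the range of [sin_ge_half]; the
     bound [s <= del / 2] keeps the second point well inside the positivity box. *)
  set (s := Rmin (/ T) (del / 2)).
  assert (s_pos : 0 < s) by (apply Rmin_glb_lt; [now apply Rinv_0_lt_compat | lra]).
  assert (sT : s * T <= 1).
  { apply Rle_trans with (/ T * T). { apply Rmult_le_compat_r; [lra | apply Rmin_l]. }
    right; field; lra. }
  (* Moving within a box of half-side [r] changes the half-angle by at most [w * s / 16], half of
     the lower bound available at its centre. *)
  set (r := s / (8 * INR d)).
  assert (r_pos : 0 < r) by (apply Rdiv_lt_0_compat; lra).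
  assert (r_del : r <= del / 2).
  { apply Rle_trans with s; [| apply Rmin_r].
    unfold r, Rdiv. rewrite <- (Rmult_1_r s) at 2. apply Rmult_le_compat_l; [lra|].
    rewrite <- Rinv_1. apply Rinv_le_contravar; lra. }
  set (c0 := 2 * (s / 16) ^ 2 * eta * (2 * r) ^ d).
  assert (c0_pos : 0 < c0).
  { unfold c0. repeat apply Rmult_lt_0_compat; try lra. apply pow_lt; lra. }
  exists (c0 / INR d ^ 2). split. { apply Rdiv_lt_0_compat; auto. apply pow_lt; lra. }
  intros xi alpha Hxi.
  destruct (norm1_le_coord d xi d_pos) as [i [Hi Hn]].
  set (w := Rabs (coord d xi i)) in *.
  assert (w0 : 0 <= w) by apply Rabs_pos.
  assert (wT : w <= T).
  { unfold w. clear -Hi Hxi. revert i Hi. induction d as [|d' IH]; intros i Hi; [lia|].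
    destruct Hxi as [H1 H2]. destruct i as [|i]; simpl; auto. apply IH; auto; lia. }
  set (g := fun y => 1 - cos (dot d xi y - alpha)).
  assert (Hg : isE g (1 - Re (eix (- alpha) * chf xi)%C)).
  { apply isE_ext with (fun y => 1 * 1 + (-1) * (cos alpha * cos (dot d xi y) + sin alpha * sin (dot d xi y))).
    { intros y. unfold g. rewrite cos_minus. ring. }
    replace (1 - Re (eix (- alpha) * chf xi)%C) with
      (1 * 1 + (-1) * (cos alpha * Re (chf xi) + sin alpha * Im (chf xi))).
    2: { unfold Re, Im, eix, Cmult; simpl. rewrite cos_neg, sin_neg. ring. }
    apply isE_lin. { apply isE_const. } apply isE_lin; [apply isE_cos | apply isE_sin]. }
  assert (Key : exists p, inbox d (del / 2) (vsub d p x0) /\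
     w * s / 8 <= Rabs (sin ((dot d xi p - alpha) / 2))).
  { set (p' := vupd d x0 i (coord d x0 i + s)).
    destruct (Rle_or_lt (w * s / 8) (Rabs (sin ((dot d xi x0 - alpha) / 2)))) as [Q | Q].
    - exists x0; split; auto. apply inbox_vsub_self; lra.
    - exists p'; split.
      + apply inbox_mono with (Rabs s). { rewrite Rabs_right by lra. apply Rmin_r. }
        apply inbox_vupd.
      + unfold p'. rewrite dot_vupd by auto.
        set (u := (dot d xi x0 - alpha) / 2) in *.
        replace ((dot d xi x0 + coord d xi i * s - alpha) / 2) with (u + coord d xi i * s / 2)
          by (unfold u; field).
        set (v := coord d xi i * s / 2).
        assert (Av : Rabs v = w * s / 2).
        { unfold v, w, Rdiv. rewrite !Rabs_mult, (Rabs_right s), (Rabs_right (/ 2)) by lra. ring. }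
        assert (S1 : w * s / 4 <= Rabs (sin v)).
        { replace (w * s / 4) with (Rabs v / 2) by (rewrite Av; field). apply sin_ge_half. rewrite Av. nra. }
        assert (S2 : Rabs (sin v) <= Rabs (sin (u + v)) + Rabs (sin u)).
        { replace v with ((u + v) - u) at 1 by ring. rewrite sin_minus. unfold Rminus.
          eapply Rle_trans. { apply Rabs_triang. } rewrite Rabs_Ropp, !Rabs_mult.
          assert (Rabs (cos u) <= 1) by apply Rabs_le, COS_bound.
          assert (Rabs (cos (u + v)) <= 1) by apply Rabs_le, COS_bound.
          generalize (Rabs_pos (sin (u + v))) (Rabs_pos (sin u)). nra. }
        lra. }
  destruct Key as [p [Hp Sp]].
  assert (LB : 2 * (w * s / 16) ^ 2 * eta * (2 * r) ^ d <= 1 - Re (eix (- alpha) * chf xi)%C).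
  { apply (integral_ge_on_subbox d (fun y => g y * phi y) _ _ p r); auto.
    - lra.
    - intros y. apply Rmult_le_pos; auto. unfold g. generalize (COS_bound (dot d xi y - alpha)); lra.
    - intros y Hy. unfold g. rewrite one_minus_cos.
      assert (w * s / 16 <= Rabs (sin ((dot d xi y - alpha) / 2))).
      { generalize (sin_lipschitz ((dot d xi p - alpha) / 2) ((dot d xi y - alpha) / 2)).
        replace ((dot d xi p - alpha) / 2 - (dot d xi y - alpha) / 2) with (- (dot d xi (vsub d y p) / 2)).
        2: { rewrite dot_vsub_r. field. }
        rewrite Rabs_Ropp. unfold Rdiv at 3. rewrite Rabs_mult, (Rabs_right (/ 2)) by lra.
        assert (Rabs (dot d xi (vsub d y p)) <= w * s / 8).
        { eapply Rle_trans. { apply Rabs_dot_box, Hy. }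
          apply Rle_trans with (INR d * w * r). { apply Rmult_le_compat_r; lra. }
          right. unfold r. field. lra. }
        generalize (Rabs_triang_inv (sin ((dot d xi p - alpha) / 2)) (sin ((dot d xi y - alpha) / 2))). lra. }
      assert (0 <= w * s / 16) by nra.
      assert ((w * s / 16) ^ 2 <= sin ((dot d xi y - alpha) / 2) ^ 2).
      { rewrite <- (pow2_abs (sin _)). apply pow_incr; lra. }
      assert (eta <= phi y).
      { apply Heta_le. apply inbox_mono with (r + del / 2). { lra. }
        now apply inbox_vsub_triangle with p. }
      generalize (pow2_ge_0 (w * s / 16)). nra. }
  assert (NQ : normsq d xi <= INR d ^ 2 * w ^ 2).
  { eapply Rle_trans. { apply normsq_le_norm1_sq. }
    rewrite <- Rpow_mult_distr. apply pow_incr. split; auto. apply norm1_ge0. }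
  assert (c0 / INR d ^ 2 * normsq d xi <= c0 * w ^ 2).
  { replace (c0 * w ^ 2) with (c0 / INR d ^ 2 * (INR d ^ 2 * w ^ 2)) by (field; lra).
    apply Rmult_le_compat_l; auto. apply Rlt_le, Rdiv_lt_0_compat; auto. apply pow_lt; lra. }
  replace (2 * (w * s / 16) ^ 2 * eta * (2 * r) ^ d) with (c0 * w ^ 2) in LB
    by (unfold c0; field). lra.
Qed.

Lemma Cmod_rotate (z : C) : exists alpha, Re (eix (- alpha) * z)%C = Cmod z.
Proof.
  destruct (classic (z = RtoC 0)) as [-> | Hz].
  - exists 0. rewrite Cmod_0. unfold Re, Cmult; simpl. ring.
  - apply Cmod_gt_0 in Hz.
    assert (E : Cmod z ^ 2 = fst z ^ 2 + snd z ^ 2).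
    { unfold Cmod. rewrite pow2_sqrt; auto. generalize (pow2_ge_0 (fst z)) (pow2_ge_0 (snd z)); lra. }
    destruct (unit_circle_angle (fst z / Cmod z) (snd z / Cmod z)) as [t [Hc Hs]].
    { replace ((fst z / Cmod z) ^ 2 + (snd z / Cmod z) ^ 2) with ((fst z ^ 2 + snd z ^ 2) / Cmod z ^ 2)
        by (field; lra). rewrite <- E. field. lra. }
    exists t. unfold Re, eix, Cmult; simpl. rewrite cos_neg, sin_neg, Hc, Hs.
    replace (fst z / Cmod z * fst z - - (snd z / Cmod z) * snd z) with
      ((fst z ^ 2 + snd z ^ 2) / Cmod z) by (field; lra).
    rewrite <- E. field. lra.
Qed.

(** [chf_spread] is uniform in [alpha]: taking [alpha] to be the argument of [chf xi] turns the real
    part into the modulus, and [alpha = 0] gives the second bound with the same constant. *)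
Lemma Cmod_chf_le T : 0 < T -> exists c, 0 < c /\ forall xi, inbox d T xi ->
  Cmod (chf xi) <= exp (- (c * normsq d xi)) /\ Re (chf xi) <= 1 - c * normsq d xi.
Proof.
  intros HT. destruct (chf_spread T HT) as [c [Hc H]]. exists c; split; auto.
  intros xi Hxi. split.
  - destruct (Cmod_rotate (chf xi)) as [a <-].
    generalize (H xi a Hxi) (exp_ge_1_plus (- (c * normsq d xi))). lra.
  - generalize (H xi 0 Hxi). rewrite Ropp_0. unfold Re, eix, Cmult; simpl. rewrite cos_0, sin_0. lra.
Qed.

Lemma Cmod_chf_le1 xi : Cmod (chf xi) <= 1.
Proof.
  destruct (inbox_exists d xi) as [M [M0 HM]].
  destruct (Cmod_chf_le (M + 1)) as [c [Hc H]]. { lra. }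
  destruct (H xi) as [H1 _]. { apply inbox_mono with M; auto; lra. }
  apply Rle_trans with (1 := H1). rewrite <- exp_0. 
  destruct (normsq_ge0 d xi) as [P | P].
  - apply Rlt_le, exp_increasing. nra.
  - rewrite <- P. right. f_equal. ring.
Qed.

End Expectation.

(** * Convolution powers as orbits *)

Lemma vsub_vadd_l d x a y : vsub d (vadd d x a) y = vadd d (vsub d x y) a.
Proof.
  induction d as [|d IH]; simpl; auto. rewrite IH. f_equal. ring.
Qed.

Lemma Cmod_le_Rabs_sum (z : C) : Cmod z <= Rabs (fst z) + Rabs (snd z).
Proof.
  unfold Cmod. assert (H1 := Rabs_pos (fst z)). assert (H2 := Rabs_pos (snd z)).
  rewrite <- (sqrt_pow2 (Rabs (fst z) + Rabs (snd z))) by lra.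
  apply sqrt_le_1_alt. rewrite <- (pow2_abs (fst z)), <- (pow2_abs (snd z)). nra.
Qed.

Lemma Cmod_eix_minus_1 t : Cmod (eix t - RtoC 1)%C <= 2 * Rabs t.
Proof.
  eapply Rle_trans. { apply Cmod_le_Rabs_sum. } simpl.
  replace (cos t + - (1)) with (cos t - cos 0) by (rewrite cos_0; ring).
  replace (sin t + - 0) with (sin t - sin 0) by (rewrite sin_0; ring).
  generalize (cos_lipschitz t 0) (sin_lipschitz t 0). rewrite !Rminus_0_r. lra.
Qed.

(** Telescoping: both numbers stay in the closed unit disk, so the error grows at most linearly in
    [n]. *)
Lemma Cmod_pow_diff (z w : C) n : Cmod z <= 1 -> Cmod w <= 1 ->
  Cmod (z ^ n - w ^ n)%C <= INR n * Cmod (z - w)%C.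
Proof.
  intros Hz Hw. induction n as [|n IH].
  { simpl. rewrite Rmult_0_l. replace (RtoC 1 - RtoC 1)%C with (RtoC 0) by ring. rewrite Cmod_0; lra. }
  rewrite !Cpow_S, S_INR.
  replace (z * z ^ n - w * w ^ n)%C with (z * (z ^ n - w ^ n) + (z - w) * w ^ n)%C by ring.
  eapply Rle_trans. { apply Cmod_triangle. } rewrite !Cmod_mult, Cmod_pow.
  assert (Cmod w ^ n <= 1). { rewrite <- (pow1 n). apply pow_incr. split; auto. apply Cmod_ge_0. }
  assert (H0 := Cmod_ge_0 z). assert (H1 := Cmod_ge_0 (z - w)%C).
  assert (H2 := Cmod_ge_0 (z ^ n - w ^ n)%C). assert (H3 := pow_le _ n (Cmod_ge_0 w)).
  nra.
Qed.

Lemma exp_neg_bounds x : 0 <= x -> 1 - x <= exp (- x) <= 1 - x + x ^ 2.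
Proof.
  intros Hx. split. { generalize (exp_ge_1_plus (- x)); lra. }
  assert (H := exp_ge_1_plus x).
  assert (E : exp (- x) * exp x = 1) by (rewrite <- exp_plus, Rplus_opp_l; apply exp_0).
  assert (P := exp_pos (- x)).
  destruct (Rle_or_lt x 1) as [L | L].
  - assert (exp (- x) * (1 + x) <= 1) by nra.
    apply Rmult_le_reg_r with (1 + x); [lra|]. nra.
  - assert (exp (- x) <= 1) by nra. nra.
Qed.

Lemma exp_pow x n : exp (INR n * x) = exp x ^ n.
Proof.
  induction n as [|n IH]. { simpl. now rewrite Rmult_0_l, exp_0. }
  rewrite S_INR, Rmult_plus_distr_r, exp_plus, IH, Rmult_1_l. simpl; ring.
Qed.

Lemma exp_le x y : x <= y -> exp x <= exp y.
Proof. intros [H | ->]; [left; now apply exp_increasing | lra]. Qed.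

Section Orbits.

Variables (d : nat) (phi : Rn d -> R).
Hypothesis Hphi : regular_density d phi.

Local Notation isE := (isE d phi).
Local Notation chf := (chf d phi).

(* [u (j+1) x] is the expectation of [u j (x - X)]; so [phi^{*(j+1)}] is the orbit of [phi], and
   pointwise inequalities propagate along orbits. *)
Definition orbit (u : nat -> Rn d -> R) : Prop :=
  forall j x, isE (fun y => u j (vsub d x y)) (u (S j) x).

Lemma orbit_le u v : orbit u -> orbit v -> (forall x, u O x <= v O x) -> forall j x, u j x <= v j x.
Proof.
  intros Hu Hv H j. induction j as [|j IH]; auto. intros x.
  apply (isE_le d phi Hphi (fun y => u j (vsub d x y)) (fun y => v j (vsub d x y))); auto.
Qed.

Lemma orbit_lin u v a b : orbit u -> orbit v -> orbit (fun j x => a * u j x + b * v j x).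
Proof. intros Hu Hv j x. apply (isE_lin d phi); auto. Qed.

Lemma orbit_const c : orbit (fun _ _ => c).
Proof. intros j x. now apply isE_const. Qed.

Lemma orbit_scal c u : orbit u -> orbit (fun j x => c * u j x).
Proof. intros Hu j x. apply (isE_scal d phi); auto. Qed.

Lemma orbit_plus u v : orbit u -> orbit v -> orbit (fun j x => u j x + v j x).
Proof. intros Hu Hv j x. apply (isE_plus d phi); auto. Qed.

Lemma orbit_translate u a : orbit u -> orbit (fun j x => u j (vadd d x a)).
Proof.
  intros Hu j x. apply isE_ext with (2 := Hu j (vadd d x a)). intros y. now rewrite vsub_vadd_l.
Qed.

Lemma orbit_sum u n : (forall i, (i <= n)%nat -> orbit (u i)) ->
  orbit (fun j x => sum_f_R0 (fun i => u i j x) n).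
Proof.
  induction n as [|n IH]; intros H; simpl. { apply H; auto. }
  apply orbit_plus; auto.
Qed.

Lemma orbit_cube_sum k n (u : Zn k -> nat -> Rn d -> R) : (forall i, orbit (u i)) ->
  orbit (fun j x => cube_sum k n (fun i => u i j x)).
Proof.
  revert u. induction k as [|k IH]; intros u H; simpl. { apply H. }
  apply (orbit_sum (fun i j x => cube_sum k n (fun m => u ((Z.of_nat i - Z.of_nat n)%Z, m) j x))).
  intros i _. apply IH. auto.
Qed.

(** The orbit of the plane wave [cos (dot d xi x)]: averaging over [x - X] multiplies [exp (i xi.x)]
    by the conjugate of [chf xi]. *)
Definition trig_orbit (xi : Rn d) (j : nat) (x : Rn d) : R :=
  Re (eix (dot d xi x) * Cconj (chf xi) ^ j)%C.

Lemma orbit_trig xi : orbit (trig_orbit xi).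
Proof.
  intros j x. unfold trig_orbit. rewrite Cpow_S.
  set (w := (Cconj (chf xi) ^ j)%C).
  set (A := fst w * cos (dot d xi x) - snd w * sin (dot d xi x)).
  set (B := fst w * sin (dot d xi x) + snd w * cos (dot d xi x)).
  apply isE_ext with (fun y => A * cos (dot d xi y) + B * sin (dot d xi y)).
  { intros y. rewrite dot_vsub_r. unfold Re, eix, Cmult; simpl. rewrite cos_minus, sin_minus.
    unfold A, B. ring. }
  replace (Re (eix (dot d xi x) * (Cconj (chf xi) * w))) with (A * Re (chf xi) + B * Im (chf xi)).
  2: { unfold A, B, Re, Im, eix, Cconj, Cmult; simpl. ring. }
  apply isE_lin; [apply isE_cos | apply isE_sin]; auto.
Qed.

Lemma trig_orbit_0 xi x : trig_orbit xi O x = cos (dot d xi x).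
Proof. unfold trig_orbit, eix, Re, Cmult; simpl. ring. Qed.

Lemma trig_orbit_le xi j x : trig_orbit xi j x <= Cmod (chf xi) ^ j.
Proof.
  unfold trig_orbit. eapply Rle_trans. { apply Rle_abs. }
  eapply Rle_trans. { apply re_le_Cmod. }
  rewrite Cmod_mult, Cmod_eix, Cmod_pow, Cmod_conj. lra.
Qed.

(** * Covariance and Gaussian approximation of the characteristic function *)

Section Moments.

Variable cov : nat -> nat -> R.
Hypothesis mean0 : forall i, (i < d)%nat -> isE (fun x => coord d x i) 0.
Hypothesis covE : forall i j, (i < d)%nat -> (j < d)%nat ->
  isE (fun x => coord d x i * coord d x j) (cov i j).

Definition cov_form (xi : Rn d) : R :=
  sumn d (fun i => sumn d (fun j => coord d xi i * coord d xi j * cov i j)).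

Lemma isE_dot xi : isE (fun y => dot d xi y) 0.
Proof.
  replace 0 with (sumn d (fun i => coord d xi i * 0)).
  - apply isE_ext with (fun y => sumn d (fun i => coord d xi i * coord d y i)).
    { intros y. now rewrite dot_sumn. }
    apply (isE_sumn d phi Hphi d (fun i y => coord d xi i * coord d y i)).
    intros i Hi. apply isE_scal; auto.
  - rewrite (sumn_ext d _ (fun i => 0 * 0)) by (intros; ring). rewrite sumn_scal. ring.
Qed.

Lemma isE_dot_sq xi : isE (fun y => dot d xi y ^ 2) (cov_form xi).
Proof.
  apply isE_ext with (fun y => sumn d (fun i => sumn d (fun j =>
     coord d xi i * coord d xi j * (coord d y i * coord d y j)))).
  { intros y. rewrite dot_sumn. simpl. rewrite Rmult_1_r. rewrite <- sumn_scal. apply sumn_ext.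
    intros i _. rewrite (Rmult_comm (sumn _ _)), <- sumn_scal. apply sumn_ext. intros; ring. }
  apply (isE_sumn d phi Hphi d (fun i y => sumn d (fun j =>
     coord d xi i * coord d xi j * (coord d y i * coord d y j)))).
  intros i Hi.
  apply (isE_sumn d phi Hphi d (fun j y => coord d xi i * coord d xi j * (coord d y i * coord d y j))).
  intros j Hj. apply isE_scal; auto.
Qed.

(** The squared norm evolves explicitly because the mean is zero; [tr] is the trace of the
    covariance. This orbit carries the correction term of the minorant in [local_limit_lower]. *)
Lemma orbit_quadratic : exists tr, 0 <= tr /\ orbit (fun j x => normsq d x + INR j * tr).
Proof.
  destruct (isE_normsq_exists d phi Hphi) as [tr Htr]. exists tr. split.
  - apply (isE_le d phi Hphi (fun _ => 0) (normsq d)); auto. { apply normsq_ge0. } now apply isE_const.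
  - intros j x. rewrite S_INR.
    apply isE_ext with (fun y => (normsq d x + INR j * tr) + ((-2) * dot d x y + 1 * normsq d y)).
    { intros y. rewrite normsq_vsub. ring. }
    replace (normsq d x + (INR j + 1) * tr) with ((normsq d x + INR j * tr) + ((-2) * 0 + 1 * tr)) by ring.
    apply isE_plus. { now apply isE_const. } apply isE_lin; auto. apply isE_dot.
Qed.

Lemma cov_form_scal s xi : cov_form (vscal d s xi) = s ^ 2 * cov_form xi.
Proof.
  apply (isE_unique d phi (fun y => dot d (vscal d s xi) y ^ 2)). { apply isE_dot_sq. }
  apply isE_ext with (fun y => s ^ 2 * dot d xi y ^ 2).
  { intros y. rewrite dot_vscal_l. ring. }
  apply isE_scal, isE_dot_sq.
Qed.

Lemma cov_form_ge0 xi : 0 <= cov_form xi.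
Proof.
  apply (isE_le d phi Hphi (fun _ => 0) (fun y => dot d xi y ^ 2)).
  - intros; apply pow2_ge_0.
  - now apply isE_const.
  - apply isE_dot_sq.
Qed.

Lemma cov_form_le : exists B, 0 <= B /\ forall xi, cov_form xi <= B * norm1 d xi ^ 2.
Proof.
  destruct (isE_normsq_exists d phi Hphi) as [tr Htr].
  assert (0 <= tr).
  { apply (isE_le d phi Hphi (fun _ => 0) (normsq d)); auto. { apply normsq_ge0. } now apply isE_const. }
  exists (INR d * tr). split. { apply Rmult_le_pos; auto. apply pos_INR. }
  intros xi. replace (INR d * tr * norm1 d xi ^ 2) with ((norm1 d xi ^ 2 * INR d) * tr) by ring.
  apply (isE_le d phi Hphi (fun y => dot d xi y ^ 2) (fun y => norm1 d xi ^ 2 * INR d * normsq d y)).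
  - intros y. rewrite Rmult_assoc.
    apply Rle_trans with (norm1 d xi ^ 2 * norm1 d y ^ 2).
    + rewrite <- Rpow_mult_distr, <- (pow2_abs (dot _ _ _)). apply pow_incr. split. { apply Rabs_pos. }
      apply Rabs_dot_le.
    + apply Rmult_le_compat_l. { apply pow2_ge_0. } apply norm1_sq_le.
  - apply isE_dot_sq.
  - now apply isE_scal.
Qed.

(** Termwise Taylor bounds for cosine and sine under the expectation; the linear term vanishes with
    the mean, and the third moment controls both remainders. *)
Lemma chf_taylor : exists A, 0 <= A /\ forall xi,
  Cmod (chf xi - RtoC (1 - cov_form xi / 2))%C <= A * norm1 d xi ^ 3.
Proof.
  destruct (isE_third_moment d phi Hphi) as [m Hm].
  assert (m0 : 0 <= m).
  { apply (isE_le d phi Hphi (fun _ => 0) (fun y => norm1 d y ^ 3)); auto.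
    - intros. apply pow_le, norm1_ge0.
    - now apply isE_const. }
  exists (2 * m). split; [lra|]. intros xi.
  assert (D : forall y, Rabs (dot d xi y) ^ 3 / 6 <= norm1 d xi ^ 3 * norm1 d y ^ 3).
  { intros y. assert (Rabs (dot d xi y) ^ 3 <= norm1 d xi ^ 3 * norm1 d y ^ 3).
    { rewrite <- Rpow_mult_distr. apply pow_incr. split. { apply Rabs_pos. } apply Rabs_dot_le. }
    generalize (pow_le _ 3 (Rabs_pos (dot d xi y))). lra. }
  assert (BE : forall g v, isE g v -> (forall y, Rabs (g y) <= norm1 d xi ^ 3 * norm1 d y ^ 3) ->
     Rabs v <= norm1 d xi ^ 3 * m).
  { intros g v Hg HB. apply Rabs_le. split.
    - replace (- (norm1 d xi ^ 3 * m)) with (- norm1 d xi ^ 3 * m) by ring.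
      apply (isE_le d phi Hphi (fun y => - norm1 d xi ^ 3 * norm1 d y ^ 3) g); auto.
      + intros y. generalize (HB y). intros h. apply Rabs_le_between in h. lra.
      + now apply isE_scal.
    - apply (isE_le d phi Hphi g (fun y => norm1 d xi ^ 3 * norm1 d y ^ 3)); auto.
      + intros y. generalize (HB y). intros h. apply Rabs_le_between in h. lra.
      + now apply isE_scal. }
  eapply Rle_trans. { apply Cmod_le_Rabs_sum. }
  change (Rabs (Re (chf xi) + - (1 - cov_form xi / 2)) + Rabs (Im (chf xi) + - 0)
    <= 2 * m * norm1 d xi ^ 3).
  replace (2 * m * norm1 d xi ^ 3) with (norm1 d xi ^ 3 * m + norm1 d xi ^ 3 * m) by ring.
  apply Rplus_le_compat.
  - apply BE with (fun y => 1 * cos (dot d xi y) + 1 * ((-1) * 1 + (/ 2) * dot d xi y ^ 2)).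
    + replace (Re (chf xi) + - (1 - cov_form xi / 2)) with
        (1 * Re (chf xi) + 1 * ((-1) * 1 + (/ 2) * cov_form xi)) by field.
      apply (isE_lin d phi (fun y => cos (dot d xi y)) (fun y => (-1) * 1 + (/ 2) * dot d xi y ^ 2)).
      { now apply isE_cos. }
      apply (isE_lin d phi (fun _ => 1) (fun y => dot d xi y ^ 2)). { now apply isE_const. }
      apply isE_dot_sq.
    + intros y. eapply Rle_trans; [| apply D]. 
      eapply Rle_trans; [| apply cos_taylor]. right. f_equal. field.
  - apply BE with (fun y => 1 * sin (dot d xi y) + (-1) * dot d xi y).
    + replace (Im (chf xi) + - 0) with (1 * Im (chf xi) + (-1) * 0) by ring.
      apply (isE_lin d phi (fun y => sin (dot d xi y)) (fun y => dot d xi y)).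
      { now apply isE_sin. } apply isE_dot.
    + intros y. eapply Rle_trans; [| apply D].
      eapply Rle_trans; [| apply sin_taylor]. right. f_equal. ring.
Qed.

(** On the unit box, [1 - cov_form xi / 2 <= Re (chf xi) <= 1 - c * normsq d xi]; comparing the two
    ends bounds the form from below, and homogeneity extends the bound to every [xi]. *)
Lemma cov_form_ge : exists c, 0 < c /\ forall xi, c * normsq d xi <= cov_form xi.
Proof.
  destruct (Cmod_chf_le d phi Hphi 1) as [c [Hc H]]. { lra. }
  exists (2 * c). split; [lra|].
  assert (U : forall xi, inbox d 1 xi -> 2 * c * normsq d xi <= cov_form xi).
  { intros xi Hxi. destruct (H xi Hxi) as [_ HR].
    assert (1 * 1 + (- / 2) * cov_form xi <= Re (chf xi)); [| lra].
    apply (isE_le d phi Hphi (fun y => 1 * 1 + (- / 2) * dot d xi y ^ 2) (fun y => cos (dot d xi y))).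
    - intros y. generalize (cos_ge_quadratic (dot d xi y)). lra.
    - apply (isE_lin d phi (fun _ => 1) (fun y => dot d xi y ^ 2)). { now apply isE_const. }
      apply isE_dot_sq.
    - now apply isE_cos. }
  intros xi. destruct (inbox_exists d xi) as [M [M0 HM]].
  assert (I : inbox d 1 (vscal d (/ (M + 1)) xi)).
  { clear -M0 HM. induction d as [|d' IH]; simpl; auto. destruct HM as [H1 H2]. split; auto.
    rewrite Rabs_mult, Rabs_right by (apply Rle_ge, Rlt_le, Rinv_0_lt_compat; lra).
    apply Rmult_le_reg_l with (M + 1); [lra|]. rewrite <- Rmult_assoc, Rinv_r; lra. }
  generalize (U _ I). rewrite cov_form_scal, normsq_vscal.
  assert (P : 0 < (/ (M + 1)) ^ 2) by (apply pow_lt, Rinv_0_lt_compat; lra).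
  intros h. apply Rmult_le_reg_l with ((/ (M + 1)) ^ 2); auto. lra.
Qed.

(** The Gaussian and its first-order expansion differ by a fourth-order term, which the restriction
    to a bounded box reduces to third order. *)
Lemma chf_near_gaussian T : 0 < T -> exists A, 0 <= A /\ forall xi, inbox d T xi ->
  Cmod (Cconj (chf xi) - RtoC (exp (- (cov_form xi / 2))))%C <= A * norm1 d xi ^ 3.
Proof.
  intros HT. destruct chf_taylor as [A [A0 HA]]. destruct cov_form_le as [B [B0 HB]].
  exists (A + B ^ 2 * (INR d * T)). split.
  { apply Rplus_le_le_0_compat; auto. apply Rmult_le_pos. { apply pow2_ge_0. }
    apply Rmult_le_pos; [apply pos_INR | lra]. }
  intros xi Hxi.
  set (q := cov_form xi) in *.
  replace (Cconj (chf xi) - RtoC (exp (- (q / 2))))%C with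
   (Cconj (chf xi - RtoC (1 - q / 2)) + RtoC ((1 - q / 2) - exp (- (q / 2))))%C.
  2: { apply injective_projections; simpl; ring. }
  eapply Rle_trans. { apply Cmod_triangle. } rewrite Cmod_conj, Cmod_R.
  assert (H1 := HA xi). fold q in H1.
  assert (q0 : 0 <= q) by apply cov_form_ge0.
  destruct (exp_neg_bounds (q / 2)) as [E1 E2]. { lra. }
  assert (Rabs (1 - q / 2 - exp (- (q / 2))) <= q ^ 2) by (apply Rabs_le; split; nra).
  assert (q ^ 2 <= B ^ 2 * (INR d * T) * norm1 d xi ^ 3); [| lra].
  assert (N0 := norm1_ge0 d xi).
  apply Rle_trans with ((B * norm1 d xi ^ 2) ^ 2). { apply pow_incr. split; auto. apply HB. }
  replace ((B * norm1 d xi ^ 2) ^ 2) with (B ^ 2 * norm1 d xi ^ 3 * norm1 d xi) by ring.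
  replace (B ^ 2 * (INR d * T) * norm1 d xi ^ 3) with (B ^ 2 * norm1 d xi ^ 3 * (INR d * T)) by ring.
  apply Rmult_le_compat_l. { apply Rmult_le_pos. { apply pow2_ge_0. } now apply pow_le. }
  now apply norm1_le_box.
Qed.

(** The error keeps a Gaussian factor, so that it can be summed over a frequency grid of any mesh.
    Here [w] stands for the weight of a Fejer kernel, close to 1 at low frequencies, and [y] for a
    bounded translation. *)
Lemma trig_orbit_gaussian T kappa Y : 0 < T -> 0 <= kappa -> 0 <= Y -> exists c, 0 < c /\
  forall del, 0 < del -> exists j0 : nat, forall j, (j0 <= j)%nat -> forall xi w y, inbox d T xi ->
   0 <= w <= 1 -> 1 - w <= kappa * norm1 d xi -> norm1 d y <= Y ->
   Rabs (w * trig_orbit xi j y - exp (- (INR j * cov_form xi / 2)))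
     <= del * exp (- (c * (INR j * normsq d xi))).
Proof.
  intros HT Hk HY. destruct (Cmod_chf_le d phi Hphi T HT) as [c1 [Hc1 H1]].
  destruct cov_form_ge as [c2 [Hc2 H2]]. destruct (chf_near_gaussian T HT) as [A [A0 HA]].
  set (c0 := Rmin c1 (c2 / 2)).
  assert (c0_pos : 0 < c0) by (apply Rmin_glb_lt; lra).
  exists (c0 / 2). split; [lra|]. intros del Hdel.
  (* beyond [j |xi|^2 >= K2] both terms are negligible *)
  set (K2 := Rmax 1 (4 / (c0 * del))).
  assert (K2_ge : 1 <= K2) by apply Rmax_l.
  assert (tail : 2 * exp (- (c0 / 2 * K2)) <= del).
  { assert (P : 4 / (c0 * del) <= K2) by apply Rmax_r.
    assert (2 / del <= c0 / 2 * K2).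
    { replace (2 / del) with (c0 / 2 * (4 / (c0 * del))) by (field; lra).
      apply Rmult_le_compat_l; lra. }
    rewrite exp_Ropp. generalize (exp_ge_1_plus (c0 / 2 * K2)). intros E.
    assert (L : 2 / del <= exp (c0 / 2 * K2)) by lra.
    apply Rmult_le_reg_r with (exp (c0 / 2 * K2)). { apply exp_pos. }
    rewrite Rmult_assoc, Rinv_l by (generalize (exp_pos (c0 / 2 * K2)); lra).
    apply Rmult_le_compat_l with (r := del) in L; [| lra].
    replace (del * (2 / del)) with 2 in L by (field; lra). lra. }
  set (D := INR d * K2).
  assert (D0 : 0 <= D) by (apply Rmult_le_pos; [apply pos_INR | lra]).
  (* In the range [j |xi|^2 < K2] one has [norm1 xi <= sqrt D / sqrt j], so an error linear in
     [norm1 xi] is at most [B / sqrt j]. *)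
  set (B := (kappa + 2 * Y + A * D) * sqrt D).
  assert (B0 : 0 <= B).
  { apply Rmult_le_pos; [| apply sqrt_pos]. generalize (Rmult_le_pos _ _ A0 D0); lra. }
  (* The target accuracy there: below the threshold [K2] the Gaussian factor is at least
     [exp (- (c0 / 2 * K2))]. *)
  set (e := del * exp (- (c0 / 2 * K2))).
  assert (e_pos : 0 < e) by (apply Rmult_lt_0_compat; auto; apply exp_pos).
  destruct (nfloor_ex ((B / e) ^ 2)) as [j1 [_ Hj1]]. { apply pow2_ge_0. }
  exists (S j1). intros j Hj xi w y Hxi Hw Hwk Hy.
  assert (Jb : (B / e) ^ 2 <= INR j).
  { apply le_INR in Hj. rewrite S_INR in Hj. lra. }
  assert (J0 : 0 < INR j) by (apply lt_0_INR; lia).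
  set (z := Cconj (chf xi)). set (g := exp (- (cov_form xi / 2))).
  assert (gj : exp (- (INR j * cov_form xi / 2)) = g ^ j).
  { unfold g. rewrite <- exp_pow. f_equal. field. }
  assert (q0 := cov_form_ge0 xi).
  assert (g1 : 0 < g <= 1).
  { unfold g. split. { apply exp_pos. } rewrite <- exp_0.
    destruct q0 as [q0 | <-]; [left; apply exp_increasing; lra | right; f_equal; field]. }
  assert (zmod : Cmod z <= 1) by (unfold z; rewrite Cmod_conj; now apply Cmod_chf_le1).
  unfold trig_orbit. fold z. rewrite gj.
  assert (Nq := norm1_sq_le d xi). assert (N0 := norm1_ge0 d xi). assert (Q0 := normsq_ge0 d xi).
  destruct (Rle_or_lt K2 (INR j * normsq d xi)) as [L | L].
  - assert (X1 : Cmod z ^ j <= exp (- (c0 * (INR j * normsq d xi)))).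
    { apply Rle_trans with (exp (- (c1 * normsq d xi)) ^ j).
      - apply pow_incr. split. { apply Cmod_ge_0. } unfold z; rewrite Cmod_conj. now apply H1.
      - rewrite <- exp_pow. apply exp_le. assert (c0 <= c1) by apply Rmin_l. nra. }
    assert (X2 : g ^ j <= exp (- (c0 * (INR j * normsq d xi)))).
    { unfold g. rewrite <- exp_pow. apply exp_le. assert (c0 <= c2 / 2) by apply Rmin_r.
      generalize (H2 xi). nra. }
    assert (X3 : Rabs (Re (eix (dot d xi y) * z ^ j)%C) <= Cmod z ^ j).
    { eapply Rle_trans. { apply re_le_Cmod. } rewrite Cmod_mult, Cmod_eix, Cmod_pow. lra. }
    assert (X4 : Rabs (w * Re (eix (dot d xi y) * z ^ j)%C) <= Cmod z ^ j).
    { rewrite Rabs_mult, (Rabs_right w) by lra. generalize (Rabs_pos (Re (eix (dot d xi y) * z ^ j)%C)). nra. }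
    assert (X5 : 0 <= g ^ j) by (apply pow_le; lra).
    assert (X6 : exp (- (c0 * (INR j * normsq d xi))) <=
       exp (- (c0 / 2 * K2)) * exp (- (c0 / 2 * (INR j * normsq d xi)))).
    { rewrite <- exp_plus. apply exp_le. nra. }
    apply Rle_trans with (2 * exp (- (c0 * (INR j * normsq d xi)))).
    { eapply Rle_trans. { apply Rabs_triang. } rewrite Rabs_Ropp, (Rabs_right (g ^ j)) by lra. lra. }
    generalize (exp_pos (- (c0 / 2 * (INR j * normsq d xi)))). nra.
  - assert (NB : norm1 d xi <= sqrt D / sqrt (INR j)).
    { apply Rmult_le_reg_r with (sqrt (INR j)). { now apply sqrt_lt_R0. }
      replace (sqrt D / sqrt (INR j) * sqrt (INR j)) with (sqrt D) by (field; apply Rgt_not_eq, sqrt_lt_R0; auto).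
      rewrite <- (sqrt_pow2 (norm1 d xi)) by auto. rewrite <- sqrt_mult_alt by apply pow2_ge_0.
      apply sqrt_le_1_alt. unfold D. generalize (pos_INR d). nra. }
    assert (NJ : INR j * norm1 d xi ^ 2 <= D).
    { unfold D. generalize (pos_INR d). nra. }
    apply Rle_trans with ((kappa + 2 * Y + A * D) * norm1 d xi).
    (* Three errors linear in [norm1 xi]: the weight [w], the phase due to the shift [y], and the
       passage from [z ^ j] to [g ^ j], where [j] times a cubic error becomes linear through
       [j * norm1 xi ^ 2 <= D]. *)
    + set (t := dot d xi y).
      replace (w * Re (eix t * z ^ j)%C - g ^ j) with
        (Re (RtoC (w - 1) * (eix t * z ^ j) + ((eix t - RtoC 1) * z ^ j + (z ^ j - RtoC g ^ j)))%C).
      2: { rewrite <- RtoC_pow. unfold Re, Cplus, Cminus, Copp, Cmult; simpl. ring. }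
      eapply Rle_trans. { apply re_le_Cmod. }
      eapply Rle_trans. { apply Cmod_triangle. }
      assert (ZP : 0 <= Cmod (z ^ j)%C <= 1).
      { split. { apply Cmod_ge_0. } rewrite Cmod_pow, <- (pow1 j). apply pow_incr. split; auto. apply Cmod_ge_0. }
      assert (Y1 : Cmod (RtoC (w - 1) * (eix t * z ^ j))%C <= kappa * norm1 d xi).
      { rewrite !Cmod_mult, Cmod_eix, Cmod_R, Rabs_minus_sym, Rabs_right by lra.
        rewrite Rmult_1_l. nra. }
      assert (Y2 : Cmod ((eix t - RtoC 1) * z ^ j)%C <= 2 * Y * norm1 d xi).
      { rewrite Cmod_mult. generalize (Cmod_eix_minus_1 t) (Rabs_dot_le d xi y) (Cmod_ge_0 (eix t - RtoC 1)%C).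
        fold t. intros. nra. }
      assert (Y3 : Cmod (z ^ j - RtoC g ^ j)%C <= A * D * norm1 d xi).
      { eapply Rle_trans. { apply Cmod_pow_diff; auto. rewrite Cmod_R, Rabs_right; lra. }
        apply Rle_trans with (INR j * (A * norm1 d xi ^ 3)).
        { apply Rmult_le_compat_l; [lra|]. now apply HA. }
        replace (INR j * (A * norm1 d xi ^ 3)) with (A * norm1 d xi * (INR j * norm1 d xi ^ 2)) by ring.
        replace (A * D * norm1 d xi) with (A * norm1 d xi * D) by ring.
        apply Rmult_le_compat_l; auto. now apply Rmult_le_pos. }
      generalize (Cmod_triangle ((eix t - RtoC 1) * z ^ j)%C (z ^ j - RtoC g ^ j)%C). lra.
    + apply Rle_trans with (B / sqrt (INR j)).
      { unfold B, Rdiv. rewrite Rmult_assoc. apply Rmult_le_compat_l.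
        { generalize (Rmult_le_pos _ _ A0 D0); lra. } apply NB. }
      apply Rle_trans with e.
      * assert (SJ := sqrt_lt_R0 _ J0). apply Rmult_le_reg_r with (sqrt (INR j)); auto.
        replace (B / sqrt (INR j) * sqrt (INR j)) with B by (field; lra).
        assert (B / e <= sqrt (INR j)).
        { rewrite <- (sqrt_pow2 (B / e)). { now apply sqrt_le_1_alt. }
          apply Rmult_le_pos; auto. now apply Rlt_le, Rinv_0_lt_compat. }
        replace B with (e * (B / e)) by (field; lra). apply Rmult_le_compat_l; lra.
      * unfold e. apply Rmult_le_compat_l; [lra|]. apply exp_le. nra.
Qed.

End Moments.

End Orbits.

(** * Fejer kernels *)

(** Written so that one layer of [cube_sum] is a [zsum] by computation. *)
Definition zsum (n : nat) (g : Z -> R) : R :=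
  sum_f_R0 (fun i => g (Z.of_nat i - Z.of_nat n)%Z) (2 * n).

Lemma zsum_S n g : zsum (S n) g = g (- Z.of_nat (S n))%Z + zsum n g + g (Z.of_nat (S n)).
Proof.
  unfold zsum. replace (2 * S n)%nat with (S (S (2 * n))) by lia.
  rewrite decomp_sum by lia. rewrite Nat.pred_succ, tech5.
  rewrite (sum_eq (fun i => g (Z.of_nat (S i) - Z.of_nat (S n))%Z)
    (fun i => g (Z.of_nat i - Z.of_nat n)%Z)) by (intros; f_equal; lia).
  replace (Z.of_nat 0 - Z.of_nat (S n))%Z with (- Z.of_nat (S n))%Z by lia.
  replace (Z.of_nat (S (S (2 * n))) - Z.of_nat (S n))%Z with (Z.of_nat (S n)) by lia. ring.
Qed.

Lemma zsum_0 g : zsum 0 g = g 0%Z.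
Proof. reflexivity. Qed.

Lemma zsum_le n f g : (forall m, (Z.abs m <= Z.of_nat n)%Z -> f m <= g m) -> zsum n f <= zsum n g.
Proof. intros H. apply sum_Rle. intros i Hi. apply H. lia. Qed.

Lemma zsum_ext n f g : (forall m, (Z.abs m <= Z.of_nat n)%Z -> f m = g m) -> zsum n f = zsum n g.
Proof. intros H. apply sum_eq. intros i Hi. apply H. lia. Qed.

Lemma zsum_scal n f c : zsum n (fun m => c * f m) = c * zsum n f.
Proof. unfold zsum. rewrite scal_sum. apply sum_eq; intros; ring. Qed.

Lemma zsum_plus n f g : zsum n (fun m => f m + g m) = zsum n f + zsum n g.
Proof. unfold zsum. apply sum_plus. Qed.

Lemma zsum_const n c : zsum n (fun _ => c) = c * (2 * INR n + 1).
Proof. unfold zsum. rewrite sum_cte, S_INR, mult_INR. simpl; ring. Qed.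

Lemma zsum_ge0 n f : (forall m, (Z.abs m <= Z.of_nat n)%Z -> 0 <= f m) -> 0 <= zsum n f.
Proof.
  intros H. apply Rle_trans with (zsum n (fun _ => 0)). { rewrite zsum_const; lra. }
  now apply zsum_le.
Qed.

Lemma zsum_odd n g : (forall m, g (- m)%Z = - g m) -> zsum n g = 0.
Proof.
  intros H. induction n as [|n IH].
  - rewrite zsum_0. generalize (H 0%Z). simpl. lra.
  - rewrite zsum_S, IH, H. ring.
Qed.

Lemma zsum_delta n c : zsum n (fun m => if Z.eq_dec m 0 then c else 0) = c.
Proof.
  induction n as [|n IH]; [reflexivity|]. rewrite zsum_S, IH.
  destruct (Z.eq_dec (- Z.of_nat (S n)) 0); [lia|]. destruct (Z.eq_dec (Z.of_nat (S n)) 0); [lia|]. ring.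
Qed.

Lemma zsum_mono n n' f : (n <= n')%nat -> (forall m, 0 <= f m) -> zsum n f <= zsum n' f.
Proof.
  intros H P. induction H as [|n' H IH]; [lra|]. rewrite zsum_S.
  generalize (P (- Z.of_nat (S n'))%Z) (P (Z.of_nat (S n'))). lra.
Qed.

(** Normalised so that the kernel equals 1 at its poles; the weight vanishes at the extreme
    frequencies [n] and [- n]. *)
Definition fejer_weight (n : nat) (m : Z) : R := (INR n - Rabs (IZR m)) / INR n ^ 2.

(* [fejer n v = (sin (n v) / (n sin v))^2] *)
Definition fejer (n : nat) (v : R) : R := zsum n (fun m => fejer_weight n m * cos (2 * IZR m * v)).

Lemma Rabs_IZR_nat n : Rabs (IZR (Z.of_nat n)) = INR n.
Proof. rewrite <- INR_IZR_INZ. apply Rabs_right, Rle_ge, pos_INR. Qed.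

Lemma Rabs_IZR_le m n : (Z.abs m <= Z.of_nat n)%Z -> Rabs (IZR m) <= INR n.
Proof. intros H. rewrite <- abs_IZR, INR_IZR_INZ. now apply IZR_le. Qed.

Lemma fejer_weight_bounds n m : (1 <= n)%nat -> (Z.abs m <= Z.of_nat n)%Z ->
  0 <= fejer_weight n m <= / INR n.
Proof.
  intros Hn Hm. apply Rabs_IZR_le in Hm. apply le_INR in Hn. simpl in Hn.
  unfold fejer_weight. assert (0 < INR n ^ 2) by (apply pow_lt; lra).
  assert (H0 := Rabs_pos (IZR m)). split.
  - apply Rmult_le_pos; [lra|]. now apply Rlt_le, Rinv_0_lt_compat.
  - apply Rmult_le_reg_r with (INR n ^ 2); auto.
    replace ((INR n - Rabs (IZR m)) / INR n ^ 2 * INR n ^ 2) with (INR n - Rabs (IZR m)) by (field; lra).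
    replace (/ INR n * INR n ^ 2) with (INR n) by (field; lra). lra.
Qed.

Definition fejer_sum (n : nat) (v : R) : R := zsum n (fun m => (INR n - Rabs (IZR m)) * cos (2 * IZR m * v)).

Lemma fejer_fejer_sum n v : fejer n v = fejer_sum n v / INR n ^ 2.
Proof.
  unfold fejer, fejer_sum, Rdiv. rewrite (Rmult_comm (zsum _ _)), <- zsum_scal.
  apply zsum_ext. intros m _. unfold fejer_weight, Rdiv. ring.
Qed.

Lemma fejer_sum_S n v : fejer_sum (S n) v = fejer_sum n v + zsum n (fun m => cos (2 * IZR m * v)).
Proof.
  unfold fejer_sum. rewrite zsum_S, opp_IZR, Rabs_Ropp, Rabs_IZR_nat, Rminus_diag, !Rmult_0_l.
  rewrite <- zsum_plus, Rplus_0_l, Rplus_0_r. apply zsum_ext. intros. rewrite S_INR. ring.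
Qed.

Lemma dirichlet_closed n v : zsum n (fun m => cos (2 * IZR m * v)) * sin v = sin ((2 * INR n + 1) * v).
Proof.
  induction n as [|n IH].
  - rewrite zsum_0. simpl. replace (2 * 0 * v) with 0 by ring. rewrite cos_0, Rmult_1_l. f_equal; ring.
  - rewrite zsum_S, opp_IZR, <- INR_IZR_INZ.
    replace (2 * - INR (S n) * v) with (- (2 * INR (S n) * v)) by ring. rewrite cos_neg.
    rewrite 2!Rmult_plus_distr_r, IH, S_INR.
    set (t := 2 * (INR n + 1) * v).
    replace ((2 * INR n + 1) * v) with (t - v) by (unfold t; ring).
    replace ((2 * (INR n + 1) + 1) * v) with (t + v) by (unfold t; ring).
    rewrite sin_minus, sin_plus. ring.
Qed.

(** Kept in multiplied form, as is the Dirichlet kernel before it, so that the induction needs no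
    case distinction at the zeros of the sine. *)
Lemma fejer_sum_closed n v : fejer_sum n v * sin v ^ 2 = sin (INR n * v) ^ 2.
Proof.
  induction n as [|n IH].
  - unfold fejer_sum. rewrite zsum_0. simpl. rewrite Rabs_R0, Rmult_0_l, sin_0. ring.
  - rewrite fejer_sum_S, Rmult_plus_distr_r, IH.
    replace (zsum n (fun m => cos (2 * IZR m * v)) * sin v ^ 2) with
      (zsum n (fun m => cos (2 * IZR m * v)) * sin v * sin v) by ring.
    rewrite dirichlet_closed, S_INR.
    set (x := INR n * v). replace ((2 * INR n + 1) * v) with (2 * x + v) by (unfold x; ring).
    replace ((INR n + 1) * v) with (x + v) by (unfold x; ring).
    rewrite !sin_plus, sin_2a, cos_2a_sin.
    assert (E := sin2_cos2 x). assert (E2 := sin2_cos2 v). unfold Rsqr in *.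
    replace ((sin x * cos v + cos x * sin v) ^ 2) with
      (sin x ^ 2 * (cos v * cos v) + 2 * (sin x * cos x) * (sin v * cos v) + (cos x * cos x) * sin v ^ 2) by ring.
    replace (cos v * cos v) with (1 - sin v * sin v) by lra.
    replace (cos x * cos x) with (1 - sin x * sin x) by lra. ring.
Qed.

Lemma fejer_sum_at_pole n v : sin v = 0 -> fejer_sum n v = INR n ^ 2.
Proof.
  intros Hv.
  assert (P : forall k, sin (INR k * v) = 0).
  { induction k as [|k IH]. { simpl. now rewrite Rmult_0_l, sin_0. }
    rewrite S_INR, Rmult_plus_distr_r, Rmult_1_l, sin_plus, IH, Hv. ring. }
  assert (Z : forall m, cos (2 * IZR m * v) = 1).
  { intros m. rewrite Rmult_assoc, cos_2a_sin.
    assert (sin (IZR m * v) = 0); [| rewrite H; ring].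
    destruct (Z_le_gt_dec 0 m).
    - rewrite <- (Z2Nat.id m) by auto. rewrite <- INR_IZR_INZ. apply P.
    - replace (IZR m * v) with (- (INR (Z.to_nat (- m)) * v)).
      { rewrite sin_neg, P. ring. }
      rewrite INR_IZR_INZ, Z2Nat.id by lia. rewrite opp_IZR. ring. }
  induction n as [|n IH].
  - unfold fejer_sum. rewrite zsum_0. simpl. rewrite Rabs_R0. ring.
  - rewrite fejer_sum_S, IH, (zsum_ext n _ (fun _ => 1)) by (intros; apply Z).
    rewrite zsum_const, S_INR. ring.
Qed.

Lemma fejer_at_pole n v : (1 <= n)%nat -> sin v = 0 -> fejer n v = 1.
Proof.
  intros Hn Hv. rewrite fejer_fejer_sum, fejer_sum_at_pole by auto.
  apply le_INR in Hn. simpl in Hn. field. lra.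
Qed.

Lemma fejer_closed n v : (1 <= n)%nat -> sin v <> 0 ->
  fejer n v = sin (INR n * v) ^ 2 / (INR n ^ 2 * sin v ^ 2).
Proof.
  intros Hn Hv. rewrite fejer_fejer_sum, <- fejer_sum_closed.
  apply le_INR in Hn. simpl in Hn. field. split; auto. lra.
Qed.

Lemma Rabs_sin_mult n v : Rabs (sin (INR n * v)) <= INR n * Rabs (sin v).
Proof.
  induction n as [|n IH]. { simpl. rewrite Rmult_0_l, sin_0, Rabs_R0. lra. }
  rewrite S_INR, Rmult_plus_distr_r, Rmult_1_l, sin_plus.
  eapply Rle_trans. { apply Rabs_triang. } rewrite !Rabs_mult.
  assert (Rabs (cos v) <= 1) by apply Rabs_le, COS_bound.
  assert (Rabs (cos (INR n * v)) <= 1) by apply Rabs_le, COS_bound.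
  generalize (Rabs_pos (sin v)) (Rabs_pos (sin (INR n * v))). nra.
Qed.

Lemma fejer_bounds n v : (1 <= n)%nat -> 0 <= fejer n v <= 1.
Proof.
  intros Hn. destruct (Req_dec (sin v) 0) as [E | E].
  { rewrite fejer_at_pole by auto. lra. }
  rewrite fejer_closed by auto. apply le_INR in Hn. simpl in Hn.
  assert (0 < sin v ^ 2) by (apply pow2_gt_0; auto).
  assert (0 < INR n ^ 2 * sin v ^ 2) by (apply Rmult_lt_0_compat; auto; apply pow_lt; lra).
  split.
  - apply Rmult_le_pos. { apply pow2_ge_0. } now apply Rlt_le, Rinv_0_lt_compat.
  - apply Rmult_le_reg_r with (INR n ^ 2 * sin v ^ 2); auto.
    unfold Rdiv. rewrite Rmult_assoc, Rinv_l, Rmult_1_r, Rmult_1_l by lra.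
    rewrite <- Rpow_mult_distr, <- (pow2_abs (sin _)), <- (pow2_abs (INR n * sin v)).
    apply pow_incr. split. { apply Rabs_pos. }
    rewrite Rabs_mult, (Rabs_right (INR n)) by lra. apply Rabs_sin_mult.
Qed.

(** * The squared sinc as a limit of Fejer kernels *)

Definition sinc_sq (u : R) : R := if Req_EM_T u 0 then 1 else (sin u / u) ^ 2.

Lemma sinc_sq_mult u : sinc_sq u * u ^ 2 = sin u ^ 2.
Proof.
  unfold sinc_sq. destruct (Req_EM_T u 0) as [-> | H]. { rewrite sin_0; ring. } field; auto.
Qed.

Lemma sinc_sq_bounds u : 0 <= sinc_sq u <= 1.
Proof.
  assert (E := sinc_sq_mult u). destruct (Req_dec u 0) as [-> | H].
  { unfold sinc_sq. destruct (Req_EM_T 0 0); lra. }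
  assert (P : 0 < u ^ 2) by (apply pow2_gt_0; auto).
  assert (Q := pow2_ge_0 (sin u)).
  assert (sin u ^ 2 <= u ^ 2).
  { rewrite <- (pow2_abs (sin u)), <- (pow2_abs u). apply pow_incr. split. { apply Rabs_pos. } apply Rabs_sin_le. }
  nra.
Qed.

Lemma sinc_sq_le_fejer n u : (1 <= n)%nat -> sinc_sq u <= fejer n (u / INR n).
Proof.
  intros Hn. destruct (Req_dec (sin (u / INR n)) 0) as [E | E].
  { rewrite fejer_at_pole by auto. apply sinc_sq_bounds. }
  rewrite fejer_closed by auto. apply le_INR in Hn. simpl in Hn.
  replace (INR n * (u / INR n)) with u by (field; lra).
  assert (U : u <> 0). { intros ->. apply E. unfold Rdiv. now rewrite Rmult_0_l, sin_0. }
  unfold sinc_sq. destruct (Req_EM_T u 0); [contradiction|].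
  replace ((sin u / u) ^ 2) with (sin u ^ 2 * / u ^ 2) by (field; auto).
  apply Rmult_le_compat_l. { apply pow2_ge_0. }
  assert (P : 0 < sin (u / INR n) ^ 2) by (apply pow2_gt_0; auto).
  assert (0 < INR n ^ 2) by (apply pow_lt; lra).
  apply Rinv_le_contravar. { now apply Rmult_lt_0_compat. }
  assert (sin (u / INR n) ^ 2 <= (u / INR n) ^ 2).
  { rewrite <- (pow2_abs (sin _)), <- (pow2_abs (u / INR n)). apply pow_incr. split. { apply Rabs_pos. } apply Rabs_sin_le. }
  replace (u ^ 2) with (INR n ^ 2 * (u / INR n) ^ 2) by (field; lra).
  apply Rmult_le_compat_l; lra.
Qed.

(** The ratio of the two kernels is [v ^ 2 / sin v ^ 2], which is at most [1 + v ^ 2] for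
    [v ^ 2 < 1] because [(1 - x / 6) ^ 2 * (1 + x) >= 1] with [x = v ^ 2]. For larger [v] the kernel
    is at most 1, which is below the error term. *)
Lemma fejer_le_sinc_sq n u : (1 <= n)%nat -> fejer n (u / INR n) <= sinc_sq u + (u / INR n) ^ 2.
Proof.
  intros Hn. set (v := u / INR n). assert (SB := sinc_sq_bounds u).
  assert (NR : 1 <= INR n) by (apply (le_INR 1); auto).
  destruct (Rle_or_lt 1 (v ^ 2)) as [L | L].
  { generalize (fejer_bounds n v Hn). lra. }
  destruct (Req_dec u 0) as [U | U].
  { assert (sinc_sq u = 1) by (unfold sinc_sq; destruct (Req_EM_T u 0); [auto | contradiction]).
    generalize (fejer_bounds n v Hn) (pow2_ge_0 v). lra. }
  assert (V : v <> 0). { unfold v. apply Rmult_integral_contrapositive. split; auto. apply Rinv_neq_0_compat; lra. }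
  assert (V2 : 0 < v ^ 2) by (apply pow2_gt_0; auto).
  assert (S : v ^ 2 <= sin v ^ 2 * (1 + v ^ 2)).
  { assert (A : Rabs v * (1 - v ^ 2 / 6) <= Rabs (sin v)).
    { generalize (sin_taylor v) (Rabs_triang_inv v (v - sin v)).
      rewrite (Rabs_minus_sym v (sin v)). replace (v - (v - sin v)) with (sin v) by ring.
      replace (Rabs v ^ 3) with (Rabs v * v ^ 2) by (rewrite <- (pow2_abs v); ring). intros. lra. }
    assert (A0 := Rabs_pos v).
    assert (B : (Rabs v * (1 - v ^ 2 / 6)) ^ 2 <= sin v ^ 2).
    { rewrite <- (pow2_abs (sin v)). apply pow_incr. split; auto. apply Rmult_le_pos; lra. }
    rewrite Rpow_mult_distr, pow2_abs in B.
    set (x := v ^ 2) in *. assert (0 <= sin v ^ 2) by apply pow2_ge_0.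
    apply Rle_trans with (x * (1 - x / 6) ^ 2 * (1 + x)). 
    - assert (1 <= (1 - x / 6) ^ 2 * (1 + x)) by nra. nra.
    - apply Rmult_le_compat_r; lra. }
  assert (SV : sin v <> 0). { intros E. rewrite E in S. nra. }
  rewrite fejer_closed by auto.
  replace (INR n * v) with u by (unfold v; field; lra).
  assert (P : 0 < sin v ^ 2) by (apply pow2_gt_0; auto).
  rewrite <- sinc_sq_mult.
  replace (sinc_sq u * u ^ 2 / (INR n ^ 2 * sin v ^ 2)) with (sinc_sq u * (v ^ 2 / sin v ^ 2))
    by (unfold v at 1; field; lra).
  assert (v ^ 2 / sin v ^ 2 <= 1 + v ^ 2).
  { apply Rmult_le_reg_r with (sin v ^ 2); auto. unfold Rdiv. rewrite Rmult_assoc, Rinv_l; lra. }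
  apply Rle_trans with (sinc_sq u * (1 + v ^ 2)).
  - apply Rmult_le_compat_l; lra.
  - nra.
Qed.

(** * Partitions of unity by translated kernels *)

Lemma sum_cos_progression N th a :
  2 * sin a * sum_f_R0 (fun k => cos (th - 2 * INR k * a)) N = sin (th + a) - sin (th - (2 * INR N + 1) * a).
Proof.
  induction N as [|N IH].
  - simpl. replace (th - 2 * 0 * a) with th by ring. replace (th - (2 * 0 + 1) * a) with (th - a) by ring.
    rewrite sin_plus, sin_minus. ring.
  - rewrite tech5, Rmult_plus_distr_l, IH, S_INR.
    set (t := th - 2 * (INR N + 1) * a).
    replace (th - (2 * INR N + 1) * a) with (t + a) by (unfold t; ring).
    replace (th - (2 * (INR N + 1) + 1) * a) with (t - a) by (unfold t; ring).
    rewrite (sin_plus t a), (sin_minus t a). ring.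
Qed.

Lemma sum_cos_roots N p th : (0 < p < S N)%nat ->
  sum_f_R0 (fun k => cos (th - 2 * INR k * (PI * INR p / INR (S N)))) N = 0.
Proof.
  intros Hp. set (a := PI * INR p / INR (S N)).
  assert (P1 : 0 < INR p) by (apply lt_0_INR; lia).
  assert (P2 : INR p < INR (S N)) by (apply lt_INR; lia).
  assert (Sa : 0 < sin a).
  { apply sin_gt_0; unfold a.
    - apply Rdiv_lt_0_compat; [| lra]. apply Rmult_lt_0_compat; auto. apply PI_RGT_0.
    - apply Rmult_lt_reg_r with (INR (S N)); [lra|].
      replace (PI * INR p / INR (S N) * INR (S N)) with (PI * INR p) by (field; lra).
      apply Rmult_lt_compat_l; auto. apply PI_RGT_0. }
  assert (H := sum_cos_progression N th a).
  assert (E : sin (th - (2 * INR N + 1) * a) = sin (th + a)).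
  { rewrite <- (sin_period (th - (2 * INR N + 1) * a) p). f_equal. unfold a.
    rewrite S_INR in *. field. lra. }
  rewrite E, Rminus_diag in H. apply Rmult_integral in H. destruct H; [lra | auto].
Qed.

Lemma sum_zsum_exchange N n (f : nat -> Z -> R) :
  sum_f_R0 (fun k => zsum n (f k)) N = zsum n (fun m => sum_f_R0 (fun k => f k m) N).
Proof.
  induction N as [|N IH]; simpl; auto. now rewrite IH, <- zsum_plus.
Qed.

(** Averaging over [N + 1] equally spaced shifts kills every nonzero frequency of absolute value at
    most [N]; the constant term is [1 / (N + 1)]. *)
Lemma fejer_partition N v :
  sum_f_R0 (fun k => fejer (S N) (v - INR k * (PI / INR (S N)))) N = 1.
Proof.
  assert (P : 0 < INR (S N)) by (apply lt_0_INR; lia).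
  unfold fejer. rewrite sum_zsum_exchange.
  rewrite (zsum_ext _ _ (fun m => if Z.eq_dec m 0 then 1 else 0)). { apply zsum_delta. }
  intros m Hm. destruct (Z.eq_dec m 0) as [-> | Hz].
  - rewrite (sum_eq _ (fun _ => / INR (S N))).
    + rewrite sum_cte. field. lra.
    + intros k _. replace (2 * IZR 0 * (v - INR k * (PI / INR (S N)))) with 0 by (simpl; ring).
      rewrite cos_0. unfold fejer_weight. simpl (IZR 0). rewrite Rabs_R0. field. lra.
  - rewrite <- (Rmult_0_r (fejer_weight (S N) m)).
    rewrite (sum_eq _ (fun k => cos (2 * IZR m * (v - INR k * (PI / INR (S N)))) * fejer_weight (S N) m))
      by (intros; ring).
    rewrite <- scal_sum.
    (* The frequencies [N + 1] and [- (N + 1)] survive the averaging but carry weight zero. *)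
    destruct (Z.eq_dec (Z.abs m) (Z.of_nat (S N))) as [E | E].
    { unfold fejer_weight. rewrite <- abs_IZR, E, <- INR_IZR_INZ, Rminus_diag. unfold Rdiv; ring. }
    f_equal.
    rewrite (sum_eq _ (fun k => cos (2 * IZR (Z.abs m) * v - 2 * INR k * (PI * INR (Z.abs_nat m) / INR (S N))))).
    { apply sum_cos_roots. lia. }
    intros k _. rewrite (INR_IZR_INZ (Z.abs_nat m)), Zabs2Nat.id_abs.
    destruct (Z_le_gt_dec 0 m).
    + rewrite Z.abs_eq by auto. f_equal. field. lra.
    + rewrite <- cos_neg. rewrite Z.abs_neq, opp_IZR by lia. f_equal. field. lra.
Qed.

(** With degree [2 * I + 1] the Fejer partition of unity has exactly as many translates as the
    finite sum has terms, so a termwise comparison suffices and no infinite series has to be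
    evaluated. *)
Lemma sinc_sq_partition I u : zsum I (fun m => sinc_sq (u - PI * IZR m)) <= 1.
Proof.
  rewrite <- (fejer_partition (2 * I) ((u + PI * INR I) / INR (S (2 * I)))).
  unfold zsum. apply sum_Rle. intros k Hk.
  assert (P : 0 < INR (S (2 * I))) by (apply lt_0_INR; lia).
  replace ((u + PI * INR I) / INR (S (2 * I)) - INR k * (PI / INR (S (2 * I)))) with
   ((u - PI * IZR (Z.of_nat k - Z.of_nat I)) / INR (S (2 * I))).
  - apply sinc_sq_le_fejer. lia.
  - rewrite minus_IZR, <- !INR_IZR_INZ. field. lra.
Qed.

(** * A nonnegative trigonometric majorant of the Cauchy density *)

Definition majorant_weight (n : nat) (m : Z) : R := fejer_weight n m * (1 + cos (IZR m * (PI / INR n))).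

(** A Fejer kernel plus half of its two translates by [PI / (2 n)]; on the Fourier side the
    translates are the factor [1 + cos]. The zeros of the kernel, where the sine of [n v] vanishes,
    are covered by the translates, where that sine becomes a cosine. *)
Definition majorant (n : nat) (v : R) : R := zsum n (fun m => majorant_weight n m * cos (2 * IZR m * v)).

Lemma majorant_fejer n v : (1 <= n)%nat ->
  majorant n v = fejer n v + / 2 * fejer n (v + PI / (2 * INR n)) + / 2 * fejer n (v - PI / (2 * INR n)).
Proof.
  intros Hn. apply (le_INR 1) in Hn. simpl in Hn.
  unfold majorant, fejer. rewrite <- !zsum_scal, <- !zsum_plus. apply zsum_ext. intros m _.
  unfold majorant_weight.
  set (t := 2 * IZR m * v). set (s := IZR m * (PI / INR n)).
  replace (2 * IZR m * (v + PI / (2 * INR n))) with (t + s) by (unfold t, s; field; lra).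
  replace (2 * IZR m * (v - PI / (2 * INR n))) with (t - s) by (unfold t, s; field; lra).
  rewrite cos_plus, cos_minus. field.
Qed.

Lemma majorant_ge_cauchy n u : (1 <= n)%nat -> cauchy_density u / 9 <= majorant n (u / INR n).
Proof.
  intros Hn. rewrite majorant_fejer by auto. assert (NR := le_INR 1 n Hn). simpl in NR.
  replace (u / INR n + PI / (2 * INR n)) with ((u + PI / 2) / INR n) by (field; lra).
  replace (u / INR n - PI / (2 * INR n)) with ((u - PI / 2) / INR n) by (field; lra).
  assert (H1 := sinc_sq_le_fejer n u Hn). assert (H2 := sinc_sq_le_fejer n (u + PI / 2) Hn).
  assert (H3 := sinc_sq_le_fejer n (u - PI / 2) Hn).
  assert (Q := pow2_ge_0 u).
  (* The arguments [u] and [u +- PI / 2] all satisfy [s ^ 2 <= 2 u ^ 2 + 8 <= 9 (1 + u ^ 2)], hence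
     the constant 9; the three bounds then combine through [sin ^ 2 + cos ^ 2 = 1]. *)
  assert (L : forall s t, sin s ^ 2 = t -> s ^ 2 <= 2 * u ^ 2 + 8 -> t * (cauchy_density u / 9) <= sinc_sq s).
  { intros s t Ht Hs. assert (E := sinc_sq_mult s). assert (B := sinc_sq_bounds s).
    assert (t <= sinc_sq s * (9 * (1 + u ^ 2))) by nra.
    unfold cauchy_density. apply Rmult_le_reg_r with (9 * (1 + u ^ 2)); [lra|].
    replace (t * (/ (1 + u ^ 2) / 9) * (9 * (1 + u ^ 2))) with t by (field; lra). lra. }
  assert (P4 := PI_4). assert (P0 := PI_RGT_0).
  assert (L1 := L u (sin u ^ 2) eq_refl ltac:(lra)).
  assert (PP : PI ^ 2 <= 16) by (simpl; nra).
  assert (L2 : cos u ^ 2 * (cauchy_density u / 9) <= sinc_sq (u + PI / 2)).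
  { apply L. { rewrite sin_plus, cos_PI2, sin_PI2. ring. } generalize (pow2_ge_0 (u - PI / 2)). lra. }
  assert (L3 : cos u ^ 2 * (cauchy_density u / 9) <= sinc_sq (u - PI / 2)).
  { apply L. { rewrite sin_minus, cos_PI2, sin_PI2. ring. } generalize (pow2_ge_0 (u + PI / 2)). lra. }
  assert (T := sin2_cos2 u). unfold Rsqr in T.
  replace (cauchy_density u / 9) with ((sin u ^ 2 + cos u ^ 2) * (cauchy_density u / 9)).
  2: { replace (sin u ^ 2 + cos u ^ 2) with 1 by lra. ring. }
  lra.
Qed.

Lemma majorant_ge0 n v : (1 <= n)%nat -> 0 <= majorant n v.
Proof.
  intros Hn. rewrite majorant_fejer by auto.
  generalize (fejer_bounds n v Hn) (fejer_bounds n (v + PI / (2 * INR n)) Hn) (fejer_bounds n (v - PI / (2 * INR n)) Hn). lra.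
Qed.

Lemma majorant_weight_bounds n m : (1 <= n)%nat -> (Z.abs m <= Z.of_nat n)%Z ->
  0 <= majorant_weight n m <= 2 / INR n.
Proof.
  intros Hn Hm. destruct (fejer_weight_bounds n m Hn Hm) as [H1 H2].
  assert (C := COS_bound (IZR m * (PI / INR n))). unfold majorant_weight, Rdiv in *. nra.
Qed.

Lemma fejer_weight_even n m : fejer_weight n (- m) = fejer_weight n m.
Proof. unfold fejer_weight. now rewrite opp_IZR, Rabs_Ropp. Qed.

Lemma majorant_weight_even n m : majorant_weight n (- m) = majorant_weight n m.
Proof.
  unfold majorant_weight. rewrite fejer_weight_even, opp_IZR, Ropp_mult_distr_l_reverse, cos_neg. reflexivity.
Qed.

(** Comparison with the integral of [1 / (1 + kappa t ^ 2)], one unit interval per term; the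
    arctangent is at most [PI / 2 <= 2]. *)
Lemma cauchy_sum_bound kappa n : 0 < kappa -> zsum n (fun m => / (1 + kappa * IZR m ^ 2)) <= 1 + 4 / sqrt kappa.
Proof.
  intros Hk. assert (SK := sqrt_lt_R0 _ Hk).
  assert (K2 : sqrt kappa ^ 2 = kappa) by (simpl; rewrite Rmult_1_r; apply sqrt_sqrt; lra).
  assert (H : zsum n (fun m => / (1 + kappa * IZR m ^ 2)) <= 1 + 2 / sqrt kappa * atan (sqrt kappa * INR n)).
  { induction n as [|n IH].
    - rewrite zsum_0. change (INR 0) with 0. replace (kappa * IZR 0 ^ 2) with 0 by (simpl; ring).
      rewrite Rmult_0_r, atan_0, Rmult_0_r, !Rplus_0_r, Rinv_1. lra.
    - rewrite zsum_S, opp_IZR, <- INR_IZR_INZ.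
      replace ((- INR (S n)) ^ 2) with (INR (S n) ^ 2) by ring.
      assert (D : / (1 + kappa * INR (S n) ^ 2) <= / sqrt kappa * (atan (sqrt kappa * INR (S n)) - atan (sqrt kappa * INR n))).
      { destruct (MVT_gen (fun t => / sqrt kappa * atan (sqrt kappa * t)) (INR n) (INR (S n))
          (fun t => / (1 + kappa * t ^ 2))) as [c [Hc E]].
        - intros t _. auto_derive; auto.
          replace (kappa * t ^ 2) with ((sqrt kappa * t) ^ 2) by (rewrite Rpow_mult_distr, K2; ring).
          generalize (pow2_ge_0 (sqrt kappa * t)). intros. field. simpl in *. split; lra.
        - intros t _. apply continuity_pt_filterlim, (@ex_derive_continuous R_AbsRing R_NormedModule
            (fun t => / sqrt kappa * atan (sqrt kappa * t))). auto_derive; auto.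
        - rewrite S_INR in *. rewrite Rmin_left, Rmax_right in Hc by lra.
          replace (INR n + 1 - INR n) with 1 in E by ring. rewrite Rmult_1_r in E.
          rewrite Rmult_minus_distr_l, E. assert (N := pos_INR n).
          apply Rinv_le_contravar.
          + generalize (pow2_ge_0 c). nra.
          + assert (c ^ 2 <= (INR n + 1) ^ 2) by (apply pow_incr; lra). nra. }
      replace (1 + 2 / sqrt kappa * atan (sqrt kappa * INR (S n))) with
       (1 + 2 / sqrt kappa * atan (sqrt kappa * INR n) + 2 * (/ sqrt kappa * (atan (sqrt kappa * INR (S n)) - atan (sqrt kappa * INR n))))
        by (field; lra). lra. }
  eapply Rle_trans; [apply H|]. apply Rplus_le_compat_l.
  replace (4 / sqrt kappa) with (2 / sqrt kappa * 2) by (field; lra).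
  apply Rmult_le_compat_l. { apply Rlt_le, Rdiv_lt_0_compat; lra. }
  generalize (atan_bound (sqrt kappa * INR n)) PI_4. lra.
Qed.

Lemma theta_sum_bound kappa n : 0 < kappa -> zsum n (fun m => exp (- (kappa * IZR m ^ 2))) <= 1 + 4 / sqrt kappa.
Proof.
  intros Hk. eapply Rle_trans; [| apply (cauchy_sum_bound kappa n Hk)].
  apply zsum_le. intros m _. rewrite exp_Ropp.
  assert (0 <= kappa * IZR m ^ 2) by (apply Rmult_le_pos; [lra | apply pow2_ge_0]).
  apply Rinv_le_contravar; [lra|]. apply exp_ge_1_plus.
Qed.

(** * Lattice sums, upper bound *)

Fixpoint in_cube (d n : nat) : Zn d -> Prop :=
  match d return Zn d -> Prop with
  | O => fun _ => True
  | S d' => fun k => (Z.abs (fst k) <= Z.of_nat n)%Z /\ in_cube d' n (snd k)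
  end.

Fixpoint prodz (d : nat) (w : Z -> R) : Zn d -> R :=
  match d return Zn d -> R with
  | O => fun _ => 1
  | S d' => fun k => w (fst k) * prodz d' w (snd k)
  end.

Lemma cube_sum_S d n f : cube_sum (S d) n f = zsum n (fun a => cube_sum d n (fun k => f (a, k))).
Proof. reflexivity. Qed.

Lemma cube_sum_le d n f g : (forall k, in_cube d n k -> f k <= g k) -> cube_sum d n f <= cube_sum d n g.
Proof.
  revert f g. induction d as [|d IH]; intros f g H. { now apply H. }
  rewrite !cube_sum_S. apply zsum_le. intros a Ha. apply IH. intros k Hk. apply H. now split.
Qed.

Lemma cube_sum_ext d n f g : (forall k, in_cube d n k -> f k = g k) -> cube_sum d n f = cube_sum d n g.
Proof.
  intros H. apply Rle_antisym; apply cube_sum_le; intros k Hk; rewrite (H k Hk); lra.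
Qed.

Lemma cube_sum_scal d n f c : cube_sum d n (fun k => c * f k) = c * cube_sum d n f.
Proof.
  revert f. induction d as [|d IH]; intros f. { reflexivity. }
  rewrite !cube_sum_S, <- zsum_scal. apply zsum_ext. intros; apply IH.
Qed.

Lemma cube_sum_plus d n f g : cube_sum d n (fun k => f k + g k) = cube_sum d n f + cube_sum d n g.
Proof.
  revert f g. induction d as [|d IH]; intros f g. { reflexivity. }
  rewrite !cube_sum_S, <- zsum_plus. apply zsum_ext. intros; apply IH.
Qed.

Lemma cube_sum_const d n c : cube_sum d n (fun _ => c) = c * (2 * INR n + 1) ^ d.
Proof.
  induction d as [|d IH]. { simpl; ring. }
  rewrite cube_sum_S, (zsum_ext n _ (fun _ => c * (2 * INR n + 1) ^ d)) by (intros; apply IH).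
  rewrite zsum_const. simpl; ring.
Qed.

Lemma cube_sum_ge0 d n f : (forall k, in_cube d n k -> 0 <= f k) -> 0 <= cube_sum d n f.
Proof.
  intros H. apply Rle_trans with (cube_sum d n (fun _ => 0)). { rewrite cube_sum_const; lra. }
  now apply cube_sum_le.
Qed.

Lemma cube_sum_prod d n w : cube_sum d n (prodz d w) = zsum n w ^ d.
Proof.
  induction d as [|d IH]. { reflexivity. }
  rewrite cube_sum_S. simpl. rewrite (Rmult_comm (zsum n w)), <- zsum_scal. apply zsum_ext.
  intros m _. rewrite cube_sum_scal, IH. ring.
Qed.

Lemma cube_sum_mono d n n' f : (n <= n')%nat -> (forall k, 0 <= f k) -> cube_sum d n f <= cube_sum d n' f.
Proof.
  intros H. revert f. induction d as [|d IH]; intros f P. { simpl; lra. }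
  rewrite !cube_sum_S. apply Rle_trans with (zsum n (fun a => cube_sum d n' (fun k => f (a, k)))).
  - apply zsum_le. intros. apply IH. auto.
  - apply zsum_mono; auto. intros. apply cube_sum_ge0. auto.
Qed.

Lemma prodz_le d n w w' k : in_cube d n k ->
  (forall m, (Z.abs m <= Z.of_nat n)%Z -> 0 <= w m <= w' m) -> 0 <= prodz d w k <= prodz d w' k.
Proof.
  intros Hk H. induction d as [|d IH]; simpl. { lra. } destruct Hk as [H1 H2].
  destruct (H _ H1), (IH _ H2). split. { now apply Rmult_le_pos. } apply Rmult_le_compat; auto.
Qed.

(* A product of one-dimensional even trigonometric polynomials expands into plane waves without
   phases, the sine parts cancelling. *)
Lemma trig_product d n w th x : (forall m, w (- m)%Z = w m) ->
  prodf d (fun t => zsum n (fun m => w m * cos (th * IZR m * t))) x =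
  cube_sum d n (fun k => prodz d w k * cos (dot d (zscale d th k) x)).
Proof.
  intros Hw. induction d as [|d IH]. { simpl. rewrite cos_0; ring. }
  rewrite cube_sum_S. simpl prodf. rewrite IH.
  set (A := cube_sum d n (fun k => prodz d w k * cos (dot d (zscale d th k) (snd x)))).
  set (B := cube_sum d n (fun k => prodz d w k * sin (dot d (zscale d th k) (snd x)))).
  symmetry. rewrite (zsum_ext n _ (fun a => A * (w a * cos (th * IZR a * fst x)) + (- B) * (w a * sin (th * IZR a * fst x)))).
  - rewrite zsum_plus, !zsum_scal. rewrite (zsum_odd n (fun m => w m * sin (th * IZR m * fst x))).
    + ring.
    + intros m. rewrite Hw, opp_IZR.
      replace (th * - IZR m * fst x) with (- (th * IZR m * fst x)) by ring. rewrite sin_neg; ring.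
  - intros a _. simpl.
    rewrite (cube_sum_ext d n _ (fun k => w a * cos (th * IZR a * fst x) * (prodz d w k * cos (dot d (zscale d th k) (snd x)))
      + (- (w a * sin (th * IZR a * fst x))) * (prodz d w k * sin (dot d (zscale d th k) (snd x))))).
    + rewrite cube_sum_plus, !cube_sum_scal. fold A B. ring.
    + intros k _. rewrite cos_plus. ring.
Qed.

Lemma inbox_zscale d th n k : 0 <= th -> in_cube d n k -> inbox d (th * INR n) (zscale d th k).
Proof.
  intros Hth. induction d as [|d IH]; simpl; auto. intros [H1 H2]. split; auto.
  rewrite Rabs_mult, (Rabs_right th) by lra. apply Rmult_le_compat_l; auto. now apply Rabs_IZR_le.
Qed.

Lemma exp_normsq_zscale d a th k :
  exp (- (a * normsq d (zscale d th k))) = prodz d (fun m => exp (- (a * th ^ 2 * IZR m ^ 2))) k.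
Proof.
  unfold normsq. induction d as [|d IH]; simpl. { now rewrite Rmult_0_r, Ropp_0, exp_0. }
  rewrite <- IH, <- exp_plus. f_equal. ring.
Qed.

Lemma prodz_mult d u v k : prodz d u k * prodz d v k = prodz d (fun m => u m * v m) k.
Proof. induction d as [|d IH]; simpl. { ring. } rewrite <- IH. ring. Qed.

Lemma prodf_le d p q x : (forall t, 0 <= p t <= q t) -> 0 <= prodf d p x <= prodf d q x.
Proof.
  intros H. induction d as [|d IH]; simpl. { lra. }
  destruct (H (fst x)), (IH (snd x)). split. { now apply Rmult_le_pos. } apply Rmult_le_compat; auto.
Qed.

Lemma prodf_scal d c p x : prodf d (fun t => c * p t) x = c ^ d * prodf d p x.
Proof. induction d as [|d IH]; simpl. { ring. } rewrite IH. ring. Qed.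

Lemma cauchy_density_anti a b : Rabs a <= Rabs b -> cauchy_density b <= cauchy_density a.
Proof.
  intros H. unfold cauchy_density. assert (a ^ 2 <= b ^ 2).
  { rewrite <- (pow2_abs a), <- (pow2_abs b). apply pow_incr. split; auto. apply Rabs_pos. }
  generalize (pow2_ge_0 a). intros. apply Rinv_le_contravar; lra.
Qed.

Lemma majorant_period n v k : majorant n (v + PI * IZR k) = majorant n v.
Proof.
  assert (P : forall x p, cos (x + 2 * IZR p * PI) = cos x).
  { intros x p. destruct (Z_le_gt_dec 0 p).
    - rewrite <- (Z2Nat.id p) by auto. rewrite <- INR_IZR_INZ. apply cos_period.
    - rewrite <- (cos_period (x + 2 * IZR p * PI) (Z.to_nat (- p))). f_equal.
      rewrite INR_IZR_INZ, Z2Nat.id, opp_IZR by lia. ring. }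
  apply zsum_ext. intros m _. rewrite <- (P (2 * IZR m * v) (m * k)%Z), mult_IZR. do 2 f_equal. ring.
Qed.

(** After reduction modulo [L], the hypothesis [n * PI <= L] makes the rescaled argument
    [n * PI * z / L] no larger than [z] in absolute value, so the Cauchy lower bound of the majorant
    is at least the one at [z]. *)
Lemma lattice_cauchy_bound M L x n : 4 <= L -> (1 <= n)%nat -> INR n * PI <= L ->
  zsum M (fun m => cauchy_density (x + L * IZR m)) <= 189 * majorant n (PI * x / L).
Proof.
  intros HL Hn HnL. assert (NR := le_INR 1 n Hn). simpl in NR. assert (P0 := PI_RGT_0).
  (* [z] is a representative of [x] modulo [L] in the interval from [- L / 2] to [L / 2]. *)
  set (k0 := (- up (x / L - / 2))%Z). set (z := x + L * IZR k0).
  assert (Hz : Rabs z <= L / 2).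
  { destruct (archimed (x / L - / 2)) as [A1 A2]. unfold z, k0. rewrite opp_IZR.
    set (y := IZR (up (x / L - / 2))) in *. replace x with (L * (x / L)) by (field; lra).
    set (w := x / L) in *. apply Rabs_le. nra. }
  assert (Pz := cauchy_density_pos z).
  assert (E : forall q : Z, q <> 0%Z -> cauchy_density (z + L * IZR q) <= 4 / L ^ 2 * / IZR q ^ 2).
  { intros q Hq. assert (Q1 : 1 <= Rabs (IZR q)).
    { rewrite <- abs_IZR. apply IZR_le. lia. }
    assert (B : L / 2 * Rabs (IZR q) <= Rabs (z + L * IZR q)).
    { generalize (Rabs_triang_inv (L * IZR q) (- z)). rewrite Rabs_Ropp, Rabs_mult, (Rabs_right L) by lra.
      replace (L * IZR q - - z) with (z + L * IZR q) by ring. nra. }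
    assert (0 < L / 2 * Rabs (IZR q)) by nra.
    replace (4 / L ^ 2 * / IZR q ^ 2) with (/ (L / 2 * Rabs (IZR q)) ^ 2).
    2: { rewrite Rpow_mult_distr, pow2_abs. field. split; [now apply not_0_IZR | lra]. }
    unfold cauchy_density. apply Rinv_le_contravar. { now apply pow_lt. }
    rewrite <- (pow2_abs (z + _)). assert ((L / 2 * Rabs (IZR q)) ^ 2 <= Rabs (z + L * IZR q) ^ 2); [| lra].
    apply pow_incr; lra. }
  (* telescoping potential for [1/q^2] over an interval of integers missing 0 *)
  set (Psi := fun q : Z => if Z_le_gt_dec 1 q then 4 - 2 / IZR q else 2 / (1 - IZR q)).
  assert (PsiB : forall q, 0 <= Psi q <= 4).
  { intros q. unfold Psi. destruct (Z_le_gt_dec 1 q) as [l | g].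
    - apply IZR_le in l. assert (0 < 2 / IZR q <= 2); [| lra].
      split. { apply Rdiv_lt_0_compat; lra. }
      apply Rmult_le_reg_r with (IZR q); [lra|]. unfold Rdiv. rewrite Rmult_assoc, Rinv_l; lra.
    - assert (h : (q <= 0)%Z) by lia. apply IZR_le in h. assert (0 < 2 / (1 - IZR q) <= 2); [| lra].
      split. { apply Rdiv_lt_0_compat; lra. }
      apply Rmult_le_reg_r with (1 - IZR q); [lra|]. unfold Rdiv. rewrite Rmult_assoc, Rinv_l; lra. }
  set (Phi := fun q : Z => 4 / L ^ 2 * Psi q + (if Z_le_gt_dec 1 q then cauchy_density z else 0)).
  assert (L2 : 0 < L ^ 2) by (apply pow_lt; lra).
  assert (L4 : 0 < 4 / L ^ 2) by (apply Rdiv_lt_0_compat; lra).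
  assert (Step : forall q, cauchy_density (z + L * IZR q) <= Phi (q + 1)%Z - Phi q).
  { intros q. unfold Phi. destruct (Z.eq_dec q 0) as [-> | Hq].
    - rewrite Rmult_0_r, Rplus_0_r. unfold Psi. simpl. lra.
    - eapply Rle_trans. { now apply E. }
      assert (D : / IZR q ^ 2 <= Psi (q + 1)%Z - Psi q).
      { unfold Psi. destruct (Z_le_gt_dec 1 (q + 1)), (Z_le_gt_dec 1 q); try lia.
        - rewrite plus_IZR. apply IZR_le in l0.
          replace (4 - 2 / (IZR q + 1) - (4 - 2 / IZR q)) with (/ (IZR q * (IZR q + 1) / 2)) by (field; lra).
          apply Rinv_le_contravar; nra.
        - assert (h : (q <= -1)%Z) by lia. apply IZR_le in h. rewrite plus_IZR.
          replace (2 / (1 - (IZR q + 1)) - 2 / (1 - IZR q)) with (/ (- IZR q * (1 - IZR q) / 2)) by (field; lra).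
          apply Rinv_le_contravar; nra. }
      destruct (Z_le_gt_dec 1 (q + 1)), (Z_le_gt_dec 1 q); try lia; nra. }
  assert (Tel : forall a N, sum_f_R0 (fun i => cauchy_density (z + L * IZR (a + Z.of_nat i))) N
      <= Phi (a + Z.of_nat (S N))%Z - Phi a).
  { intros a N. induction N as [|N IH].
    - simpl sum_f_R0. rewrite Z.add_0_r. apply Step.
    - rewrite tech5. eapply Rle_trans. { apply Rplus_le_compat. { apply IH. } apply Step. }
      replace (a + Z.of_nat (S N) + 1)%Z with (a + Z.of_nat (S (S N)))%Z by lia. lra. }
  (* The term nearest to the origin gives [cauchy_density z]; the others total at most
     [16 / L ^ 2 <= 20 * cauchy_density z] because [|z| <= L / 2]. With the 9 of
     [majorant_ge_cauchy] this yields [189 = 21 * 9]. *)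
  assert (S1 : zsum M (fun m => cauchy_density (x + L * IZR m)) <= 21 * cauchy_density z).
  { unfold zsum. rewrite (sum_eq _ (fun i => cauchy_density (z + L * IZR ((- Z.of_nat M - k0) + Z.of_nat i)))).
    - eapply Rle_trans. { apply Tel. } unfold Phi.
      set (a := (- Z.of_nat M - k0)%Z). set (b := (a + Z.of_nat (S (2 * M)))%Z).
      assert (B1 := PsiB a). assert (B2 := PsiB b).
      assert (16 / L ^ 2 <= 20 * cauchy_density z).
      { assert (z ^ 2 <= (L / 2) ^ 2).
        { rewrite <- pow2_abs. apply pow_incr. split; auto. apply Rabs_pos. }
        unfold cauchy_density. assert (/ (5 * L ^ 2 / 4) <= / (1 + z ^ 2)).
        { generalize (pow2_ge_0 z). intros. apply Rinv_le_contravar; nra. }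
        replace (16 / L ^ 2) with (20 * / (5 * L ^ 2 / 4)) by (field; lra). lra. }
      replace (16 / L ^ 2) with (4 / L ^ 2 * 4) in H by (field; lra).
      destruct (Z_le_gt_dec 1 b), (Z_le_gt_dec 1 a); nra.
    - intros i _. f_equal. unfold z. rewrite !plus_IZR, !minus_IZR, opp_IZR. ring. }
  eapply Rle_trans; [apply S1|].
  replace (PI * x / L) with (PI * z / L + PI * IZR (- k0)).
  2: { unfold z. rewrite opp_IZR. field. lra. }
  rewrite majorant_period.
  assert (MG := majorant_ge_cauchy n (INR n * (PI * z / L)) Hn).
  replace (INR n * (PI * z / L) / INR n) with (PI * z / L) in MG by (field; lra).
  assert (cauchy_density z <= cauchy_density (INR n * (PI * z / L))).
  { apply cauchy_density_anti. replace (INR n * (PI * z / L)) with ((INR n * PI / L) * z) by (field; lra).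
    assert (0 <= INR n * PI / L <= 1).
    { split. { apply Rmult_le_pos; [nra|]. apply Rlt_le, Rinv_0_lt_compat; lra. }
      apply Rmult_le_reg_r with L; [lra|]. unfold Rdiv. rewrite Rmult_assoc, Rinv_l; lra. }
    rewrite Rabs_mult, Rabs_right by lra. generalize (Rabs_pos z). nra. }
  lra.
Qed.

Section UpperBound.

Variables (d : nat) (phi : Rn d -> R).
Hypothesis Hphi : regular_density d phi.
Local Notation chf := (chf d phi).

(** Plane waves on the frequency grid [th Z^d] with product weights; for even weights [trig_product]
    identifies the state at time 0 as a product of one-dimensional kernels. *)
Definition kernel_orbit (n : nat) (w : Z -> R) (th : R) (j : nat) (x : Rn d) : R :=
  cube_sum d n (fun k => prodz d w k * trig_orbit d phi (zscale d th k) j x).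

Lemma orbit_kernel n w th : orbit d phi (kernel_orbit n w th).
Proof.
  apply (orbit_cube_sum d phi d n (fun k j x => prodz d w k * trig_orbit d phi (zscale d th k) j x)).
  intros k. apply orbit_scal. now apply orbit_trig.
Qed.

Lemma kernel_orbit_0 n w th x : (forall m, w (- m)%Z = w m) ->
  kernel_orbit n w th O x = prodf d (fun t => zsum n (fun m => w m * cos (th * IZR m * t))) x.
Proof.
  intros Hw. rewrite trig_product by auto. apply cube_sum_ext. intros k _. now rewrite trig_orbit_0.
Qed.

Lemma kernel_orbit_le T : 0 < T -> exists c, 0 < c /\ forall n w th B j x,
  0 < th -> th * INR n <= T -> (1 <= j)%nat ->
  (forall m, (Z.abs m <= Z.of_nat n)%Z -> 0 <= w m <= B) ->
  kernel_orbit n w th j x <= (B * (1 + 4 / (th * sqrt (c * INR j)))) ^ d.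
Proof.
  intros HT. destruct (Cmod_chf_le d phi Hphi T HT) as [c [Hc H]]. exists c; split; auto.
  intros n w th B j x Hth Hn Hj Hw.
  assert (J : 0 < INR j) by (apply lt_0_INR; lia).
  assert (B0 : 0 <= B) by (destruct (Hw 0%Z); [lia | lra]).
  apply Rle_trans with (cube_sum d n (prodz d (fun m => B * exp (- (c * INR j * th ^ 2 * IZR m ^ 2))))).
  - apply cube_sum_le. intros k Hk.
    destruct (prodz_le d n w (fun _ => B) k Hk Hw) as [W0 W1].
    rewrite <- prodz_mult, <- exp_normsq_zscale.
    apply Rle_trans with (prodz d w k * exp (- (c * INR j * normsq d (zscale d th k)))).
    + apply Rmult_le_compat_l; auto.
      eapply Rle_trans. { apply trig_orbit_le. }
      replace (- (c * INR j * normsq d (zscale d th k))) with (INR j * - (c * normsq d (zscale d th k))) by ring.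
      rewrite exp_pow. apply pow_incr. split. { apply Cmod_ge_0. }
      apply H. apply inbox_mono with (1 := Hn). apply inbox_zscale; auto; lra.
    + apply Rmult_le_compat_r; auto. left; apply exp_pos.
  - rewrite cube_sum_prod, zsum_scal. apply pow_incr.
    assert (K : 0 < c * INR j * th ^ 2) by (repeat apply Rmult_lt_0_compat; auto; simpl; lra).
    split.
    { apply Rmult_le_pos; auto. apply zsum_ge0. intros; left; apply exp_pos. }
    apply Rmult_le_compat_l; auto.
    eapply Rle_trans. { now apply theta_sum_bound. }
    right. do 2 f_equal. rewrite sqrt_mult_alt by nra. rewrite sqrt_pow2 by lra. ring.
Qed.

Variable psi : nat -> Rn d -> R.
Hypothesis psi1 : forall x, psi 1%nat x = phi x.
Hypothesis psi_orbit : orbit d phi (fun j => psi (S j)).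

Lemma lattice_sum_upper : exists C, 0 <= C /\ forall L j M, 4 <= L -> (1 <= j)%nat ->
  L ^ d * cube_sum d M (fun k => psi j (zscale d L k)) <= C * (1 + L / sqrt (INR j)) ^ d.
Proof.
  destruct (phi_le_cauchy d phi Hphi 0) as [A [A0 HA]].
  destruct (kernel_orbit_le 2) as [c [Hc HK]]. { lra. }
  set (C1 := A * 189 ^ d).
  assert (C10 : 0 <= C1) by (apply Rmult_le_pos; auto; apply pow_le; lra).
  assert (SC := sqrt_lt_R0 _ Hc).
  exists (C1 * 2 ^ d + C1 * (16 * (1 + / sqrt c)) ^ d).
  assert (SC' := Rinv_0_lt_compat _ SC).
  split.
  { apply Rplus_le_le_0_compat; apply Rmult_le_pos; auto; apply pow_le; lra. }
  intros L j M HL Hj.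
  assert (P0 := PI_RGT_0). assert (P4 := PI_4).
  assert (LP : 1 <= L / PI).
  { apply Rmult_le_reg_r with PI; auto. replace (L / PI * PI) with L by (field; lra). lra. }
  (* The largest degree with [n * PI <= L]: the frequencies [2 * PI * m / L] then stay in the box of
     half-side 2, while [n] remains comparable to [L]. *)
  destruct (nfloor_ex (L / PI)) as [n [Hn1 Hn2]]. { lra. }
  assert (Hn : (1 <= n)%nat).
  { destruct n; [| lia]. simpl in Hn2. lra. }
  assert (NR := le_INR 1 n Hn). simpl in NR.
  assert (HnL : INR n * PI <= L).
  { apply Rmult_le_compat_r with (r := PI) in Hn1; [| lra].
    replace (L / PI * PI) with L in Hn1 by (field; lra). lra. }
  assert (HnL2 : L <= 2 * (INR n * PI)).
  { apply Rmult_lt_compat_r with (r := PI) in Hn2; auto.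
    replace (L / PI * PI) with L in Hn2 by (field; lra). nra. }
  set (th := 2 * PI / L).
  assert (Hth : 0 < th) by (apply Rdiv_lt_0_compat; lra).
  set (u := fun j x => cube_sum d M (fun k => psi (S j) (vadd d x (zscale d L k)))).
  set (K := kernel_orbit n (majorant_weight n) th).
  assert (K0 : forall x, K O x = prodf d (fun t => majorant n (PI * t / L)) x).
  { intros x. unfold K. rewrite kernel_orbit_0 by apply majorant_weight_even.
    assert (E : forall t, zsum n (fun m => majorant_weight n m * cos (th * IZR m * t)) = majorant n (PI * t / L)).
    { intros t. apply zsum_ext. intros m _. do 2 f_equal. unfold th. field. lra. }
    clear -E. induction d as [|d' IH]; simpl; auto. now rewrite E, IH. }
  assert (U0 : forall x, u O x <= C1 * K O x).
  { intros x. rewrite K0. unfold u.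
    apply Rle_trans with (A * prodf d (fun t => zsum M (fun m => cauchy_density (t + L * IZR m))) x).
    - assert (E : forall x, prodf d (fun t => zsum M (fun m => cauchy_density (t + L * IZR m))) x
        = cube_sum d M (fun k => prodf d cauchy_density (vadd d x (zscale d L k)))).
      { clear. induction d as [|d' IH]; intros x. { reflexivity. }
        rewrite cube_sum_S. simpl prodf. rewrite IH, (Rmult_comm (zsum _ _)), <- zsum_scal.
        apply zsum_ext. intros m _. rewrite (Rmult_comm (cube_sum _ _ _)), <- cube_sum_scal. reflexivity. }
      rewrite E, <- cube_sum_scal. apply cube_sum_le. intros k _. rewrite psi1.
      generalize (HA (vadd d x (zscale d L k))). rewrite pow_O, Rmult_1_l. auto.
    - unfold C1. rewrite Rmult_assoc. apply Rmult_le_compat_l; auto.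
      rewrite <- prodf_scal. apply prodf_le. intros t. split.
      + apply zsum_ge0. intros. left; apply cauchy_density_pos.
      + now apply lattice_cauchy_bound. }
  assert (OU : orbit d phi u).
  { apply (orbit_cube_sum d phi d M (fun k j x => psi (S j) (vadd d x (zscale d L k)))).
    intros k. now apply (orbit_translate d phi (fun j => psi (S j))). }
  assert (OK : orbit d phi (fun j x => C1 * K j x)) by (apply orbit_scal, orbit_kernel).
  assert (UK := orbit_le d phi Hphi u _ OU OK U0).
  assert (Uj : cube_sum d M (fun k => psi j (zscale d L k)) = u (pred j) (vzero d)).
  { unfold u. destruct j; [lia|]. apply cube_sum_ext. intros k _. f_equal. simpl pred.
    clear. induction d as [|d' IH]; simpl. { now destruct k. }
    rewrite <- IH, Rplus_0_l. reflexivity. }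
  rewrite Uj.
  assert (J : 1 <= INR j) by (apply (le_INR 1); auto).
  assert (SJ : 1 <= sqrt (INR j)) by (rewrite <- sqrt_1; now apply sqrt_le_1_alt).
  assert (LJ : 0 <= L / sqrt (INR j)) by (apply Rlt_le, Rdiv_lt_0_compat; lra).
  assert (L0 : 0 <= L ^ d) by (apply pow_le; lra).
  assert (X0 : 0 <= (1 + L / sqrt (INR j)) ^ d) by (apply pow_le; lra).
  (* Orbits start at time 0 with [psi 1], so [psi j] sits at time [j - 1]. At time 0 there is no
     decay in frequency, and the kernel is bounded by 2 per coordinate instead. *)
  destruct (Nat.eq_dec j 1) as [-> | Hj1].
  - simpl pred.
    apply Rle_trans with (L ^ d * (C1 * 2 ^ d)).
    + apply Rmult_le_compat_l; auto. eapply Rle_trans. { apply U0. }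
      apply Rmult_le_compat_l; auto. rewrite K0.
      apply Rle_trans with (prodf d (fun _ => 2) (vzero d)).
      * apply prodf_le. intros t. split. { now apply majorant_ge0. }
        rewrite majorant_fejer by auto. set (v := PI * t / L).
        generalize (fejer_bounds n v Hn) (fejer_bounds n (v + PI / (2 * INR n)) Hn) (fejer_bounds n (v - PI / (2 * INR n)) Hn). lra.
      * right. clear. induction d as [|d' IH]; simpl; auto. now rewrite IH.
    + assert (L ^ d <= (1 + L / sqrt (INR 1)) ^ d).
      { apply pow_incr. simpl. rewrite sqrt_1. lra. }
      assert (0 <= C1 * 2 ^ d) by (apply Rmult_le_pos; auto; apply pow_le; lra).
      assert (0 <= C1 * (16 * (1 + / sqrt c)) ^ d) by (apply Rmult_le_pos; auto; apply pow_le; lra).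
      nra.
  - apply Rle_trans with (L ^ d * (C1 * (2 / INR n * (1 + 4 / (th * sqrt (c * INR (pred j))))) ^ d)).
    + apply Rmult_le_compat_l; auto. eapply Rle_trans. { apply UK. }
      apply Rmult_le_compat_l; auto. apply HK; auto.
      * unfold th. apply Rmult_le_reg_r with L; [lra|].
        replace (2 * PI / L * INR n * L) with (2 * (INR n * PI)) by (field; lra). lra.
      * lia.
      * intros m Hm. now apply majorant_weight_bounds.
    + assert (JP : INR j <= 2 * INR (pred j)).
      { replace j with (S (pred j)) at 1 by lia. rewrite S_INR.
        assert (1 <= INR (pred j)) by (apply (le_INR 1); lia). lra. }
      assert (D1 : 4 / (th * sqrt (c * INR (pred j))) <= / sqrt c * (L / sqrt (INR j))).
      { rewrite sqrt_mult_alt by lra.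
        assert (SP : sqrt (INR j) <= 3 / 2 * sqrt (INR (pred j))).
        { replace (3 / 2) with (sqrt ((3 / 2) ^ 2)) by (apply sqrt_pow2; lra).
          rewrite <- sqrt_mult_alt by nra. apply sqrt_le_1_alt. lra. }
        assert (P3 : 3 < PI) by (generalize PI2_3_2; lra).
        assert (0 < sqrt (INR (pred j))) by lra.
        unfold th. 
        replace (4 / (2 * PI / L * (sqrt c * sqrt (INR (pred j))))) with
          (/ sqrt c * (L / (PI / 2 * sqrt (INR (pred j))))) by (field; repeat split; lra).
        apply Rmult_le_compat_l; [lra|]. unfold Rdiv. apply Rmult_le_compat_l; [lra|].
        apply Rinv_le_contravar; [lra|]. nra. }
      (* From [L <= 2 * (n * PI)] and [PI <= 4]. *)
      assert (D2 : 2 / INR n <= 16 / L).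
      { apply Rmult_le_reg_r with (INR n * L). { nra. }
        replace (2 / INR n * (INR n * L)) with (2 * L) by (field; lra).
        replace (16 / L * (INR n * L)) with (16 * INR n) by (field; lra). nra. }
      set (X := L / sqrt (INR j)) in *. set (Y := / sqrt c) in *.
      assert (Y4 : 0 <= 4 / (th * sqrt (c * INR (pred j)))).
      { apply Rlt_le, Rdiv_lt_0_compat; [lra|]. apply Rmult_lt_0_compat; auto.
        apply sqrt_lt_R0. apply Rmult_lt_0_compat; lra. }
      assert (N2 : 0 <= 2 / INR n) by (apply Rlt_le, Rdiv_lt_0_compat; lra).
      apply Rle_trans with (C1 * (16 * (1 + Y) * (1 + X)) ^ d).
      * rewrite <- Rmult_assoc, (Rmult_comm (L ^ d)), Rmult_assoc. apply Rmult_le_compat_l; auto.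
        rewrite <- Rpow_mult_distr. apply pow_incr. split.
        { repeat apply Rmult_le_pos; lra. }
        apply Rle_trans with (L * (16 / L * (1 + Y * X))).
        { apply Rmult_le_compat_l; [lra|]. apply Rmult_le_compat; lra. }
        replace (L * (16 / L * (1 + Y * X))) with (16 * (1 + Y * X)) by (field; lra). nra.
      * rewrite Rpow_mult_distr, <- Rmult_assoc. apply Rmult_le_compat_r; auto.
        assert (0 <= C1 * 2 ^ d) by (apply Rmult_le_pos; auto; apply pow_le; lra). lra.
Qed.

End UpperBound.

(** * Band-limited minorants *)

Fixpoint prodk (d : nat) (g : R -> Z -> R) : Rn d -> Zn d -> R :=
  match d return Rn d -> Zn d -> R with
  | O => fun _ _ => 1
  | S d' => fun x k => g (fst x) (fst k) * prodk d' g (snd x) (snd k)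
  end.

Lemma prodk_ge0 d g x k : (forall t m, 0 <= g t m) -> 0 <= prodk d g x k.
Proof.
  intros H. induction d as [|d IH]; simpl; [lra|]. apply Rmult_le_pos; auto.
Qed.

Lemma cube_sum_prodk d n g x : cube_sum d n (prodk d g x) = prodf d (fun t => zsum n (g t)) x.
Proof.
  induction d as [|d IH]. { reflexivity. }
  rewrite cube_sum_S. simpl. rewrite (Rmult_comm (zsum _ _)), <- zsum_scal. apply zsum_ext.
  intros m _. rewrite cube_sum_scal, IH. ring.
Qed.

Lemma prodf_le1 d p x : (forall t, 0 <= p t <= 1) -> 0 <= prodf d p x <= 1.
Proof.
  intros H. induction d as [|d IH]; simpl; [lra|]. destruct (H (fst x)), (IH (snd x)). split; nra.
Qed.

(** The norm is expanded coordinate by coordinate; the sums over the other coordinates are at most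
    1, so the errors add up to [d * E]. *)
Lemma cube_sum_prodk_norm1 d n h g x E : (forall t m, 0 <= g t m) ->
  (forall t, zsum n (g t) <= 1) -> 0 <= E ->
  (forall t, zsum n (fun m => g t m * Rabs (t - h * IZR m)) <= E) ->
  cube_sum d n (fun k => prodk d g x k * norm1 d (vsub d x (zscale d h k))) <= INR d * E.
Proof.
  intros G0 G1 E0 GE. induction d as [|d IH]. { simpl; lra. }
  rewrite cube_sum_S, S_INR. simpl prodk. simpl norm1.
  assert (B := prodf_le1 d (fun t => zsum n (g t)) (snd x)).
  assert (B' : 0 <= prodf d (fun t => zsum n (g t)) (snd x) <= 1).
  { apply B. intros t. split; auto. apply zsum_ge0; auto. }
  set (P := prodf d (fun t => zsum n (g t)) (snd x)) in *.
  rewrite (zsum_ext n _ (fun a => P * (g (fst x) a * Rabs (fst x - h * IZR a)) +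
     cube_sum d n (fun k => prodk d g (snd x) k * norm1 d (vsub d (snd x) (zscale d h k))) * g (fst x) a)).
  - rewrite zsum_plus, !zsum_scal.
    assert (A1 := GE (fst x)). assert (A2 := G1 (fst x)).
    assert (A3 : 0 <= zsum n (g (fst x))) by (apply zsum_ge0; auto).
    assert (A4 : 0 <= zsum n (fun m => g (fst x) m * Rabs (fst x - h * IZR m))).
    { apply zsum_ge0. intros. apply Rmult_le_pos; auto. apply Rabs_pos. }
    assert (A5 := IH (snd x)). assert (D := pos_INR d).
    change (zsum n (fun a => g (fst x) a)) with (zsum n (g (fst x))).
    set (Q := cube_sum d n _) in *. set (U := zsum n (g (fst x))) in *.
    set (V := zsum n (fun m => _)) in *.
    assert (Q * U <= INR d * E).
    { apply Rle_trans with (INR d * E * U). { apply Rmult_le_compat_r; lra. }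
      assert (0 <= INR d * E) by now apply Rmult_le_pos. nra. }
    nra.
  - intros a _. unfold P. rewrite <- cube_sum_prodk.
    rewrite (Rmult_comm (cube_sum d n (prodk d g (snd x)))), (Rmult_comm (cube_sum _ _ _) (g (fst x) a)).
    rewrite <- !cube_sum_scal, <- cube_sum_plus. apply cube_sum_ext. intros; ring.
Qed.

(** Outside the box some coordinate exceeds [M], and that single factor supplies the gain [r]; the
    other factors cost [Q] each. *)
Lemma prodf_one_small d p q x M r Q : 0 <= r <= 1 -> (forall t, 0 <= p t) -> (forall t, 0 <= q t) ->
  (forall t, q t <= Q * p t) -> (forall t, M < Rabs t -> q t <= r * Q * p t) -> 0 <= Q ->
  ~ inbox d M x -> prodf d q x <= r * Q ^ d * prodf d p x.
Proof.
  intros Hr Hp Hq H1 H2 HQ. induction d as [|d IH]. { simpl; tauto. }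
  intros N. simpl.
  assert (B : 0 <= prodf d q (snd x) <= prodf d (fun t => Q * p t) (snd x)) by (apply prodf_le; auto).
  rewrite prodf_scal in B.
  assert (PP : 0 <= prodf d p (snd x)).
  { apply (prodf_le d p p). intros; split; auto; lra. }
  assert (QP : 0 <= Q ^ d) by now apply pow_le.
  assert (A1 := Hp (fst x)). assert (A2 := Hq (fst x)).
  destruct (Rle_or_lt (Rabs (fst x)) M) as [L | L].
  - assert (N' : ~ inbox d M (snd x)) by (intros N'; apply N; split; auto).
    specialize (IH _ N').
    replace (r * (Q * Q ^ d) * (p (fst x) * prodf d p (snd x))) with
      ((Q * p (fst x)) * (r * Q ^ d * prodf d p (snd x))) by ring.
    apply Rmult_le_compat; auto; lra.
  - replace (r * (Q * Q ^ d) * (p (fst x) * prodf d p (snd x))) with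
      ((r * Q * p (fst x)) * (Q ^ d * prodf d p (snd x))) by ring.
    apply Rmult_le_compat; auto; lra.
Qed.

Lemma in_cell_norm1 d h k x : in_cell d h k x -> norm1 d (vsub d x (zscale d h k)) <= INR d * (h / 2).
Proof.
  induction d as [|d IH]. { simpl; lra. } intros [H1 H2]. rewrite S_INR. simpl.
  generalize (IH _ _ H2). lra.
Qed.

(** Interpolation kernel of the grid [h Z]: equal to 1 at its own node and 0 at the other nodes. *)
Definition sinc_kernel (h t : R) (m : Z) : R := sinc_sq (PI * (t - h * IZR m) / h).

Lemma sinc_kernel_bounds h t m : 0 <= sinc_kernel h t m <= 1.
Proof. apply sinc_sq_bounds. Qed.

Lemma sinc_kernel_sum h t n : 0 < h -> zsum n (sinc_kernel h t) <= 1.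
Proof.
  intros Hh. rewrite (zsum_ext n _ (fun m => sinc_sq (PI * t / h - PI * IZR m))).
  - apply sinc_sq_partition.
  - intros m _. unfold sinc_kernel. f_equal. field. lra.
Qed.

Lemma sinc_kernel_decay h t m : 0 < h -> sinc_kernel h t m * (t - h * IZR m) ^ 2 <= h ^ 2.
Proof.
  intros Hh. unfold sinc_kernel. set (y := t - h * IZR m).
  assert (E := sinc_sq_mult (PI * y / h)). assert (B := sinc_sq_bounds (PI * y / h)).
  assert (S1 : sin (PI * y / h) ^ 2 <= 1) by (generalize (SIN_bound (PI * y / h)); nra).
  assert (P : 1 <= PI ^ 2).
  { generalize PI2_3_2. intros. nra. }
  set (q := sinc_sq (PI * y / h)) in *.
  assert (Y : y ^ 2 <= h ^ 2 * (PI * y / h) ^ 2).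
  { replace (h ^ 2 * (PI * y / h) ^ 2) with (PI ^ 2 * y ^ 2) by (field; lra).
    generalize (pow2_ge_0 y). nra. }
  apply Rle_trans with (q * (h ^ 2 * (PI * y / h) ^ 2)). { apply Rmult_le_compat_l; lra. }
  replace (q * (h ^ 2 * (PI * y / h) ^ 2)) with (h ^ 2 * (q * (PI * y / h) ^ 2)) by ring.
  rewrite E. generalize (pow2_ge_0 h). nra.
Qed.

Lemma Rinv_nat_small e : 0 < e -> exists p : nat, (1 <= p)%nat /\ / INR p <= e.
Proof.
  intros He. destruct (nfloor_ex (/ e)) as [p [_ Hp]]. { now apply Rlt_le, Rinv_0_lt_compat. }
  exists (S p). split; [lia|]. rewrite S_INR. rewrite <- (Rinv_inv e).
  apply Rinv_le_contravar; [now apply Rinv_0_lt_compat | lra].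
Qed.

(* The kernels are Fejer-type, so the minorant has frequencies bounded by [2 pi / h]. *)
Lemma bandlimited_minorant d phi eta : regular_density d phi -> 0 < eta ->
  exists h I, 0 < h /\ 1 - eta <= h ^ d * cube_sum d I (fun i => phi (zscale d h i)) /\
   forall x, cube_sum d I (fun i => phi (zscale d h i) * prodk d (sinc_kernel h) x i)
     <= phi x + eta * prodf d cauchy_density x.
Proof.
  intros Hphi Heta.
  assert (P0 := rd_ge0 d phi Hphi).
  destruct (rd_lip d phi Hphi) as [K [K0 HK]].
  destruct (phi_le_cauchy d phi Hphi 0) as [B [B0 HB']].
  assert (HB : forall x, phi x <= B).
  { intros x. generalize (HB' x). rewrite pow_O, Rmult_1_l. intros h.
    assert (prodf d cauchy_density x <= 1).
    { apply prodf_le1. intros t. split. { apply Rlt_le, cauchy_density_pos. }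
      unfold cauchy_density. rewrite <- Rinv_1. generalize (pow2_ge_0 t). intros.
      apply Rinv_le_contravar; lra. }
    nra. }
  destruct (rd_mass d phi Hphi (eta / 2)) as [M0 HM0]. { lra. }
  destruct (nfloor_ex (Rmax 0 M0)) as [m0 [_ Hm0]]. { apply Rmax_l. }
  set (m := S m0).
  assert (HmM : M0 <= INR m) by (unfold m; rewrite S_INR; generalize (Rmax_r 0 M0); lra).
  assert (Hm1 : 1 <= INR m) by (apply (le_INR 1); unfold m; lia).
  assert (D := pos_INR d).
  (* [Q] meets two demands: [Q * cauchy_density t >= 1] for [|t| <= 2 m], and
     [4 (2 m + 1) (1 + t ^ 2) <= Q t ^ 2] for larger [|t|]. *)
  set (Q := 11 + 8 * INR m ^ 2 + 16 * INR m).
  assert (Q1 : 1 <= Q) by (unfold Q; nra).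
  assert (QD : 1 <= Q ^ d) by now apply pow_R1_Rle.
  (* The interpolation error inside the box is at most [K * d * (2 * del)], and this choice puts it
     below [eta / Q ^ d], hence below [eta] times the Cauchy product. *)
  set (del := eta / (2 * Q ^ d * (K * INR d + 1))).
  assert (KD : 0 <= K * INR d) by now apply Rmult_le_pos.
  assert (del_pos : 0 < del) by (apply Rdiv_lt_0_compat; nra).
  set (c1 := (2 * INR m + 1) ^ d * (K * INR d) + 1).
  assert (c1_pos : 0 < c1).
  { unfold c1. assert (0 <= (2 * INR m + 1) ^ d * (K * INR d)); [| lra].
    apply Rmult_le_pos; auto. apply pow_le; lra. }
  (* Three upper bounds for the mesh: for the error of the Riemann sum of the mass, for the kernel
     tails inside the box, and for the smallness of the minorant outside it. *)
  set (e := Rmin (eta / c1) (Rmin (del ^ 2 / (2 * INR m + 1)) (eta / (B * Q ^ d + 1)))).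
  assert (e_pos : 0 < e).
  { unfold e. repeat apply Rmin_glb_lt.
    - now apply Rdiv_lt_0_compat.
    - apply Rdiv_lt_0_compat; [apply pow_lt; auto | lra].
    - apply Rdiv_lt_0_compat; auto. nra. }
  (* Taking [h] to be the inverse of an integer [p] makes the grid with [I = p * m] reach exactly to
     [m]. *)
  destruct (Rinv_nat_small e e_pos) as [p [Hp Hpe]].
  set (h := / INR p) in *.
  assert (Rp : 1 <= INR p) by (apply (le_INR 1); auto).
  assert (h_pos : 0 < h) by (apply Rinv_0_lt_compat; lra).
  assert (h1 : h <= 1) by (unfold h; rewrite <- Rinv_1; apply Rinv_le_contravar; lra).
  assert (he1 : h * c1 <= eta).
  { assert (h <= eta / c1) by (eapply Rle_trans; [apply Hpe | apply Rmin_l]).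
    apply Rmult_le_reg_r with (/ c1). { now apply Rinv_0_lt_compat. }
    rewrite Rmult_assoc, Rinv_r; unfold Rdiv in *; lra. }
  assert (he2 : h * (2 * INR m + 1) <= del ^ 2).
  { assert (h <= del ^ 2 / (2 * INR m + 1)).
    { eapply Rle_trans; [apply Hpe |]. eapply Rle_trans; [apply Rmin_r | apply Rmin_l]. }
    apply Rmult_le_reg_r with (/ (2 * INR m + 1)). { apply Rinv_0_lt_compat; lra. }
    rewrite Rmult_assoc, Rinv_r; unfold Rdiv in *; lra. }
  assert (he3 : h * (B * Q ^ d) <= eta).
  { assert (h <= eta / (B * Q ^ d + 1)).
    { eapply Rle_trans; [apply Hpe |]. eapply Rle_trans; [apply Rmin_r | apply Rmin_r]. }
    assert (0 <= B * Q ^ d) by (apply Rmult_le_pos; lra).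
    apply Rmult_le_compat_r with (r := B * Q ^ d + 1) in H; [| lra].
    unfold Rdiv in H. rewrite Rmult_assoc, Rinv_l in H; lra. }
  set (I := (p * m)%nat).
  assert (HI : h * INR I = INR m) by (unfold I, h; rewrite mult_INR; field; lra).
  exists h, I. split; auto.
  set (s := sinc_kernel h).
  assert (s0 : forall t k, 0 <= s t k) by (intros; apply sinc_kernel_bounds).
  assert (s1 : forall t, zsum I (s t) <= 1) by (intros; now apply sinc_kernel_sum).
  split.
  - destruct (HM0 (h * (INR I + / 2))) as [J [HJ DJ]]. { lra. }
    apply Rabs_def2 in DJ.
    assert (J <= h ^ d * cube_sum d I (fun i => phi (zscale d h i) + K * (INR d * (h / 2)))).
    { apply (box_int_le_cells d I h phi); auto.
      intros i x Hx. apply in_cell_norm1 in Hx.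
      generalize (HK x (zscale d h i)). intros a. apply Rabs_le_between in a.
      assert (K * norm1 d (vsub d x (zscale d h i)) <= K * (INR d * (h / 2))) by now apply Rmult_le_compat_l.
      lra. }
    rewrite cube_sum_plus, cube_sum_const, Rmult_plus_distr_l in H.
    replace (h ^ d * (K * (INR d * (h / 2)) * (2 * INR I + 1) ^ d)) with
      ((h * (2 * INR I + 1)) ^ d * (K * INR d) * (h / 2)) in H by (rewrite Rpow_mult_distr; ring).
    replace (h * (2 * INR I + 1)) with (2 * INR m + h) in H by (rewrite <- HI; ring).
    assert ((2 * INR m + h) ^ d <= (2 * INR m + 1) ^ d) by (apply pow_incr; lra).
    assert ((2 * INR m + h) ^ d * (K * INR d) <= c1).
    { unfold c1. assert ((2 * INR m + h) ^ d * (K * INR d) <= (2 * INR m + 1) ^ d * (K * INR d)) by now apply Rmult_le_compat_r.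
      lra. }
    nra.
  - intros x. assert (PC : forall t, 0 <= cauchy_density t) by (intros; apply Rlt_le, cauchy_density_pos).
    (* The grid fills the box of half-side [m]. Within twice that box the minorant is a local
       average of [phi], close to it by the Lipschitz bound; outside, some coordinate is at distance
       at least half its size from every node, and its kernel sum is of order [h]. *)
    destruct (classic (inbox d (2 * INR m) x)) as [Hx | Hx].
    + set (E := del + (2 * INR m + 1) * h / del).
      assert (E0 : 0 <= E).
      { unfold E. assert (0 <= (2 * INR m + 1) * h / del); [| lra].
        apply Rlt_le, Rdiv_lt_0_compat; auto. nra. }
      assert (S1 : cube_sum d I (fun k => prodk d s x k * norm1 d (vsub d x (zscale d h k))) <= INR d * E).
      { apply cube_sum_prodk_norm1; auto.
        intros t. apply Rle_trans with (zsum I (fun k => del * s t k + h ^ 2 / del)).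
        - apply zsum_le. intros k _. set (y := t - h * IZR k).
          assert (G := sinc_kernel_decay h t k h_pos). fold s y in G.
          (* A squared sinc has no uniformly bounded first moment. This splits [|y|] into a constant
             and a second-moment term, which costs at most [h ^ 2 / del] per node. *)
          assert (Rabs y <= del + y ^ 2 / del).
          { apply Rmult_le_reg_r with del; auto.
            replace ((del + y ^ 2 / del) * del) with (del ^ 2 + y ^ 2) by (field; lra).
            rewrite <- (pow2_abs y). generalize (pow2_ge_0 (Rabs y - del)) (Rabs_pos y). nra. }
          apply Rle_trans with (s t k * (del + y ^ 2 / del)). { now apply Rmult_le_compat_l. }
          replace (s t k * (del + y ^ 2 / del)) with (del * s t k + s t k * y ^ 2 / del) by (field; lra).
          apply Rplus_le_compat_l. apply Rmult_le_compat_r; auto. now apply Rlt_le, Rinv_0_lt_compat.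
        - rewrite zsum_plus, zsum_scal, zsum_const. unfold E. apply Rplus_le_compat.
          + generalize (s1 t). change (zsum I (fun m1 => s t m1)) with (zsum I (s t)). nra.
          + replace (h ^ 2 / del * (2 * INR I + 1)) with (h / del * (2 * INR m + h)).
            2: { rewrite <- HI. field. lra. }
            replace ((2 * INR m + 1) * h / del) with (h / del * (2 * INR m + 1)) by (field; lra).
            apply Rmult_le_compat_l; [| lra]. now apply Rlt_le, Rdiv_lt_0_compat. }
      assert (T1 : cube_sum d I (prodk d s x) <= 1).
      { rewrite cube_sum_prodk. apply prodf_le1. intros t; split; auto. apply zsum_ge0; auto. }
      apply Rle_trans with (phi x * cube_sum d I (prodk d s x) +
        K * cube_sum d I (fun k => prodk d s x k * norm1 d (vsub d x (zscale d h k)))).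
      { rewrite <- !cube_sum_scal, <- cube_sum_plus. apply cube_sum_le. intros k _.
        assert (W := prodk_ge0 d s x k s0). assert (A := HK x (zscale d h k)). apply Rabs_le_between in A.
        replace (phi x * prodk d s x k + K * (prodk d s x k * norm1 d (vsub d x (zscale d h k)))) with
          ((phi x + K * norm1 d (vsub d x (zscale d h k))) * prodk d s x k) by ring.
        apply Rmult_le_compat_r; lra. }
      assert (T2 : K * (INR d * E) <= eta * prodf d cauchy_density x).
      { assert (EE : E <= 2 * del).
        { unfold E. assert ((2 * INR m + 1) * h / del <= del); [| lra].
          apply Rmult_le_reg_r with del; auto.
          replace ((2 * INR m + 1) * h / del * del) with (h * (2 * INR m + 1)) by (field; lra).
          replace (del * del) with (del ^ 2) by ring. lra. }
        assert (PQ : 1 <= Q ^ d * prodf d cauchy_density x).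
        { rewrite <- prodf_scal. clear -Hx Hm1. induction d as [|d' IH]; simpl; [lra|].
          destruct Hx as [Hx1 Hx2]. generalize (IH _ Hx2).
          assert (1 <= Q * cauchy_density (fst x)); [| nra].
          unfold cauchy_density. assert (fst x ^ 2 <= (2 * INR m) ^ 2).
          { rewrite <- (pow2_abs (fst x)). apply pow_incr. split; auto. apply Rabs_pos. }
          assert (0 <= fst x ^ 2) by apply pow2_ge_0.
          apply Rmult_le_reg_r with (1 + fst x ^ 2); [lra|]. rewrite Rmult_assoc, Rinv_l by lra.
          unfold Q. nra. }
        assert (DD : del * (2 * Q ^ d * (K * INR d + 1)) = eta) by (unfold del; field; split; lra).
        assert (Q0 : 0 < Q ^ d) by lra.
        apply Rle_trans with (K * INR d * (2 * del)). { rewrite <- Rmult_assoc. now apply Rmult_le_compat_l. }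
        apply Rle_trans with (eta / Q ^ d).
        - rewrite <- DD. replace (del * (2 * Q ^ d * (K * INR d + 1)) / Q ^ d) with (2 * del * (K * INR d + 1)) by (field; lra). nra.
        - apply Rmult_le_reg_l with (Q ^ d); auto. replace (Q ^ d * (eta / Q ^ d)) with eta by (field; lra). nra. }
      assert (K * cube_sum d I (fun k => prodk d s x k * norm1 d (vsub d x (zscale d h k))) <= K * (INR d * E))
        by now apply Rmult_le_compat_l.
      assert (phi x * cube_sum d I (prodk d s x) <= phi x).
      { generalize (P0 x). nra. }
      lra.
    + apply Rle_trans with (B * cube_sum d I (prodk d s x)).
      { rewrite <- cube_sum_scal. apply cube_sum_le. intros k _.
        apply Rmult_le_compat_r; auto. now apply prodk_ge0. }
      rewrite cube_sum_prodk.
      assert (Far : forall t, 2 * INR m < Rabs t -> zsum I (s t) <= h * Q * cauchy_density t).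
      { intros t Ht.
        assert (T1 : 1 <= t ^ 2) by (rewrite <- pow2_abs; nra).
        apply Rle_trans with (zsum I (fun _ => 4 * h ^ 2 / t ^ 2)).
        - apply zsum_le. intros k Hk. apply Rabs_IZR_le in Hk.
          assert (G := sinc_kernel_decay h t k h_pos). fold s in G.
          assert (Y : Rabs t / 2 <= Rabs (t - h * IZR k)).
          { generalize (Rabs_triang_inv t (h * IZR k)). rewrite Rabs_mult, (Rabs_right h) by lra.
            assert (h * Rabs (IZR k) <= INR m); [| lra]. rewrite <- HI. apply Rmult_le_compat_l; lra. }
          assert (Y2 : t ^ 2 / 4 <= (t - h * IZR k) ^ 2).
          { rewrite <- (pow2_abs t), <- (pow2_abs (t - _)). generalize (Rabs_pos t). nra. }
          apply Rmult_le_reg_r with (t ^ 2 / 4); [lra|].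
          replace (4 * h ^ 2 / t ^ 2 * (t ^ 2 / 4)) with (h ^ 2) by (field; nra).
          apply Rle_trans with (2 := G). apply Rmult_le_compat_l; auto.
        - rewrite zsum_const.
          replace (4 * h ^ 2 / t ^ 2 * (2 * INR I + 1)) with (h * (4 * (2 * INR m + h)) / t ^ 2).
          2: { rewrite <- HI. field. nra. }
          unfold cauchy_density. apply Rmult_le_reg_r with (t ^ 2 * (1 + t ^ 2)); [nra|].
          replace (h * (4 * (2 * INR m + h)) / t ^ 2 * (t ^ 2 * (1 + t ^ 2))) with
            (h * (4 * (2 * INR m + h) * (1 + t ^ 2))) by (field; nra).
          replace (h * Q * / (1 + t ^ 2) * (t ^ 2 * (1 + t ^ 2))) with (h * (Q * t ^ 2)) by (field; nra).
          apply Rmult_le_compat_l; [lra|]. unfold Q. nra. }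
      assert (prodf d (fun t => zsum I (s t)) x <= h * Q ^ d * prodf d cauchy_density x).
      { apply prodf_one_small with (M := 2 * INR m); auto; try lra.
        - intros t. apply zsum_ge0; auto.
        - intros t. destruct (Rle_or_lt (Rabs t) (2 * INR m)) as [L | L].
          + apply Rle_trans with 1; auto. unfold cauchy_density.
            assert (t ^ 2 <= (2 * INR m) ^ 2).
            { rewrite <- (pow2_abs t). apply pow_incr. split; auto. apply Rabs_pos. }
            assert (0 <= t ^ 2) by apply pow2_ge_0.
            apply Rmult_le_reg_r with (1 + t ^ 2); [lra|]. rewrite Rmult_assoc, Rinv_l by lra.
            unfold Q. nra.
          + eapply Rle_trans. { now apply Far. }
            apply Rmult_le_compat_r; auto. nra. }
      assert (PP := prodf_le1 d cauchy_density x).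
      assert (0 <= prodf d cauchy_density x) by (apply Rlt_le, prodf_pos, cauchy_density_pos).
      apply Rle_trans with (B * (h * Q ^ d * prodf d cauchy_density x)). { now apply Rmult_le_compat_l. }
      replace (B * (h * Q ^ d * prodf d cauchy_density x)) with (h * (B * Q ^ d) * prodf d cauchy_density x) by ring.
      generalize (P0 x). nra.
Qed.

(** * Convolution powers at the origin, lower bound *)

(** The Fejer weight multiplied by [n]: a triangle with value 1 at frequency 0, sampling the Fourier
    transform of a squared sinc. *)
Definition fourier_weight (n : nat) (m : Z) : R := 1 - Rabs (IZR m) / INR n.

Lemma prodz_const_mult d c w k : prodz d (fun m => c * w m) k = c ^ d * prodz d w k.
Proof. induction d as [|d IH]; simpl. { ring. } rewrite IH. ring. Qed.

Lemma prodz_ext d u v k : (forall m, u m = v m) -> prodz d u k = prodz d v k.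
Proof. intros H. induction d as [|d IH]; simpl; auto. now rewrite H, IH. Qed.

Lemma fourier_weight_prod d n th k : (1 <= n)%nat -> 0 < th -> in_cube d n k ->
  0 <= prodz d (fourier_weight n) k <= 1 /\
  1 - prodz d (fourier_weight n) k <= / (th * INR n) * norm1 d (zscale d th k).
Proof.
  intros Hn Hth. apply (le_INR 1) in Hn. simpl in Hn.
  assert (P : 0 < / (th * INR n)) by (apply Rinv_0_lt_compat; nra).
  induction d as [|d IH]. { simpl. intros _; lra. }
  intros [H1 H2]. destruct (IH _ H2) as [[A1 A2] A3]. simpl.
  apply Rabs_IZR_le in H1. assert (Q := Rabs_pos (IZR (fst k))).
  set (u := Rabs (IZR (fst k)) / INR n).
  assert (U : 0 <= u <= 1).
  { unfold u. split. { apply Rmult_le_pos; auto. apply Rlt_le, Rinv_0_lt_compat; lra. }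
    apply Rmult_le_reg_r with (INR n); [lra|]. unfold Rdiv. rewrite Rmult_assoc, Rinv_l; lra. }
  assert (E : / (th * INR n) * Rabs (th * IZR (fst k)) = u).
  { rewrite Rabs_mult, (Rabs_right th) by lra. unfold u. field. lra. }
  rewrite Rmult_plus_distr_l, E. change (fourier_weight n (fst k)) with (1 - u).
  set (v := prodz d (fourier_weight n) (snd k)) in *. split; [split|]; nra.
Qed.

Lemma normsq_vadd_le d x y : normsq d (vadd d x y) <= 2 * normsq d x + 2 * normsq d y.
Proof.
  unfold normsq. induction d as [|d IH]; simpl; [lra|].
  generalize (IH (snd x) (snd y)) (pow2_ge_0 (fst x - fst y)). nra.
Qed.

(** Factors are replaced one at a time; each replacement costs [c * t ^ 2] because the remaining
    factors are at most 1. *)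
Lemma prod_minus_squares d p q z c : 0 <= c ->
  (forall t, 0 <= p t <= 1) -> (forall t, 0 <= q t <= 1) ->
  (forall t, p t <= q t + c * t ^ 2) -> prodf d p z <= prodf d q z + c * normsq d z.
Proof.
  intros C0 Hp Hq Hc. induction d as [|d IH]. { unfold normsq; simpl; lra. }
  destruct (prodf_le1 d p (snd z) Hp) as [A1 A2].
  specialize (IH (snd z)). assert (N := normsq_ge0 d (snd z)).
  assert (H2 := Hq (fst z)). assert (H3 := Hc (fst z)). assert (T := pow2_ge_0 (fst z)).
  replace (normsq (S d) z) with (fst z ^ 2 + normsq d (snd z)) by (unfold normsq; simpl; ring).
  simpl prodf.
  set (P := prodf d p (snd z)) in *. set (R := prodf d q (snd z)) in *.
  set (a := p (fst z)) in *. set (b := q (fst z)) in *. set (t2 := fst z ^ 2) in *.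
  set (N0 := normsq d (snd z)) in *.
  apply Rle_trans with ((b + c * t2) * P). { apply Rmult_le_compat_r; lra. }
  assert (0 <= c * t2) by now apply Rmult_le_pos.
  assert (0 <= c * N0) by now apply Rmult_le_pos.
  assert (b * P <= b * (R + c * N0)) by (apply Rmult_le_compat_l; lra).
  nra.
Qed.

Section LocalLimit.

Variables (d : nat) (phi : Rn d -> R).
Hypothesis Hphi : regular_density d phi.

Variable cov : nat -> nat -> R.
Hypothesis mean0 : forall i, (i < d)%nat -> isE d phi (fun x => coord d x i) 0.
Hypothesis covE : forall i j, (i < d)%nat -> (j < d)%nat ->
  isE d phi (fun x => coord d x i * coord d x j) (cov i j).

Local Notation cov_form := (cov_form d cov).

(* That is, [gam] is at most the local limit constant [(2 pi)^{-d} int exp (- cov_form / 2)]; Riemann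
   sums avoid computing this integral, which is only needed in the plane. *)
Definition gaussian_sums_ge (gam : R) : Prop := exists s0 R0, 0 < s0 /\
  forall s n, 0 < s <= s0 -> R0 <= INR n * s ->
  gam <= (s / (2 * PI)) ^ d * cube_sum d n (fun k => exp (- (cov_form (zscale d s k) / 2))).

Lemma zscale_vscal a b k : zscale d (a * b) k = vscal d b (zscale d a k).
Proof.
  clear. induction d as [|d' IH]; simpl; auto. rewrite IH. f_equal. ring.
Qed.

(** After time [j] the plane waves have nearly Gaussian amplitudes, and the kernel is close to a
    Riemann sum of the Gaussian with mesh [th * sqrt j]. Uniformity over bounded [y] serves the
    translated kernels of the minorant. *)
Lemma fejer_kernel_lower gam h Y : 0 < gam -> gaussian_sums_ge gam -> 0 < h -> 0 <= Y ->
  forall e, 0 < e -> exists j0 : nat, forall j n y, (j0 <= j)%nat -> (j ^ 2 <= n)%nat -> norm1 d y <= Y ->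
  h ^ d * gam - e <= sqrt (INR j) ^ d * kernel_orbit d phi n (fejer_weight n) (2 * PI / (h * INR n)) j y.
Proof.
  intros Hgam [s0 [R0 [Hs0 HG]]] Hh HY e He.
  assert (P0 := PI_RGT_0).
  set (T := 2 * PI / h).
  assert (HT : 0 < T) by (apply Rdiv_lt_0_compat; lra).
  destruct (trig_orbit_gaussian d phi Hphi cov mean0 covE T (/ T) Y HT) as [c [Hc HD]]; auto.
  { now apply Rlt_le, Rinv_0_lt_compat. }
  assert (SC := sqrt_lt_R0 _ Hc).
  (* Bounds the sum of the Gaussian factors of all error terms after normalisation, so a relative
     error [e / C1] costs [e]. *)
  set (C1 := (h / (2 * PI)) ^ d * (1 + 4 / sqrt c) ^ d).
  assert (C10 : 0 < C1).
  { unfold C1. apply Rmult_lt_0_compat; apply pow_lt. { apply Rdiv_lt_0_compat; lra. }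
    assert (0 < 4 / sqrt c) by (apply Rdiv_lt_0_compat; lra). lra. }
  destruct (HD (e / C1)) as [j1 Hj1]. { now apply Rdiv_lt_0_compat. }
  set (smin := Rmin 1 s0).
  assert (Hsm : 0 < smin) by (apply Rmin_glb_lt; lra).
  destruct (nfloor_ex (Rmax (T / smin) ((R0 * h) ^ 2))) as [j2 [_ Hj2]].
  { eapply Rle_trans; [| apply Rmax_l]. now apply Rlt_le, Rdiv_lt_0_compat. }
  exists (Nat.max j1 (S j2)). intros j n y Hj Hn Hy.
  assert (Jp : (1 <= j)%nat) by lia. assert (J1 : 1 <= INR j) by (apply (le_INR 1); auto).
  assert (JB : Rmax (T / smin) ((R0 * h) ^ 2) <= INR j).
  { assert (INR (S j2) <= INR j) by (apply le_INR; lia). rewrite S_INR in H. lra. }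
  assert (JB1 := Rle_trans _ _ _ (Rmax_l _ _) JB). assert (JB2 := Rle_trans _ _ _ (Rmax_r _ _) JB).
  assert (Hn1 : (1 <= n)%nat) by (simpl in Hn; nia).
  assert (N1 : 1 <= INR n) by (apply (le_INR 1); auto).
  assert (NJ : INR j ^ 2 <= INR n) by (rewrite <- pow_INR; now apply le_INR).
  set (th := 2 * PI / (h * INR n)).
  assert (Hth : 0 < th) by (apply Rdiv_lt_0_compat; nra).
  assert (thn : th * INR n = T) by (unfold th, T; field; lra).
  assert (SJ : 1 <= sqrt (INR j)) by (rewrite <- sqrt_1; now apply sqrt_le_1_alt).
  assert (SJ2 : sqrt (INR j) ^ 2 = INR j) by (apply pow2_sqrt; lra).
  (* The mesh in rescaled frequency. The condition [j ^ 2 <= n] sends it to 0, while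
     [s * n = T * sqrt j] tends to infinity, as [gaussian_sums_ge] requires. *)
  set (s := th * sqrt (INR j)).
  assert (s_pos : 0 < s) by (unfold s; nra).
  assert (s_small : s <= smin).
  { assert (s * INR n = T * sqrt (INR j)) by (unfold s; rewrite <- thn; ring).
    assert (T <= smin * INR j).
    { apply Rmult_le_compat_l with (r := smin) in JB1; [| lra].
      replace (smin * (T / smin)) with T in JB1 by (field; lra). lra. }
    apply Rmult_le_reg_r with (INR n); [lra|]. rewrite H.
    apply Rle_trans with (smin * INR j * INR j).
    - apply Rmult_le_compat; nra.
    - replace (smin * INR j * INR j) with (smin * INR j ^ 2) by ring. apply Rmult_le_compat_l; lra. }
  assert (ns_big : R0 <= INR n * s).
  { replace (INR n * s) with (T * sqrt (INR j)) by (unfold s; rewrite <- thn; ring).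
    assert (R0 * h <= sqrt (INR j)).
    { destruct (Rle_or_lt (R0 * h) 0); [lra|]. rewrite <- (sqrt_pow2 (R0 * h)) by lra. now apply sqrt_le_1_alt. }
    unfold T. apply Rmult_le_reg_r with h; auto.
    replace (2 * PI / h * sqrt (INR j) * h) with (2 * PI * sqrt (INR j)) by (field; lra).
    generalize PI2_3_2. nra. }
  assert (GS := HG s n (conj s_pos (Rle_trans _ _ _ s_small (Rmin_r _ _))) ns_big).
  set (w0 := exp 0) in *. clear w0.
  assert (LB : cube_sum d n (fun k => (/ INR n) ^ d * exp (- (cov_form (zscale d s k) / 2))
      + - ((/ INR n) ^ d * (e / C1)) * prodz d (fun m => exp (- (c * s ^ 2 * IZR m ^ 2))) k)
      <= kernel_orbit d phi n (fejer_weight n) th j y).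
  { apply cube_sum_le. intros k Hk.
    destruct (fourier_weight_prod d n th k Hn1 Hth Hk) as [W1 W2].
    rewrite thn in W2.
    assert (Hin : inbox d T (zscale d th k)).
    { rewrite <- thn. apply inbox_zscale; auto; lra. }
    assert (HH := Hj1 j ltac:(lia) (zscale d th k) (prodz d (fourier_weight n) k) y Hin W1 W2 Hy).
    apply Rabs_le_between in HH.
    rewrite (prodz_ext d (fejer_weight n) (fun m => / INR n * fourier_weight n m)).
    2: { intros m. unfold fejer_weight, fourier_weight. field. lra. }
    rewrite prodz_const_mult.
    assert (E1 : exp (- (c * (INR j * normsq d (zscale d th k)))) = prodz d (fun m => exp (- (c * s ^ 2 * IZR m ^ 2))) k).
    { replace (c * (INR j * normsq d (zscale d th k))) with (c * INR j * normsq d (zscale d th k)) by ring.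
      rewrite exp_normsq_zscale. apply prodz_ext. intros m. f_equal. f_equal.
      unfold s. rewrite Rpow_mult_distr, SJ2. ring. }
    assert (E2 : INR j * cov_form (zscale d th k) / 2 = cov_form (zscale d s k) / 2).
    { f_equal. unfold s. rewrite zscale_vscal, (cov_form_scal d phi Hphi cov covE), SJ2. reflexivity. }
    rewrite E1, E2 in HH.
    assert (IN : 0 < (/ INR n) ^ d) by (apply pow_lt, Rinv_0_lt_compat; lra).
    set (a := (/ INR n) ^ d) in *. set (b := prodz d (fun m => exp _) k) in *.
    set (g := exp (- (cov_form (zscale d s k) / 2))) in *.
    replace (a * g + - (a * (e / C1)) * b) with (a * (g - e / C1 * b)) by ring.
    rewrite Rmult_assoc. apply Rmult_le_compat_l; lra. }
  rewrite cube_sum_plus, !cube_sum_scal, cube_sum_prod in LB.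
  assert (Z := theta_sum_bound (c * s ^ 2) n).
  assert (cs : 0 < c * s ^ 2) by (apply Rmult_lt_0_compat; auto; apply pow_lt; auto).
  specialize (Z cs). rewrite sqrt_mult_alt, sqrt_pow2 in Z by lra.
  set (S0 := zsum n _) in *. set (G0 := cube_sum d n _) in *.
  assert (S00 : 0 <= S0) by (apply zsum_ge0; intros; left; apply exp_pos).
  assert (SR : 0 <= sqrt (INR j) ^ d) by (apply pow_le; lra).
  apply Rle_trans with (sqrt (INR j) ^ d * ((/ INR n) ^ d * G0 + - ((/ INR n) ^ d * (e / C1)) * S0 ^ d)).
  2: { apply Rmult_le_compat_l; auto. }
  rewrite Rmult_plus_distr_l, <- Rmult_assoc, <- Rpow_mult_distr.
  assert (E3 : sqrt (INR j) * / INR n = h * (s / (2 * PI))).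
  { unfold s, th. field. lra. }
  replace (sqrt (INR j) ^ d * (- ((/ INR n) ^ d * (e / C1)) * S0 ^ d)) with
    (- ((sqrt (INR j) * / INR n * S0) ^ d * (e / C1))) by (rewrite !Rpow_mult_distr; ring).
  rewrite E3.
  assert (X1 : h ^ d * gam <= (h * (s / (2 * PI))) ^ d * G0).
  { rewrite Rpow_mult_distr, Rmult_assoc. apply Rmult_le_compat_l; auto. apply pow_le; lra. }
  assert (X2 : (h * (s / (2 * PI)) * S0) ^ d <= C1).
  { unfold C1. rewrite <- Rpow_mult_distr. apply pow_incr.
    assert (0 <= s / (2 * PI)) by (apply Rlt_le, Rdiv_lt_0_compat; lra).
    split. { apply Rmult_le_pos; auto. apply Rmult_le_pos; lra. }
    replace (h * (s / (2 * PI)) * S0) with (h / (2 * PI) * (s * S0)) by (field; lra).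
    apply Rmult_le_compat_l. { apply Rlt_le, Rdiv_lt_0_compat; lra. }
    apply Rle_trans with (s * (1 + 4 / (sqrt c * s))). { apply Rmult_le_compat_l; lra. }
    replace (s * (1 + 4 / (sqrt c * s))) with (s + 4 / sqrt c) by (field; lra).
    assert (smin <= 1) by apply Rmin_l. lra. }
  assert (e / C1 * C1 = e) by (field; lra).
  assert (0 < e / C1) by now apply Rdiv_lt_0_compat.
  nra.
Qed.

Variable psi : nat -> Rn d -> R.
Hypothesis psi1 : forall x, psi 1%nat x = phi x.
Hypothesis psi_orbit : orbit d phi (fun j => psi (S j)).

Lemma psi_ge0 j x : (1 <= j)%nat -> 0 <= psi j x.
Proof.
  intros Hj. destruct j as [|j]; [lia|].
  apply (orbit_le d phi Hphi (fun _ _ => 0) (fun j => psi (S j))); auto.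
  - now apply orbit_const.
  - intros y. rewrite psi1. apply (rd_ge0 d phi Hphi).
Qed.

(** Fejer kernels in place of sinc kernels turn the band-limited minorant into finitely many plane
    waves. The sum of the samples of [phi] times [h ^ d] is close to the total mass 1, so the
    constant [gam] is lost only by an arbitrarily small amount. *)
Lemma local_limit_lower gam gam' : gaussian_sums_ge gam -> gam' < gam ->
  exists j0 : nat, forall j, (j0 <= j)%nat -> gam' <= sqrt (INR j) ^ d * psi j (vzero d).
Proof.
  intros HG Hlt.
  (* For nonpositive [gam'] positivity of [psi] is enough; in the other case [gam] is positive, as
     [fejer_kernel_lower] demands. *)
  destruct (Rle_or_lt gam' 0) as [Neg | Pos].
  { exists 1%nat. intros j Hj. apply Rle_trans with 0; auto.
    apply Rmult_le_pos. { apply pow_le, sqrt_pos. } now apply psi_ge0. }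
  destruct (kernel_orbit_le d phi Hphi 2) as [c [Hc HK]]. { lra. }
  assert (SC := sqrt_lt_R0 _ Hc).
  assert (P0 := PI_RGT_0).
  set (C2 := 9 ^ d * (2 + 4 / sqrt c) ^ d).
  assert (C20 : 0 < C2).
  { unfold C2. apply Rmult_lt_0_compat; apply pow_lt; try lra.
    assert (0 < 4 / sqrt c) by (apply Rdiv_lt_0_compat; lra). lra. }
  set (e := gam - gam').
  (* The lost mass [eta * gam] and the majorant term [eta * C2] together cost [e / 4]; the Riemann
     sum and the quadratic correction are each allowed [e / 4]. *)
  set (eta := e / (4 * (gam + C2))).
  assert (Heta : 0 < eta) by (apply Rdiv_lt_0_compat; unfold e; lra).
  assert (Eeta : eta * (gam + C2) = e / 4) by (unfold eta; field; lra).
  destruct (bandlimited_minorant d phi eta Hphi Heta) as [h [I [Hh [Hmass Hmin]]]].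
  set (ph := fun i => phi (zscale d h i)) in *.
  assert (ph0 : forall i, 0 <= ph i) by (intros; apply (rd_ge0 d phi Hphi)).
  set (Sph := cube_sum d I ph) in *.
  assert (Sph0 : 0 <= Sph) by (apply cube_sum_ge0; auto).
  set (Y := INR d * (h * INR I)).
  assert (HY : 0 <= Y) by (repeat apply Rmult_le_pos; try apply pos_INR; lra).
  assert (HYi : forall i, in_cube d I i -> norm1 d (vscal d (-1) (zscale d h i)) <= Y).
  { intros i Hi. rewrite norm1_vscal. replace (Rabs (-1)) with 1 by (rewrite Rabs_left; lra). rewrite Rmult_1_l.
    apply norm1_le_box. apply inbox_zscale; auto; lra. }
  destruct (fejer_kernel_lower gam h Y ltac:(lra) HG Hh HY (e / (4 * (Sph + 1)))) as [j1 Hj1].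
  { apply Rdiv_lt_0_compat; unfold e; lra. }
  destruct (orbit_quadratic d phi Hphi mean0) as [tr [Htr OQ]].
  set (kap := (PI / h) ^ 2 * Sph).
  assert (kap0 : 0 <= kap) by (apply Rmult_le_pos; auto; apply pow2_ge_0).
  set (C3 := kap * (2 * Y ^ 2 + 2 * tr)).
  assert (C30 : 0 <= C3).
  { apply Rmult_le_pos; auto. generalize (pow2_ge_0 Y); lra. }
  destruct (nfloor_ex (4 * C3 / e)) as [j2 [_ Hj2]].
  { apply Rmult_le_pos; [lra|]. apply Rlt_le, Rinv_0_lt_compat. unfold e; lra. }
  exists (S (S (Nat.max j1 j2))). intros jj Hjj.
  (* [psi (S j)] is the state at time [j]; the factor [sqrt j] is raised to [sqrt (S j)] at the very
     end. *)
  destruct jj as [|j]; [lia|].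
  assert (Hj : (Nat.max j1 j2 < j)%nat) by lia.
  assert (J1 : 1 <= INR j) by (apply (le_INR 1); lia).
  (* Large enough for [j ^ 2 <= n] and for [sqrt j ^ d * j <= n]; the second makes the quadratic
     correction of order [1 / n]. *)
  set (n := (j ^ (d + 2))%nat).
  assert (Hn2 : (j ^ 2 <= n)%nat) by (apply Nat.pow_le_mono_r; lia).
  assert (NR : INR n = INR j ^ (d + 2)) by apply pow_INR.
  assert (NJ : INR j <= INR n).
  { rewrite NR. rewrite <- (pow_1 (INR j)) at 1. apply Rle_pow; auto; lia. }
  assert (Hn1 : (1 <= n)%nat) by (apply INR_le; simpl; lra).
  set (th := 2 * PI / (h * INR n)).
  set (KF := kernel_orbit d phi n (fejer_weight n) th).
  set (KM := kernel_orbit d phi n (majorant_weight n) (2 / INR n)).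
  (* The Fejer form of the minorant, minus a quadratic bound for the excess of Fejer over sinc
     kernels, minus the error [eta] times the Cauchy product, itself replaced by a majorant kernel.
     Every summand has an explicit orbit. *)
  set (v := fun (l : nat) (x : Rn d) =>
     1 * cube_sum d I (fun i => ph i * KF l (vadd d x (vscal d (-1) (zscale d h i))))
     + 1 * ((- (kap / INR n ^ 2 * (2 * Y ^ 2))) + 1 * (- (kap / INR n ^ 2 * 2) * (normsq d x + INR l * tr)
        + (- (eta * 9 ^ d)) * KM l x))).
  assert (OV : orbit d phi v).
  { unfold v. apply (orbit_lin d phi (fun l x => cube_sum d I (fun i => ph i * KF l (vadd d x (vscal d (-1) (zscale d h i)))))
      (fun l x => (- (kap / INR n ^ 2 * (2 * Y ^ 2))) + 1 * (- (kap / INR n ^ 2 * 2) * (normsq d x + INR l * tr)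
        + (- (eta * 9 ^ d)) * KM l x)) 1 1).
    - apply (orbit_cube_sum d phi d I (fun i l x => ph i * KF l (vadd d x (vscal d (-1) (zscale d h i))))).
      intros i. apply orbit_scal. apply (orbit_translate d phi KF). now apply orbit_kernel.
    - apply (orbit_plus d phi (fun _ _ => - (kap / INR n ^ 2 * (2 * Y ^ 2)))
       (fun l x => 1 * (- (kap / INR n ^ 2 * 2) * (normsq d x + INR l * tr) + (- (eta * 9 ^ d)) * KM l x))).
      + now apply orbit_const.
      + apply (orbit_scal d phi 1). apply (orbit_lin d phi); auto. now apply orbit_kernel. }
  assert (N2 : 0 < INR n ^ 2) by (apply pow_lt; lra).
  assert (V0 : forall x, v O x <= psi 1%nat x).
  { intros x. rewrite psi1. unfold v.
    assert (M1 : 9 ^ d * KM O x >= prodf d cauchy_density x).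
    { unfold KM. rewrite kernel_orbit_0 by apply majorant_weight_even.
      rewrite <- prodf_scal. apply Rle_ge, prodf_le. intros t. split. { apply Rlt_le, cauchy_density_pos. }
      generalize (majorant_ge_cauchy n t Hn1). unfold majorant.
      rewrite (zsum_ext n (fun m => majorant_weight n m * cos (2 * IZR m * (t / INR n)))
        (fun m => majorant_weight n m * cos (2 / INR n * IZR m * t))).
      - lra.
      - intros m _. do 2 f_equal. field. lra. }
    assert (M2 : cube_sum d I (fun i => ph i * KF O (vadd d x (vscal d (-1) (zscale d h i))))
       <= cube_sum d I (fun i => ph i * prodk d (sinc_kernel h) x i) + kap / INR n ^ 2 * (2 * normsq d x + 2 * Y ^ 2)).
    { replace (kap / INR n ^ 2 * (2 * normsq d x + 2 * Y ^ 2)) with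
        (cube_sum d I (fun i => (PI / (h * INR n)) ^ 2 * (2 * normsq d x + 2 * Y ^ 2) * ph i)).
      2: { rewrite cube_sum_scal. fold Sph. unfold kap. field. lra. }
      rewrite <- cube_sum_plus. apply cube_sum_le. intros i Hi.
      replace (ph i * prodk d (sinc_kernel h) x i + (PI / (h * INR n)) ^ 2 * (2 * normsq d x + 2 * Y ^ 2) * ph i)
       with (ph i * (prodk d (sinc_kernel h) x i + (PI / (h * INR n)) ^ 2 * (2 * normsq d x + 2 * Y ^ 2))) by ring.
      apply Rmult_le_compat_l; auto.
      unfold KF. rewrite kernel_orbit_0 by apply fejer_weight_even.
      set (z := vadd d x (vscal d (-1) (zscale d h i))).
      assert (Z1 : normsq d z <= 2 * normsq d x + 2 * Y ^ 2).
      { unfold z. eapply Rle_trans. { apply normsq_vadd_le. }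
        assert (normsq d (vscal d (-1) (zscale d h i)) <= Y ^ 2); [| lra].
        eapply Rle_trans. { apply normsq_le_norm1_sq. }
        apply pow_incr. split. { apply norm1_ge0. } now apply HYi. }
      set (q := fun t => sinc_sq (PI * t / h)).
      set (p := fun t => zsum n (fun m => fejer_weight n m * cos (th * IZR m * t))).
      assert (pE : forall t, p t = fejer n ((PI * t / h) / INR n)).
      { intros t. apply zsum_ext. intros m _. do 2 f_equal. unfold th. field. lra. }
      assert (Z2 : prodk d (sinc_kernel h) x i = prodf d q z).
      { unfold z. clear. induction d as [|d' IH]; simpl; auto. rewrite IH. f_equal.
        unfold sinc_kernel, q. do 3 f_equal. ring. }
      assert (Z3 : prodf d p z <= prodf d q z + (PI / (h * INR n)) ^ 2 * normsq d z).
      { apply prod_minus_squares.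
        - apply pow2_ge_0.
        - intros t. rewrite pE. now apply fejer_bounds.
        - intros t. apply sinc_sq_bounds.
        - intros t. rewrite pE. eapply Rle_trans. { now apply fejer_le_sinc_sq. }
          right. unfold q. f_equal. field. lra. }
      rewrite Z2. fold p. 
      assert ((PI / (h * INR n)) ^ 2 * normsq d z <= (PI / (h * INR n)) ^ 2 * (2 * normsq d x + 2 * Y ^ 2)).
      { apply Rmult_le_compat_l; auto. apply pow2_ge_0. }
      lra. }
    assert (M3 : cube_sum d I (fun i => ph i * prodk d (sinc_kernel h) x i)
      <= phi x + eta * prodf d cauchy_density x) by exact (Hmin x). simpl (INR 0). rewrite Rmult_0_l.
    assert (M4 : eta * prodf d cauchy_density x <= eta * (9 ^ d * KM O x)) by (apply Rmult_le_compat_l; lra).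
    lra. }
  assert (VJ := orbit_le d phi Hphi v (fun j => psi (S j)) OV psi_orbit V0 j (vzero d)).
  assert (SJ1 : 1 <= sqrt (INR j)) by (rewrite <- sqrt_1; now apply sqrt_le_1_alt).
  assert (SJJ : sqrt (INR j) <= INR j).
  { rewrite <- (sqrt_pow2 (INR j)) at 2 by lra. apply sqrt_le_1_alt. nra. }
  set (SD := sqrt (INR j) ^ d) in *.
  assert (SD1 : 1 <= SD) by (apply pow_R1_Rle; auto).
  assert (L1 : gam - e / 4 - eta * gam <= SD * cube_sum d I (fun i => ph i * KF j (vadd d (vzero d) (vscal d (-1) (zscale d h i))))).
  { rewrite <- cube_sum_scal.
    apply Rle_trans with (cube_sum d I (fun i => (h ^ d * gam - e / (4 * (Sph + 1))) * ph i)).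
    - rewrite cube_sum_scal. fold Sph.
      assert (e / (4 * (Sph + 1)) * Sph <= e / 4).
      { apply Rmult_le_reg_r with (4 * (Sph + 1)); [lra|].
        replace (e / (4 * (Sph + 1)) * Sph * (4 * (Sph + 1))) with (e * Sph) by (field; lra).
        replace (e / 4 * (4 * (Sph + 1))) with (e * (Sph + 1)) by field.
        apply Rmult_le_compat_l; unfold e; lra. }
      assert ((1 - eta) * gam <= h ^ d * Sph * gam) by (apply Rmult_le_compat_r; lra).
      lra.
    - apply cube_sum_le. intros i Hi.
      assert (ZV : vadd d (vzero d) (vscal d (-1) (zscale d h i)) = vscal d (-1) (zscale d h i)).
      { clear. induction d as [|d' IH]; simpl; auto. rewrite IH. f_equal. ring. }
      rewrite ZV. 
      generalize (Hj1 j n (vscal d (-1) (zscale d h i)) ltac:(lia) Hn2 (HYi i Hi)). fold th KF SD. intros Q.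
      replace (SD * (ph i * KF j (vscal d (-1) (zscale d h i)))) with ((SD * KF j (vscal d (-1) (zscale d h i))) * ph i) by ring.
      apply Rmult_le_compat_r; auto. }
  assert (L2 : SD * KM j (vzero d) <= (2 + 4 / sqrt c) ^ d).
  { assert (Q : KM j (vzero d) <= (2 / INR n * (1 + 4 / (2 / INR n * sqrt (c * INR j)))) ^ d).
    { apply HK.
      - apply Rdiv_lt_0_compat; lra.
      - right. field. lra.
      - lia.
      - intros m Hm. now apply majorant_weight_bounds. }
    apply Rle_trans with (SD * (2 / INR n * (1 + 4 / (2 / INR n * sqrt (c * INR j)))) ^ d).
    { apply Rmult_le_compat_l; auto; lra. }
    unfold SD. rewrite <- Rpow_mult_distr. apply pow_incr.
    rewrite sqrt_mult_alt by lra.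
    replace (sqrt (INR j) * (2 / INR n * (1 + 4 / (2 / INR n * (sqrt c * sqrt (INR j)))))) with
      (2 * (sqrt (INR j) / INR n) + 4 / sqrt c) by (field; repeat split; lra).
    assert (0 < 4 / sqrt c) by (apply Rdiv_lt_0_compat; lra).
    assert (0 <= sqrt (INR j) / INR n <= 1).
    { split. { apply Rlt_le, Rdiv_lt_0_compat; lra. }
      apply Rmult_le_reg_r with (INR n); [lra|]. unfold Rdiv. rewrite Rmult_assoc, Rinv_l; lra. }
    lra. }
  assert (L3 : SD * (kap / INR n ^ 2 * (2 * Y ^ 2 + 2 * (INR j * tr))) <= e / 4).
  { assert (SDn : SD * INR j <= INR n).
    { unfold SD. apply Rle_trans with (INR j ^ d * INR j).
      - apply Rmult_le_compat_r; [lra|]. apply pow_incr; lra.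
      - rewrite NR, pow_add. apply Rmult_le_compat_l. { apply pow_le; lra. } simpl; nra. }
    apply Rle_trans with (C3 / INR n).
    - replace (C3 / INR n) with (kap / INR n ^ 2 * (INR n * (2 * Y ^ 2 + 2 * tr))) by (unfold C3; field; lra).
      replace (SD * (kap / INR n ^ 2 * (2 * Y ^ 2 + 2 * (INR j * tr)))) with
       (kap / INR n ^ 2 * (SD * (2 * Y ^ 2 + 2 * (INR j * tr)))) by ring.
      apply Rmult_le_compat_l. { apply Rmult_le_pos; auto. apply Rlt_le, Rinv_0_lt_compat; auto. }
      assert (0 <= Y ^ 2) by apply pow2_ge_0.
      assert (SD * (2 * Y ^ 2) <= INR n * (2 * Y ^ 2)).
      { apply Rmult_le_compat_r; nra. }
      assert (SD * (INR j * tr) <= INR n * tr).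
      { rewrite <- Rmult_assoc. apply Rmult_le_compat_r; auto. }
      lra.
    - assert (J2 : 4 * C3 / e <= INR j).
      { assert (INR (S j2) <= INR j) by (apply le_INR; lia). rewrite S_INR in H. lra. }
      assert (e_pos : 0 < e) by (unfold e; lra).
      apply Rmult_le_reg_r with (4 * INR n / e). { apply Rdiv_lt_0_compat; lra. }
      replace (C3 / INR n * (4 * INR n / e)) with (4 * C3 / e) by (field; lra).
      replace (e / 4 * (4 * INR n / e)) with (INR n) by (field; lra). lra. }
  assert (SS : SD <= sqrt (INR (S j)) ^ d).
  { apply pow_incr. split; [lra|]. apply sqrt_le_1_alt. rewrite S_INR. lra. }
  assert (VV : gam' <= SD * v j (vzero d)).
  { unfold v.
    assert (Z0 : normsq d (vzero d) = 0) by apply dot_vzero_r.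
    rewrite Z0.
    set (CF := cube_sum d I _) in *.
    assert (eta * (9 ^ d * (SD * KM j (vzero d))) <= eta * C2).
    { apply Rmult_le_compat_l; [lra|]. unfold C2. apply Rmult_le_compat_l; auto. apply pow_le; lra. }
    unfold e in *. lra. }
  apply Rle_trans with (1 := VV).
  apply Rle_trans with (SD * psi (S j) (vzero d)).
  - apply Rmult_le_compat_l; auto. lra.
  - apply Rmult_le_compat_r; auto. apply psi_ge0. lia.
Qed.

End LocalLimit.

(** * Schwartz densities *)

Lemma lipschitz_of_partials d f (g : nat -> Rn d -> R) B :
  (forall i, (i < d)%nat -> partial d i f (g i)) -> (forall i x, (i < d)%nat -> Rabs (g i x) <= B) ->
  forall x y, Rabs (f x - f y) <= B * norm1 d (vsub d x y).
Proof.
  revert f g. induction d as [|d IH]; intros f g Hp Hb x y.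
  { simpl. destruct x, y. rewrite Rminus_diag, Rabs_R0. lra. }
  destruct x as [x1 x], y as [y1 y].
  replace (f (x1, x) - f (y1, y)) with ((f (x1, x) - f (y1, x)) + (f (y1, x) - f (y1, y))) by ring.
  eapply Rle_trans. { apply Rabs_triang. }
  simpl norm1. rewrite Rmult_plus_distr_l. apply Rplus_le_compat.
  - apply (lipschitz_of_derive (fun t => f (t, x)) (fun t => g O (t, x)) B).
    + intros t. apply is_derive_Reals. apply (Hp O ltac:(lia) (t, x)).
    + intros t. apply Hb; lia.
  - apply (IH (fun z => f (y1, z)) (fun i z => g (S i) (y1, z))).
    + intros i Hi z. apply (Hp (S i) ltac:(lia) (y1, z)).
    + intros i z Hi. apply Hb; lia.
Qed.

Lemma finite_common_bound (P : nat -> R -> Prop) n :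
  (forall i b b', b <= b' -> P i b -> P i b') -> (forall i, (i < n)%nat -> exists b, P i b) ->
  exists b, forall i, (i < n)%nat -> P i b.
Proof.
  intros Hm. induction n as [|n IH]; intros H. { exists 0. intros; lia. }
  destruct IH as [b Hb]. { intros; apply H; lia. }
  destruct (H n) as [b' Hb']; [lia|].
  exists (Rmax b b'). intros i Hi. destruct (Nat.eq_dec i n) as [-> | Hn].
  - apply Hm with b'; auto. apply Rmax_r.
  - apply Hm with b. { apply Rmax_l. } apply Hb; lia.
Qed.

Definition japanese_list (d : nat) (l : list nat) (x : Rn d) : R :=
  fold_right (fun i acc => japanese (coord d x i) * acc) 1 l.

Lemma japanese_list_app d l l' x : japanese_list d (l ++ l') x = japanese_list d l x * japanese_list d l' x.
Proof. induction l as [|i l IH]; simpl. { ring. } rewrite IH. ring. Qed.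

Lemma prodf_japanese_list d x : prodf d japanese x = japanese_list d (seq 0 d) x.
Proof.
  induction d as [|d IH]. { reflexivity. }
  simpl. f_equal. rewrite IH, <- seq_shift. unfold japanese_list.
  generalize (seq 0 d). intros l. induction l as [|i l IHl]; simpl; auto. now rewrite IHl.
Qed.

(** The Schwartz bounds concern monomials indexed by lists of coordinates; a bracket [1 + x_i ^ 2]
    splits into the given list and the list with [i] added twice. *)
Lemma japanese_list_decay d f l : (forall x, 0 <= f x) ->
  (forall a, exists C, forall x, Rabs (monom d a x * f x) <= C) ->
  forall a, exists C, forall x, japanese_list d l x * (Rabs (monom d a x) * f x) <= C.
Proof.
  intros Pf H. induction l as [|i l IH]; intros a.
  - destruct (H a) as [C HC]. exists C. intros x. simpl. rewrite Rmult_1_l.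
    generalize (HC x). rewrite Rabs_mult, (Rabs_right (f x)); auto. apply Rle_ge; auto.
  - destruct (IH a) as [C HC]. destruct (IH (i :: i :: a)) as [C' HC'].
    exists (C + C'). intros x. generalize (HC x) (HC' x). simpl. rewrite !Rabs_mult.
    replace (Rabs (coord d x i) * (Rabs (coord d x i) * Rabs (monom d a x))) with
      (coord d x i ^ 2 * Rabs (monom d a x)).
    2: { rewrite <- (pow2_abs (coord d x i)). ring. }
    unfold japanese. fold (japanese_list d l x). intros h1 h2.
    replace ((1 + coord d x i ^ 2) * japanese_list d l x * (Rabs (monom d a x) * f x)) with
     (japanese_list d l x * (Rabs (monom d a x) * f x) +
      japanese_list d l x * (coord d x i ^ 2 * Rabs (monom d a x) * f x)) by ring. lra.
Qed.

Lemma schwartz_regular_density d phi : (1 <= d)%nat -> schwartz d phi -> (forall x, 0 <= phi x) ->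
  integral d phi 1 -> regular_density d phi.
Proof.
  intros Hd [D [D0 [Dp Db]]] P0 Hi. split; auto.
  - destruct (finite_common_bound (fun i b => forall x, Rabs (D (i :: nil) x) <= b) d) as [B HB].
    + intros i b b' Hb H x. generalize (H x); lra.
    + intros i Hid. destruct (Db (i :: nil) nil) as [C HC]. exists C. intros x.
      generalize (HC x). simpl. now rewrite Rmult_1_l.
    + exists (Rmax 0 B). split. { apply Rmax_l. }
      apply (lipschitz_of_partials d phi (fun i => D (i :: nil))).
      * intros i Hid. rewrite <- D0. now apply Dp.
      * intros i x Hid. apply Rle_trans with B; auto. apply Rmax_r.
  - intros k.
    assert (H : forall a, exists C, forall x, Rabs (monom d a x * phi x) <= C).
    { intros a. rewrite <- D0. apply Db. }
    assert (E : exists l, forall x, prodf d japanese x ^ k = japanese_list d l x).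
    { induction k as [|k [l Hl]]. { now exists nil. }
      exists (seq 0 d ++ l). intros x. rewrite japanese_list_app, <- Hl, <- prodf_japanese_list. reflexivity. }
    destruct E as [l Hl]. destruct (japanese_list_decay d phi l P0 H nil) as [C HC].
    exists C. intros x. rewrite Hl. generalize (HC x). simpl. now rewrite Rabs_R1, Rmult_1_l.
Qed.

(** Only grid points with [|m| s <= 1] are kept: there are at least [1 / s] of them per axis, and
    each factor is at least [exp (- a)]. *)
Lemma gaussian_sums_ge_some d phi cov : regular_density d phi ->
  (forall i j, (i < d)%nat -> (j < d)%nat -> isE d phi (fun x => coord d x i * coord d x j) (cov i j)) ->
  exists gam, 0 < gam /\ gaussian_sums_ge d cov gam.
Proof.
  intros Hphi covE. destruct (cov_form_le d phi Hphi cov covE) as [B [B0 HB]].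
  assert (P0 := PI_RGT_0).
  set (a := B * INR d / 2).
  assert (a0 : 0 <= a) by (unfold a; generalize (pos_INR d); nra).
  exists ((exp (- a) / (2 * PI)) ^ d). split.
  { apply pow_lt, Rdiv_lt_0_compat; [apply exp_pos | lra]. }
  exists 1, 1. split; [lra|]. intros s n Hs Hn.
  apply Rle_trans with ((s / (2 * PI)) ^ d * zsum n (fun m => exp (- (a * s ^ 2 * IZR m ^ 2))) ^ d).
  - rewrite <- Rpow_mult_distr. apply pow_incr. split.
    { apply Rlt_le, Rdiv_lt_0_compat; [apply exp_pos | lra]. }
    destruct (nfloor_ex (/ s)) as [N [HN1 HN2]]. { apply Rlt_le, Rinv_0_lt_compat; lra. }
    assert (HNs : INR N * s <= 1).
    { apply Rmult_le_reg_r with (/ s). { apply Rinv_0_lt_compat; lra. }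
      rewrite Rmult_assoc, Rinv_r; lra. }
    assert (HNn : (N <= n)%nat).
    { apply INR_le. apply Rmult_le_reg_r with s; lra. }
    assert (Z : / s * exp (- a) <= zsum n (fun m => exp (- (a * s ^ 2 * IZR m ^ 2)))).
    { apply Rle_trans with (zsum N (fun m => exp (- (a * s ^ 2 * IZR m ^ 2)))).
      2: { apply zsum_mono; auto. intros; left; apply exp_pos. }
      apply Rle_trans with (zsum N (fun _ => exp (- a))).
      - rewrite zsum_const. generalize (exp_pos (- a)) (pos_INR N). nra.
      - apply zsum_le. intros m Hm. apply exp_le. apply Rabs_IZR_le in Hm.
        assert (s ^ 2 * IZR m ^ 2 <= 1).
        { rewrite <- (pow2_abs (IZR m)). generalize (Rabs_pos (IZR m)). intros.
          rewrite <- Rpow_mult_distr. rewrite <- (pow1 2). apply pow_incr. nra. }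
        nra. }
    apply Rmult_le_compat_l with (r := s / (2 * PI)) in Z.
    2: { apply Rlt_le, Rdiv_lt_0_compat; lra. }
    replace (s / (2 * PI) * (/ s * exp (- a))) with (exp (- a) / (2 * PI)) in Z by (field; lra). lra.
  - apply Rmult_le_compat_l. { apply pow_le, Rlt_le, Rdiv_lt_0_compat; lra. }
    rewrite <- cube_sum_prod. apply cube_sum_le. intros k _. rewrite <- exp_normsq_zscale.
    apply exp_le. generalize (HB (zscale d s k)) (norm1_sq_le d (zscale d s k)). unfold a. intros h1 h2.
    apply Rmult_le_compat_l with (r := B) in h2; auto. lra.
Qed.

(** * Gaussian integrals *)

Definition gauss (x : R) : R := exp (- (x ^ 2 / 2)).

Lemma continuous_gauss x : continuous gauss x.
Proof.
  apply (@ex_derive_continuous R_AbsRing R_NormedModule). unfold gauss. auto_derive. auto.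
Qed.

Lemma ex_RInt_gauss a b : ex_RInt gauss a b.
Proof. apply (@ex_RInt_continuous R_CompleteNormedModule). intros; apply continuous_gauss. Qed.

(** The classical device for the Gaussian integral: the derivative in [x] of
    [RInt (gauss_aux x) 0 1] cancels that of [RInt gauss 0 x ^ 2], so their sum is constant, and at
    0 it equals [2 * atan 1]. *)
Definition gauss_aux (x t : R) : R := 2 * exp (- (x ^ 2 * (1 + t ^ 2) / 2)) / (1 + t ^ 2).

Lemma one_plus_sq_pos t : 0 < 1 + t ^ 2.
Proof. generalize (pow2_ge_0 t); lra. Qed.

Lemma is_derive_gauss_aux x t :
  is_derive (fun u => gauss_aux u t) x (-2 * x * exp (- (x ^ 2 * (1 + t ^ 2) / 2))).
Proof.
  unfold gauss_aux. assert (H := one_plus_sq_pos t). auto_derive. { simpl in *; lra. }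
  replace (x * (x * 1) * (1 + t * (t * 1)) * / 2) with (x ^ 2 * (1 + t ^ 2) / 2) by (simpl; field).
  set (E := exp _). simpl in *. field. lra.
Qed.

Lemma ex_RInt_gauss_aux x a b : ex_RInt (gauss_aux x) a b.
Proof.
  apply (@ex_RInt_continuous R_CompleteNormedModule). intros t _.
  apply (@ex_derive_continuous R_AbsRing R_NormedModule). unfold gauss_aux.
  assert (H := one_plus_sq_pos t). auto_derive. simpl in *; lra.
Qed.

Lemma is_derive_gauss_aux_int x :
  is_derive (fun x => RInt (gauss_aux x) 0 1) x (-2 * exp (- (x ^ 2 / 2)) * RInt gauss 0 x).
Proof.
  replace (-2 * exp (- (x ^ 2 / 2)) * RInt gauss 0 x) with
    (RInt (fun t => Derive (fun u => gauss_aux u t) x) 0 1).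
  - apply (is_derive_RInt_param gauss_aux 0 1 x).
    + apply filter_forall. intros y t _. eexists. apply is_derive_gauss_aux.
    + intros t _.
      apply continuity_2d_pt_ext with (fun u v => -2 * u * exp (- (u ^ 2 * (1 + v ^ 2) / 2))).
      { intros u v. symmetry. apply is_derive_unique, is_derive_gauss_aux. }
      apply continuity_2d_pt_mult.
      * apply continuity_2d_pt_mult. { apply continuity_2d_pt_const. } apply continuity_2d_pt_id1.
      * apply (continuity_1d_2d_pt_comp exp (fun u v => - (u ^ 2 * (1 + v ^ 2) / 2))).
        { apply derivable_continuous_pt, derivable_pt_exp. }
        apply continuity_2d_pt_ext with (fun u v => (- / 2) * ((u * u) * (1 + v * v))).
        { intros; field. }
        apply continuity_2d_pt_mult. { apply continuity_2d_pt_const. }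
        apply continuity_2d_pt_mult.
        { apply continuity_2d_pt_mult; apply continuity_2d_pt_id1. }
        apply continuity_2d_pt_plus. { apply continuity_2d_pt_const. }
        apply continuity_2d_pt_mult; apply continuity_2d_pt_id2.
    + apply filter_forall. intros y. apply ex_RInt_gauss_aux.
  - apply is_RInt_unique.
    (* The factor [exp (- (x ^ 2 / 2))] splits off, and the substitution [u = x * t] leaves the
       Gaussian integral. *)
    apply is_RInt_ext with (fun t => scal (-2 * exp (- (x ^ 2 / 2))) (scal x (gauss (x * t + 0)))).
    + intros t _. symmetry. etransitivity. { apply is_derive_unique, is_derive_gauss_aux. }
      unfold scal; simpl; unfold mult; simpl. unfold gauss.
      replace (- (x * (x * 1) * (1 + t * (t * 1)) / 2)) with
        (- (x ^ 2 / 2) + - ((x * t + 0) ^ 2 / 2)) by (simpl; field).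
      rewrite exp_plus. simpl. ring.
    + apply (@is_RInt_scal R_NormedModule). apply (@is_RInt_comp_lin R_NormedModule).
      rewrite Rmult_0_r, Rplus_0_l, Rmult_1_r, Rplus_0_r.
      apply (@RInt_correct R_CompleteNormedModule), ex_RInt_gauss.
Qed.

Lemma gauss_int_sq x : RInt gauss 0 x ^ 2 + RInt (gauss_aux x) 0 1 = PI / 2.
Proof.
  set (F := fun x => RInt gauss 0 x ^ 2 + RInt (gauss_aux x) 0 1).
  assert (D : forall y, is_derive F y 0).
  { intros y. unfold F.
    assert (D1 : is_derive (fun x => RInt gauss 0 x) y (gauss y)).
    { apply (is_derive_RInt gauss (fun x => RInt gauss 0 x) 0 y).
      - apply filter_forall. intros z. apply (@RInt_correct R_CompleteNormedModule), ex_RInt_gauss.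
      - apply continuous_gauss. }
    assert (D2 : is_derive (fun x => RInt gauss 0 x ^ 2) y (INR 2 * gauss y * RInt gauss 0 y ^ 1)).
    { apply (is_derive_pow (fun x => RInt gauss 0 x) 2 y (gauss y) D1). }
    assert (D3 := @is_derive_plus R_AbsRing R_NormedModule _ _ _ _ _ D2 (is_derive_gauss_aux_int y)).
    refine (eq_rect _ (fun l => is_derive F y l) D3 _ _).
    unfold plus, gauss; simpl; ring. }
  assert (E : F x = F 0).
  { destruct (MVT_gen F 0 x (fun _ => 0)) as [c [_ E]].
    - intros; apply D.
    - intros t _. apply continuity_pt_filterlim, (@ex_derive_continuous R_AbsRing R_NormedModule).
      eexists; apply D.
    - rewrite Rmult_0_l in E. lra. }
  fold (F x). rewrite E. unfold F. rewrite RInt_point.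
  replace (PI / 2) with (0 ^ 2 + 2 * (PI / 4)) by (simpl; field). unfold zero; simpl. f_equal.
  apply is_RInt_unique.
  apply is_RInt_ext with (fun t => scal 2 (cauchy_density t)).
  { intros t _. unfold scal, gauss_aux, cauchy_density; simpl. unfold mult; simpl.
    rewrite !Rmult_0_l. replace (- (0 / 2)) with 0 by field. rewrite exp_0.
    assert (H := one_plus_sq_pos t). simpl in H. field. lra. }
  replace (2 * (PI / 4)) with (scal 2 (minus (atan 1) (atan 0))).
  2: { rewrite atan_1, atan_0. unfold scal, minus, plus, opp; simpl. unfold mult; simpl. ring. }
  apply (@is_RInt_scal R_NormedModule).
  apply (@is_RInt_derive R_CompleteNormedModule atan cauchy_density).
  - intros y _. unfold cauchy_density. auto_derive; auto. rewrite Rmult_1_l. reflexivity.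
  - intros y _. unfold cauchy_density. apply (@ex_derive_continuous R_AbsRing R_NormedModule).
    auto_derive. generalize (one_plus_sq_pos y); simpl; lra.
Qed.

(** The square of the half-line integral misses [PI / 2] by at most [2 * exp (- (x ^ 2 / 2))]; since
    [sqrt (PI / 2) >= 1], taking the root does not enlarge the error. *)
Lemma gauss_half_bounds x : 0 <= x ->
  sqrt (PI / 2) - 2 * exp (- (x ^ 2 / 2)) <= RInt gauss 0 x <= sqrt (PI / 2).
Proof.
  intros Hx. assert (E := gauss_int_sq x). assert (P := PI_RGT_0).
  assert (K0 : 0 <= RInt gauss 0 x).
  { apply RInt_ge_0; auto. { apply ex_RInt_gauss. } intros; left; apply exp_pos. }
  assert (G0 : 0 <= RInt (gauss_aux x) 0 1).
  { apply RInt_ge_0. { lra. } { apply ex_RInt_gauss_aux. }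
    intros t _. unfold gauss_aux. apply Rlt_le, Rdiv_lt_0_compat. 2: apply one_plus_sq_pos.
    generalize (exp_pos (- (x ^ 2 * (1 + t ^ 2) / 2))); lra. }
  assert (G1 : RInt (gauss_aux x) 0 1 <= 2 * exp (- (x ^ 2 / 2))).
  { replace (2 * exp (- (x ^ 2 / 2))) with (RInt (fun _ => 2 * exp (- (x ^ 2 / 2))) 0 1).
    2: { rewrite RInt_const. unfold scal; simpl; unfold mult; simpl. ring. }
    apply RInt_le. { lra. } { apply ex_RInt_gauss_aux. } { eexists; apply (@is_RInt_const R_NormedModule). }
    intros t _. unfold gauss_aux. assert (H := one_plus_sq_pos t). assert (Q := pow2_ge_0 t).
    assert (L : exp (- (x ^ 2 * (1 + t ^ 2) / 2)) <= exp (- (x ^ 2 / 2))).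
    { apply exp_le. generalize (pow2_ge_0 x). nra. }
    apply Rmult_le_reg_r with (1 + t ^ 2); auto. unfold Rdiv at 1. rewrite Rmult_assoc, Rinv_l by lra.
    generalize (exp_pos (- (x ^ 2 / 2))). nra. }
  set (K := RInt gauss 0 x) in *. set (S := sqrt (PI / 2)).
  assert (S2 : S ^ 2 = PI / 2) by (apply pow2_sqrt; lra).
  assert (S1 : 1 <= S). { unfold S. rewrite <- sqrt_1. apply sqrt_le_1_alt. generalize PI2_3_2; lra. }
  set (e := exp (- (x ^ 2 / 2))) in *. split; nra.
Qed.

Lemma gauss_tail_small e : 0 < e -> exists R0, 0 < R0 /\ forall x, R0 <= x -> exp (- (x ^ 2 / 2)) <= e.
Proof.
  intros He. exists (1 + 2 / e). assert (P : 0 < 2 / e) by (apply Rdiv_lt_0_compat; lra).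
  split; [lra|]. intros x Hx. rewrite exp_Ropp.
  assert (H := exp_ge_1_plus (x ^ 2 / 2)).
  rewrite <- (Rinv_inv e). apply Rinv_le_contravar. { now apply Rinv_0_lt_compat. }
  assert (2 / e <= x ^ 2) by nra. unfold Rdiv in *. lra.
Qed.

Lemma gauss_int_symm x : RInt gauss (-x) x = 2 * RInt gauss 0 x.
Proof.
  rewrite <- (RInt_Chasles gauss (-x) 0 x) by apply ex_RInt_gauss.
  assert (E : RInt gauss (-x) 0 = RInt gauss 0 x).
  { apply is_RInt_unique.
    assert (H : is_RInt gauss (-1 * - x + 0) (-1 * 0 + 0) (RInt gauss x 0)).
    { replace (-1 * - x + 0) with x by ring. replace (-1 * 0 + 0) with 0 by ring.
      apply (@RInt_correct R_CompleteNormedModule), ex_RInt_gauss. }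
    apply (@is_RInt_comp_lin R_NormedModule) in H. apply (@is_RInt_scal R_NormedModule _ _ _ (-1)) in H.
    rewrite <- (opp_RInt_swap gauss x 0) by apply ex_RInt_gauss.
    replace (opp (RInt gauss x 0)) with (scal (-1) (RInt gauss x 0))
      by (unfold opp, scal; simpl; unfold mult; simpl; ring).
    apply is_RInt_ext with (2 := H). intros y _. unfold scal; simpl; unfold mult; simpl.
    rewrite Rplus_0_r. unfold gauss. replace ((-1 * y) ^ 2) with (y ^ 2) by ring. ring. }
  rewrite E. unfold plus; simpl. ring.
Qed.

Lemma gauss_int_limit e : 0 < e -> exists R0, 0 < R0 /\ forall x, R0 <= x ->
  sqrt (2 * PI) - e <= RInt gauss (-x) x <= sqrt (2 * PI).
Proof.
  intros He. destruct (gauss_tail_small (e / 4)) as [R0 [HR0 H]]. { lra. }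
  exists R0; split; auto. intros x Hx. rewrite gauss_int_symm.
  assert (E : sqrt (2 * PI) = 2 * sqrt (PI / 2)).
  { replace (2 * PI) with (2 ^ 2 * (PI / 2)) by field. rewrite sqrt_mult_alt by lra.
    rewrite sqrt_pow2; lra. }
  rewrite E. generalize (gauss_half_bounds x ltac:(lra)) (H x Hx). lra.
Qed.

Lemma gauss_scaled_int c x : 0 < c -> RInt (fun t => exp (- (c * t ^ 2 / 2))) (-x) x =
  / sqrt c * RInt gauss (- (sqrt c * x)) (sqrt c * x).
Proof.
  intros Hc. assert (S := sqrt_lt_R0 _ Hc).
  assert (S2 : sqrt c ^ 2 = c) by (apply pow2_sqrt; lra).
  apply is_RInt_unique.
  assert (H : is_RInt gauss (sqrt c * - x + 0) (sqrt c * x + 0) (RInt gauss (- (sqrt c * x)) (sqrt c * x))).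
  { replace (sqrt c * - x + 0) with (- (sqrt c * x)) by ring. replace (sqrt c * x + 0) with (sqrt c * x) by ring.
    apply (@RInt_correct R_CompleteNormedModule), ex_RInt_gauss. }
  apply (@is_RInt_comp_lin R_NormedModule) in H. apply (@is_RInt_scal R_NormedModule _ _ _ (/ sqrt c)) in H.
  apply is_RInt_ext with (2 := H). intros y _. unfold scal; simpl; unfold mult; simpl.
  rewrite <- Rmult_assoc, Rinv_l, Rmult_1_l by lra.
  unfold gauss. do 2 f_equal. rewrite Rplus_0_r, Rpow_mult_distr, S2. reflexivity.
Qed.

(** Uniformity in the shift [b] is needed after completing a square in the plane, where the centre
    of the inner sum depends on the outer variable. *)
Lemma gauss_riemann_lower c B e : 0 < c -> 0 <= B -> 0 < e -> exists s0 R0, 0 < s0 /\ 0 < R0 /\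
  forall s n b, 0 < s <= s0 -> R0 <= INR n * s -> Rabs b <= B ->
  sqrt (2 * PI / c) - e <= s * zsum n (fun m => exp (- (c * (s * IZR m + b) ^ 2 / 2))).
Proof.
  intros Hc HB He. assert (S := sqrt_lt_R0 _ Hc).
  destruct (gauss_int_limit (e / 2 * sqrt c)) as [R1 [HR1 HG]]. { apply Rmult_lt_0_compat; lra. }
  set (R2 := R1 / sqrt c).
  assert (HR2 : 0 < R2) by now apply Rdiv_lt_0_compat.
  set (g := fun t => exp (- (c * t ^ 2 / 2))).
  assert (Ig : forall u v, ex_RInt g u v).
  { intros. apply (@ex_RInt_continuous R_CompleteNormedModule). intros t _.
    apply (@ex_derive_continuous R_AbsRing R_NormedModule). unfold g. auto_derive. auto. }
  assert (I2 : sqrt (2 * PI / c) - e / 2 <= RInt g (- R2) R2).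
  { unfold g. rewrite gauss_scaled_int by auto.
    replace (sqrt c * R2) with R1 by (unfold R2; field; lra).
    generalize (HG R1 (Rle_refl _)). intros [h _].
    rewrite sqrt_div_alt by auto.
    apply Rmult_le_reg_l with (sqrt c); auto.
    rewrite <- Rmult_assoc, Rinv_r, Rmult_1_l by lra.
    replace (sqrt c * (sqrt (2 * PI) / sqrt c - e / 2)) with (sqrt (2 * PI) - e / 2 * sqrt c) by (field; lra).
    lra. }
  set (K := 1 + c).
  assert (Lg : forall u v, Rabs (g u - g v) <= K * Rabs (u - v)).
  { apply lipschitz_of_derive with (fun t => - (c * t) * g t).
    - intros t. unfold g. auto_derive; auto.
      replace (c * (t * (t * 1)) * / 2) with (c * t ^ 2 / 2) by (simpl; field).
      set (E := exp _). field.
    - intros t. unfold g. rewrite Rabs_mult, (Rabs_right (exp _)) by (apply Rle_ge, Rlt_le, exp_pos).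
      rewrite exp_Ropp. rewrite Rabs_Ropp, Rabs_mult, (Rabs_right c) by lra.
      assert (Q := exp_ge_1_plus (c * t ^ 2 / 2)).
      assert (P := exp_pos (c * t ^ 2 / 2)).
      apply Rmult_le_reg_r with (exp (c * t ^ 2 / 2)); auto.
      rewrite Rmult_assoc, Rinv_l by lra.
      assert (A := pow2_ge_0 (Rabs t - 1)). assert (T := pow2_abs t). assert (T0 := Rabs_pos t).
      assert (X : 2 * Rabs t <= 1 + t ^ 2) by nra.
      assert (c * Rabs t <= K * (1 + c * t ^ 2 / 2)).
      { unfold K. assert (0 <= t ^ 2) by apply pow2_ge_0. assert (0 <= c * t ^ 2) by nra. nra. }
      assert (K * (1 + c * t ^ 2 / 2) <= K * exp (c * t ^ 2 / 2)) by (apply Rmult_le_compat_l; unfold K; lra).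
      lra. }
  (* Room for the integration window [R2], for the shift [B] and for one mesh step. *)
  set (W := R2 + B + 1).
  (* Each cell costs at most [K * s] times its width, over a total length of at most [2 * W + 1]. *)
  set (s0 := Rmin 1 (e / 2 / (K * (2 * W + 1)))).
  assert (Kp : 0 < K) by (unfold K; lra). assert (Wp : 0 < W) by (unfold W; lra).
  assert (KW : 0 < K * (2 * W + 1)) by (apply Rmult_lt_0_compat; unfold K, W; lra).
  exists s0, W. split. { apply Rmin_glb_lt; [lra|]. apply Rdiv_lt_0_compat; lra. }
  split. { unfold W; lra. }
  intros s n b [Hs Hs0] Hn Hb.
  assert (s1 : s <= 1) by (eapply Rle_trans; [apply Hs0 | apply Rmin_l]).
  assert (s2 : s * (K * (2 * W + 1)) <= e / 2).
  { assert (h : s <= e / 2 / (K * (2 * W + 1))) by (eapply Rle_trans; [apply Hs0 | apply Rmin_r]).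
    apply Rmult_le_compat_r with (r := K * (2 * W + 1)) in h; [| lra].
    replace (e / 2 / (K * (2 * W + 1)) * (K * (2 * W + 1))) with (e / 2) in h by (field; split; lra). lra. }
  destruct (nfloor_ex (W / s)) as [N [HN1 HN2]]. { apply Rlt_le, Rdiv_lt_0_compat; lra. }
  assert (HN1' : INR N * s <= W).
  { apply Rmult_le_compat_r with (r := s) in HN1; [| lra]. replace (W / s * s) with W in HN1 by (field; lra). lra. }
  assert (HN2' : W - s <= INR N * s).
  { apply Rmult_lt_compat_r with (r := s) in HN2; [| lra]. replace (W / s * s) with W in HN2 by (field; lra). lra. }
  assert (HNn : (N <= n)%nat).
  { apply INR_le. apply Rmult_le_reg_r with s; lra. }
  apply Rle_trans with (s * zsum N (fun m => exp (- (c * (s * IZR m + b) ^ 2 / 2)))).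
  2: { apply Rmult_le_compat_l; [lra|]. apply zsum_mono; auto. intros; left; apply exp_pos. }
  set (lo := - (INR N * s) + b).
  apply Rabs_le_between in Hb.
  assert (RL : RInt g lo (lo + s * INR (Datatypes.S (2 * N))) <=
     s * sum_f_R0 (fun i => g (s * IZR (Z.of_nat i - Z.of_nat N) + b) + K * s) (2 * N)).
  { apply RInt_le_cells; auto.
    intros i Hi x Hx. rewrite S_INR in Hx. unfold lo in Hx.
    set (x0 := s * IZR (Z.of_nat i - Z.of_nat N) + b).
    assert (E : x0 = - (INR N * s) + b + s * INR i).
    { unfold x0. rewrite minus_IZR, <- !INR_IZR_INZ. ring. }
    generalize (Lg x x0). rewrite E. intros h. apply Rabs_le_between in h.
    rewrite (Rabs_right (x - _)) in h by lra.
    assert (K * (x - (- (INR N * s) + b + s * INR i)) <= K * s).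
    { apply Rmult_le_compat_l. { unfold K; lra. } lra. }
    lra. }
  rewrite sum_plus, sum_cte in RL. fold (zsum N (fun m => g (s * IZR m + b))) in RL.
  unfold g in RL at 2. set (Z := zsum N _) in *.
  assert (Bd : RInt g (- R2) R2 <= RInt g lo (lo + s * INR (Datatypes.S (2 * N)))).
  { assert (a1 : lo <= - R2) by (unfold lo, W in *; lra).
    assert (a2 : R2 <= lo + s * INR (Datatypes.S (2 * N))).
    { rewrite S_INR, mult_INR. unfold lo, W in *. change (INR 2) with 2. lra. }
    set (hi := lo + s * INR (Datatypes.S (2 * N))) in *.
    rewrite <- (RInt_Chasles g lo (- R2) hi), <- (RInt_Chasles g (- R2) R2 hi) by apply Ig.
    assert (0 <= RInt g lo (- R2)) by (apply RInt_ge_0; auto; intros; left; apply exp_pos).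
    assert (0 <= RInt g R2 hi) by (apply RInt_ge_0; auto; intros; left; apply exp_pos).
    unfold plus; simpl. lra. }
  assert (Er : s * (K * s * INR (Datatypes.S (2 * N))) <= e / 2).
  { rewrite S_INR, mult_INR. change (INR 2) with 2.
    replace (s * (K * s * (2 * INR N + 1))) with (s * (K * (2 * (INR N * s) + s))) by ring.
    apply Rle_trans with (2 := s2). apply Rmult_le_compat_l; [lra|].
    apply Rmult_le_compat_l; unfold K; lra. }
  lra.
Qed.

(** Completing the square gives [kap t1 ^ 2 + c11 (t2 + be t1) ^ 2] with [kap * c11 = det], so two
    one-dimensional Riemann sums suffice, and [(2 PI / sqrt det) / (2 PI) ^ 2] is the stated
    constant. *)
Lemma gaussian_sums_ge_plane phi cov gam : regular_density 2 phi ->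
  (forall i j, (i < 2)%nat -> (j < 2)%nat -> isE 2 phi (fun x => coord 2 x i * coord 2 x j) (cov i j)) ->
  let det := cov O O * cov 1%nat 1%nat - cov O 1%nat * cov 1%nat O in
  0 < det /\ (gam < / (2 * PI * sqrt det) -> gaussian_sums_ge 2 cov gam).
Proof.
  intros Hphi covE det.
  assert (Sym : cov 1%nat O = cov O 1%nat).
  { apply (isE_unique 2 phi (fun x => coord 2 x 1 * coord 2 x 0)). { apply covE; lia. }
    apply isE_ext with (2 := covE O 1%nat ltac:(lia) ltac:(lia)). intros; ring. }
  destruct (cov_form_ge 2 phi Hphi cov covE) as [c [Hc HQ]].
  set (c00 := cov O O) in *. set (c01 := cov O 1%nat) in *. set (c11 := cov 1%nat 1%nat) in *.
  assert (Q : forall t1 t2, cov_form 2 cov (t1, (t2, tt)) = c00 * t1 ^ 2 + 2 * c01 * t1 * t2 + c11 * t2 ^ 2).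
  { intros. unfold cov_form. simpl. fold c00 c01 c11. rewrite Sym. fold c01. ring. }
  assert (H11 : 0 < c11).
  { generalize (HQ (0, (1, tt))). rewrite Q. unfold normsq; simpl. lra. }
  (* At [(1, - c01 / c11)], the minimum over the second coordinate, the form equals [det / c11]. *)
  assert (Hdet : 0 < det).
  { generalize (HQ (1, (- c01 / c11, tt))). rewrite Q. unfold normsq; simpl.
    replace (c00 * (1 * (1 * 1)) + 2 * c01 * 1 * (- c01 / c11) + c11 * (- c01 / c11 * (- c01 / c11 * 1)))
      with (det / c11) by (unfold det; rewrite Sym; fold c01; field; lra).
    intros h. assert (0 < det / c11).
    { assert (0 <= - c01 / c11 * (- c01 / c11)) by nra. nra. }
    replace det with (det / c11 * c11) by (field; lra). now apply Rmult_lt_0_compat. }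
  split; auto. intros Hg.
  assert (P0 := PI_RGT_0). assert (SD := sqrt_lt_R0 _ Hdet).
  set (kap := det / c11).
  assert (Hk : 0 < kap) by now apply Rdiv_lt_0_compat.
  set (A1 := sqrt (2 * PI / kap)). set (A2 := sqrt (2 * PI / c11)).
  assert (A1p : 0 < A1) by (apply sqrt_lt_R0, Rdiv_lt_0_compat; lra).
  assert (A2p : 0 < A2) by (apply sqrt_lt_R0, Rdiv_lt_0_compat; lra).
  assert (A12 : A1 * A2 = 2 * PI / sqrt det).
  { unfold A1, A2. rewrite <- sqrt_mult_alt by (apply Rlt_le, Rdiv_lt_0_compat; lra).
    replace (2 * PI / kap * (2 * PI / c11)) with ((2 * PI) ^ 2 / det) by (unfold kap; field; lra).
    rewrite sqrt_div_alt by auto. rewrite sqrt_pow2; lra. }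
  assert (Hg' : gam * (4 * PI ^ 2) < A1 * A2).
  { rewrite A12. apply Rmult_lt_compat_r with (r := 4 * PI ^ 2) in Hg; [| nra].
    replace (/ (2 * PI * sqrt det) * (4 * PI ^ 2)) with (2 * PI / sqrt det) in Hg by (field; lra). lra. }
  (* Guarantees [(A1 - e) (A2 - e) >= A1 A2 - e (A1 + A2) >= gam (2 PI) ^ 2] with both factors
     nonnegative. *)
  set (e := Rmin (Rmin A1 A2) ((A1 * A2 - gam * (4 * PI ^ 2)) / (A1 + A2))).
  assert (He : 0 < e).
  { unfold e. repeat apply Rmin_glb_lt; auto. apply Rdiv_lt_0_compat; lra. }
  assert (e1 : e <= A1) by (eapply Rle_trans; [apply Rmin_l | apply Rmin_l]).
  assert (e2 : e <= A2) by (eapply Rle_trans; [apply Rmin_l | apply Rmin_r]).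
  assert (e3 : e * (A1 + A2) <= A1 * A2 - gam * (4 * PI ^ 2)).
  { assert (h : e <= (A1 * A2 - gam * (4 * PI ^ 2)) / (A1 + A2)) by apply Rmin_r.
    apply Rmult_le_compat_r with (r := A1 + A2) in h; [| lra].
    replace ((A1 * A2 - gam * (4 * PI ^ 2)) / (A1 + A2) * (A1 + A2)) with (A1 * A2 - gam * (4 * PI ^ 2)) in h by (field; lra). lra. }
  destruct (gauss_riemann_lower kap 0 e Hk (Rle_refl 0) He) as [s1 [R1 [Hs1 [HR1 HS1]]]].
  set (be := c01 / c11).
  destruct (gauss_riemann_lower c11 (Rabs be * (R1 + 1)) e H11) as [s2 [R2 [Hs2 [HR2 HS2]]]]; auto.
  { apply Rmult_le_pos; [apply Rabs_pos | lra]. }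
  exists (Rmin 1 (Rmin s1 s2)), (Rmax (R1 + 1) R2). split. { repeat apply Rmin_glb_lt; lra. }
  intros s n [Hs Hs0] Hn.
  assert (sl1 : s <= 1) by (eapply Rle_trans; [apply Hs0 | apply Rmin_l]).
  assert (sl2 : s <= s1) by (eapply Rle_trans; [apply Hs0 |]; eapply Rle_trans; [apply Rmin_r | apply Rmin_l]).
  assert (sl3 : s <= s2) by (eapply Rle_trans; [apply Hs0 |]; eapply Rle_trans; [apply Rmin_r | apply Rmin_r]).
  assert (n1 : R1 + 1 <= INR n * s) by (eapply Rle_trans; [apply Rmax_l | apply Hn]).
  assert (n2 : R2 <= INR n * s) by (eapply Rle_trans; [apply Rmax_r | apply Hn]).
  (* The outer sum is truncated to [|s a| <= R1 + 1], which keeps the inner shift [be * s a]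
     bounded; positivity discards the remaining terms. *)
  destruct (nfloor_ex ((R1 + 1) / s)) as [N [HN1 HN2]]. { apply Rlt_le, Rdiv_lt_0_compat; lra. }
  assert (HN1' : INR N * s <= R1 + 1).
  { apply Rmult_le_compat_r with (r := s) in HN1; [| lra]. replace ((R1 + 1) / s * s) with (R1 + 1) in HN1 by (field; lra). lra. }
  assert (HN2' : R1 <= INR N * s).
  { apply Rmult_lt_compat_r with (r := s) in HN2; [| lra]. replace ((R1 + 1) / s * s) with (R1 + 1) in HN2 by (field; lra). lra. }
  assert (HNn : (N <= n)%nat) by (apply INR_le; apply Rmult_le_reg_r with s; lra).
  set (inner := fun a : Z => zsum n (fun m => exp (- (c11 * (s * IZR m + be * (s * IZR a)) ^ 2 / 2)))).
  assert (Split : cube_sum 2 n (fun k => exp (- (cov_form 2 cov (zscale 2 s k) / 2))) =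
    zsum n (fun a => exp (- (kap * (s * IZR a + 0) ^ 2 / 2)) * inner a)).
  { rewrite cube_sum_S. apply zsum_ext. intros a _. rewrite cube_sum_S. unfold inner. rewrite <- zsum_scal.
    apply zsum_ext. intros m _. simpl cube_sum. 
    change (zscale 2 s (a, (m, tt))) with (s * IZR a, (s * IZR m, tt)). rewrite Q, <- exp_plus.
    f_equal. unfold kap, be, det. rewrite Sym. fold c00 c01 c11. field. lra. }
  rewrite Split.
  assert (In0 : forall a, 0 <= inner a) by (intros; apply zsum_ge0; intros; left; apply exp_pos).
  assert (L1 : zsum N (fun a => exp (- (kap * (s * IZR a + 0) ^ 2 / 2)) * ((A2 - e) / s)) <=
     zsum n (fun a => exp (- (kap * (s * IZR a + 0) ^ 2 / 2)) * inner a)).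
  { apply Rle_trans with (zsum N (fun a => exp (- (kap * (s * IZR a + 0) ^ 2 / 2)) * inner a)).
    - apply zsum_le. intros a Ha. apply Rmult_le_compat_l. { left; apply exp_pos. }
      apply Rabs_IZR_le in Ha.
      assert (Hb : Rabs (be * (s * IZR a)) <= Rabs be * (R1 + 1)).
      { rewrite Rabs_mult. apply Rmult_le_compat_l. { apply Rabs_pos. }
        rewrite Rabs_mult, (Rabs_right s) by lra. apply Rle_trans with (s * INR N); [| lra].
        apply Rmult_le_compat_l; lra. }
      generalize (HS2 s n (be * (s * IZR a)) (conj Hs sl3) n2 Hb). fold A2. intros h.
      apply Rmult_le_reg_l with s; auto. replace (s * ((A2 - e) / s)) with (A2 - e) by (field; lra). exact h.
    - apply zsum_mono; auto. intros a. apply Rmult_le_pos; auto. left; apply exp_pos. }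
  assert (L2 := HS1 s N 0 (conj Hs sl2) HN2' ltac:(rewrite Rabs_R0; lra)). fold A1 in L2.
  rewrite (zsum_ext N (fun a => exp (- (kap * (s * IZR a + 0) ^ 2 / 2)) * ((A2 - e) / s))
    (fun a => (A2 - e) / s * exp (- (kap * (s * IZR a + 0) ^ 2 / 2)))) in L1 by (intros; ring).
  rewrite zsum_scal in L1.
  set (Z1 := zsum N _) in *. set (Z2 := zsum n _) in *.
  assert (L3 : (A1 - e) * (A2 - e) <= s ^ 2 * Z2).
  { apply Rle_trans with (s ^ 2 * ((A2 - e) / s * Z1)).
    - replace (s ^ 2 * ((A2 - e) / s * Z1)) with ((s * Z1) * (A2 - e)) by (field; lra).
      apply Rmult_le_compat_r; lra.
    - apply Rmult_le_compat_l; auto. apply pow2_ge_0. }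
  replace ((s / (2 * PI)) ^ 2 * Z2) with (s ^ 2 * Z2 / (4 * PI ^ 2)) by (field; lra).
  assert (P2 : 0 < 4 * PI ^ 2) by nra.
  apply Rmult_le_reg_r with (4 * PI ^ 2); auto.
  replace (s ^ 2 * Z2 / (4 * PI ^ 2) * (4 * PI ^ 2)) with (s ^ 2 * Z2) by (field; lra).
  nra.
Qed.

(** * Trigonometric series *)

(** Convergence at a point slightly beyond [|z|] bounds the terms there, hence the radius from
    below. *)
Lemma CV_radius_ge_1 (a : nat -> R) :
  (forall z, 0 < z < 1 -> exists l, infinite_sum (fun n => a n * z ^ n) l) ->
  forall z, Rabs z < 1 -> Rbar_lt (Rabs z) (CV_radius a).
Proof.
  intros H z Hz. set (y := (Rabs z + 1) / 2).
  assert (Hy : Rabs z < y < 1) by (unfold y; lra).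
  apply Rbar_lt_le_trans with (Finite y). { simpl; lra. }
  apply (CV_radius_bounded a).
  destruct (H y) as [l Hl]. { generalize (Rabs_pos z); lra. }
  apply is_series_Reals in Hl.
  assert (L := ex_series_lim_0 _ (ex_intro _ l Hl)).
  apply is_lim_seq_Reals in L.
  destruct (maj_by_pos (fun n => a n * y ^ n)) as [M [_ HM]].
  - exists 0. exact L.
  - exists M. exact HM.
Qed.

Lemma nat_pow_bound q n : 0 < q < 1 -> INR n * q ^ n <= / (/ q - 1).
Proof.
  intros [H0 H1]. set (x := / q - 1).
  assert (Hx : 0 < x).
  { unfold x. assert (1 < / q); [| lra]. rewrite <- Rinv_1. apply Rinv_lt_contravar; lra. }
  assert (E : q = / (1 + x)) by (unfold x; field; lra).
  assert (B := poly n x Hx). rewrite E, pow_inv.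
  assert (N := pos_INR n). assert (P : 0 < (1 + x) ^ n) by (apply pow_lt; lra).
  apply Rmult_le_reg_r with (x * (1 + x) ^ n). { now apply Rmult_lt_0_compat. }
  replace (INR n * / (1 + x) ^ n * (x * (1 + x) ^ n)) with (INR n * x) by (field; lra).
  replace (/ x * (x * (1 + x) ^ n)) with ((1 + x) ^ n) by (field; lra). lra.
Qed.

(** Compare with an intermediate radius [y]: the factor [n] is absorbed by [(z / y) ^ n]. *)
Lemma abs_conv_moment (a : nat -> R) : (forall z, 0 < z < 1 -> ex_series (fun n => Rabs (a n) * z ^ n)) ->
  forall z, 0 < z < 1 -> ex_series (fun n => Rabs (INR n * a n) * z ^ n).
Proof.
  intros H z Hz. set (y := (z + 1) / 2). assert (Hy : z < y < 1) by (unfold y; lra).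
  assert (Q : 0 < z / y < 1).
  { split. { apply Rdiv_lt_0_compat; lra. } apply Rmult_lt_reg_r with y; [lra|].
    unfold Rdiv. rewrite Rmult_assoc, Rinv_l; lra. }
  set (K := / (/ (z / y) - 1)).
  apply (@ex_series_le R_AbsRing R_CompleteNormedModule) with (fun n => K * (Rabs (a n) * y ^ n)).
  - intros n. change (norm (Rabs (INR n * a n) * z ^ n)) with (Rabs (Rabs (INR n * a n) * z ^ n)).
    rewrite Rabs_right.
    2: { apply Rle_ge, Rmult_le_pos. { apply Rabs_pos. } apply pow_le; lra. }
    rewrite Rabs_mult, (Rabs_right (INR n)) by (apply Rle_ge, pos_INR).
    replace (z ^ n) with ((z / y) ^ n * y ^ n).
    2: { rewrite <- Rpow_mult_distr. f_equal. field. lra. }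
    replace (INR n * Rabs (a n) * ((z / y) ^ n * y ^ n)) with ((INR n * (z / y) ^ n) * (Rabs (a n) * y ^ n)) by ring.
    apply Rmult_le_compat_r. { apply Rmult_le_pos. { apply Rabs_pos. } apply pow_le; lra. }
    now apply nat_pow_bound.
  - apply (@ex_series_scal R_AbsRing R_NormedModule K). apply H; lra.
Qed.

Lemma Series_quadratic_expansion (u v w : nat -> R) (k : nat -> R) : 
  ex_series u -> ex_series v -> ex_series w -> ex_series k ->
  (forall n, Rabs (u n - v n - w n) <= k n) -> Rabs (Series u - Series v - Series w) <= Series k.
Proof.
  intros Hu Hv Hw Hk H.
  assert (E2 : ex_series (fun n => Rabs (u n - v n - w n))).
  { apply (@ex_series_le R_AbsRing R_CompleteNormedModule) with k; auto.
    intros n. change (norm (Rabs (u n - v n - w n))) with (Rabs (Rabs (u n - v n - w n))).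
    now rewrite Rabs_Rabsolu. }
  rewrite <- Series_minus by auto.
  rewrite <- Series_minus; auto. 2: { now apply (@ex_series_minus R_AbsRing R_NormedModule). }
  eapply Rle_trans. { now apply Series_Rabs. }
  apply Series_le; auto. intros n; split; auto. apply Rabs_pos.
Qed.

(** Summable second moments leave a remainder quadratic in [h], so trigonometric series can be
    differentiated termwise without a discussion of uniform convergence. *)
Lemma is_derive_of_quadratic (F : R -> R) x l K :
  (forall h, Rabs (F (x + h) - F x - h * l) <= K * h ^ 2) -> is_derive F x l.
Proof.
  intros H. apply is_derive_Reals. intros e He.
  assert (K0 : 0 < Rabs K + 1) by (generalize (Rabs_pos K); lra).
  exists (mkposreal (e / (Rabs K + 1)) (Rdiv_lt_0_compat _ _ He K0)). simpl. intros h Hh Hd.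
  replace ((F (x + h) - F x) / h - l) with ((F (x + h) - F x - h * l) / h) by (field; auto).
  unfold Rdiv. rewrite Rabs_mult, Rabs_inv by auto.
  assert (Ph : 0 < Rabs h) by now apply Rabs_pos_lt.
  apply Rmult_lt_reg_r with (Rabs h); auto. rewrite Rmult_assoc, Rinv_l, Rmult_1_r by lra.
  apply Rle_lt_trans with ((Rabs K + 1) * Rabs h * Rabs h).
  - eapply Rle_trans; [apply H|]. rewrite <- pow2_abs. generalize (Rle_abs K) (pow2_ge_0 (Rabs h)). simpl. nra.
  - apply Rmult_lt_compat_r; auto.
    apply Rmult_lt_compat_r with (r := Rabs K + 1) in Hd; auto.
    replace (e / (Rabs K + 1) * (Rabs K + 1)) with e in Hd by (field; lra). lra.
Qed.

Lemma sin_minus_id_sq x : Rabs (sin x - x) <= x ^ 2.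
Proof.
  assert (H0 := Rabs_pos x). rewrite <- pow2_abs.
  destruct (Rle_or_lt (Rabs x) 2) as [L | L].
  - eapply Rle_trans; [apply sin_taylor|]. simpl. nra.
  - eapply Rle_trans; [apply Rabs_triang|]. rewrite Rabs_Ropp. generalize (Rabs_sin_le x). simpl. nra.
Qed.

Lemma cos_quadratic u h : Rabs (cos (u + h) - cos u - h * - sin u) <= 2 * h ^ 2.
Proof.
  replace (cos (u + h) - cos u - h * - sin u) with (cos u * (cos h - 1) + - (sin u * (sin h - h))).
  2: { rewrite cos_plus. ring. }
  eapply Rle_trans; [apply Rabs_triang|]. rewrite Rabs_Ropp, !Rabs_mult.
  assert (Rabs (cos u) <= 1) by apply Rabs_le, COS_bound.
  assert (Rabs (sin u) <= 1) by apply Rabs_le, SIN_bound.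
  assert (Rabs (cos h - 1) <= h ^ 2).
  { generalize (cos_ge_quadratic h) (COS_bound h) (pow2_ge_0 h). intros. apply Rabs_le; lra. }
  generalize (sin_minus_id_sq h) (Rabs_pos (cos h - 1)) (Rabs_pos (sin h - h)). nra.
Qed.

Lemma sin_quadratic u h : Rabs (sin (u + h) - sin u - h * cos u) <= 2 * h ^ 2.
Proof.
  generalize (cos_quadratic (u - PI / 2) h).
  replace (u - PI / 2 + h) with (- (PI / 2 - (u + h))) by ring.
  replace (u - PI / 2) with (- (PI / 2 - u)) by ring.
  rewrite !cos_neg, !cos_shift, sin_neg, sin_shift.
  replace (h * - - cos u) with (h * cos u) by ring. auto.
Qed.

(** * Termwise differentiation and Fourier inversion *)

Definition cos_series (c : nat -> R) (t : R) : R := Series (fun n => c n * cos (INR n * t)).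
Definition sin_series (c : nat -> R) (t : R) : R := Series (fun n => c n * sin (INR n * t)).

Lemma ex_series_bounded_mult (c w : nat -> R) : ex_series (fun n => Rabs (c n)) ->
  (forall n, Rabs (w n) <= 1) -> ex_series (fun n => Rabs (c n * w n)).
Proof.
  intros H Hw. apply (@ex_series_le R_AbsRing R_CompleteNormedModule) with (fun n => Rabs (c n)); auto.
  intros n. change (norm (Rabs (c n * w n))) with (Rabs (Rabs (c n * w n))). rewrite Rabs_Rabsolu, Rabs_mult.
  generalize (Rabs_pos (c n)) (Hw n). nra.
Qed.

Lemma ex_series_cos c t : ex_series (fun n => Rabs (c n)) -> ex_series (fun n => Rabs (c n * cos (INR n * t))).
Proof. intros H. apply ex_series_bounded_mult; auto. intros; apply Rabs_le, COS_bound. Qed.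

Lemma ex_series_sin c t : ex_series (fun n => Rabs (c n)) -> ex_series (fun n => Rabs (c n * sin (INR n * t))).
Proof. intros H. apply ex_series_bounded_mult; auto. intros; apply Rabs_le, SIN_bound. Qed.

Section TrigSeries.

Variable c : nat -> R.
Hypothesis sum0 : ex_series (fun n => Rabs (c n)).
Hypothesis sum1 : ex_series (fun n => Rabs (INR n * c n)).
Hypothesis sum2 : ex_series (fun n => Rabs (INR n * (INR n * c n))).

Lemma is_derive_cos_series t : is_derive (cos_series c) t (- sin_series (fun n => INR n * c n) t).
Proof.
  apply is_derive_of_quadratic with (2 * Series (fun n => Rabs (INR n * (INR n * c n)))).
  intros h. unfold cos_series, sin_series.
  replace (h * - Series (fun n => INR n * c n * sin (INR n * t))) with
    (Series (fun n => - h * (INR n * c n * sin (INR n * t)))) by (rewrite Series_scal_l; ring).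
  replace (2 * Series (fun n => Rabs (INR n * (INR n * c n))) * h ^ 2) with
    (Series (fun n => 2 * h ^ 2 * Rabs (INR n * (INR n * c n)))) by (rewrite Series_scal_l; ring).
  apply Series_quadratic_expansion.
  - apply ex_series_Rabs. now apply ex_series_cos.
  - apply ex_series_Rabs. now apply ex_series_cos.
  - apply (@ex_series_scal R_AbsRing R_NormedModule (- h)), ex_series_Rabs.
    now apply (ex_series_sin (fun n => INR n * c n)).
  - now apply (@ex_series_scal R_AbsRing R_NormedModule (2 * h ^ 2)).
  - intros n. rewrite Rmult_plus_distr_l.
    replace (c n * cos (INR n * t + INR n * h) - c n * cos (INR n * t) - - h * (INR n * c n * sin (INR n * t)))
      with (c n * (cos (INR n * t + INR n * h) - cos (INR n * t) - INR n * h * - sin (INR n * t))) by ring.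
    rewrite Rabs_mult. eapply Rle_trans.
    { apply Rmult_le_compat_l. { apply Rabs_pos. } apply cos_quadratic. }
    rewrite !Rabs_mult, (Rabs_right (INR n)) by apply Rle_ge, pos_INR. right; ring.
Qed.

Lemma is_derive_sin_series t : is_derive (sin_series c) t (cos_series (fun n => INR n * c n) t).
Proof.
  apply is_derive_of_quadratic with (2 * Series (fun n => Rabs (INR n * (INR n * c n)))).
  intros h. unfold cos_series, sin_series.
  replace (h * Series (fun n => INR n * c n * cos (INR n * t))) with
    (Series (fun n => h * (INR n * c n * cos (INR n * t)))) by (rewrite Series_scal_l; ring).
  replace (2 * Series (fun n => Rabs (INR n * (INR n * c n))) * h ^ 2) with
    (Series (fun n => 2 * h ^ 2 * Rabs (INR n * (INR n * c n)))) by (rewrite Series_scal_l; ring).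
  apply Series_quadratic_expansion.
  - apply ex_series_Rabs. now apply ex_series_sin.
  - apply ex_series_Rabs. now apply ex_series_sin.
  - apply (@ex_series_scal R_AbsRing R_NormedModule h), ex_series_Rabs.
    now apply (ex_series_cos (fun n => INR n * c n)).
  - now apply (@ex_series_scal R_AbsRing R_NormedModule (2 * h ^ 2)).
  - intros n. rewrite Rmult_plus_distr_l.
    replace (c n * sin (INR n * t + INR n * h) - c n * sin (INR n * t) - h * (INR n * c n * cos (INR n * t)))
      with (c n * (sin (INR n * t + INR n * h) - sin (INR n * t) - INR n * h * cos (INR n * t))) by ring.
    rewrite Rabs_mult. eapply Rle_trans.
    { apply Rmult_le_compat_l. { apply Rabs_pos. } apply sin_quadratic. }
    rewrite !Rabs_mult, (Rabs_right (INR n)) by apply Rle_ge, pos_INR. right; ring.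
Qed.

Lemma RInt_cos_nat (k : Z) : is_RInt (fun t => cos (IZR k * t)) (- PI) PI (if Z.eq_dec k 0 then 2 * PI else 0).
Proof.
  destruct (Z.eq_dec k 0) as [-> | Hk].
  - apply is_RInt_ext with (fun _ => 1). { intros t _. simpl. now rewrite Rmult_0_l, cos_0. }
    replace (2 * PI) with (scal (PI - - PI) 1) by (unfold scal; simpl; unfold mult; simpl; ring).
    apply (@is_RInt_const R_NormedModule).
  - assert (Hk' : IZR k <> 0) by now apply not_0_IZR.
    assert (S0 : sin (IZR k * PI) = 0) by (apply sin_eq_0_1; now exists k).
    replace 0 with (minus (sin (IZR k * PI) / IZR k) (sin (IZR k * - PI) / IZR k)).
    2: { replace (IZR k * - PI) with (- (IZR k * PI)) by ring. rewrite sin_neg, S0.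
         unfold minus, plus, opp; simpl. field; auto. }
    apply (@is_RInt_derive R_CompleteNormedModule (fun t => sin (IZR k * t) / IZR k)).
    + intros t _. auto_derive; auto. field; auto.
    + intros t _. apply (@ex_derive_continuous R_AbsRing R_NormedModule). auto_derive; auto.
Qed.

(** The integrand is the series of [c n * cos ((n - m) t)]. Its partial sums integrate exactly by
    orthogonality, and the tail is uniformly bounded by the tail of the absolute series. *)
Lemma fourier_inversion m :
  is_RInt (fun t => cos_series c t * cos (INR m * t) + sin_series c t * sin (INR m * t)) (- PI) PI (2 * PI * c m).
Proof.
  set (f := fun t => cos_series c t * cos (INR m * t) + sin_series c t * sin (INR m * t)).
  assert (P0 := PI_RGT_0).
  assert (Cf : forall t, continuous f t).
  { intros t. apply (@ex_derive_continuous R_AbsRing R_NormedModule). unfold f.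
    assert (E1 := is_derive_cos_series t). assert (E2 := is_derive_sin_series t).
    auto_derive. repeat split; eexists; eassumption. }
  assert (Ef : ex_RInt f (- PI) PI).
  { apply (@ex_RInt_continuous R_CompleteNormedModule). intros; apply Cf. }
  assert (term : forall n t, c n * cos (INR n * t) * cos (INR m * t) + c n * sin (INR n * t) * sin (INR m * t)
     = c n * cos (IZR (Z.of_nat n - Z.of_nat m) * t)).
  { intros n t. rewrite minus_IZR, <- !INR_IZR_INZ, Rmult_minus_distr_r, cos_minus. ring. }
  assert (fS : forall t, f t = Series (fun n => c n * cos (IZR (Z.of_nat n - Z.of_nat m) * t))).
  { intros t. unfold f, cos_series, sin_series. rewrite <- !Series_scal_r, <- Series_plus.
    - apply Series_ext. intros n. apply term.
    - apply ex_series_scal_r, ex_series_Rabs. now apply ex_series_cos.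
    - apply ex_series_scal_r, ex_series_Rabs. now apply ex_series_sin. }
  assert (part : forall M, is_RInt (fun t => sum_f_R0 (fun n => c n * cos (IZR (Z.of_nat n - Z.of_nat m) * t)) M)
    (- PI) PI (sum_f_R0 (fun n => c n * (if Z.eq_dec (Z.of_nat n - Z.of_nat m) 0 then 2 * PI else 0)) M)).
  { induction M as [|M IH]; simpl.
    - apply (@is_RInt_scal R_NormedModule). apply RInt_cos_nat.
    - apply (@is_RInt_plus R_NormedModule); auto. apply (@is_RInt_scal R_NormedModule). apply RInt_cos_nat. }
  assert (val : forall M, (m <= M)%nat ->
    sum_f_R0 (fun n => c n * (if Z.eq_dec (Z.of_nat n - Z.of_nat m) 0 then 2 * PI else 0)) M = 2 * PI * c m).
  { assert (Z0 : forall M, (M < m)%nat ->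
      sum_f_R0 (fun n => c n * (if Z.eq_dec (Z.of_nat n - Z.of_nat m) 0 then 2 * PI else 0)) M = 0).
    { induction M as [|M IH]; intros HM.
      - simpl sum_f_R0. destruct (Z.eq_dec _ _); [lia | ring].
      - rewrite tech5, IH by lia. destruct (Z.eq_dec _ _); [lia | ring]. }
    intros M HM. induction HM as [|M HM IH].
    - destruct m as [|m'].
      + simpl. ring.
      + rewrite tech5, Z0 by lia. destruct (Z.eq_dec _ _); [ring | lia].
    - rewrite tech5, IH. destruct (Z.eq_dec _ _); [lia | ring]. }
  assert (RInt f (- PI) PI = 2 * PI * c m); [| rewrite <- H; now apply (@RInt_correct R_CompleteNormedModule)].
  apply Rminus_diag_uniq.
  (* The integral of every partial sum with [M >= m] already has the final value, so the discrepancy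
     is at most the tail after [M] times the length of the interval. *)
  assert (B : forall M, (m <= M)%nat -> Rabs (RInt f (- PI) PI - 2 * PI * c m)
     <= (PI - - PI) * (Series (fun n => Rabs (c n)) - sum_f_R0 (fun n => Rabs (c n)) M)).
  { intros M HM. 
    set (fM := fun t => sum_f_R0 (fun n => c n * cos (IZR (Z.of_nat n - Z.of_nat m) * t)) M).
    assert (I := part M). rewrite val in I by auto. fold fM in I.
    assert (I2 : is_RInt (fun t => minus (f t) (fM t)) (- PI) PI (minus (RInt f (- PI) PI) (2 * PI * c m))).
    { apply (@is_RInt_minus R_NormedModule); auto. now apply (@RInt_correct R_CompleteNormedModule). }
    change (RInt f (- PI) PI - 2 * PI * c m) with (minus (RInt f (- PI) PI) (2 * PI * c m)).
    rewrite <- (is_RInt_unique _ _ _ _ I2).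
    apply abs_RInt_le_const; [lra | now eexists; apply I2 |].
    intros t _. change (minus (f t) (fM t)) with (f t - fM t). rewrite fS. unfold fM.
    assert (Ex : ex_series (fun n => Rabs (c n * cos (IZR (Z.of_nat n - Z.of_nat m) * t)))).
    { apply ex_series_bounded_mult; auto. intros; apply Rabs_le, COS_bound. }
    rewrite (Series_incr_n (fun n => c n * cos (IZR (Z.of_nat n - Z.of_nat m) * t)) (S M)), (Series_incr_n (fun n => Rabs (c n)) (S M)); auto; try lia.
    2: { now apply ex_series_Rabs. }
    simpl pred.
    match goal with |- Rabs (?a + ?b - ?a) <= ?x + ?y - ?x => replace (a + b - a) with b by ring; replace (x + y - x) with y by ring end.
    assert (Ex' : ex_series (fun k => Rabs (c (S M + k)%nat * cos (IZR (Z.of_nat (S M + k) - Z.of_nat m) * t)))).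
    { apply (ex_series_incr_n (fun n => Rabs (c n * cos (IZR (Z.of_nat n - Z.of_nat m) * t))) (S M)). exact Ex. }
    eapply Rle_trans. { apply Series_Rabs. exact Ex'. }
    apply Series_le.
    - intros k; split. { apply Rabs_pos. } rewrite Rabs_mult.
      assert (Rabs (cos (IZR (Z.of_nat (S M + k) - Z.of_nat m) * t)) <= 1) by apply Rabs_le, COS_bound.
      generalize (Rabs_pos (c (S M + k)%nat)). nra.
    - apply (ex_series_incr_n (fun n => Rabs (c n)) (S M)). exact sum0. }
  destruct (Req_dec (RInt f (- PI) PI - 2 * PI * c m) 0) as [E | E]; auto. exfalso.
  assert (L := Series_correct _ sum0). apply is_series_Reals in L.
  assert (PE : 0 < Rabs (RInt f (- PI) PI - 2 * PI * c m)) by now apply Rabs_pos_lt.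
  destruct (L (Rabs (RInt f (- PI) PI - 2 * PI * c m) / (2 * PI))) as [M0 HM0].
  { apply Rdiv_lt_0_compat; lra. }
  specialize (HM0 (Nat.max M0 m) ltac:(lia)). specialize (B (Nat.max M0 m) ltac:(lia)).
  unfold Rdist in HM0. rewrite Rabs_minus_sym in HM0.
  set (D := Rabs (RInt f (- PI) PI - 2 * PI * c m)) in *.
  apply (Rle_lt_trans _ _ _ (Rle_abs _)) in HM0.
  apply Rmult_lt_compat_l with (r := 2 * PI) in HM0; [| lra].
  replace (2 * PI * (D / (2 * PI))) with D in HM0 by (field; lra). lra.
Qed.

End TrigSeries.

(** * The power series exp G *)

Lemma ex_series_disk (a : nat -> R) :
  (forall z, Rabs z < 1 -> Rbar_lt (Rabs z) (CV_radius a)) ->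
  forall z, 0 < z < 1 -> ex_series (fun n => Rabs (a n) * z ^ n).
Proof.
  intros H z Hz. apply ex_series_ext with (fun n => Rabs (a n * z ^ n)).
  - intros n. rewrite Rabs_mult, (Rabs_right (z ^ n)); auto. apply Rle_ge, pow_le; lra.
  - apply CV_disk_inside, H. rewrite Rabs_right; lra.
Qed.

Lemma ex_series_weighted (a : nat -> R) r : 0 < r < 1 ->
  (forall z, 0 < z < 1 -> ex_series (fun n => Rabs (a n) * z ^ n)) ->
  ex_series (fun n => Rabs (a n * r ^ n)) /\
  ex_series (fun n => Rabs (INR n * (a n * r ^ n))) /\
  ex_series (fun n => Rabs (INR n * (INR n * (a n * r ^ n)))) /\
  ex_series (fun n => Rabs (INR n * (INR n * (INR n * (a n * r ^ n))))).
Proof.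
  intros Hr H. assert (M1 := abs_conv_moment a H). assert (M2 := abs_conv_moment _ M1).
  assert (M3 := abs_conv_moment _ M2).
  assert (P : forall n, 0 <= r ^ n) by (intros; apply pow_le; lra).
  repeat split.
  - apply ex_series_ext with (2 := H r Hr). intros n. rewrite Rabs_mult, (Rabs_right (r ^ n)); auto.
    now apply Rle_ge.
  - apply ex_series_ext with (2 := M1 r Hr). intros n.
    rewrite <- Rmult_assoc, (Rabs_mult _ (r ^ n)), (Rabs_right (r ^ n)); auto. now apply Rle_ge.
  - apply ex_series_ext with (2 := M2 r Hr). intros n.
    rewrite <- !Rmult_assoc, (Rabs_mult _ (r ^ n)), (Rabs_right (r ^ n)); auto. now apply Rle_ge.
  - apply ex_series_ext with (2 := M3 r Hr). intros n.
    rewrite <- !Rmult_assoc, (Rabs_mult _ (r ^ n)), (Rabs_right (r ^ n)); auto. now apply Rle_ge.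
Qed.

Section Exponential.

Variables (W : nat -> R) (G0 G1 G2 : R -> R) (H : nat -> R) (r : R).
Hypothesis r01 : 0 < r < 1.
Hypothesis G0_series : forall z, -1 < z < 1 ->
  infinite_sum (fun n => W (S n) * z ^ (S n) / INR (S n)) (G0 z).
Hypothesis G1_derive : forall z, -1 < z < 1 -> derivable_pt_lim G0 z (G1 z).
Hypothesis G2_derive : forall z, -1 < z < 1 -> derivable_pt_lim G1 z (G2 z).
Hypothesis H_series : forall z, -1 < z < 1 -> infinite_sum (fun n => H n * z ^ n) (exp (G0 z)).

(** The coefficients of [G_L], the logarithm of the generating function of [H], indexed from 0 with
    value 0 there. *)
Definition log_coef (n : nat) : R := match n with O => 0 | S m => W (S m) / INR (S m) end.

Lemma log_coef_series z : -1 < z < 1 -> is_series (fun n => log_coef n * z ^ n) (G0 z).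
Proof.
  intros Hz. apply is_series_decr_1. simpl (log_coef 0). rewrite Rmult_0_l.
  apply is_series_ext with (fun n => W (S n) * z ^ (S n) / INR (S n)).
  - intros n. change (W (S n) * z ^ S n / INR (S n) = W (S n) / INR (S n) * z ^ S n). unfold Rdiv. ring.
  - assert (E := G0_series z Hz). apply is_series_Reals in E.
    change (is_series (fun n => W (S n) * z ^ S n / INR (S n)) (G0 z + - 0)).
    now rewrite Ropp_0, Rplus_0_r.
Qed.

Lemma cv_log_coef z : Rabs z < 1 -> Rbar_lt (Rabs z) (CV_radius log_coef).
Proof.
  apply CV_radius_ge_1. intros y Hy. exists (G0 y). apply is_series_Reals, log_coef_series. lra.
Qed.

Lemma cv_H z : Rabs z < 1 -> Rbar_lt (Rabs z) (CV_radius H).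
Proof.
  apply CV_radius_ge_1. intros y Hy. exists (exp (G0 y)). apply H_series. lra.
Qed.

Lemma PSeries_log_coef z : -1 < z < 1 -> PSeries log_coef z = G0 z.
Proof. intros Hz. apply is_series_unique. now apply log_coef_series. Qed.

Lemma PSeries_H z : -1 < z < 1 -> PSeries H z = exp (G0 z).
Proof. intros Hz. apply is_series_unique. now apply is_series_Reals, H_series. Qed.

Lemma locally_unit_interval (P : R -> Prop) z : -1 < z < 1 -> (forall y, -1 < y < 1 -> P y) -> locally z P.
Proof.
  intros Hz HP. assert (D : 0 < Rmin (z + 1) (1 - z)) by (apply Rmin_glb_lt; lra).
  exists (mkposreal _ D). intros y Hy. apply HP.
  assert (A : Rabs (y - z) < Rmin (z + 1) (1 - z)) by exact Hy.
  generalize (Rmin_l (z + 1) (1 - z)) (Rmin_r (z + 1) (1 - z)). apply Rabs_def2 in A. lra.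
Qed.

Lemma G1_PSeries z : -1 < z < 1 -> G1 z = PSeries (PS_derive log_coef) z.
Proof.
  intros Hz. transitivity (Derive G0 z).
  { symmetry. apply is_derive_unique, is_derive_Reals. auto. }
  apply is_derive_unique. apply is_derive_ext_loc with (PSeries log_coef).
  - apply locally_unit_interval; auto. apply PSeries_log_coef.
  - apply is_derive_PSeries, cv_log_coef. apply Rabs_def1; lra.
Qed.

Lemma G2_PSeries z : -1 < z < 1 -> G2 z = PSeries (PS_derive (PS_derive log_coef)) z.
Proof.
  intros Hz. transitivity (Derive G1 z).
  { symmetry. apply is_derive_unique, is_derive_Reals. auto. }
  apply is_derive_unique. apply is_derive_ext_loc with (PSeries (PS_derive log_coef)).
  - apply locally_unit_interval; auto. intros; symmetry; now apply G1_PSeries.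
  - apply is_derive_PSeries. rewrite CV_radius_derive. apply cv_log_coef. apply Rabs_def1; lra.
Qed.

Definition lam (n : nat) : R := log_coef n * r ^ n.
Definition prob (n : nat) : R := H n * r ^ n / exp (G0 r).

Lemma lam_summable : ex_series (fun n => Rabs (lam n)) /\
  ex_series (fun n => Rabs (INR n * lam n)) /\
  ex_series (fun n => Rabs (INR n * (INR n * lam n))) /\
  ex_series (fun n => Rabs (INR n * (INR n * (INR n * lam n)))).
Proof. apply (ex_series_weighted log_coef r r01). apply ex_series_disk, cv_log_coef. Qed.

Lemma prob_summable : ex_series (fun n => Rabs (prob n)) /\
  ex_series (fun n => Rabs (INR n * prob n)) /\
  ex_series (fun n => Rabs (INR n * (INR n * prob n))).
Proof.
  destruct (ex_series_weighted (fun n => H n * / exp (G0 r)) r r01) as [A [B [C _]]].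
  - intros z Hz. apply ex_series_ext with (fun n => / exp (G0 r) * (Rabs (H n) * z ^ n)).
    { intros n. rewrite Rabs_mult, (Rabs_right (/ exp (G0 r))).
      { match goal with |- @eq _ ?a ?b => change (@eq R a b) end. ring. }
      apply Rle_ge, Rlt_le, Rinv_0_lt_compat, exp_pos. }
    apply (@ex_series_scal R_AbsRing R_NormedModule). now apply (ex_series_disk H cv_H).
  - assert (E : forall n, prob n = H n * / exp (G0 r) * r ^ n) by (intros; unfold prob, Rdiv; ring).
    repeat split.
    + apply ex_series_ext with (2 := A). intros n. now rewrite E.
    + apply ex_series_ext with (2 := B). intros n. now rewrite E.
    + apply ex_series_ext with (2 := C). intros n. now rewrite E.
Qed.

Lemma prob_total : Series prob = 1.
Proof.
  unfold prob. unfold Rdiv. rewrite Series_scal_r. change (Series (fun n => H n * r ^ n)) with (PSeries H r).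
  rewrite PSeries_H by lra. apply Rinv_r. generalize (exp_pos (G0 r)); lra.
Qed.

Lemma mean_series : r * G1 r = Series (fun n => INR n * lam n).
Proof.
  destruct lam_summable as [_ [S1 _]].
  rewrite Series_incr_1 by now apply ex_series_Rabs.
  simpl (INR 0). rewrite Rmult_0_l, Rplus_0_l, G1_PSeries by lra.
  unfold PSeries, PS_derive. rewrite <- Series_scal_l. apply Series_ext. intros n. unfold lam. simpl pow. ring.
Qed.

Lemma variance_series : r * G1 r + r ^ 2 * G2 r = Series (fun n => INR n * (INR n * lam n)).
Proof.
  destruct lam_summable as [_ [S1 [S2 _]]].
  rewrite mean_series.
  assert (E : r ^ 2 * G2 r = Series (fun n => INR n * (INR n * lam n) - INR n * lam n)).
  { assert (EX : ex_series (fun n => INR n * (INR n * lam n) - INR n * lam n)).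
    { apply (@ex_series_minus R_AbsRing R_NormedModule); now apply ex_series_Rabs. }
    rewrite Series_incr_1, Series_incr_1; auto.
    2: { now apply (ex_series_incr_1 (fun n => INR n * (INR n * lam n) - INR n * lam n)). }
    simpl (INR 0). simpl (INR 1).
    replace (0 * (0 * lam 0) - 0 * lam 0 + (1 * (1 * lam 1) - 1 * lam 1 +
     Series (fun k => INR (S (S k)) * (INR (S (S k)) * lam (S (S k))) - INR (S (S k)) * lam (S (S k))))) with
     (Series (fun k => INR (S (S k)) * (INR (S (S k)) * lam (S (S k))) - INR (S (S k)) * lam (S (S k)))) by ring.
    rewrite G2_PSeries by lra. unfold PSeries, PS_derive. rewrite <- Series_scal_l. apply Series_ext.
    intros n. unfold lam. rewrite (S_INR (S n)). simpl pow. ring. }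
  rewrite E, Series_minus by now apply ex_series_Rabs. ring.
Qed.

(* z F'(z) = z G'(z) F(z) for F = exp G, coefficientwise *)
Lemma exp_recurrence n :
  INR n * prob n = sum_f_R0 (fun k => (INR k * lam k) * prob (n - k)%nat) n.
Proof.
  assert (R : forall m, INR (S m) * H (S m) = sum_f_R0 (fun k => INR (S k) * log_coef (S k) * H (m - k)%nat) m).
  { intros m. change (PS_derive H m = PS_mult (PS_derive log_coef) H m).
    assert (Z1 : Rabs 0 < 1) by (rewrite Rabs_R0; lra).
    assert (C1 := cv_log_coef 0 Z1). assert (C2 := cv_H 0 Z1). rewrite Rabs_R0 in C1, C2.
    assert (D1 : forall y, -1 < y < 1 -> Rbar_lt (Rabs y) (CV_radius (PS_derive log_coef))).
    { intros y Hy. rewrite CV_radius_derive. apply cv_log_coef. apply Rabs_def1; lra. }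
    assert (D2 : forall y, -1 < y < 1 -> Rbar_lt (Rabs y) (CV_radius H)).
    { intros y Hy. apply cv_H. apply Rabs_def1; lra. }
    (* The coefficients are identified through equality near 0 of two power series, both equal to
       the derivative of [exp G0]. *)
    apply PSeries_ext_recip.
    - now rewrite CV_radius_derive.
    - apply Rbar_lt_le_trans with (Finite (/ 2)). { simpl; lra. }
      apply (CV_radius_bounded (PS_mult (PS_derive log_coef) H)).
      assert (S : is_pseries (PS_mult (PS_derive log_coef) H) (/ 2) (PSeries (PS_derive log_coef) (/ 2) * PSeries H (/ 2))).
      { apply is_pseries_mult.
        - apply PSeries_correct, CV_radius_inside. apply D1. lra.
        - apply PSeries_correct, CV_radius_inside. apply D2. lra.
        - apply D1. lra.
        - apply D2. lra. }
      assert (L := ex_series_lim_0 _ (ex_intro _ _ S)). apply is_lim_seq_Reals in L.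
      destruct (maj_by_pos (fun n => scal (pow_n (/ 2) n) (PS_mult (PS_derive log_coef) H n))) as [M [_ HM]].
      { exists 0. exact L. }
      exists M. intros k. generalize (HM k). rewrite pow_n_pow. unfold scal; simpl. unfold mult; simpl.
      now rewrite Rmult_comm.
    - apply locally_unit_interval; [lra|]. intros y Hy.
      rewrite PSeries_mult; [| now apply D1 | now apply D2].
      rewrite <- G1_PSeries, PSeries_H by auto.
      transitivity (Derive (fun z => exp (G0 z)) y).
      + symmetry. apply is_derive_unique. apply is_derive_ext_loc with (PSeries H).
        { apply locally_unit_interval; auto. apply PSeries_H. }
        apply is_derive_PSeries. now apply D2.
      + apply is_derive_unique. apply (is_derive_comp exp G0 y (exp (G0 y)) (G1 y)).
        * apply is_derive_exp.
        * apply is_derive_Reals. auto. }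
  destruct n as [|m].
  - simpl. ring.
  - rewrite (decomp_sum _ (S m)) by lia. simpl (INR 0). rewrite !Rmult_0_l, Rplus_0_l.
    simpl pred. unfold prob.
    replace (INR (S m) * (H (S m) * r ^ S m / exp (G0 r))) with ((r ^ S m / exp (G0 r)) * (INR (S m) * H (S m)))
      by (unfold Rdiv; ring).
    rewrite R, scal_sum. apply sum_eq. intros k Hk.
    change (S m - S k)%nat with (m - k)%nat. unfold lam.
    replace (r ^ S m) with (r ^ S k * r ^ (m - k)).
    2: { rewrite <- pow_add. f_equal. lia. }
    unfold Rdiv. ring.
Qed.

(** Minus the logarithm of the modulus of the characteristic function of [prob]. *)
Definition dispersion (t : R) : R := Series lam - cos_series lam t.

Let D (n : nat) : R := INR n * lam n.

(** Real and imaginary parts of one Cauchy product: by [exp_recurrence] the sequence [n * prob n] is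
    the convolution of [D] and [prob]. *)
Lemma cauchy_cos_sin t :
  cos_series (fun n => INR n * prob n) t = cos_series D t * cos_series prob t - sin_series D t * sin_series prob t /\
  sin_series (fun n => INR n * prob n) t = cos_series D t * sin_series prob t + sin_series D t * cos_series prob t.
Proof.
  destruct lam_summable as [_ [SD _]]. destruct prob_summable as [Sp _].
  assert (Cd : ex_series (fun n => Rabs (D n * cos (INR n * t)))) by now apply ex_series_cos.
  assert (Sd : ex_series (fun n => Rabs (D n * sin (INR n * t)))) by now apply ex_series_sin.
  assert (Cp : ex_series (fun n => Rabs (prob n * cos (INR n * t)))) by now apply ex_series_cos.
  assert (Sp' : ex_series (fun n => Rabs (prob n * sin (INR n * t)))) by now apply ex_series_sin.
  assert (M := fun u v hu hv => is_series_mult u v _ _ (Series_correct u (ex_series_Rabs u hu)) (Series_correct v (ex_series_Rabs v hv)) hu hv).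
  assert (CC := M _ _ Cd Cp). assert (SS := M _ _ Sd Sp'). assert (CS := M _ _ Cd Sp'). assert (SC := M _ _ Sd Cp).
  split.
  - assert (E := @is_series_minus R_AbsRing R_NormedModule _ _ _ _ CC SS).
    apply is_series_unique. apply is_series_ext with (2 := E). intros n.
    rewrite exp_recurrence. fold D. unfold plus, opp; simpl.
    rewrite Rmult_comm, scal_sum.
    match goal with |- ?a + - ?b = _ => change (a + - b) with (a - b) end.
    rewrite <- minus_sum. apply sum_eq. intros k Hk.
    replace (INR n * t) with (INR k * t + INR (n - k) * t).
    2: { rewrite minus_INR by auto. ring. }
    rewrite cos_plus. unfold D. ring.
  - assert (E := @is_series_plus R_AbsRing R_NormedModule _ _ _ _ CS SC).
    apply is_series_unique. apply is_series_ext with (2 := E). intros n.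
    rewrite exp_recurrence. fold D. unfold plus; simpl.
    rewrite Rmult_comm, scal_sum, <- sum_plus. apply sum_eq. intros k Hk.
    replace (INR n * t) with (INR k * t + INR (n - k) * t).
    2: { rewrite minus_INR by auto. ring. }
    rewrite sin_plus. unfold D. ring.
Qed.

Lemma const_of_zero_derive (f : R -> R) : (forall t, is_derive f t 0) -> forall t, f t = f 0.
Proof.
  intros Hf t. destruct (MVT_gen f 0 t (fun _ => 0)) as [c [_ E]].
  - intros; apply Hf.
  - intros x _. apply continuity_pt_filterlim, (@ex_derive_continuous R_AbsRing R_NormedModule).
    eexists; apply Hf.
  - lra.
Qed.

Lemma Series_zero : Series (fun _ => 0) = 0.
Proof.
  rewrite (Series_ext _ (fun _ => 0 * 0)) by (intros; ring). rewrite Series_scal_l. ring.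
Qed.

(* Both sides solve the same linear ODE in t. *)
Lemma characteristic_function t :
  cos_series prob t = exp (- dispersion t) * cos (sin_series lam t) /\
  sin_series prob t = exp (- dispersion t) * sin (sin_series lam t).
Proof.
  destruct lam_summable as [L0 [L1 [L2 L3]]]. destruct prob_summable as [Q0 [Q1 Q2]].
  set (X := cos_series prob). set (Y := sin_series prob). set (A := cos_series D). set (B := sin_series D).
  assert (dX : forall s, is_derive X s (- (A s * Y s + B s * X s))).
  { intros s. destruct (cauchy_cos_sin s) as [_ E]. fold A B X Y in E. rewrite <- E. now apply is_derive_cos_series. }
  assert (dY : forall s, is_derive Y s (A s * X s - B s * Y s)).
  { intros s. destruct (cauchy_cos_sin s) as [E _]. fold A B X Y in E. rewrite <- E. now apply is_derive_sin_series. }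
  assert (dS : forall s, is_derive (sin_series lam) s (A s)) by (intros; now apply is_derive_sin_series).
  assert (dC : forall s, is_derive (cos_series lam) s (- B s)) by (intros; now apply is_derive_cos_series).
  assert (dQ : forall s, is_derive dispersion s (B s)).
  { intros s. assert (E1 := dC s). unfold dispersion. auto_derive. { eexists; eassumption. }
    rewrite (is_derive_unique (fun x : R => cos_series lam x) s _ E1). ring. }
  assert (at0 : X 0 = 1 /\ Y 0 = 0 /\ sin_series lam 0 = 0 /\ dispersion 0 = 0).
  { assert (S0 : forall c, sin_series c 0 = 0).
    { intros c. unfold sin_series. rewrite (Series_ext _ (fun _ => 0)).
      - apply Series_zero.
      - intros n. rewrite Rmult_0_r, sin_0. ring. }
    assert (C0 : forall c, cos_series c 0 = Series c).
    { intros c. unfold cos_series. apply Series_ext. intros n. rewrite Rmult_0_r, cos_0. ring. }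
    repeat split.
    - unfold X. rewrite C0. apply prob_total.
    - apply S0.
    - apply S0.
    - unfold dispersion. rewrite C0. ring. }
  destruct at0 as [X0 [Y0 [S0 D0]]].
  set (S := sin_series lam) in *.
  (* Undoing the damping by [dispersion] and the rotation by the phase [S] leaves a constant complex
     number; [U] and [V] are its real and imaginary parts. *)
  assert (U : forall s, exp (dispersion s) * (X s * cos (S s) + Y s * sin (S s)) = 1).
  { intros s. set (f := fun s => exp (dispersion s) * (X s * cos (S s) + Y s * sin (S s))).
    change (f s = 1). rewrite (const_of_zero_derive f).
    - unfold f. rewrite X0, Y0, S0, D0, cos_0, sin_0, exp_0. ring.
    - intros y. unfold f. assert (E1 := dX y). assert (E2 := dY y). assert (E3 := dS y). assert (E4 := dQ y).
      auto_derive. { repeat split; eexists; eassumption. }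
      rewrite (is_derive_unique (fun x : R => X x) y _ E1), (is_derive_unique (fun x : R => Y x) y _ E2),
        (is_derive_unique (fun x : R => S x) y _ E3), (is_derive_unique (fun x : R => dispersion x) y _ E4). ring. }
  assert (V : forall s, exp (dispersion s) * (Y s * cos (S s) - X s * sin (S s)) = 0).
  { intros s. set (f := fun s => exp (dispersion s) * (Y s * cos (S s) - X s * sin (S s))).
    change (f s = 0). rewrite (const_of_zero_derive f).
    - unfold f. rewrite X0, Y0, S0, D0, cos_0, sin_0, exp_0. ring.
    - intros y. unfold f. assert (E1 := dX y). assert (E2 := dY y). assert (E3 := dS y). assert (E4 := dQ y).
      auto_derive. { repeat split; eexists; eassumption. }
      rewrite (is_derive_unique (fun x : R => X x) y _ E1), (is_derive_unique (fun x : R => Y x) y _ E2),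
        (is_derive_unique (fun x : R => S x) y _ E3), (is_derive_unique (fun x : R => dispersion x) y _ E4). ring. }
  specialize (U t). specialize (V t).
  assert (EE : exp (- dispersion t) * exp (dispersion t) = 1).
  { rewrite <- exp_plus, Rplus_opp_l. apply exp_0. }
  assert (P := exp_pos (dispersion t)).
  set (u := X t * cos (S t) + Y t * sin (S t)) in *. set (v := Y t * cos (S t) - X t * sin (S t)) in *.
  assert (v0 : v = 0) by (apply Rmult_integral in V; destruct V; auto; lra).
  assert (u0 : u = exp (- dispersion t)).
  { apply Rmult_eq_reg_l with (exp (dispersion t)); lra. }
  assert (T := sin2_cos2 (S t)). unfold Rsqr in T.
  split.
  - rewrite <- u0. transitivity (u * cos (S t) - v * sin (S t)); [| rewrite v0; ring].
    unfold u, v. replace (X t) with (X t * (sin (S t) * sin (S t) + cos (S t) * cos (S t))) at 1 by (rewrite T; ring). ring.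
  - rewrite <- u0. transitivity (u * sin (S t) + v * cos (S t)); [| rewrite v0; ring].
    unfold u, v. replace (Y t) with (Y t * (sin (S t) * sin (S t) + cos (S t) * cos (S t))) at 1 by (rewrite T; ring). ring.
Qed.

Lemma prob_integral m :
  is_RInt (fun t => exp (- dispersion t) * cos (sin_series lam t - INR m * t)) (- PI) PI (2 * PI * prob m).
Proof.
  destruct prob_summable as [Q0 [Q1 Q2]].
  apply is_RInt_ext with (2 := fourier_inversion prob Q0 Q1 Q2 m).
  intros t _. destruct (characteristic_function t) as [-> ->]. rewrite cos_minus.
  match goal with |- @eq _ ?a ?b => change (@eq R a b) end. ring.
Qed.

End Exponential.

(** * A quantitative local limit theorem *)

(** The fourth power is the one that turns a bound of order [sqrt (l |t|)] into [l ^ 2 t ^ 2], which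
    matches the variance. *)
Lemma exp_ge_quartic y : 0 <= y -> y ^ 4 / 256 <= exp y.
Proof.
  intros Hy. replace (exp y) with (exp (y / 4) ^ 4).
  2: { rewrite <- exp_pow. f_equal. simpl. field. }
  replace (y ^ 4 / 256) with ((y / 4) ^ 4) by field.
  apply pow_incr. generalize (exp_ge_1_plus (y / 4)). lra.
Qed.

Lemma exp_neg_lipschitz x y : 0 <= x -> 0 <= y -> Rabs (exp (- x) - exp (- y)) <= Rabs (x - y).
Proof.
  assert (P : forall x y, 0 <= x <= y -> Rabs (exp (- x) - exp (- y)) <= y - x).
  { intros u v Huv. assert (exp (- v) <= exp (- u)) by (apply exp_le; lra).
    rewrite Rabs_right by lra.
    assert (exp (- u) <= 1) by (rewrite <- exp_0; apply exp_le; lra).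
    replace (exp (- v)) with (exp (- u) * exp (- (v - u))) by (rewrite <- exp_plus; f_equal; ring).
    generalize (exp_ge_1_plus (- (v - u))) (exp_pos (- u)). nra. }
  intros Hx Hy. destruct (Rle_or_lt x y).
  - rewrite (Rabs_left1 (x - y)) by lra. generalize (P x y). lra.
  - rewrite Rabs_minus_sym, (Rabs_right (x - y)) by lra. apply P. lra.
Qed.

Section LocalLimitTheorem.

Variable lam : nat -> R.
Hypothesis lam_ge0 : forall n, 0 <= lam n.
Hypothesis sum0 : ex_series (fun n => Rabs (lam n)).
Hypothesis sum1 : ex_series (fun n => Rabs (INR n * lam n)).
Hypothesis sum2 : ex_series (fun n => Rabs (INR n * (INR n * lam n))).
Hypothesis sum3 : ex_series (fun n => Rabs (INR n * (INR n * (INR n * lam n)))).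

Let mean := Series (fun n => INR n * lam n).
Let var := Series (fun n => INR n * (INR n * lam n)).
Let third := Series (fun n => INR n * (INR n * (INR n * lam n))).
Let disp (t : R) := Series lam - cos_series lam t.

Lemma dispersion_series t : ex_series (fun n => lam n * (1 - cos (INR n * t))) /\
  disp t = Series (fun n => lam n * (1 - cos (INR n * t))).
Proof.
  assert (E0 := ex_series_Rabs _ sum0). assert (E1 := ex_series_Rabs _ (ex_series_cos lam t sum0)).
  assert (X : forall n, lam n - lam n * cos (INR n * t) = lam n * (1 - cos (INR n * t))) by (intros; ring).
  split.
  - apply ex_series_ext with (2 := @ex_series_minus R_AbsRing R_NormedModule _ _ E0 E1). exact X.
  - unfold disp, cos_series. rewrite <- Series_minus by auto. now apply Series_ext.
Qed.

Lemma dispersion_ge0 t : 0 <= disp t.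
Proof.
  destruct (dispersion_series t) as [E ->].
  rewrite <- Series_zero. apply Series_le; auto. intros n. split; [lra|].
  apply Rmult_le_pos; auto. generalize (COS_bound (INR n * t)); lra.
Qed.

Lemma third_ge0 : 0 <= third.
Proof.
  rewrite <- Series_zero. apply Series_le.
  - intros n; split; [lra|]. repeat apply Rmult_le_pos; auto; apply pos_INR.
  - now apply ex_series_Rabs.
Qed.

Lemma ex_third_scaled t : ex_series (fun n => Rabs t ^ 3 / 6 * (INR n * (INR n * (INR n * lam n)))).
Proof. apply (@ex_series_scal R_AbsRing R_NormedModule). now apply ex_series_Rabs. Qed.

Lemma dispersion_taylor t : Rabs (disp t - var * t ^ 2 / 2) <= third * Rabs t ^ 3 / 6.
Proof.
  destruct (dispersion_series t) as [E ->].
  replace (var * t ^ 2 / 2) with (Series (fun n => t ^ 2 / 2 * (INR n * (INR n * lam n)))).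
  2: { rewrite Series_scal_l. unfold var. field. }
  replace (third * Rabs t ^ 3 / 6) with (Series (fun n => Rabs t ^ 3 / 6 * (INR n * (INR n * (INR n * lam n))))).
  2: { rewrite Series_scal_l. unfold third. field. }
  rewrite <- (Rminus_0_r (_ - _)). rewrite <- Series_zero.
  apply Series_quadratic_expansion; auto.
  - apply (@ex_series_scal R_AbsRing R_NormedModule). now apply ex_series_Rabs.
  - exists 0. apply is_series_Reals. intros e He. exists O. intros n _. unfold Rdist.
    rewrite sum_cte, Rmult_0_l, Rminus_diag, Rabs_R0. auto.
  - apply ex_third_scaled.
  - intros n. replace (lam n * (1 - cos (INR n * t)) - t ^ 2 / 2 * (INR n * (INR n * lam n)) - 0) with
      (lam n * - (cos (INR n * t) - 1 + (INR n * t) ^ 2 / 2)) by field.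
    rewrite Rabs_mult, Rabs_Ropp, (Rabs_right (lam n)) by (apply Rle_ge; auto).
    eapply Rle_trans. { apply Rmult_le_compat_l; auto. apply cos_taylor. }
    rewrite Rabs_mult, (Rabs_right (INR n)) by apply Rle_ge, pos_INR. right. field.
Qed.

Lemma phase_taylor t : Rabs (sin_series lam t - mean * t) <= third * Rabs t ^ 3 / 6.
Proof.
  unfold sin_series.
  replace (mean * t) with (Series (fun n => t * (INR n * lam n))).
  2: { rewrite Series_scal_l. unfold mean. ring. }
  replace (third * Rabs t ^ 3 / 6) with (Series (fun n => Rabs t ^ 3 / 6 * (INR n * (INR n * (INR n * lam n))))).
  2: { rewrite Series_scal_l. unfold third. field. }
  rewrite <- (Rminus_0_r (_ - _)). rewrite <- Series_zero.
  apply Series_quadratic_expansion; auto.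
  - apply ex_series_Rabs. now apply ex_series_sin.
  - apply (@ex_series_scal R_AbsRing R_NormedModule). now apply ex_series_Rabs.
  - exists 0. apply is_series_Reals. intros e He. exists O. intros n _. unfold Rdist.
    rewrite sum_cte, Rmult_0_l, Rminus_diag, Rabs_R0. auto.
  - apply ex_third_scaled.
  - intros n. replace (lam n * sin (INR n * t) - t * (INR n * lam n) - 0) with
      (lam n * (sin (INR n * t) - INR n * t)) by ring.
    rewrite Rabs_mult, (Rabs_right (lam n)) by (apply Rle_ge; auto).
    eapply Rle_trans. { apply Rmult_le_compat_l; auto. apply sin_taylor. }
    rewrite Rabs_mult, (Rabs_right (INR n)) by apply Rle_ge, pos_INR. right. field.
Qed.

Variables (m : nat) (p J c C A l K : R).
Hypothesis p_integral :
  is_RInt (fun t => exp (- disp t) * cos (sin_series lam t - INR m * t)) (- PI) PI (2 * PI * p).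
Hypothesis m_near : Rabs (mean - INR m) <= J.
Hypothesis c_pos : 0 < c.
Hypothesis A_ge1 : 1 <= A.
Hypothesis l_pos : 0 < l.
Hypothesis var_pos : 0 < var.
Hypothesis var_le : var <= C * (A * l ^ 2).
Hypothesis disp_small_t : forall t, Rabs t <= / l -> c * A * (l * t) ^ 2 <= disp t.
Hypothesis disp_large_t : forall t, / l <= Rabs t <= PI -> c * A * sqrt (l * Rabs t) <= disp t.
Hypothesis K_pos : 0 < K.
Hypothesis K_le : K <= PI * sqrt var.

Let C' := C / c + 256 * C / c ^ 4.

(** Both ranges of [t] are reduced to one integrable bound: [exp x >= 1 + x] serves small [t] and
    [exp_ge_quartic] large [t]. These are the two summands of [C']; [A >= 1] allows [A ^ 4] to be
    lowered to [A]. *)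
Lemma exp_dispersion_le t : t <> 0 -> Rabs t <= PI -> exp (- disp t) <= C' / var / t ^ 2.
Proof.
  intros Ht Hp. assert (T2 : 0 < t ^ 2) by now apply pow2_gt_0.
  assert (AL : 0 < A * l ^ 2) by (apply Rmult_lt_0_compat; [lra | now apply pow_lt]).
  assert (C0 : 0 < C).
  { destruct (Rle_or_lt C 0); auto. exfalso. nra. }
  assert (c4 : 0 < c ^ 4) by now apply pow_lt.
  assert (B1 : 0 < C / c) by now apply Rdiv_lt_0_compat.
  assert (B2 : 0 < 256 * C / c ^ 4) by (apply Rdiv_lt_0_compat; lra).
  assert (E : C' / var / t ^ 2 = C / c / (var * t ^ 2) + 256 * C / c ^ 4 / (var * t ^ 2)).
  { unfold C'. field. repeat split; lra. }
  assert (VT : 0 < var * t ^ 2) by now apply Rmult_lt_0_compat.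
  assert (F1 : 0 < C / c / (var * t ^ 2)) by now apply Rdiv_lt_0_compat.
  assert (F2 : 0 < 256 * C / c ^ 4 / (var * t ^ 2)) by now apply Rdiv_lt_0_compat.
  rewrite E, exp_Ropp.
  destruct (Rle_or_lt (Rabs t) (/ l)) as [L | L].
  - assert (Q := disp_small_t t L). assert (EX := exp_ge_1_plus (disp t)).
    assert (L1 : var * t ^ 2 * c / C <= exp (disp t)).
    { apply Rle_trans with (c * A * (l * t) ^ 2); [| lra].
      apply Rmult_le_reg_r with C; auto. unfold Rdiv. rewrite Rmult_assoc, Rinv_l, Rmult_1_r by lra.
      replace (c * A * (l * t) ^ 2 * C) with (C * (A * l ^ 2) * t ^ 2 * c) by ring.
      apply Rmult_le_compat_r; [lra|]. apply Rmult_le_compat_r; lra. }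
    assert (/ exp (disp t) <= / (var * t ^ 2 * c / C)).
    { apply Rinv_le_contravar; auto. apply Rdiv_lt_0_compat; auto. now apply Rmult_lt_0_compat. }
    replace (/ (var * t ^ 2 * c / C)) with (C / c / (var * t ^ 2)) in H by (field; repeat split; lra). lra.
  - assert (Q := disp_large_t t (conj (Rlt_le _ _ L) Hp)).
    assert (LT : 0 < l * Rabs t) by (apply Rmult_lt_0_compat; auto; now apply Rabs_pos_lt).
    assert (SQ := sqrt_lt_R0 _ LT).
    assert (Q0 : 0 < c * A * sqrt (l * Rabs t)) by (repeat apply Rmult_lt_0_compat; lra).
    assert (EX := exp_ge_quartic (disp t) ltac:(lra)).
    assert (P4 : (c * A * sqrt (l * Rabs t)) ^ 4 <= disp t ^ 4) by (apply pow_incr; lra).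
    assert (S4 : sqrt (l * Rabs t) ^ 4 = l ^ 2 * t ^ 2).
    { replace (sqrt (l * Rabs t) ^ 4) with ((sqrt (l * Rabs t) ^ 2) ^ 2) by ring.
      rewrite pow2_sqrt by lra. rewrite Rpow_mult_distr, pow2_abs. reflexivity. }
    rewrite Rpow_mult_distr, S4, Rpow_mult_distr in P4.
    assert (A4 : A <= A ^ 4).
    { rewrite <- (pow_1 A) at 1. apply Rle_pow; auto with arith. }
    assert (L1 : var * t ^ 2 * c ^ 4 / (256 * C) <= exp (disp t)).
    { apply Rle_trans with (2 := EX). apply Rle_trans with (c ^ 4 * A ^ 4 * (l ^ 2 * t ^ 2) / 256).
      2: { unfold Rdiv. apply Rmult_le_compat_r; lra. }
      apply Rmult_le_reg_r with (256 * C); [lra|]. unfold Rdiv.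
      rewrite Rmult_assoc, Rinv_l, Rmult_1_r by lra.
      replace (c ^ 4 * A ^ 4 * (l ^ 2 * t ^ 2) * / 256 * (256 * C)) with (C * (A ^ 4 * l ^ 2) * t ^ 2 * c ^ 4) by field.
      apply Rmult_le_compat_r; [lra|]. apply Rmult_le_compat_r; [lra|].
      apply Rle_trans with (1 := var_le). apply Rmult_le_compat_l; [lra|].
      apply Rmult_le_compat_r; auto. apply pow2_ge_0. }
    assert (/ exp (disp t) <= / (var * t ^ 2 * c ^ 4 / (256 * C))).
    { apply Rinv_le_contravar; auto. apply Rdiv_lt_0_compat; [| lra]. now apply Rmult_lt_0_compat. }
    replace (/ (var * t ^ 2 * c ^ 4 / (256 * C))) with (256 * C / c ^ 4 / (var * t ^ 2)) in H by (field; repeat split; lra).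
    lra.
Qed.

(** The three terms are the truncation of the Gaussian integral at [K], the Taylor error of modulus
    and phase on the central interval, and the integral of the [1 / t ^ 2] bound outside it. *)
Lemma local_limit_estimate :
  Rabs (2 * PI * p * sqrt var - sqrt (2 * PI)) <=
   Rabs (RInt gauss (- K) K - sqrt (2 * PI)) + 2 * K * (third * K ^ 3 / (3 * sqrt var ^ 3) + J * K / sqrt var)
    + 2 * C' / K.
Proof.
  assert (P0 := PI_RGT_0). assert (SV := sqrt_lt_R0 _ var_pos).
  assert (SV2 : sqrt var ^ 2 = var) by (apply pow2_sqrt; lra).
  assert (T0 := third_ge0).
  assert (J0 : 0 <= J) by (eapply Rle_trans; [apply Rabs_pos | apply m_near]).
  set (f := fun t => exp (- disp t) * cos (sin_series lam t - INR m * t)).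
  fold f in p_integral.
  (* The point where [sqrt var * t] reaches [K]; [K_le] keeps it within [PI]. *)
  set (tau := K / sqrt var).
  assert (tau_pos : 0 < tau) by now apply Rdiv_lt_0_compat.
  assert (tau_pi : tau <= PI).
  { apply Rmult_le_reg_r with (sqrt var); auto. unfold tau, Rdiv. rewrite Rmult_assoc, Rinv_l; lra. }
  assert (Ef : ex_RInt f (- PI) PI) by (eexists; apply p_integral).
  assert (E1 : ex_RInt f (- PI) tau).
  { apply (@ex_RInt_Chasles_1 R_CompleteNormedModule) with PI; auto; lra. }
  assert (E2 : ex_RInt f tau PI).
  { apply (@ex_RInt_Chasles_2 R_CompleteNormedModule) with (- PI); auto; lra. }
  assert (E3 : ex_RInt f (- PI) (- tau)).
  { apply (@ex_RInt_Chasles_1 R_CompleteNormedModule) with tau; auto; lra. }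
  assert (E4 : ex_RInt f (- tau) tau).
  { apply (@ex_RInt_Chasles_2 R_CompleteNormedModule) with (- PI); auto; lra. }
  assert (Dec : 2 * PI * p = RInt f (- PI) (- tau) + RInt f (- tau) tau + RInt f tau PI).
  { rewrite <- (is_RInt_unique _ _ _ _ p_integral).
    rewrite <- (RInt_Chasles f (- PI) tau PI), <- (RInt_Chasles f (- PI) (- tau) tau) by auto. reflexivity. }
  assert (fb : forall t, Rabs (f t) <= exp (- disp t)).
  { intros t. unfold f. rewrite Rabs_mult, (Rabs_right (exp _)) by apply Rle_ge, Rlt_le, exp_pos.
    assert (Rabs (cos (sin_series lam t - INR m * t)) <= 1) by apply Rabs_le, COS_bound.
    generalize (exp_pos (- disp t)). nra. }
  assert (C'0 : 0 <= C' / var).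
  { assert (H := exp_dispersion_le PI ltac:(lra) ltac:(rewrite Rabs_right; lra)).
    assert (0 < C' / var / PI ^ 2) by (eapply Rlt_le_trans; [apply exp_pos | apply H]).
    apply Rmult_lt_compat_r with (r := PI ^ 2) in H0; [| nra].
    replace (C' / var / PI ^ 2 * PI ^ 2) with (C' / var) in H0 by (field; lra). lra. }
  set (D := C' / var) in *.
  assert (Hyp : forall a b, 0 < a <= b -> is_RInt (fun t => D / t ^ 2) a b (D / a - D / b)).
  { intros a b Hab. replace (D / a - D / b) with (minus (- D / b) (- D / a)).
    2: { unfold minus, plus, opp; simpl. field. lra. }
    apply (@is_RInt_derive R_CompleteNormedModule (fun t => - D / t)).
    - intros t Ht. rewrite Rmin_left in Ht by lra. auto_derive; [lra|]. field. lra.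
    - intros t Ht. rewrite Rmin_left in Ht by lra.
      apply (@ex_derive_continuous R_AbsRing R_NormedModule). auto_derive. 
      assert (0 < t * t) by nra. simpl. lra. }
  assert (Tail : forall g, ex_RInt g tau PI -> (forall t, tau <= t <= PI -> Rabs (g t) <= D / t ^ 2) ->
     Rabs (RInt g tau PI) <= D / tau).
  { intros g Eg Hg. assert (I := Hyp tau PI (conj tau_pos tau_pi)).
    apply Rle_trans with (D / tau - D / PI).
    - rewrite <- (is_RInt_unique _ _ _ _ I).
      apply (norm_RInt_le g (fun t => D / t ^ 2) tau PI); auto.
      + now apply (@RInt_correct R_CompleteNormedModule).
      + rewrite (is_RInt_unique _ _ _ _ I). exact I.
    - assert (0 <= D / PI); [| lra]. apply Rmult_le_pos; auto. now apply Rlt_le, Rinv_0_lt_compat. }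
  assert (T1 : Rabs (RInt f tau PI) <= D / tau).
  { apply Tail; auto. intros t Ht. eapply Rle_trans; [apply fb|]. apply exp_dispersion_le.
    - lra. - rewrite Rabs_right; lra. }
  assert (T2 : Rabs (RInt f (- PI) (- tau)) <= D / tau).
  { assert (I : is_RInt f (-1 * tau + 0) (-1 * PI + 0) (RInt f (- tau) (- PI))).
    { replace (-1 * tau + 0) with (- tau) by ring. replace (-1 * PI + 0) with (- PI) by ring.
      apply (@RInt_correct R_CompleteNormedModule). now apply ex_RInt_swap. }
    apply (@is_RInt_comp_lin R_NormedModule) in I.
    assert (B := Tail _ (ex_intro _ _ I)). rewrite (is_RInt_unique _ _ _ _ I) in B.
    rewrite <- (opp_RInt_swap f) by now apply ex_RInt_swap.
    change (opp (RInt f (- tau) (- PI))) with (- RInt f (- tau) (- PI)). rewrite Rabs_Ropp. apply B.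
    intros t Ht. change (scal (-1) (f (-1 * t + 0))) with (-1 * f (-1 * t + 0)).
    replace (-1 * f (-1 * t + 0)) with (- f (- t)).
    2: { replace (-1 * t + 0) with (- t) by ring. ring. }
    rewrite Rabs_Ropp. eapply Rle_trans; [apply fb|].
    replace (t ^ 2) with ((- t) ^ 2) by ring. apply exp_dispersion_le.
    - lra. - rewrite Rabs_Ropp, Rabs_right; lra. }
  set (g := fun t => exp (- (var * t ^ 2 / 2))).
  assert (Eg : ex_RInt g (- tau) tau).
  { apply (@ex_RInt_continuous R_CompleteNormedModule). intros t _.
    apply (@ex_derive_continuous R_AbsRing R_NormedModule). unfold g. auto_derive. auto. }
  assert (Ig : sqrt var * RInt g (- tau) tau = RInt gauss (- K) K).
  { unfold g. rewrite gauss_scaled_int by auto.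
    replace (sqrt var * tau) with K by (unfold tau; field; lra). field. lra. }
  (* Modulus and phase each contribute [third * tau ^ 3 / 6]; the distance [J] between the mean and
     the target contributes [J * tau]. *)
  set (B0 := third * tau ^ 3 / 3 + J * tau).
  assert (Mid : Rabs (RInt f (- tau) tau - RInt g (- tau) tau) <= 2 * tau * B0).
  { change (RInt f (- tau) tau - RInt g (- tau) tau) with (minus (RInt f (- tau) tau) (RInt g (- tau) tau)).
    rewrite <- (RInt_minus f g) by auto.
    replace (2 * tau * B0) with ((tau - - tau) * B0) by ring.
    apply abs_RInt_le_const; [lra | now apply (@ex_RInt_minus R_NormedModule) |].
    intros t Ht. change (minus (f t) (g t)) with (f t - g t).
    assert (At : Rabs t <= tau) by (apply Rabs_le; lra).
    assert (A3 : Rabs t ^ 3 <= tau ^ 3) by (apply pow_incr; split; auto; apply Rabs_pos).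
    assert (X1 := dispersion_taylor t). assert (X2 := phase_taylor t).
    assert (X3 : third * Rabs t ^ 3 <= third * tau ^ 3) by now apply Rmult_le_compat_l.
    unfold f, g.
    replace (exp (- disp t) * cos (sin_series lam t - INR m * t) - exp (- (var * t ^ 2 / 2))) with
      ((exp (- disp t) - exp (- (var * t ^ 2 / 2))) + exp (- disp t) * (cos (sin_series lam t - INR m * t) - cos 0)).
    2: { rewrite cos_0. ring. }
    eapply Rle_trans; [apply Rabs_triang|].
    assert (Y1 : Rabs (exp (- disp t) - exp (- (var * t ^ 2 / 2))) <= third * tau ^ 3 / 6).
    { eapply Rle_trans. { apply exp_neg_lipschitz. { apply dispersion_ge0. } generalize (pow2_ge_0 t). nra. } lra. }
    assert (Y2 : Rabs (exp (- disp t) * (cos (sin_series lam t - INR m * t) - cos 0)) <= third * tau ^ 3 / 6 + J * tau).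
    { rewrite Rabs_mult, (Rabs_right (exp _)) by apply Rle_ge, Rlt_le, exp_pos.
      assert (exp (- disp t) <= 1).
      { rewrite <- exp_0. apply exp_le. generalize (dispersion_ge0 t). lra. }
      assert (Z := cos_lipschitz (sin_series lam t - INR m * t) 0). rewrite Rminus_0_r in Z.
      assert (Z2 : Rabs (sin_series lam t - INR m * t) <= third * tau ^ 3 / 6 + J * tau).
      { replace (sin_series lam t - INR m * t) with ((sin_series lam t - mean * t) + (mean - INR m) * t) by ring.
        eapply Rle_trans; [apply Rabs_triang|]. rewrite Rabs_mult.
        assert (Rabs (mean - INR m) * Rabs t <= J * tau) by (apply Rmult_le_compat; auto; apply Rabs_pos). lra. }
      generalize (exp_pos (- disp t)) (Rabs_pos (cos (sin_series lam t - INR m * t) - cos 0)). nra. }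
    unfold B0. lra. }
  replace (2 * PI * p * sqrt var - sqrt (2 * PI)) with
   ((RInt gauss (- K) K - sqrt (2 * PI)) + sqrt var * (RInt f (- tau) tau - RInt g (- tau) tau)
     + sqrt var * (RInt f (- PI) (- tau) + RInt f tau PI)).
  2: { rewrite Dec, <- Ig. ring. }
  eapply Rle_trans; [apply Rabs_triang|]. apply Rplus_le_compat.
  - eapply Rle_trans; [apply Rabs_triang|]. apply Rplus_le_compat_l.
    rewrite Rabs_mult, (Rabs_right (sqrt var)) by lra.
    replace (2 * K * (third * K ^ 3 / (3 * sqrt var ^ 3) + J * K / sqrt var)) with (sqrt var * (2 * tau * B0)).
    2: { unfold B0, tau. field. lra. }
    apply Rmult_le_compat_l; [lra | exact Mid].
  - rewrite Rabs_mult, (Rabs_right (sqrt var)) by lra.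
    replace (2 * C' / K) with (sqrt var * (2 * (D / tau))).
    2: { unfold D, tau. replace (C' / var) with (C' / sqrt var ^ 2) by now rewrite SV2. field. lra. }
    apply Rmult_le_compat_l; [lra|]. eapply Rle_trans; [apply Rabs_triang|]. lra.
Qed.

End LocalLimitTheorem.

(** * Bounds on the tilted coefficients *)

Lemma Series_le_of_partial u B : ex_series u -> (forall M, sum_f_R0 u M <= B) -> Series u <= B.
Proof.
  intros E H. assert (S := Series_correct u E). apply is_series_Reals in S.
  apply Rnot_lt_le. intros L. destruct (S (Series u - B)) as [M0 HM]; [lra|].
  specialize (HM M0 (le_n _)). unfold Rdist in HM. apply Rabs_def2 in HM. specialize (H M0). lra.
Qed.

Lemma partial_le_Series u M : ex_series u -> (forall n, 0 <= u n) -> sum_f_R0 u M <= Series u.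
Proof.
  intros E P. rewrite (Series_incr_n u (S M)) by (auto; lia). simpl pred.
  assert (0 <= Series (fun k => u (S M + k)%nat)); [| lra].
  rewrite <- Series_zero. apply Series_le. { intros; split; auto; lra. }
  now apply (ex_series_incr_n u (S M)).
Qed.

Lemma block_le_Series u s k : ex_series u -> (forall n, 0 <= u n) ->
  sum_f_R0 (fun i => u (s + i)%nat) k <= Series u.
Proof.
  intros E P. destruct s as [|s]. { now apply partial_le_Series. }
  rewrite (Series_incr_n u (S s)) by (auto; lia). simpl pred.
  assert (0 <= sum_f_R0 u s) by (apply cond_pos_sum; auto).
  assert (sum_f_R0 (fun i => u (S s + i)%nat) k <= Series (fun i => u (S s + i)%nat)); [| lra].
  apply partial_le_Series; auto. now apply (ex_series_incr_n u (S s)).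
Qed.

(** Each summand is at most a difference [v n - v (n + 1)] of an explicit nonnegative sequence, so
    the sum is at most [v 0]. *)
Lemma sum_pow_moments r M : 0 < r < 1 ->
  sum_f_R0 (fun n => r ^ n) M <= / (1 - r) /\
  sum_f_R0 (fun n => INR n * r ^ n) M <= / (1 - r) ^ 2 /\
  sum_f_R0 (fun n => INR n ^ 2 * r ^ n) M <= 2 / (1 - r) ^ 3.
Proof.
  intros Hr. set (e := 1 - r). assert (He : 0 < e) by (unfold e; lra).
  assert (re : r = 1 - e) by (unfold e; ring).
  assert (Tel : forall (u v : nat -> R), (forall n, u n <= v n - v (S n)) -> forall M, sum_f_R0 u M <= v O - v (S M)).
  { intros u v H. induction M0 as [|M0 IH]; simpl sum_f_R0. { apply H. } generalize (H (S M0)). lra. }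
  assert (P : forall n, 0 <= r ^ n) by (intros; apply pow_le; lra).
  assert (N : forall n, 0 <= INR n) by apply pos_INR.
  assert (I1 : 0 < / e) by now apply Rinv_0_lt_compat.
  assert (I2 : 0 < / e ^ 2) by (apply Rinv_0_lt_compat, pow_lt; auto).
  assert (I3 : 0 < 2 / e ^ 3) by (apply Rdiv_lt_0_compat; [lra | apply pow_lt; auto]).
  repeat split.
  - eapply Rle_trans. { apply (Tel _ (fun n => r ^ n * / e)). intros n. simpl. rewrite re at 3. right. field. lra. }
    simpl. generalize (P M). intros. rewrite Rmult_1_l. assert (0 <= r * r ^ M * / e) by (repeat apply Rmult_le_pos; lra). lra.
  - eapply Rle_trans. 
    { apply (Tel _ (fun n => r ^ n * (INR n / e + / e ^ 2))). intros n. rewrite S_INR. simpl pow.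
      replace (r ^ n * (INR n / e + / (e * (e * 1))) - r * r ^ n * ((INR n + 1) / e + / (e * (e * 1)))) with
        (r ^ n * (INR n + 1)).
      - generalize (P n). nra.
      - rewrite re at 3. field. lra. }
    simpl (INR 0). rewrite pow_O. unfold Rdiv. rewrite Rmult_0_l, Rplus_0_l, Rmult_1_l.
    assert (0 <= r ^ S M * (INR (S M) * / e + / e ^ 2)); [| lra].
    apply Rmult_le_pos; auto. apply Rplus_le_le_0_compat; [apply Rmult_le_pos; auto |]; lra.
  - eapply Rle_trans.
    { apply (Tel _ (fun n => r ^ n * (INR n ^ 2 / e + 2 * INR n / e ^ 2 + 2 / e ^ 3))). intros n. rewrite S_INR.
      replace (r ^ n * (INR n ^ 2 / e + 2 * INR n / e ^ 2 + 2 / e ^ 3) -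
         r ^ S n * ((INR n + 1) ^ 2 / e + 2 * (INR n + 1) / e ^ 2 + 2 / e ^ 3)) with
        (r ^ n * (INR n ^ 2 + (2 * INR n + (1 + / e)))).
      - rewrite (Rmult_comm (INR n ^ 2)). apply Rmult_le_compat_l; auto. generalize (N n); lra.
      - simpl pow. rewrite re at 3. field. lra. }
    simpl (INR 0). rewrite pow_O.
    replace (1 * (0 ^ 2 / e + 2 * 0 / e ^ 2 + 2 / e ^ 3)) with (2 / e ^ 3) by (field; lra).
    assert (0 <= r ^ S M * (INR (S M) ^ 2 / e + 2 * INR (S M) / e ^ 2 + 2 / e ^ 3)); [| lra].
    apply Rmult_le_pos; auto. apply Rplus_le_le_0_compat; [apply Rplus_le_le_0_compat |]; try lra.
    + apply Rmult_le_pos; [apply pow_le; auto | lra].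
    + apply Rmult_le_pos; [generalize (N (S M)); lra | lra].
Qed.

(** Two angles at distance [s] cannot both be near multiples of [2 PI] unless [s] is: the sine of
    [s / 2] is bounded by the sum of the sines of the half-angles. *)
Lemma pair_cos_ge u s : (1 - cos s) / 2 <= (1 - cos u) + (1 - cos (u + s)).
Proof.
  rewrite !one_minus_cos.
  assert (S2 : Rabs (sin (s / 2)) <= Rabs (sin ((u + s) / 2)) + Rabs (sin (u / 2))).
  { replace (s / 2) with ((u + s) / 2 - u / 2) by field. rewrite sin_minus. unfold Rminus.
    eapply Rle_trans. { apply Rabs_triang. } rewrite Rabs_Ropp, !Rabs_mult.
    assert (Rabs (cos (u / 2)) <= 1) by apply Rabs_le, COS_bound.
    assert (Rabs (cos ((u + s) / 2)) <= 1) by apply Rabs_le, COS_bound.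
    generalize (Rabs_pos (sin ((u + s) / 2))) (Rabs_pos (sin (u / 2))). nra. }
  rewrite <- (pow2_abs (sin (s / 2))), <- (pow2_abs (sin (u / 2))), <- (pow2_abs (sin ((u + s) / 2))).
  assert (P := Rabs_pos (sin (s / 2))).
  generalize (pow2_ge_0 (Rabs (sin (u / 2)) - Rabs (sin ((u + s) / 2)))). nra.
Qed.

Lemma one_minus_cos_ge x : Rabs x <= 2 -> x ^ 2 / 8 <= 1 - cos x.
Proof.
  intros H. rewrite one_minus_cos.
  assert (A : Rabs (x / 2) = Rabs x / 2).
  { unfold Rdiv. rewrite Rabs_mult, (Rabs_right (/ 2)); lra. }
  assert (S := sin_ge_half (x / 2)). rewrite A in S. specialize (S ltac:(lra)).
  rewrite <- (pow2_abs (sin _)), <- (pow2_abs x). assert (P := Rabs_pos x). nra.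
Qed.

Lemma pow_lower_exp r r0 n B : 0 < r0 <= r -> r < 1 -> INR n * (1 - r) <= B -> exp (- (B / r0)) <= r ^ n.
Proof.
  intros H0 H1 HB.
  assert (E : exp (- ((1 - r) / r0)) <= r).
  { rewrite exp_Ropp. assert (X := exp_ge_1_plus ((1 - r) / r0)).
    assert (Y : / r <= 1 + (1 - r) / r0).
    { replace (/ r) with (1 + (1 - r) / r) by (field; lra). apply Rplus_le_compat_l.
      unfold Rdiv. apply Rmult_le_compat_l; [lra|]. apply Rinv_le_contravar; lra. }
    rewrite <- (Rinv_inv r) at 2. apply Rinv_le_contravar; [apply Rinv_0_lt_compat; lra | lra]. }
  apply Rle_trans with (exp (- ((1 - r) / r0)) ^ n).
  - rewrite <- exp_pow. apply exp_le. 
    assert (INR n * (1 - r) / r0 <= B / r0).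
    { unfold Rdiv. apply Rmult_le_compat_r; auto. apply Rlt_le, Rinv_0_lt_compat; lra. }
    unfold Rdiv in *. lra.
  - apply pow_incr. split; auto. left; apply exp_pos.
Qed.

Lemma INR_mul_lam W r n : (1 <= n)%nat -> INR n * lam W r n = W n * r ^ n.
Proof.
  intros Hn. unfold lam, log_coef. destruct n as [|n]; [lia|]. field.
  apply not_0_INR. lia.
Qed.

Lemma lam_ge0 W r n : 0 <= r -> (forall j, (1 <= j)%nat -> 0 <= W j) -> 0 <= lam W r n.
Proof.
  intros hr hW. unfold lam, log_coef. destruct n as [|n]; [lra|].
  apply Rmult_le_pos; [| apply pow_le; lra].
  apply Rmult_le_pos; [apply hW; lia |]. apply Rlt_le, Rinv_0_lt_compat, lt_0_INR. lia.
Qed.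

Section SaddleBounds.

Variables (W : nat -> R) (r : R) (d : nat) (V cW CU r0 : R) (j0 l : nat).
Hypothesis d_pos : (1 <= d)%nat.
Hypothesis r0_pos : 0 < r0.
Hypothesis r_bounds : r0 <= r < 1.
Hypothesis V_pos : 0 < V.
Hypothesis cW_pos : 0 < cW.
Hypothesis j0_pos : (1 <= j0)%nat.
Hypothesis l_pos : (1 <= l)%nat.
Hypothesis l_lower : 1 <= INR l * (1 - r).
Hypothesis l_upper : INR l * (1 - r) <= 2.

Let A : R := V / sqrt (INR l) ^ d.

Hypothesis W_ge0 : forall j, (1 <= j)%nat -> 0 <= W j.
Hypothesis W_lower : forall j, (j0 <= j)%nat -> cW * V <= W j * sqrt (INR j) ^ d.
Hypothesis W_upper : forall j, (1 <= j)%nat -> W j <= CU * (A * (1 + INR l / INR j)).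

Local Notation lam := (lam W r).
Hypothesis lam_sum0 : ex_series (fun n => Rabs (lam n)).
Hypothesis lam_sum2 : ex_series (fun n => Rabs (INR n * (INR n * lam n))).
Hypothesis lam_sum3 : ex_series (fun n => Rabs (INR n * (INR n * (INR n * lam n)))).

(** A lower bound for [r ^ n] as long as [n <= k0 * l], since then [n * (1 - r) <= 2 * k0]; not the
    particle density. The value [k0 = j0 + 2] is such that two adjacent blocks of length [q]
    starting at [j0] stay below [k0 * q]. *)
Let rho : R := exp (- (2 * (INR j0 + 2) / r0)).
Let k0 : R := INR j0 + 2.
Let cA : R := cW * rho / sqrt k0 ^ d.

Lemma INR_l_ge1 : 1 <= INR l.
Proof. apply (le_INR 1). exact l_pos. Qed.

Lemma k0_ge1 : 1 <= k0.
Proof. unfold k0. generalize (pos_INR j0). lra. Qed.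

Lemma A_pos : 0 < A.
Proof.
  apply Rdiv_lt_0_compat; auto. apply pow_lt, sqrt_lt_R0. generalize INR_l_ge1; lra.
Qed.

Let lam_nonneg n : 0 <= lam n.
Proof. apply lam_ge0; [lra | exact W_ge0]. Qed.

Lemma CU_pos : 0 <= CU.
Proof.
  assert (H := W_upper 1 (le_n _)). assert (H0 := W_ge0 1 (le_n _)). simpl (INR 1) in H.
  assert (0 < A * (1 + INR l / 1)).
  { apply Rmult_lt_0_compat; [apply A_pos |]. generalize INR_l_ge1; lra. }
  destruct (Rle_or_lt 0 CU); auto. nra.
Qed.

Lemma term_upper n : INR n * lam n <= CU * A * (1 + INR l / INR n) * r ^ n \/ n = O.
Proof.
  destruct n as [|n]; [now right|]. left. rewrite INR_mul_lam by lia.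
  rewrite (Rmult_assoc CU). apply Rmult_le_compat_r; [apply pow_le; lra|]. apply W_upper; lia.
Qed.

Lemma inv_eps_le : / (1 - r) <= INR l.
Proof.
  apply Rmult_le_reg_r with (1 - r); [lra|]. rewrite Rinv_l; lra.
Qed.

Lemma variance_upper : Series (fun n => INR n * (INR n * lam n)) <= 2 * CU * (A * INR l ^ 2).
Proof.
  apply Series_le_of_partial. { now apply ex_series_Rabs. }
  intros M. destruct (sum_pow_moments r M ltac:(lra)) as [S0 [S1 S2]].
  assert (CA : 0 <= CU * A) by (apply Rmult_le_pos; [apply CU_pos | apply Rlt_le, A_pos]).
  apply Rle_trans with (CU * A * (sum_f_R0 (fun n => INR n * r ^ n) M + INR l * sum_f_R0 (fun n => r ^ n) M)).
  - rewrite (scal_sum (fun n => r ^ n)), <- sum_plus, scal_sum. apply sum_Rle. intros n _.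
    assert (P : 0 <= r ^ n) by (apply pow_le; lra). assert (L := INR_l_ge1).
    destruct n as [|n].
    { change (INR 0) with 0. rewrite !Rmult_0_l, Rplus_0_l.
      apply Rmult_le_pos; [apply Rmult_le_pos; lra | auto]. }
    destruct (term_upper (S n)) as [T | T]; [| lia].
    assert (N : 0 < INR (S n)) by (apply lt_0_INR; lia).
    apply Rmult_le_compat_l with (r := INR (S n)) in T; [| lra].
    eapply Rle_trans; [apply T|]. right. field. lra.
  - assert (E := inv_eps_le). assert (I : 0 < / (1 - r)) by (apply Rinv_0_lt_compat; lra).
    replace (2 * CU * (A * INR l ^ 2)) with (CU * A * (INR l * INR l + INR l * INR l)) by ring.
    apply Rmult_le_compat_l; auto. apply Rplus_le_compat.
    + eapply Rle_trans; [apply S1|].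
      replace (/ (1 - r) ^ 2) with (/ (1 - r) * / (1 - r)) by (field; lra). nra.
    + apply Rmult_le_compat_l; [apply pos_INR | lra].
Qed.

Lemma third_upper : Series (fun n => INR n * (INR n * (INR n * lam n))) <= 3 * CU * (A * INR l ^ 3).
Proof.
  apply Series_le_of_partial. { now apply ex_series_Rabs. }
  intros M. destruct (sum_pow_moments r M ltac:(lra)) as [S0 [S1 S2]].
  assert (CA : 0 <= CU * A) by (apply Rmult_le_pos; [apply CU_pos | apply Rlt_le, A_pos]).
  apply Rle_trans with (CU * A * (sum_f_R0 (fun n => INR n ^ 2 * r ^ n) M + INR l * sum_f_R0 (fun n => INR n * r ^ n) M)).
  - rewrite (scal_sum (fun n => INR n * r ^ n)), <- sum_plus, scal_sum. apply sum_Rle. intros n _.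
    assert (P : 0 <= r ^ n) by (apply pow_le; lra). assert (L := INR_l_ge1).
    destruct n as [|n].
    { simpl (INR 0). right. ring. }
    destruct (term_upper (S n)) as [T | T]; [| lia].
    assert (N : 0 < INR (S n)) by (apply lt_0_INR; lia).
    apply Rmult_le_compat_l with (r := INR (S n) ^ 2) in T; [| apply pow2_ge_0].
    replace (INR (S n) * (INR (S n) * (INR (S n) * lam (S n)))) with (INR (S n) ^ 2 * (INR (S n) * lam (S n))) by ring.
    eapply Rle_trans; [apply T|]. right. field. lra.
  - assert (E := inv_eps_le). assert (I : 0 < / (1 - r)) by (apply Rinv_0_lt_compat; lra).
    replace (3 * CU * (A * INR l ^ 3)) with (CU * A * (2 * INR l ^ 3 + INR l * INR l ^ 2)) by ring.
    apply Rmult_le_compat_l; auto. apply Rplus_le_compat.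
    + eapply Rle_trans; [apply S2|].
      replace (2 / (1 - r) ^ 3) with (2 * (/ (1 - r)) ^ 3) by (field; lra).
      apply Rmult_le_compat_l; [lra|]. apply pow_incr; lra.
    + apply Rmult_le_compat_l; [apply pos_INR |]. eapply Rle_trans; [apply S1|].
      rewrite <- pow_inv. apply pow_incr; lra.
Qed.

(** For such [n] both factors are under control: [sqrt n ^ d] is at most [sqrt (k0 * q) ^ d], and
    [r ^ n] is at least [rho]. *)
Lemma window_lower q n : (1 <= q <= l)%nat -> (j0 <= n)%nat -> INR n <= k0 * INR q ->
  cA * (V / sqrt (INR q) ^ d) <= INR n * lam n.
Proof.
  intros Hq Hn Hnq. rewrite INR_mul_lam by lia.
  assert (Q1 : 1 <= INR q) by (apply (le_INR 1); lia).
  assert (QL : INR q <= INR l) by (apply le_INR; lia).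
  assert (N1 : 1 <= INR n) by (apply (le_INR 1); lia).
  assert (R : rho <= r ^ n).
  { unfold rho. apply pow_lower_exp; try lra. fold k0.
    apply Rle_trans with (k0 * INR l * (1 - r)).
    - apply Rmult_le_compat_r; [lra|]. generalize k0_ge1. nra.
    - generalize k0_ge1. nra. }
  assert (SN : 1 <= sqrt (INR n)) by (rewrite <- sqrt_1; now apply sqrt_le_1_alt).
  assert (SNd : 0 < sqrt (INR n) ^ d) by (apply pow_lt; lra).
  assert (SQ : 0 < sqrt (INR q)) by (apply sqrt_lt_R0; lra).
  assert (SK : 0 < sqrt k0) by (apply sqrt_lt_R0; generalize k0_ge1; lra).
  assert (SB : sqrt (INR n) ^ d <= sqrt k0 ^ d * sqrt (INR q) ^ d).
  { rewrite <- Rpow_mult_distr. apply pow_incr. split; [lra|].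
    rewrite <- sqrt_mult_alt by (generalize k0_ge1; lra). now apply sqrt_le_1_alt. }
  assert (R0 : 0 < rho) by apply exp_pos.
  assert (WL : cW * V / sqrt (INR n) ^ d <= W n).
  { apply Rmult_le_reg_r with (sqrt (INR n) ^ d); auto. unfold Rdiv.
    rewrite Rmult_assoc, Rinv_l, Rmult_1_r by lra. now apply W_lower. }
  assert (CV : 0 < cW * V) by now apply Rmult_lt_0_compat.
  assert (KQ : 0 < sqrt k0 ^ d * sqrt (INR q) ^ d) by (apply Rmult_lt_0_compat; apply pow_lt; auto).
  assert (WL2 : cW * V / (sqrt k0 ^ d * sqrt (INR q) ^ d) <= W n).
  { eapply Rle_trans; [| apply WL]. unfold Rdiv. apply Rmult_le_compat_l; [lra|].
    now apply Rinv_le_contravar. }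
  assert (0 < cW * V / (sqrt k0 ^ d * sqrt (INR q) ^ d)) by now apply Rdiv_lt_0_compat.
  replace (cA * (V / sqrt (INR q) ^ d)) with (cW * V / (sqrt k0 ^ d * sqrt (INR q) ^ d) * rho).
  - apply Rmult_le_compat; lra.
  - unfold cA. field. split; apply pow_nonzero; lra.
Qed.

Lemma cA_pos : 0 < cA.
Proof.
  unfold cA. apply Rdiv_lt_0_compat.
  - apply Rmult_lt_0_compat; auto. apply exp_pos.
  - apply pow_lt, sqrt_lt_R0. generalize k0_ge1; lra.
Qed.

Lemma mean_lower : ex_series (fun n => Rabs (INR n * lam n)) ->
  cA * (A * INR l) <= Series (fun n => INR n * lam n).
Proof.
  intros E. assert (L := INR_l_ge1).
  assert (P : forall n, 0 <= INR n * lam n).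
  { intros. apply Rmult_le_pos; [apply pos_INR | apply lam_nonneg]. }
  eapply Rle_trans; [| apply (block_le_Series _ (j0 + l) (pred l)); auto; now apply ex_series_Rabs].
  apply Rle_trans with (sum_f_R0 (fun _ => cA * A) (pred l)).
  - rewrite sum_cte. replace (S (pred l)) with l by lia. right; ring.
  - apply sum_Rle. intros i Hi. apply (window_lower l); [lia | lia |].
    rewrite !plus_INR. assert (INR i <= INR l) by (apply le_INR; lia).
    assert (J := pos_INR j0). unfold k0. nra.
Qed.

Lemma variance_lower : cA * (A * INR l ^ 2) <= Series (fun n => INR n * (INR n * lam n)).
Proof.
  assert (L := INR_l_ge1).
  assert (P : forall n, 0 <= INR n * (INR n * lam n)).
  { intros. apply Rmult_le_pos; [apply pos_INR |]. apply Rmult_le_pos; [apply pos_INR | apply lam_nonneg]. }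
  eapply Rle_trans; [| apply (block_le_Series _ (j0 + l) (pred l)); auto; now apply ex_series_Rabs].
  apply Rle_trans with (sum_f_R0 (fun _ => INR l * (cA * A)) (pred l)).
  - rewrite sum_cte. replace (S (pred l)) with l by lia. right; ring.
  - apply sum_Rle. intros i Hi.
    assert (N1 : INR l <= INR (j0 + l + i)) by (apply le_INR; lia).
    assert (CA0 : 0 <= cA * A).
    { apply Rmult_le_pos; apply Rlt_le; [apply cA_pos | apply A_pos]. }
    apply Rmult_le_compat; auto; [lra|].
    apply (window_lower l); [lia | lia |].
    rewrite !plus_INR. assert (INR i <= INR l) by (apply le_INR; lia).
    assert (J := pos_INR j0). unfold k0. nra.
Qed.

(** Indices [n] and [n + q] are paired over two adjacent blocks of length [q]. By [pair_cos_ge] each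
    pair sees the oscillation of [q t], whatever the phase at [n]. *)
Lemma dispersion_lower q t : (1 <= q <= l)%nat ->
  cA / (2 * k0) * (V / sqrt (INR q) ^ d) * (1 - cos (INR q * t)) <= dispersion W r t.
Proof.
  intros Hq. assert (K := k0_ge1). assert (Q1 : 1 <= INR q) by (apply (le_INR 1); lia).
  assert (VQ : 0 < V / sqrt (INR q) ^ d) by (apply Rdiv_lt_0_compat; auto; apply pow_lt, sqrt_lt_R0; lra).
  assert (CP := cA_pos).
  destruct (dispersion_series lam lam_sum0 t) as [E D].
  unfold dispersion. rewrite D.
  set (u := fun n => lam n * (1 - cos (INR n * t))).
  assert (P : forall n, 0 <= u n).
  { intros n. apply Rmult_le_pos; [apply lam_nonneg |]. generalize (COS_bound (INR n * t)); lra. }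
  set (mu := cA * (V / sqrt (INR q) ^ d) / (k0 * INR q)).
  assert (mu0 : 0 < mu) by (apply Rdiv_lt_0_compat; nra).
  assert (LB : forall n, (j0 <= n)%nat -> INR n <= k0 * INR q -> mu <= lam n).
  { intros n Hn Hnq. assert (N1 : 1 <= INR n) by (apply (le_INR 1); lia).
    assert (Wn := window_lower q n Hq Hn Hnq).
    apply Rle_trans with (cA * (V / sqrt (INR q) ^ d) / INR n).
    - unfold mu, Rdiv. apply Rmult_le_compat_l; [apply Rlt_le, Rmult_lt_0_compat; auto |].
      apply Rinv_le_contravar; lra.
    - apply Rmult_le_reg_l with (INR n); [lra|].
      set (Y := cA * (V / sqrt (INR q) ^ d)) in *.
      replace (INR n * (Y / INR n)) with Y by (field; lra).
      exact Wn. }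
  (* The two blocks start at [j0] and [j0 + q], so every index involved lies between [j0] and
     [k0 * q]. *)
  assert (Split : sum_f_R0 (fun i => u (j0 + i)%nat) (pred q) + sum_f_R0 (fun i => u (j0 + q + i)%nat) (pred q)
     <= Series u).
  { eapply Rle_trans; [| apply (block_le_Series u j0 (pred q + S (pred q))); auto].
    rewrite (tech2 (fun i => u (j0 + i)%nat) (pred q) (pred q + S (pred q))) by lia.
    apply Rplus_le_compat_l. replace (pred q + S (pred q) - S (pred q))%nat with (pred q) by lia.
    right. apply sum_eq. intros i _. f_equal. lia. }
  eapply Rle_trans; [| apply Split]. rewrite <- sum_plus.
  apply Rle_trans with (sum_f_R0 (fun _ => mu * ((1 - cos (INR q * t)) / 2)) (pred q)).
  - rewrite sum_cte. replace (S (pred q)) with q by lia. right. unfold mu. field.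
    repeat split; try lra. apply pow_nonzero, Rgt_not_eq, sqrt_lt_R0; lra.
  - apply sum_Rle. intros i Hi. unfold u.
    assert (J := pos_INR j0). assert (IQ : INR i <= INR q) by (apply le_INR; lia).
    assert (L1 : mu <= lam (j0 + i)).
    { apply LB; [lia|]. rewrite plus_INR. unfold k0. nra. }
    assert (L2 : mu <= lam (j0 + q + i)).
    { apply LB; [lia|]. rewrite !plus_INR. unfold k0. nra. }
    assert (PC := pair_cos_ge (INR (j0 + i) * t) (INR q * t)).
    replace (INR (j0 + i) * t + INR q * t) with (INR (j0 + q + i) * t) in PC by (rewrite !plus_INR; ring).
    assert (C1 := COS_bound (INR (j0 + i) * t)). assert (C2 := COS_bound (INR (j0 + q + i) * t)).
    nra.
Qed.

Lemma dispersion_small t : Rabs t <= / INR l -> cA / (16 * k0) * A * (INR l * t) ^ 2 <= dispersion W r t.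
Proof.
  intros Ht. assert (L := INR_l_ge1). assert (K := k0_ge1). assert (CP := cA_pos). assert (AP := A_pos).
  eapply Rle_trans; [| apply (dispersion_lower l)]; [| lia]. fold A.
  assert (X : Rabs (INR l * t) <= 2).
  { rewrite Rabs_mult, (Rabs_right (INR l)) by lra.
    apply Rmult_le_compat_l with (r := INR l) in Ht; [| lra]. rewrite Rinv_r in Ht; lra. }
  apply one_minus_cos_ge in X.
  assert (0 < cA / (2 * k0) * A) by (apply Rmult_lt_0_compat; auto; apply Rdiv_lt_0_compat; lra).
  replace (cA / (16 * k0) * A * (INR l * t) ^ 2) with (cA / (2 * k0) * A * ((INR l * t) ^ 2 / 8)) by (field; lra).
  apply Rmult_le_compat_l; lra.
Qed.

(** A block length [q] of order [1 / |t|] keeps [q t] away from multiples of [2 PI]. The weight at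
    scale [q] exceeds [A] by the factor [(l / q) ^ (d / 2)], at least [sqrt (l / q)], and hence of
    order [sqrt (l |t|)]. *)
Lemma dispersion_large t : / INR l <= Rabs t <= PI ->
  cA / (128 * k0) * A * sqrt (INR l * Rabs t) <= dispersion W r t.
Proof.
  intros Ht. assert (L := INR_l_ge1). assert (K := k0_ge1). assert (CP := cA_pos). assert (AP := A_pos).
  assert (T0 : 0 < Rabs t) by (eapply Rlt_le_trans; [apply Rinv_0_lt_compat | apply Ht]; lra).
  assert (P4 := PI_4).
  (* For [|t| <= 1] the integer part of [1 / |t|] gives [q |t|] between 1/2 and 1; for [|t|] between
     1 and [PI] already [q = 1] works. *)
  assert (Key : exists q, (1 <= q <= l)%nat /\ / 32 <= 1 - cos (INR q * t) /\ Rabs t * INR q <= 4).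
  { destruct (Rle_or_lt (Rabs t) 1) as [T1 | T1].
    - destruct (nfloor_ex (/ Rabs t)) as [q [Q1 Q2]]. { now apply Rlt_le, Rinv_0_lt_compat. }
      assert (I1 : 1 <= / Rabs t) by (rewrite <- Rinv_1; now apply Rinv_le_contravar).
      assert (Hq1 : (1 <= q)%nat). { destruct q; [simpl in Q2; lra | lia]. }
      assert (Q3 := le_INR 1 q Hq1). simpl in Q3.
      assert (X1 : INR q * Rabs t <= 1).
      { apply Rmult_le_compat_r with (r := Rabs t) in Q1; [| lra]. rewrite Rinv_l in Q1; lra. }
      assert (X2 : / 2 <= INR q * Rabs t).
      { apply Rmult_lt_compat_r with (r := Rabs t) in Q2; auto. rewrite Rinv_l in Q2; nra. }
      exists q. repeat split; auto.
      + apply INR_le. apply Rle_trans with (1 := Q1). rewrite <- (Rinv_inv (INR l)).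
        apply Rinv_le_contravar; [apply Rinv_0_lt_compat; lra | apply Ht].
      + assert (Y : Rabs (INR q * t) = INR q * Rabs t) by (rewrite Rabs_mult, (Rabs_right (INR q)); lra).
        assert (Z := one_minus_cos_ge (INR q * t) ltac:(lra)). rewrite <- pow2_abs, Y in Z. nra.
      + lra.
    - exists 1%nat. simpl (INR 1). rewrite Rmult_1_l, Rmult_1_r. repeat split; auto; try lia; [| lra].
      destruct (Rle_or_lt (Rabs t) 2) as [T2 | T2].
      + assert (Z := one_minus_cos_ge t T2). rewrite <- pow2_abs in Z. nra.
      + assert (cos t <= 0); [| lra].
        assert (E : cos t = cos (Rabs t)).
        { unfold Rabs. destruct (Rcase_abs t); auto. now rewrite cos_neg. }
        rewrite E. apply cos_le_0; generalize PI2_3_2; lra. }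
  destruct Key as [q [Hq [C32 TQ]]].
  eapply Rle_trans; [| apply (dispersion_lower q); auto].
  assert (Q1 : 1 <= INR q) by (apply (le_INR 1); lia).
  assert (QL : INR q <= INR l) by (apply le_INR; lia).
  assert (SQ : 0 < sqrt (INR q)) by (apply sqrt_lt_R0; lra).
  assert (SL : 0 < sqrt (INR l)) by (apply sqrt_lt_R0; lra).
  set (x := sqrt (INR l) / sqrt (INR q)).
  assert (x1 : 1 <= x).
  { unfold x. apply Rmult_le_reg_r with (sqrt (INR q)); auto. unfold Rdiv.
    rewrite Rmult_assoc, Rinv_l by lra. rewrite Rmult_1_l, Rmult_1_r. now apply sqrt_le_1_alt. }
  assert (xd : x <= x ^ d).
  { rewrite <- (pow_1 x) at 1. now apply Rle_pow. }
  assert (VA : V / sqrt (INR q) ^ d = A * x ^ d).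
  { unfold A, x, Rdiv. rewrite Rpow_mult_distr, pow_inv. field. split; apply pow_nonzero; lra. }
  assert (LT : sqrt (INR l * Rabs t) <= 2 * x).
  { replace (2 * x) with (sqrt ((2 * x) ^ 2)) by (apply sqrt_pow2; lra).
    apply sqrt_le_1_alt. unfold x.
    replace ((2 * (sqrt (INR l) / sqrt (INR q))) ^ 2) with (4 * (sqrt (INR l) ^ 2 / sqrt (INR q) ^ 2)) by (field; lra).
    rewrite !pow2_sqrt by lra.
    apply Rmult_le_reg_r with (INR q); [lra|].
    replace (4 * (INR l / INR q) * INR q) with (4 * INR l) by (field; lra). nra. }
  rewrite VA.
  assert (c0 : 0 < cA / (128 * k0)) by (apply Rdiv_lt_0_compat; lra).
  replace (cA / (2 * k0)) with (64 * (cA / (128 * k0))) by (field; lra).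
  set (c1 := cA / (128 * k0)) in *.
  apply Rle_trans with (c1 * A * (2 * x)).
  - apply Rmult_le_compat_l; auto. apply Rlt_le, Rmult_lt_0_compat; auto.
  - apply Rle_trans with (64 * c1 * (A * x ^ d) * / 32).
    + replace (64 * c1 * (A * x ^ d) * / 32) with (c1 * A * (2 * x ^ d)) by field.
      apply Rmult_le_compat_l; [apply Rlt_le, Rmult_lt_0_compat; auto | lra].
    + apply Rmult_le_compat_l; auto. apply Rmult_le_pos; [lra|]. apply Rmult_le_pos; lra.
Qed.

End SaddleBounds.

(** * Uniform local limit *)

Lemma cv_infty_ge u B : cv_infty u -> exists N1, forall N, (N1 <= N)%nat -> B <= u N.
Proof.
  intros H. destruct (H B) as [N1 HN]. exists N1. intros N h. left. now apply HN.
Qed.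

Lemma uniform_local_limit (W : nat -> nat -> R) (G G1 G2 : nat -> R -> R) (H : nat -> nat -> R)
  (r V : nat -> R) (l jN : nat -> nat) d cW CU r0 j0 N0 :
  (1 <= d)%nat -> 0 < r0 -> 0 < cW -> (1 <= j0)%nat ->
  (forall N, (N0 <= N)%nat -> r0 <= r N < 1 /\ 0 < V N /\ (1 <= l N)%nat /\ 1 <= INR (l N) * (1 - r N) <= 2) ->
  (forall N j, (N0 <= N)%nat -> (1 <= j)%nat -> 0 <= W N j) ->
  (forall N j, (N0 <= N)%nat -> (j0 <= j)%nat -> cW * V N <= W N j * sqrt (INR j) ^ d) ->
  (forall N j, (N0 <= N)%nat -> (1 <= j)%nat ->
     W N j <= CU * (V N / sqrt (INR (l N)) ^ d * (1 + INR (l N) / INR j))) ->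
  (forall N z, (N0 <= N)%nat -> -1 < z < 1 ->
     infinite_sum (fun n => W N (S n) * z ^ S n / INR (S n)) (G N z)) ->
  (forall N z, (N0 <= N)%nat -> -1 < z < 1 -> derivable_pt_lim (G N) z (G1 N z)) ->
  (forall N z, (N0 <= N)%nat -> -1 < z < 1 -> derivable_pt_lim (G1 N) z (G2 N z)) ->
  (forall N z, (N0 <= N)%nat -> -1 < z < 1 -> infinite_sum (fun n => H N n * z ^ n) (exp (G N z))) ->
  (forall N, (N0 <= N)%nat -> r N * G1 N (r N) = INR N) ->
  (forall N, (N0 <= N)%nat -> (jN N <= N)%nat) ->
  cv_infty (fun N => V N / sqrt (INR (l N)) ^ d) ->
  let a := fun N => r N * G1 N (r N) + r N ^ 2 * G2 N (r N) in
  Un_cv (fun N => INR (jN N) ^ 2 / a N) 0 ->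
  forall eps, 0 < eps -> exists N1 : nat, forall N j : nat, (N1 <= N)%nat -> (j <= jN N)%nat ->
    Rabs (H N (N - j)%nat * r N ^ (N - j) * sqrt (2 * PI * a N) / exp (G N (r N)) - 1) < eps.
Proof.
  intros hd hr0 hcW hj0 hr hW hWl hWu hG hG1 hG2 hH hm hj hA a ha eps heps.
  pose (cA := cW * exp (- (2 * (INR j0 + 2) / r0)) / sqrt (INR j0 + 2) ^ d).
  assert (hcA : 0 < cA) by (apply cA_pos; auto).
  pose (k0 := INR j0 + 2). assert (hk0 : 1 <= k0) by apply k0_ge1.
  pose (c := cA / (128 * k0)). assert (hc : 0 < c) by (apply Rdiv_lt_0_compat; lra).
  pose (C := 2 * CU).
  assert (hCU : 0 <= CU).
  { destruct (hr N0 (le_n _)) as (h1 & h2 & h3 & h4).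
    apply (CU_pos (W N0) d (V N0) CU (l N0)); auto. }
  pose (D := 2 * (C / c + 256 * C / c ^ 4)).
  assert (hD : 0 <= D).
  { unfold D, C. assert (0 < c ^ 4) by (apply pow_lt; auto).
    apply Rmult_le_pos; [lra |]. apply Rplus_le_le_0_compat; apply Rmult_le_pos; try lra;
      left; now apply Rinv_0_lt_compat. }
  destruct (gauss_int_limit (eps / 4)) as (R0 & hR0 & hgauss); [lra|].
  (* [R0] brings the truncated Gaussian integral within [eps / 4], and [4 * D / eps] does the same
     for the outer tails; [e1] then makes the two central errors cost another [eps / 4]. *)
  pose (K := R0 + 4 * D / eps + 1).
  assert (hDe : 0 <= 4 * D / eps) by (apply Rmult_le_pos; [lra | left; now apply Rinv_0_lt_compat]).
  assert (hK : 0 < K) by (unfold K; lra).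
  pose (e1 := eps / (16 * K)). assert (he1 : 0 < e1) by (apply Rdiv_lt_0_compat; lra).
  (* With [S_] at least [sqrt (cA * A) * l], the third-moment error is at most
     [K ^ 3 * CU / (cA * sqrt (cA * A))]; it is below [e1] once [sqrt (cA * A) >= B1]. *)
  pose (B1 := K ^ 3 * CU / (cA * e1)).
  assert (hB1 : 0 <= B1).
  { apply Rmult_le_pos. apply Rmult_le_pos; auto. apply pow_le; lra.
    left. apply Rinv_0_lt_compat. now apply Rmult_lt_0_compat. }
  (* Forces [sqrt (cA * A) >= B1 + K]: the summand [B1] serves the third moment, and [K] keeps the
     cut-off inside the circle. The extra 1 gives [A >= 1]. *)
  destruct (cv_infty_ge _ (1 + (B1 + K) ^ 2 / cA) hA) as [Na HNa].
  destruct (ha ((e1 / K) ^ 2)) as [Nb HNb].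
  { apply pow_lt. now apply Rdiv_lt_0_compat. }
  exists (Nat.max N0 (Nat.max Na Nb)). intros N j hN hjj.
  assert (n0 : (N0 <= N)%nat) by lia. specialize (HNa N ltac:(lia)). specialize (HNb N ltac:(lia)).
  destruct (hr N n0) as (hrN & hV & hl & hl1 & hl2).
  assert (r01 : 0 < r N < 1) by lra.
  destruct (lam_summable (W N) (G N) (r N) r01 (fun z => hG N z n0)) as (s0 & s1 & s2 & s3).
  assert (Mean := mean_series (W N) (G N) (G1 N) (r N) r01 (fun z => hG N z n0) (fun z => hG1 N z n0)).
  assert (Var := variance_series (W N) (G N) (G1 N) (G2 N) (r N) r01
    (fun z => hG N z n0) (fun z => hG1 N z n0) (fun z => hG2 N z n0)).
  fold (a N) in Var.
  assert (PI_ := prob_integral (W N) (G N) (G1 N) (H N) (r N) r01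
    (fun z => hG N z n0) (fun z => hG1 N z n0) (fun z => hH N z n0) (N - j)%nat).
  assert (W0 := fun j h => hW N j n0 h). assert (Wl := fun j h => hWl N j n0 h).
  assert (Wu := fun j h => hWu N j n0 h).
  assert (vl := variance_lower (W N) (r N) d (V N) cW r0 j0 (l N) hd hr0 hrN hV hcW hj0 hl hl1 hl2 W0 Wl s2).
  assert (vu := variance_upper (W N) (r N) d (V N) CU r0 j0 (l N) hd hr0 hrN hV hj0 hl hl1 W0 Wu s2).
  assert (tu := third_upper (W N) (r N) d (V N) CU r0 j0 (l N) hd hr0 hrN hV hj0 hl hl1 W0 Wu s3).
  assert (ds := dispersion_small (W N) (r N) d (V N) cW r0 j0 (l N) hd hr0 hrN hV hcW hj0 hl hl2 W0 Wl s0).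
  assert (dl := dispersion_large (W N) (r N) d (V N) cW r0 j0 (l N) hd hr0 hrN hV hcW hj0 hl hl2 W0 Wl s0).
  assert (lg := fun n => lam_ge0 (W N) (r N) n ltac:(lra) W0).
  fold cA in vl, ds, dl. fold k0 in ds, dl.
  set (A := V N / sqrt (INR (l N)) ^ d) in *.
  assert (l1 : 1 <= INR (l N)) by (change 1 with (INR 1); now apply le_INR).
  assert (hq : 0 <= (B1 + K) ^ 2 / cA).
  { apply Rmult_le_pos; [apply pow2_ge_0 | left; now apply Rinv_0_lt_compat]. }
  assert (A1 : 1 <= A) by lra.
  assert (cAA : (B1 + K) ^ 2 <= cA * A).
  { replace ((B1 + K) ^ 2) with (cA * ((B1 + K) ^ 2 / cA)) by (field; lra).
    apply Rmult_le_compat_l; lra. }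
  rewrite <- Var in vl, vu.
  pose (s := sqrt (cA * A)).
  assert (ss : s * s = cA * A) by (apply sqrt_sqrt; nra).
  assert (sB : B1 + K <= s).
  { unfold s. rewrite <- (sqrt_pow2 (B1 + K)) by lra. apply sqrt_le_1_alt; auto. }
  assert (ap : 0 < a N). { eapply Rlt_le_trans; [| exact vl]. apply Rmult_lt_0_compat; [exact hcA |]. apply Rmult_lt_0_compat; [lra |]. apply pow_lt; lra. }
  pose (S_ := sqrt (a N)). assert (SS : S_ * S_ = a N) by (apply sqrt_sqrt; lra).
  assert (Sp : 0 < S_) by (apply sqrt_lt_R0; auto).
  assert (Sl : s * INR (l N) <= S_).
  { unfold S_. rewrite <- (sqrt_pow2 (s * INR (l N))).
    apply sqrt_le_1_alt. eapply Rle_trans; [| exact vl]. right.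
    replace ((s * INR (l N)) ^ 2) with (s * s * INR (l N) ^ 2) by ring. rewrite ss. ring.
    apply Rmult_le_pos; lra. }
  assert (sS : s <= S_) by nra.
  set (third := Series (fun n => INR n * (INR n * (INR n * lam (W N) (r N) n)))) in *.
  assert (T1 : third * K ^ 3 / (3 * S_ ^ 3) <= e1).
  { apply (Rmult_le_reg_r (3 * S_ ^ 3)). { apply Rmult_lt_0_compat; [lra | now apply pow_lt]. }
    replace (third * K ^ 3 / (3 * S_ ^ 3) * (3 * S_ ^ 3)) with (third * K ^ 3) by (field; lra).
    assert (K3 : 0 < K ^ 3) by now apply pow_lt.
    apply Rle_trans with (3 * CU * (A * INR (l N) ^ 3) * K ^ 3).
    { apply Rmult_le_compat_r; lra. }
    assert (cu : CU * K ^ 3 = B1 * (cA * e1)) by (unfold B1; field; lra).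
    replace (3 * CU * (A * INR (l N) ^ 3) * K ^ 3) with (3 * (CU * K ^ 3) * (A * INR (l N) ^ 3)) by ring.
    rewrite cu.
    replace (3 * (B1 * (cA * e1)) * (A * INR (l N) ^ 3)) with
      (e1 * (3 * ((cA * (A * INR (l N) ^ 2)) * (B1 * INR (l N))))) by ring.
    apply Rmult_le_compat_l; [lra|]. apply Rmult_le_compat_l; [lra|].
    replace (S_ ^ 3) with (S_ * S_ * S_) by ring. rewrite SS.
    apply Rmult_le_compat; auto.
    - apply Rmult_le_pos; [lra |]. apply Rmult_le_pos; [lra |]. apply pow_le; lra.
    - apply Rmult_le_pos; lra.
    - eapply Rle_trans; [| exact Sl]. apply Rmult_le_compat_r; lra. }
  assert (T2 : INR (jN N) * K / S_ <= e1).
  { unfold Rdist in HNb. rewrite Rminus_0_r in HNb. rewrite Rabs_right in HNb.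
    2: { apply Rle_ge, Rmult_le_pos; [apply pow2_ge_0 | left; now apply Rinv_0_lt_compat]. }
    assert (Q : (INR (jN N) / S_) ^ 2 <= (e1 / K) ^ 2).
    { rewrite <- SS in HNb. replace ((INR (jN N) / S_) ^ 2) with (INR (jN N) ^ 2 / (S_ * S_)) by (field; lra). lra. }
    assert (Q' : INR (jN N) / S_ <= e1 / K).
    { apply Rsqr_incr_0_var. - unfold Rsqr. nra. - apply Rmult_le_pos; [lra | left; now apply Rinv_0_lt_compat]. }
    replace (INR (jN N) * K / S_) with (INR (jN N) / S_ * K) by (field; lra).
    replace e1 with (e1 / K * K) by (field; lra). apply Rmult_le_compat_r; lra. }
  assert (Pi3 := PI_RGT_0). assert (Pi2 := PI2_1).
  assert (E := local_limit_estimate (lam (W N) (r N)) lg s0 s1 s2 s3 (N - j)%nat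
    (prob (G N) (H N) (r N) (N - j)) (INR (jN N)) c C A (INR (l N)) K).
  rewrite <- Var in E. fold S_ in E. fold third in E. rewrite <- Mean, (hm N n0) in E.
  assert (E' : Rabs (2 * PI * prob (G N) (H N) (r N) (N - j) * S_ - sqrt (2 * PI)) <=
     Rabs (RInt gauss (- K) K - sqrt (2 * PI)) + 2 * K * (third * K ^ 3 / (3 * S_ ^ 3) + INR (jN N) * K / S_) +
     2 * (C / c + 256 * C / c ^ 4) / K).
  { assert (jm : (jN N <= N)%nat) by (apply hj; auto).
    apply E; auto; try lra.
    - rewrite minus_INR by lia. replace (INR N - (INR N - INR j)) with (INR j) by ring.
      rewrite Rabs_right by (apply Rle_ge, pos_INR). now apply le_INR.
    - intros t ht. eapply Rle_trans; [| apply (ds t ht)].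
      apply Rmult_le_compat_r; [apply pow2_ge_0 |]. apply Rmult_le_compat_r; [lra|].
      unfold c, Rdiv. apply Rmult_le_compat_l; [lra|]. apply Rinv_le_contravar; lra.
    - apply Rle_trans with (1 * S_); [| apply Rmult_le_compat_r; lra]. lra. }
  clear E. fold D in E'.
  assert (gK : Rabs (RInt gauss (- K) K - sqrt (2 * PI)) <= eps / 4).
  { destruct (hgauss K) as [g1 g2]; [unfold K; lra|]. apply Rabs_le. lra. }
  assert (DK : D / K <= eps / 4).
  { apply (Rmult_le_reg_r K); auto. replace (D / K * K) with D by (field; lra).
    apply Rle_trans with (4 * D / eps * (eps / 4)); [right; field; lra |].
    rewrite (Rmult_comm (eps / 4)). apply Rmult_le_compat_r; [lra |]. unfold K. lra. }
  assert (MK : 2 * K * (third * K ^ 3 / (3 * S_ ^ 3) + INR (jN N) * K / S_) <= eps / 4).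
  { replace (eps / 4) with (2 * K * (e1 + e1)) by (unfold e1; field; lra).
    apply Rmult_le_compat_l; lra. }
  pose (q := sqrt (2 * PI)). fold q in E', gK.
  assert (qq : q * q = 2 * PI) by (apply sqrt_sqrt; lra).
  assert (q1 : 1 <= q). { unfold q. rewrite <- sqrt_1. apply sqrt_le_1_alt. lra. }
  rewrite sqrt_mult by lra. fold q S_.
  set (p := prob (G N) (H N) (r N) (N - j)) in *.
  replace (H N (N - j)%nat * r N ^ (N - j) * (q * S_) / exp (G N (r N)) - 1) with ((2 * PI * p * S_ - q) * / q).
  2: { unfold p, prob. rewrite <- qq. field. repeat split; try lra; apply Rgt_not_eq, exp_pos. }
  rewrite Rabs_mult, (Rabs_right (/ q)) by (apply Rle_ge; left; apply Rinv_0_lt_compat; lra).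
  assert (/ q <= 1) by (rewrite <- Rinv_1; apply Rinv_le_contravar; lra).
  apply Rle_lt_trans with (Rabs (2 * PI * p * S_ - q) * 1); [apply Rmult_le_compat_l; auto using Rabs_pos |].
  lra.
Qed.

(** * The weights *)

Lemma Un_cv_le_const u a B : Un_cv u a -> (forall n, u n <= B) -> a <= B.
Proof.
  intros C H. apply Rnot_lt_le. intros L. destruct (C (a - B)) as [N HN]; [lra|].
  specialize (HN N (le_n _)). specialize (H N). apply Rabs_def2 in HN. lra.
Qed.

Lemma Un_cv_ge_const u a B : Un_cv u a -> (forall n, B <= u n) -> B <= a.
Proof.
  intros C H. apply Rnot_lt_le. intros L. destruct (C (B - a)) as [N HN]; [lra|].
  specialize (HN N (le_n _)). specialize (H N). apply Rabs_def2 in HN. lra.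
Qed.

Lemma cube_sum_center d (g : Rn d -> R) L : cube_sum d 0 (fun k => g (zscale d L k)) = g (vzero d).
Proof.
  induction d as [|d IH]; [reflexivity|].
  change (cube_sum d 0 (fun k => g (L * 0, zscale d L k)) = g (0, vzero d)).
  rewrite (IH (fun y => g (L * 0, y))), Rmult_0_r. reflexivity.
Qed.

Section Weights.

Variables (d : nat) (theta : R) (phi : Rn d -> R) (psi : nat -> Rn d -> R) (W : R -> nat -> R).
Hypothesis theta_pos : 0 < theta.
Hypothesis phi_density : regular_density d phi.
Hypothesis psi1 : forall x, psi 1%nat x = phi x.
Hypothesis psi_orbit : orbit d phi (fun j => psi (S j)).
Hypothesis W_def : forall L j, 0 < L -> (1 <= j)%nat ->
  exists S, Zsum d (fun k => psi j (zscale d L k)) S /\ W L j = theta * L ^ d * S.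

(** All terms are nonnegative, so the single lattice point 0 is a lower bound; this term is the one
    controlled by the local limit. *)
Lemma weight_ge_center L j : 0 < L -> (1 <= j)%nat -> theta * L ^ d * psi j (vzero d) <= W L j.
Proof.
  intros hL hj. destruct (W_def L j hL hj) as (S_ & HS & ->).
  apply Rmult_le_compat_l. { apply Rmult_le_pos; [lra | apply pow_le; lra]. }
  apply (Un_cv_ge_const _ _ _ HS). intros M. rewrite <- (cube_sum_center d (psi j) L).
  apply cube_sum_mono; [lia |]. intros k. now apply (psi_ge0 d phi phi_density psi psi1 psi_orbit).
Qed.

Lemma weight_ge0 L j : 0 < L -> (1 <= j)%nat -> 0 <= W L j.
Proof.
  intros hL hj. eapply Rle_trans; [| now apply weight_ge_center].
  apply Rmult_le_pos; [apply Rmult_le_pos; [lra | apply pow_le; lra] |].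
  now apply (psi_ge0 d phi phi_density psi psi1 psi_orbit).
Qed.

Lemma weight_upper : exists C, 0 <= C /\ forall L j, 4 <= L -> (1 <= j)%nat ->
  W L j <= C * (1 + L / sqrt (INR j)) ^ d.
Proof.
  destruct (lattice_sum_upper d phi phi_density psi psi1 psi_orbit) as (C & hC & H).
  exists (theta * C). split. { apply Rmult_le_pos; lra. }
  intros L j hL hj. destruct (W_def L j ltac:(lra) hj) as (S_ & HS & ->).
  rewrite !Rmult_assoc. apply Rmult_le_compat_l; [lra|].
  assert (Lp : 0 < L ^ d) by (apply pow_lt; lra).
  apply (Rmult_le_reg_l (/ L ^ d)). { now apply Rinv_0_lt_compat. }
  rewrite <- Rmult_assoc, Rinv_l, Rmult_1_l by lra.
  apply (Un_cv_le_const _ _ _ HS). intros M.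
  apply (Rmult_le_reg_l (L ^ d)); auto. rewrite <- (Rmult_assoc _ (/ L ^ d)), Rinv_r, Rmult_1_l by lra.
  now apply H.
Qed.

End Weights.

(** * Growth of the density *)

Lemma Rpower_root_pow x d : 0 < x -> (1 <= d)%nat -> Rpower x (/ INR d) ^ d = x.
Proof.
  intros hx hd. rewrite <- Rpower_pow by apply exp_pos. rewrite Rpower_mult, Rinv_l.
  - now apply Rpower_1.
  - apply not_0_INR. lia.
Qed.

Lemma pow_le_inv x y d : 0 <= y -> x ^ d < y ^ d -> x < y.
Proof.
  intros hy h. apply Rnot_le_lt. intros L. assert (y ^ d <= x ^ d) by (apply pow_incr; lra). lra.
Qed.

Lemma pow_one_plus_le x d : 0 <= x -> (1 + x) ^ d <= 2 ^ d * (1 + x ^ d).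
Proof.
  intros hx. assert (0 < 2 ^ d) by (apply pow_lt; lra). assert (0 <= x ^ d) by (apply pow_le; lra).
  destruct (Rle_dec x 1).
  - assert ((1 + x) ^ d <= 2 ^ d) by (apply pow_incr; lra). nra.
  - assert ((1 + x) ^ d <= (2 * x) ^ d) by (apply pow_incr; lra). rewrite Rpow_mult_distr in H1. nra.
Qed.

Lemma pow_ge_bernoulli r n : 0 <= r <= 1 -> 1 - INR n * (1 - r) <= r ^ n.
Proof.
  intros hr. induction n as [|n IH]. { simpl. lra. }
  rewrite S_INR. simpl pow. assert (0 <= INR n) by apply pos_INR.
  assert (r ^ n <= 1). { rewrite <- (pow1 n). apply pow_incr. lra. } nra.
Qed.

Lemma harmonic_ge_ln s k : (1 <= s)%nat ->
  ln (INR (s + k + 1)) - ln (INR s) <= sum_f_R0 (fun i => / INR (s + i)) k.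
Proof.
  intros hs.
  assert (step : forall n, (1 <= n)%nat -> ln (INR (n + 1)) - ln (INR n) <= / INR n).
  { intros n hn. assert (0 < INR n) by (apply lt_0_INR; lia).
    assert (0 < / INR n) by now apply Rinv_0_lt_compat.
    replace (INR (n + 1)) with (INR n * (1 + / INR n)) by (rewrite plus_INR; simpl (INR 1); field; lra).
    rewrite ln_mult by lra.
    assert (ln (1 + / INR n) <= / INR n); [| lra].
    rewrite <- (ln_exp (/ INR n)) at 2. apply ln_le; [lra |]. now apply exp_ge_1_plus. }
  induction k as [|k IH].
  - simpl sum_f_R0. replace (s + 0 + 1)%nat with (s + 1)%nat by lia. rewrite Nat.add_0_r. now apply step.
  - simpl sum_f_R0. generalize (step (s + S k)%nat ltac:(lia)).
    replace (s + k + 1)%nat with (s + S k)%nat in IH by lia. lra.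
Qed.

Lemma INR_cv_infty : cv_infty INR.
Proof.
  intros B. destruct (nfloor_ex (Rmax B 0)) as [n [h1 h2]]. { apply Rmax_r. }
  exists (S n). intros N hN. apply le_INR in hN. rewrite S_INR in hN. generalize (Rmax_l B 0). lra.
Qed.

Lemma sqrt_INR_cv_infty : cv_infty (fun N => sqrt (INR N)).
Proof.
  intros B. destruct (INR_cv_infty (Rmax B 0 * Rmax B 0)) as [n hn]. exists n. intros N hN.
  apply Rle_lt_trans with (Rmax B 0); [apply Rmax_l |].
  rewrite <- (sqrt_square (Rmax B 0)) by apply Rmax_r. apply sqrt_lt_1_alt.
  split; [| now apply hn]. generalize (Rmax_r B 0). nra.
Qed.

Lemma ln_le_2sqrt x : 0 < x -> ln x <= 2 * sqrt x.
Proof.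
  intros hx. assert (s := sqrt_lt_R0 x hx).
  rewrite <- (sqrt_sqrt x) at 1 by lra. rewrite ln_mult by auto.
  assert (ln (sqrt x) <= sqrt x - 1); [| lra].
  generalize (exp_ineq1_le (ln (sqrt x))). rewrite exp_ln by auto. lra.
Qed.

Lemma ln_INR_cv_infty : cv_infty (fun N => ln (INR N)).
Proof.
  intros B. destruct (INR_cv_infty (exp B)) as [n hn]. exists n. intros N hN.
  rewrite <- (ln_exp B). apply ln_increasing; [apply exp_pos | now apply hn].
Qed.

Lemma cv_div_infty u a v : Un_cv u a -> cv_infty v -> Un_cv (fun N => u N / v N) 0.
Proof.
  intros hu hv eps heps. destruct (hu 1) as [n1 h1]; [lra|].
  destruct (hv ((Rabs a + 1) / eps)) as [n2 h2]. exists (Nat.max n1 n2). intros N hN.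
  specialize (h1 N ltac:(lia)). specialize (h2 N ltac:(lia)). unfold Rdist in *.
  assert (0 < (Rabs a + 1) / eps) by (apply Rdiv_lt_0_compat; generalize (Rabs_pos a); lra).
  rewrite Rminus_0_r. unfold Rdiv. rewrite Rabs_mult, Rabs_inv, (Rabs_right (v N)) by lra.
  apply (Rmult_lt_reg_r (v N)); [lra|]. rewrite Rmult_assoc, Rinv_l by lra. rewrite Rmult_1_r.
  apply Rle_lt_trans with (Rabs a + 1).
  - replace (u N) with ((u N - a) + a) by ring. eapply Rle_trans; [apply Rabs_triang |]. lra.
  - replace (Rabs a + 1) with (eps * ((Rabs a + 1) / eps)) by (field; lra).
    apply Rmult_lt_compat_l; auto.
Qed.

(* The regimes differ only in how fast the density may grow. *)
Lemma regime_cases d theta psi cov rho : regime d theta psi cov rho ->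
  (exists rho0 N1, 0 < rho0 /\ forall N, (N1 <= N)%nat -> rho0 <= rho N) /\
  ((d = 1%nat /\ Un_cv (fun N => rho N / sqrt (INR N)) 0) \/
   (d = 2%nat /\ exists alpha, (0 = alpha \/ 0 <= alpha < theta / (2 * PI * sqrt (cov 0%nat 0%nat * cov 1%nat 1%nat
                                 - cov 0%nat 1%nat * cov 1%nat 0%nat))) /\ Un_cv (fun N => rho N / ln (INR N)) alpha) \/
   ((3 <= d)%nat /\ exists rs rhoc, infinite_sum (fun n => theta * psi (S n) (vzero d)) rhoc /\
      0 < rs < rhoc /\ Un_cv rho rs)).
Proof.
  assert (fin : forall rs, 0 < rs -> Un_cv rho rs -> exists rho0 N1, 0 < rho0 /\ forall N, (N1 <= N)%nat -> rho0 <= rho N).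
  { intros rs h1 h2. destruct (h2 (rs / 2)) as [n hn]; [lra|]. exists (rs / 2), n. split; [lra|].
    intros N h. specialize (hn N h). apply Rabs_def2 in hn. lra. }
  assert (inf : cv_infty rho -> exists rho0 N1, 0 < rho0 /\ forall N, (N1 <= N)%nat -> rho0 <= rho N).
  { intros h. destruct (cv_infty_ge _ 1 h) as [n hn]. exists 1, n. split; [lra | auto]. }
  intros [(hd & rs & h1 & h2) | [(hd & h1 & h2) | [(hd & rs & h1 & h2) | [(hd & h1 & alpha & h2 & h3) | (hd & rs & rhoc & h1 & h2 & h3)]]]].
  - split; [eauto | left]. split; auto. eapply cv_div_infty; eauto using sqrt_INR_cv_infty.
  - split; [eauto | left]. auto.
  - split; [eauto | right; left]. split; auto. exists 0. split; auto. eapply cv_div_infty; eauto using ln_INR_cv_infty.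
  - split; [eauto | right; left]. split; auto. exists alpha. auto.
  - split; [eapply fin; eauto; lra | right; right]. eauto 10.
Qed.

(** In every regime the density is [O (sqrt N)], while [N / sqrt N] tends to infinity. *)
Lemma scale_cv_infty d theta psi cov rho : regime d theta psi cov rho -> cv_infty (fun N => INR N / rho N).
Proof.
  intros Hr. destruct (regime_cases _ _ _ _ _ Hr) as ((rho0 & N1 & r0 & hr0) & Hc).
  assert (Hs : exists M N2, 0 < M /\ forall N, (N2 <= N)%nat -> rho N <= M * sqrt (INR N)).
  { destruct Hc as [(_ & hc) | [(_ & alpha & ha & hc) | (_ & rs & rhoc & _ & hrs & hc)]].
    - destruct (hc 1) as [n hn]; [lra|]. exists 1, (Nat.max 1 n). split; [lra|]. intros N hN.
      specialize (hn N ltac:(lia)). apply Rabs_def2 in hn. destruct hn as [hn _]. rewrite Rminus_0_r in hn.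
      assert (0 < sqrt (INR N)) by (apply sqrt_lt_R0, lt_0_INR; lia).
      apply (Rmult_le_reg_r (/ sqrt (INR N))). { now apply Rinv_0_lt_compat. }
      rewrite Rmult_assoc, Rinv_r by lra. unfold Rdiv in hn. lra.
    - assert (a0 : 0 <= alpha) by lra.
      destruct (hc 1) as [n hn]; [lra|]. exists (2 * (alpha + 1)), (Nat.max 2 n). split; [lra|]. intros N hN.
      specialize (hn N ltac:(lia)). apply Rabs_def2 in hn. destruct hn as [hn _].
      assert (N2 : 2 <= INR N) by (change 2 with (INR 2); apply le_INR; lia).
      assert (0 < ln (INR N)) by (rewrite <- ln_1; apply ln_increasing; lra).
      assert (ln (INR N) <= 2 * sqrt (INR N)) by (apply ln_le_2sqrt; lra).
      apply Rle_trans with ((alpha + 1) * ln (INR N)).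
      + replace (rho N) with (rho N / ln (INR N) * ln (INR N)) by (field; lra). apply Rmult_le_compat_r; lra.
      + replace (2 * (alpha + 1) * sqrt (INR N)) with ((alpha + 1) * (2 * sqrt (INR N))) by ring.
        apply Rmult_le_compat_l; lra.
    - destruct (hc 1) as [n hn]; [lra|]. exists (rs + 1), (Nat.max 1 n). split; [lra|]. intros N hN.
      specialize (hn N ltac:(lia)). apply Rabs_def2 in hn.
      assert (1 <= sqrt (INR N)).
      { rewrite <- sqrt_1. apply sqrt_le_1_alt. change 1 with (INR 1). apply le_INR. lia. }
      nra. }
  destruct Hs as (M & N2 & M0 & hM). intros B.
  destruct (sqrt_INR_cv_infty (M * Rmax B 1)) as [N3 h3]. exists (Nat.max N1 (Nat.max N2 N3)). intros N hN.
  specialize (hM N ltac:(lia)). specialize (hr0 N ltac:(lia)). specialize (h3 N ltac:(lia)).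
  assert (b1 := Rmax_r B 1). assert (b2 := Rmax_l B 1).
  apply Rle_lt_trans with (Rmax B 1); auto.
  apply (Rmult_lt_reg_r (rho N)); [lra|]. replace (INR N / rho N * rho N) with (INR N) by (field; lra).
  rewrite <- (sqrt_sqrt (INR N)) by apply pos_INR.
  assert (0 < M * Rmax B 1) by nra.
  apply Rle_lt_trans with (Rmax B 1 * (M * sqrt (INR N))). { apply Rmult_le_compat_l; lra. }
  rewrite <- Rmult_assoc. apply Rmult_lt_compat_r; lra.
Qed.

(** * Growth of the saddle *)

(** The scale [l] of cycle lengths at which the tilting factor [r ^ j] becomes effective; rounding
    up gives [1 <= l * (1 - r) <= 2]. *)
Definition cutoff (r : R) : nat := Z.to_nat (up (/ (1 - r))).

Lemma cutoff_bounds r : 0 < r < 1 -> (1 <= cutoff r)%nat /\ 1 <= INR (cutoff r) * (1 - r) <= 2.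
Proof.
  intros hr. unfold cutoff. destruct (archimed (/ (1 - r))) as [h1 h2].
  assert (i1 : 0 < / (1 - r)) by (apply Rinv_0_lt_compat; lra).
  assert (e : / (1 - r) * (1 - r) = 1) by (field; lra).
  assert (zp : (0 < up (/ (1 - r)))%Z) by (apply lt_IZR; lra).
  rewrite INR_IZR_INZ, Z2Nat.id by lia. split; [lia |]. nra.
Qed.

Lemma pow_le_exponent r m n : 0 <= r <= 1 -> (m <= n)%nat -> r ^ n <= r ^ m.
Proof.
  intros hr h. induction h as [|n h IH]; [lra|]. simpl pow.
  assert (0 <= r ^ n) by (apply pow_le; lra). nra.
Qed.

(** Lets the lattice bound, with its power [d / 2] of [l / j], be put in the dimension-free form
    [1 + l / j]. It holds with constant 1 for [d <= 2]; in higher dimension it follows from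
    boundedness of [l]. *)
Definition cutoff_growth (d : nat) (r : nat -> R) (Mu : R) (N2 : nat) := 0 <= Mu /\ forall N j, (N2 <= N)%nat -> (1 <= j)%nat ->
  (sqrt (INR (cutoff (r N))) / sqrt (INR j)) ^ d <= Mu * (1 + INR (cutoff (r N)) / INR j).

Lemma cutoff_growth_low d r N2 : (1 <= d <= 2)%nat -> cutoff_growth d r 1 N2.
Proof.
  intros hd. split; [lra|]. intros N j h hj.
  assert (jp : 0 < INR j) by (apply lt_0_INR; lia).
  rewrite <- sqrt_div by (auto using pos_INR).
  assert (0 <= INR (cutoff (r N)) / INR j) by (apply Rmult_le_pos; [apply pos_INR | left; now apply Rinv_0_lt_compat]).
  set (q := INR (cutoff (r N)) / INR j) in *. assert (sq := sqrt_sqrt q H). assert (sp := sqrt_pos q).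
  assert (hd' : d = 1%nat \/ d = 2%nat) by lia.
  destruct hd' as [-> | ->]; simpl pow; nra.
Qed.

Section Saddle.

Variables (d : nat) (theta C rho0 : R) (psi : nat -> Rn d -> R) (W : nat -> nat -> R) (rho r L : nat -> R) (N1 : nat).
Hypothesis d_pos : (1 <= d)%nat.
Hypothesis theta_pos : 0 < theta.
Hypothesis C_ge0 : 0 <= C.
Hypothesis rho0_pos : 0 < rho0.
Hypothesis N1_pos : (1 <= N1)%nat.
Hypothesis W_ge0 : forall N j, (N1 <= N)%nat -> (1 <= j)%nat -> 0 <= W N j.
Hypothesis W_center : forall N j, (N1 <= N)%nat -> (1 <= j)%nat -> theta * L N ^ d * psi j (vzero d) <= W N j.
Hypothesis W_lattice : forall N j, (N1 <= N)%nat -> (1 <= j)%nat -> W N j <= C * (1 + L N / sqrt (INR j)) ^ d.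
Hypothesis L_ge4 : forall N, (N1 <= N)%nat -> 4 <= L N.
Hypothesis L_pow : forall N, (N1 <= N)%nat -> L N ^ d = INR N / rho N.
Hypothesis rho_ge : forall N, (N1 <= N)%nat -> rho0 <= rho N.
Hypothesis volume_infty : cv_infty (fun N => INR N / rho N).
Hypothesis r_01 : forall N, (N1 <= N)%nat -> 0 < r N < 1.
Hypothesis summable : forall N, (N1 <= N)%nat -> ex_series (fun n => Rabs (INR n * lam (W N) (r N) n)).
Hypothesis mean_eq : forall N, (N1 <= N)%nat -> INR N = Series (fun n => INR n * lam (W N) (r N) n).

Local Notation V N := (L N ^ d).
Local Notation l N := (cutoff (r N)).

Lemma volume_pos N : (N1 <= N)%nat -> 0 < V N.
Proof. intros h. apply pow_lt. generalize (L_ge4 N h). lra. Qed.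

Lemma size_eq N : (N1 <= N)%nat -> INR N = rho N * V N.
Proof. intros h. rewrite L_pow by auto. field. generalize (rho_ge N h). lra. Qed.

Lemma mean_term_ge0 N n : (N1 <= N)%nat -> 0 <= INR n * lam (W N) (r N) n.
Proof.
  intros h. destruct n as [|n]. { simpl (INR 0). lra. }
  rewrite INR_mul_lam by lia. apply Rmult_le_pos. apply W_ge0; auto; lia. apply pow_le. generalize (r_01 N h). lra.
Qed.

Lemma mean_block N s k : (N1 <= N)%nat -> (1 <= s)%nat ->
  sum_f_R0 (fun i => W N (s + i)%nat * r N ^ (s + i)) k <= INR N.
Proof.
  intros h hs. rewrite (mean_eq N h).
  eapply Rle_trans; [| apply (block_le_Series _ s k)].
  - right. apply sum_eq. intros i _. symmetry. apply INR_mul_lam. lia.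
  - apply ex_series_Rabs. now apply summable.
  - intros n. now apply mean_term_ge0.
Qed.

(** Every weight is at most [C * (2 L) ^ d], so the mean [rho * V] is at most
    [C * 2 ^ d * V * r / (1 - r)]. *)
Lemma radius_lower : forall N, (N1 <= N)%nat -> rho0 / (rho0 + C * 2 ^ d) <= r N.
Proof.
  intros N h. assert (h01 := r_01 N h). assert (hL := L_ge4 N h). assert (hr := rho_ge N h).
  assert (hV := volume_pos N h). assert (p2 : 0 < 2 ^ d) by (apply pow_lt; lra).
  set (B := C * (2 * L N) ^ d).
  assert (B0 : 0 <= B) by (apply Rmult_le_pos; auto; apply pow_le; lra).
  (* The mean has no term at [n = 0]. Keeping the resulting [- 1] produces [r / (1 - r)], which is
     what keeps [r] away from 0. *)
  assert (E : INR N <= B * (/ (1 - r N) - 1)).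
  { rewrite (mean_eq N h). apply Series_le_of_partial. { apply ex_series_Rabs. now apply summable. }
    intros M. apply Rle_trans with (B * (sum_f_R0 (fun n => r N ^ n) M - 1)).
    2: { apply Rmult_le_compat_l; auto. generalize (proj1 (sum_pow_moments (r N) M h01)). lra. }
    induction M as [|M IH]. { simpl. lra. }
    cbn [sum_f_R0]. rewrite INR_mul_lam by lia.
    assert (W N (S M) <= B).
    { eapply Rle_trans; [apply W_lattice; auto; lia |]. apply Rmult_le_compat_l; auto. apply pow_incr.
      assert (1 <= sqrt (INR (S M))).
      { rewrite <- sqrt_1. apply sqrt_le_1_alt. change 1 with (INR 1). apply le_INR. lia. }
      assert (/ sqrt (INR (S M)) <= 1) by (rewrite <- Rinv_1; apply Rinv_le_contravar; lra).
      assert (0 < / sqrt (INR (S M))) by (apply Rinv_0_lt_compat; lra). unfold Rdiv. nra. }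
    assert (0 <= r N ^ S M) by (apply pow_le; lra). nra. }
  unfold B in E. rewrite Rpow_mult_distr in E. rewrite (size_eq N h) in E.
  assert (E2 : rho N * (1 - r N) <= C * 2 ^ d * r N).
  { apply (Rmult_le_reg_r (V N / (1 - r N))). { apply Rdiv_lt_0_compat; lra. }
    replace (rho N * (1 - r N) * (V N / (1 - r N))) with (rho N * V N) by (field; lra).
    eapply Rle_trans; [exact E |]. right. field. lra. }
  assert (0 <= C * 2 ^ d) by (apply Rmult_le_pos; lra).
  apply (Rmult_le_reg_r (rho0 + C * 2 ^ d)); [lra|].
  replace (rho0 / (rho0 + C * 2 ^ d) * (rho0 + C * 2 ^ d)) with rho0 by (field; lra). nra.
Qed.

(** [L ^ d / j ^ (d / 2)] equals [A * (l / j) ^ (d / 2)], and the constant term of the lattice bound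
    is absorbed once [A >= 1]. *)
Lemma weight_upper_cutoff Mu N2 : cutoff_growth d r Mu N2 -> cv_infty (fun N => V N / sqrt (INR (l N)) ^ d) ->
  exists N3, (N1 <= N3)%nat /\ forall N j, (N3 <= N)%nat -> (1 <= j)%nat ->
   W N j <= C * 2 ^ d * (1 + Mu) * (V N / sqrt (INR (l N)) ^ d * (1 + INR (l N) / INR j)).
Proof.
  intros [Mu0 HM] HA. destruct (cv_infty_ge _ 1 HA) as [N3 H3]. exists (Nat.max N1 (Nat.max N2 N3)).
  split; [lia|]. intros N j hN hj.
  specialize (H3 N ltac:(lia)). specialize (HM N j ltac:(lia) hj). assert (h : (N1 <= N)%nat) by lia.
  set (A := V N / sqrt (INR (l N)) ^ d) in *.
  destruct (cutoff_bounds (r N) (r_01 N h)) as [hl _].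
  assert (l0 : 0 < sqrt (INR (l N))) by (apply sqrt_lt_R0, lt_0_INR; lia).
  assert (jp : 0 < INR j) by (apply lt_0_INR; lia).
  assert (j0 : 0 < sqrt (INR j)) by (apply sqrt_lt_R0; auto).
  assert (L4 := L_ge4 N h).
  eapply Rle_trans; [apply W_lattice; auto |].
  rewrite !Rmult_assoc. apply Rmult_le_compat_l; auto.
  assert (x0 : 0 <= L N / sqrt (INR j)) by (apply Rmult_le_pos; [lra | left; now apply Rinv_0_lt_compat]).
  eapply Rle_trans; [apply pow_one_plus_le; auto |].
  apply Rmult_le_compat_l. { apply pow_le. lra. }
  replace ((L N / sqrt (INR j)) ^ d) with (A * (sqrt (INR (l N)) / sqrt (INR j)) ^ d).
  2: { unfold A, Rdiv. rewrite !Rpow_mult_distr, !pow_inv. field. split; apply pow_nonzero; lra. }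
  assert (0 <= INR (l N) / INR j) by (apply Rmult_le_pos; [apply pos_INR | left; now apply Rinv_0_lt_compat]).
  set (q := INR (l N) / INR j) in *. 
  assert (A * (sqrt (INR (l N)) / sqrt (INR j)) ^ d <= A * (Mu * (1 + q))) by (apply Rmult_le_compat_l; lra).
  assert (1 <= A * (1 + q)) by nra. nra.
Qed.

(** From [cA * sqrt l <= rho] and [V = N / rho] one gets [V / sqrt l >= cA * N / rho ^ 2], which
    tends to infinity since [rho = o (sqrt N)]. *)
Lemma saddle_growth_1 c1 j1 : d = 1%nat -> 0 < c1 -> (1 <= j1)%nat ->
  (forall j, (j1 <= j)%nat -> c1 <= sqrt (INR j) ^ d * psi j (vzero d)) ->
  Un_cv (fun N => rho N / sqrt (INR N)) 0 ->
  cv_infty (fun N => V N / sqrt (INR (l N)) ^ d).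
Proof.
  intros d1 hc hj1 hpsi hrho.
  pose (r0 := rho0 / (rho0 + C * 2 ^ d)).
  assert (r0p : 0 < r0).
  { apply Rdiv_lt_0_compat; auto. assert (0 < 2 ^ d) by (apply pow_lt; lra).
    assert (0 <= C * 2 ^ d) by (apply Rmult_le_pos; lra). lra. }
  pose (cA := theta * c1 * exp (- (2 * (INR j1 + 2) / r0)) / sqrt (INR j1 + 2) ^ d).
  assert (cAp : 0 < cA) by (apply cA_pos; now apply Rmult_lt_0_compat).
  intros B. pose (e := cA / (Rmax B 1)). assert (b1 := Rmax_r B 1). assert (b2 := Rmax_l B 1).
  assert (ep : 0 < e) by (apply Rdiv_lt_0_compat; lra).
  destruct (hrho (sqrt e)) as [n hn]. { now apply sqrt_lt_R0. }
  exists (Nat.max N1 n). intros N hN. specialize (hn N ltac:(lia)). assert (h : (N1 <= N)%nat) by lia.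
  assert (Np : 0 < INR N) by (apply lt_0_INR; lia).
  destruct (cutoff_bounds (r N) (r_01 N h)) as (hl & hl1 & hl2).
  assert (hr := rho_ge N h).
  assert (Mn : cA * (V N / sqrt (INR (l N)) ^ d * INR (l N)) <= INR N).
  { rewrite (mean_eq N h).
    apply (mean_lower (W N) (r N) d (V N) (theta * c1) r0 j1 (l N)); auto.
    - split; [now apply radius_lower | apply r_01; auto].
    - now apply volume_pos.
    - now apply Rmult_lt_0_compat.
    - intros j hj. assert (hj' : (1 <= j)%nat) by lia.
      assert (0 <= sqrt (INR j) ^ d) by (apply pow_le, sqrt_pos).
      assert (0 < theta * V N) by (apply Rmult_lt_0_compat; auto; now apply volume_pos).
      apply Rle_trans with (theta * V N * psi j (vzero d) * sqrt (INR j) ^ d).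
      + specialize (hpsi j hj). nra.
      + apply Rmult_le_compat_r; auto. }
  assert (Vp := volume_pos N h). assert (Se := size_eq N h).
  set (sl := sqrt (INR (l N))) in *.
  assert (slp : 0 < sl) by (apply sqrt_lt_R0, lt_0_INR; lia).
  assert (sl2 : sl * sl = INR (l N)) by (apply sqrt_sqrt, pos_INR).
  replace (sl ^ d) with sl in * by (rewrite d1; ring).
  rewrite <- sl2 in Mn. replace (V N / sl * (sl * sl)) with (V N * sl) in Mn by (field; lra).
  assert (M2 : cA * sl <= rho N).
  { apply (Rmult_le_reg_r (V N)); auto. lra. }
  unfold Rdist in hn. rewrite Rminus_0_r in hn.
  assert (sN : 0 < sqrt (INR N)) by now apply sqrt_lt_R0.
  rewrite Rabs_right in hn.
  2: { apply Rle_ge, Rmult_le_pos; [lra | left; now apply Rinv_0_lt_compat]. }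
  assert (se := sqrt_sqrt e ltac:(lra)). assert (sN2 := sqrt_sqrt (INR N) ltac:(lra)).
  assert (hn' : rho N < sqrt e * sqrt (INR N)).
  { replace (rho N) with (rho N / sqrt (INR N) * sqrt (INR N)) by (field; lra). now apply Rmult_lt_compat_r. }
  assert (rr : rho N * rho N < e * INR N).
  { rewrite <- se, <- sN2. replace (sqrt e * sqrt e * (sqrt (INR N) * sqrt (INR N))) with
      ((sqrt e * sqrt (INR N)) * (sqrt e * sqrt (INR N))) by ring. apply Rmult_le_0_lt_compat; lra. }
  apply Rle_lt_trans with (Rmax B 1); auto.
  apply (Rmult_lt_reg_r sl); auto. replace (V N / sl * sl) with (V N) by (field; lra).
  apply (Rmult_lt_reg_l (rho N * cA)). { apply Rmult_lt_0_compat; lra. }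
  replace (rho N * cA * V N) with (cA * INR N) by (rewrite Se; ring).
  apply Rle_lt_trans with (Rmax B 1 * (rho N * rho N)).
  - replace (rho N * cA * (Rmax B 1 * sl)) with (Rmax B 1 * (rho N * (cA * sl))) by ring.
    apply Rmult_le_compat_l; [lra|]. apply Rmult_le_compat_l; lra.
  - replace (cA * INR N) with (Rmax B 1 * (e * INR N)) by (unfold e; field; lra). apply Rmult_lt_compat_l; lra.
Qed.

(** The weights give [beta * V] times a harmonic sum from [j1] to [l]. Bernoulli's inequality
    replaces [r ^ j] by [1 - j (1 - r)], and this loss totals at most [l * (1 - r) <= 2]. *)
Lemma density_ge_log_cutoff beta j1 : d = 2%nat -> 0 < beta -> (1 <= j1)%nat ->
  (forall j, (j1 <= j)%nat -> beta <= theta * (sqrt (INR j) ^ d * psi j (vzero d))) ->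
  forall N, (N1 <= N)%nat -> beta * (ln (INR (l N)) - ln (INR j1) - 2) <= rho N.
Proof.
  intros d2 hb hj1 hpsi N h.
  assert (h01 := r_01 N h). assert (hV := volume_pos N h). assert (hr := rho_ge N h).
  destruct (cutoff_bounds (r N) h01) as (hl & hl1 & hl2).
  assert (lp : 0 < INR (l N)) by (apply lt_0_INR; lia).
  assert (jp : 0 < INR j1) by (apply lt_0_INR; lia).
  destruct (Nat.lt_ge_cases (l N) j1) as [c | c].
  { assert (ln (INR (l N)) <= ln (INR j1)) by (apply ln_le; auto; apply le_INR; lia). nra. }
  assert (Mb := mean_block N j1 (l N - j1) h hj1).
  apply (Rmult_le_reg_r (V N)); auto. rewrite <- (size_eq N h).
  eapply Rle_trans; [| exact Mb].
  apply Rle_trans with (sum_f_R0 (fun i => (/ INR (j1 + i) - (1 - r N)) * (beta * V N)) (l N - j1)).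
  - rewrite <- scal_sum, minus_sum, sum_cte.
    assert (Hh := harmonic_ge_ln j1 (l N - j1) hj1).
    assert (ln (INR (l N)) <= ln (INR (j1 + (l N - j1) + 1))) by (apply ln_le; auto; apply le_INR; lia).
    assert ((1 - r N) * INR (S (l N - j1)) <= 2).
    { assert (INR (S (l N - j1)) <= INR (l N)) by (apply le_INR; lia). nra. }
    replace (beta * (ln (INR (l N)) - ln (INR j1) - 2) * V N) with (beta * V N * (ln (INR (l N)) - ln (INR j1) - 2)) by ring.
    apply Rmult_le_compat_l; [apply Rmult_le_pos |]; lra.
  - apply sum_Rle. intros i hi.
    assert (ip : 0 < INR (j1 + i)) by (apply lt_0_INR; lia).
    assert (Bn := pow_ge_bernoulli (r N) (j1 + i) ltac:(lra)).
    assert (rp : 0 <= r N ^ (j1 + i)) by (apply pow_le; lra).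
    assert (P := hpsi (j1 + i)%nat ltac:(lia)).
    replace (sqrt (INR (j1 + i)) ^ d) with (INR (j1 + i)) in P
      by (rewrite d2; rewrite <- (sqrt_sqrt (INR (j1 + i))) at 1 by lra; ring).
    assert (Wc := W_center N (j1 + i)%nat h ltac:(lia)).
    assert (P2 : beta * V N * / INR (j1 + i) <= W N (j1 + i)%nat).
    { eapply Rle_trans; [| exact Wc]. apply (Rmult_le_reg_r (INR (j1 + i))); auto.
      replace (beta * V N * / INR (j1 + i) * INR (j1 + i)) with (V N * beta) by (field; lra).
      replace (theta * V N * psi (j1 + i)%nat (vzero d) * INR (j1 + i)) with
        (V N * (theta * (INR (j1 + i) * psi (j1 + i)%nat (vzero d)))) by ring.
      apply Rmult_le_compat_l; lra. }
    apply Rle_trans with (beta * V N * / INR (j1 + i) * r N ^ (j1 + i)); [| apply Rmult_le_compat_r; auto].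
    assert (0 < / INR (j1 + i)) by now apply Rinv_0_lt_compat.
    replace ((/ INR (j1 + i) - (1 - r N)) * (beta * V N)) with
      (beta * V N * (/ INR (j1 + i) - (1 - r N))) by ring.
    rewrite (Rmult_assoc _ (/ _)). apply Rmult_le_compat_l; [apply Rmult_le_pos; lra |].
    apply Rle_trans with (/ INR (j1 + i) * (1 - INR (j1 + i) * (1 - r N))).
    + right. field. lra.
    + apply Rmult_le_compat_l; lra.
Qed.

(** On logarithmic scale: [ln l <= rho / beta + O(1)] and [ln V = ln N - ln rho]. As [rho] is about
    [alpha * ln N] with [alpha < beta], the difference is at least a positive multiple of [ln N], up
    to a constant. *)
Lemma saddle_growth_2 alpha beta j1 : d = 2%nat -> 0 <= alpha < beta -> (1 <= j1)%nat ->
  (forall j, (j1 <= j)%nat -> beta <= theta * (sqrt (INR j) ^ d * psi j (vzero d))) ->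
  Un_cv (fun N => rho N / ln (INR N)) alpha ->
  cv_infty (fun N => V N / sqrt (INR (l N)) ^ d).
Proof.
  intros d2 ha hj1 hpsi hrho.
  assert (Hl := density_ge_log_cutoff beta j1 d2 ltac:(lra) hj1 hpsi).
  assert (ib : 0 < / beta) by (apply Rinv_0_lt_compat; lra).
  assert (ab : 0 <= alpha * / beta < 1).
  { split; [apply Rmult_le_pos; lra |]. apply (Rmult_lt_reg_r beta); [lra |].
    rewrite Rmult_assoc, Rinv_l by lra. lra. }
  (* Half of the gap [1 - alpha / beta]; [de] is small enough for
     [(alpha + de) (1 / beta + de) <= 1 - ka]. *)
  pose (ka := (1 - alpha * / beta) / 2). assert (kap : 0 < ka <= / 2) by (unfold ka; lra).
  pose (w := alpha + / beta + 1). assert (w1 : 1 <= w) by (unfold w; lra).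
  pose (de := ka / w).
  assert (dp : 0 < de) by (apply Rdiv_lt_0_compat; lra).
  assert (dw : de * w = ka) by (unfold de; field; lra).
  assert (d1 : de <= 1) by nra.
  assert (dk : (alpha + de) * (/ beta + de) <= 1 - ka).
  { replace ((alpha + de) * (/ beta + de)) with (alpha * / beta + de * (w - 1 + de)) by (unfold w; ring).
    assert (de * (w - 1 + de) <= de * w) by (apply Rmult_le_compat_l; lra).
    assert (1 - ka = alpha * / beta + ka) by (unfold ka; lra). lra. }
  intros B. pose (B' := Rmax B 1). assert (b1 := Rmax_r B 1). assert (b2 := Rmax_l B 1). fold B' in b1, b2.
  pose (c0 := 1 - ln de + ln (INR j1) + ln B').
  destruct (ln_INR_cv_infty (Rmax (c0 / ka) 0)) as [na hna]. 
  destruct (hrho de dp) as [nb hnb].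
  exists (Nat.max N1 (Nat.max na nb)). intros N hN. specialize (hna N ltac:(lia)). specialize (hnb N ltac:(lia)).
  assert (h : (N1 <= N)%nat) by lia. specialize (Hl N h).
  assert (hr := rho_ge N h). assert (hV := volume_pos N h).
  destruct (cutoff_bounds (r N) (r_01 N h)) as (hl & _).
  assert (lp : 0 < INR (l N)) by (apply lt_0_INR; lia).
  assert (ln0 : 0 < ln (INR N)) by (generalize (Rmax_r (c0 / ka) 0); lra).
  assert (lnc : c0 < ka * ln (INR N)).
  { replace c0 with (ka * (c0 / ka)) by (field; lra). apply Rmult_lt_compat_l; [lra|].
    generalize (Rmax_l (c0 / ka) 0). lra. }
  replace (sqrt (INR (l N)) ^ d) with (INR (l N))
      by (rewrite d2; rewrite <- (sqrt_sqrt (INR (l N))) at 1 by lra; ring).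
  assert (hb : rho N < (alpha + de) * ln (INR N)).
  { apply Rabs_def2 in hnb. replace (rho N) with (rho N / ln (INR N) * ln (INR N)) by (field; lra).
    apply Rmult_lt_compat_r; lra. }
  (* The logarithm lies below a line of arbitrarily small slope, so [ln rho] is absorbed into the
     linear term. *)
  assert (lr : ln (rho N) <= de * rho N - 1 - ln de).
  { assert (E := exp_ineq1_le (ln (de * rho N))). assert (0 < de * rho N) by nra. rewrite exp_ln in E by auto.
    rewrite ln_mult in E by lra. lra. }
  assert (ll : ln (INR (l N)) <= rho N * / beta + ln (INR j1) + 2).
  { apply (Rmult_le_compat_l (/ beta)) in Hl; [| lra]. rewrite <- Rmult_assoc, Rinv_l, Rmult_1_l in Hl by lra. lra. }
  assert (Np : 0 < INR N) by (apply lt_0_INR; lia).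
  assert (lN : ln (INR N) = ln (rho N) + ln (V N)) by (rewrite (size_eq N h) at 1; apply ln_mult; lra).
  apply Rle_lt_trans with B'; auto.
  apply ln_lt_inv; [lra | apply Rdiv_lt_0_compat; auto |].
  rewrite ln_div by auto.
  assert (rho N * (/ beta + de) <= (1 - ka) * ln (INR N)).
  { apply Rle_trans with ((alpha + de) * ln (INR N) * (/ beta + de)). { apply Rmult_le_compat_r; lra. }
    replace ((alpha + de) * ln (INR N) * (/ beta + de)) with ((alpha + de) * (/ beta + de) * ln (INR N)) by ring.
    apply Rmult_le_compat_r; lra. }
  unfold c0 in lnc. lra.
Qed.

(** Finitely many terms of the series for [rhoc] already exceed [rs]. Were [r] close to 1, these
    terms alone would give a mean above [rho * V]. *)
Lemma cutoff_bounded_3 rs rhoc :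
  infinite_sum (fun n => theta * psi (S n) (vzero d)) rhoc -> 0 < rs < rhoc -> Un_cv rho rs ->
  exists lb N2, 1 <= lb /\ (N1 <= N2)%nat /\ forall N, (N2 <= N)%nat -> INR (l N) <= lb.
Proof.
  intros hs hrs hrho. pose (de := (rhoc - rs) / 3). assert (dp : 0 < de) by (unfold de; lra).
  destruct (hs de dp) as [m hm]. specialize (hm m (le_n _)). apply Rabs_def2 in hm. destruct hm as [_ hm].
  destruct (hrho de dp) as [n hn].
  (* The partial sum up to [m] exceeds [rs + 2 * de] and [rho] is eventually below [rs + de], so
     [r ^ (m + 1)] is at most their ratio [q < 1]. *)
  pose (q := (rs + de) / (rs + 2 * de)).
  assert (q01 : q < 1). { apply (Rmult_lt_reg_r (rs + 2 * de)); [lra|]. unfold q. replace ((rs + de) / (rs + 2 * de) * (rs + 2 * de)) with (rs + de) by (field; lra). lra. }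
  pose (lb := Rmax 1 (2 * INR (S m) / (1 - q))).
  exists lb, (Nat.max N1 n). split; [apply Rmax_l |]. split; [lia|].
  intros N hN. assert (h : (N1 <= N)%nat) by lia. specialize (hn N ltac:(lia)). apply Rabs_def2 in hn. destruct hn as [hn _].
  assert (h01 := r_01 N h). assert (hV := volume_pos N h).
  destruct (cutoff_bounds (r N) h01) as (hl & hl1 & hl2).
  assert (Mb := mean_block N 1 m h (le_n _)). rewrite (size_eq N h) in Mb.
  assert (rp : 0 < r N ^ S m) by (apply pow_lt; lra).
  assert (Mc : V N * r N ^ S m * sum_f_R0 (fun n => theta * psi (S n) (vzero d)) m <= rho N * V N).
  { eapply Rle_trans; [| exact Mb]. rewrite scal_sum. apply sum_Rle. intros i hi. simpl (1 + i)%nat.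
    assert (Wc := W_center N (S i) h ltac:(lia)).
    assert (W0 := W_ge0 N (S i) h ltac:(lia)).
    assert (r N ^ S m <= r N ^ S i) by (apply pow_le_exponent; lra || lia).
    apply Rle_trans with (W N (S i) * r N ^ S m).
    - replace (theta * psi (S i) (vzero d) * (V N * r N ^ S m)) with (theta * V N * psi (S i) (vzero d) * r N ^ S m) by ring.
      apply Rmult_le_compat_r; lra.
    - apply Rmult_le_compat_l; lra. }
  assert (rq : r N ^ S m <= q).
  { apply (Rmult_le_reg_r (rs + 2 * de)); [lra|]. unfold q.
    replace ((rs + de) / (rs + 2 * de) * (rs + 2 * de)) with (rs + de) by (field; lra).
    apply (Rmult_le_reg_r (V N)); auto.
    apply Rle_trans with (V N * r N ^ S m * sum_f_R0 (fun n => theta * psi (S n) (vzero d)) m).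
    - replace (r N ^ S m * (rs + 2 * de) * V N) with (V N * r N ^ S m * (rs + 2 * de)) by ring.
      apply Rmult_le_compat_l; [left; now apply Rmult_lt_0_compat |]. unfold de in *. lra.
    - eapply Rle_trans; [exact Mc |]. apply Rmult_le_compat_r; lra. }
  assert (Bn := pow_ge_bernoulli (r N) (S m) ltac:(lra)).
  eapply Rle_trans; [| apply Rmax_r].
  apply (Rmult_le_reg_r (1 - q)); [lra|].
  replace (2 * INR (S m) / (1 - q) * (1 - q)) with (2 * INR (S m)) by (field; lra).
  assert (0 <= INR (l N)) by apply pos_INR. assert (0 <= INR (S m)) by apply pos_INR.
  apply Rle_trans with (INR (l N) * (INR (S m) * (1 - r N))).
  - apply Rmult_le_compat_l; lra.
  - replace (INR (l N) * (INR (S m) * (1 - r N))) with (INR (l N) * (1 - r N) * INR (S m)) by ring.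
    apply Rmult_le_compat_r; lra.
Qed.

(** With [l] bounded, [(l / j) ^ (d / 2)] is bounded and the volume alone drives [A] to infinity. *)
Lemma saddle_growth_3 lb N2 : 1 <= lb -> (N1 <= N2)%nat -> (forall N, (N2 <= N)%nat -> INR (l N) <= lb) ->
  cutoff_growth d r (sqrt lb ^ d) N2 /\ cv_infty (fun N => V N / sqrt (INR (l N)) ^ d).
Proof.
  intros hlb hN2 hl.
  assert (slb : 1 <= sqrt lb) by (rewrite <- sqrt_1; apply sqrt_le_1_alt; auto).
  assert (sd : 0 < sqrt lb ^ d) by (apply pow_lt; lra).
  assert (sl : forall N, (N2 <= N)%nat -> 0 < sqrt (INR (l N)) <= sqrt lb).
  { intros N h. split.
    - destruct (cutoff_bounds (r N) (r_01 N ltac:(lia))) as (hl' & _). apply sqrt_lt_R0, lt_0_INR. lia.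
    - apply sqrt_le_1_alt. auto. }
  split; [split; [lra|] |].
  - intros N j h hj. specialize (sl N h).
    assert (jp : 1 <= INR j) by (change 1 with (INR 1); apply le_INR; lia).
    assert (sj : 1 <= sqrt (INR j)) by (rewrite <- sqrt_1; apply sqrt_le_1_alt; auto).
    assert (0 <= INR (l N) / INR j) by (apply Rmult_le_pos; [apply pos_INR | left; apply Rinv_0_lt_compat; lra]).
    apply Rle_trans with (sqrt lb ^ d * 1); [| apply Rmult_le_compat_l; lra].
    rewrite Rmult_1_r. apply pow_incr.
    assert (/ sqrt (INR j) <= 1) by (rewrite <- Rinv_1; apply Rinv_le_contravar; lra).
    assert (0 < / sqrt (INR j)) by (apply Rinv_0_lt_compat; lra). unfold Rdiv. nra.
  - intros B. destruct (volume_infty (Rmax B 0 * sqrt lb ^ d)) as [n hn]. exists (Nat.max N2 n). intros N hN.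
    specialize (hn N ltac:(lia)). rewrite <- L_pow in hn by lia.
    specialize (sl N ltac:(lia)). assert (b1 := Rmax_l B 0). assert (b2 := Rmax_r B 0).
    apply Rle_lt_trans with (Rmax B 0); auto.
    assert (sp : 0 < sqrt (INR (l N)) ^ d) by (apply pow_lt; lra).
    apply (Rmult_lt_reg_r (sqrt (INR (l N)) ^ d)); auto.
    replace (V N / sqrt (INR (l N)) ^ d * sqrt (INR (l N)) ^ d) with (V N) by (field; lra).
    eapply Rle_lt_trans; [| exact hn]. apply Rmult_le_compat_l; auto. apply pow_incr. lra.
Qed.

End Saddle.

(** [theta * q] is [alpha_c]. The gap to [alpha] is cut in three: one third is lost on the Gaussian
    sums, one third on the local limit, and the last separates [beta] from [alpha]. *)
Lemma planar_center_lower d theta phi psi cov alpha : d = 2%nat -> 0 < theta -> regular_density d phi ->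
  (forall i, (i < d)%nat -> isE d phi (fun x => coord d x i) 0) ->
  (forall i j, (i < d)%nat -> (j < d)%nat -> isE d phi (fun x => coord d x i * coord d x j) (cov i j)) ->
  (forall x, psi 1%nat x = phi x) -> orbit d phi (fun j => psi (S j)) ->
  (0 = alpha \/ 0 <= alpha < theta / (2 * PI * sqrt (cov 0%nat 0%nat * cov 1%nat 1%nat - cov 0%nat 1%nat * cov 1%nat 0%nat))) ->
  exists beta j1, 0 <= alpha < beta /\ (1 <= j1)%nat /\
    forall j, (j1 <= j)%nat -> beta <= theta * (sqrt (INR j) ^ d * psi j (vzero d)).
Proof.
  intros -> htheta dens hmean hcov hpsi1 orb halpha.
  (* The value 0 is a placeholder: only positivity of the determinant is extracted here. *)
  destruct (gaussian_sums_ge_plane phi cov 0 dens hcov) as [det_pos _].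
  set (det := cov 0%nat 0%nat * cov 1%nat 1%nat - cov 0%nat 1%nat * cov 1%nat 0%nat) in *.
  set (q := / (2 * PI * sqrt det)).
  assert (hq : 0 < q).
  { apply Rinv_0_lt_compat, Rmult_lt_0_compat; [generalize PI_RGT_0; lra | now apply sqrt_lt_R0]. }
  assert (hq' : 0 < theta * q) by now apply Rmult_lt_0_compat.
  assert (ha : 0 <= alpha < theta * q) by (unfold Rdiv in halpha; fold q in halpha; lra).
  pose (e := (q - alpha / theta) / 3).
  assert (te : theta * e = (theta * q - alpha) / 3) by (unfold e; field; lra).
  assert (he : 0 < e) by (apply (Rmult_lt_reg_l theta); auto; lra).
  destruct (gaussian_sums_ge_plane phi cov (q - e) dens hcov) as [_ hg].
  destruct (local_limit_lower 2 phi dens cov hmean hcov psi hpsi1 orb (q - e) (q - 2 * e)) as (j0 & hj0).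
  { apply hg. change (q - e < q). lra. } { lra. }
  exists (theta * (q - 2 * e)), (Nat.max 1 j0). split; [lra|]. split; [lia|].
  intros j hj. apply Rmult_le_compat_l; [lra|]. apply hj0. lia.
Qed.

Theorem mainTheorem13
  (d : nat) (theta : R) (phi : Rn d -> R) (psi : nat -> Rn d -> R)
  (cov : nat -> nat -> R) (W : R -> nat -> R) (G G1 G2 : R -> R -> R)
  (H : R -> nat -> R) (rho : nat -> R) (r : nat -> R) (jN : nat -> nat)
  (N0 : nat) :
  (1 <= d)%nat -> 0 < theta ->
  (* X has Schwartz density phi, mean 0, covariance cov *)
  schwartz d phi -> (forall x, 0 <= phi x) -> integral d phi 1 ->
  (forall i, (i < d)%nat -> integral d (fun x => coord d x i * phi x) 0) ->
  (forall i j, (i < d)%nat -> (j < d)%nat ->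
     integral d (fun x => coord d x i * coord d x j * phi x) (cov i j)) ->
  (* psi j = phi^{*j} *)
  (forall x, psi 1%nat x = phi x) ->
  (forall j x, (1 <= j)%nat ->
     integral d (fun y => psi j (vsub d x y) * phi y) (psi (S j) x)) ->
  (* W L j = theta L^d sum_{k in Z^d} phi^{*j}(L k) *)
  (forall L j, 0 < L -> (1 <= j)%nat ->
     exists S, Zsum d (fun k => psi j (zscale d L k)) S /\
               W L j = theta * L ^ d * S) ->
  (* G_L(z) = sum_{j>=1} W_{L,j} z^j / j, with derivatives G1 = G_L', G2 = G_L'' *)
  (forall L z, 0 < L -> -1 < z < 1 ->
     infinite_sum (fun n => W L (S n) * z ^ (S n) / INR (S n)) (G L z)) ->
  (forall L z, 0 < L -> -1 < z < 1 -> derivable_pt_lim (G L) z (G1 L z)) ->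
  (forall L z, 0 < L -> -1 < z < 1 -> derivable_pt_lim (G1 L) z (G2 L z)) ->
  (* sum_n H_n(L) z^n = exp(G_L(z)) *)
  (forall L z, 0 < L -> -1 < z < 1 ->
     infinite_sum (fun n => H L n * z ^ n) (exp (G L z))) ->
  regime d theta psi cov rho ->
  let L := fun N : nat => Rpower (INR N / rho N) (/ INR d) in
  (forall N, (N0 <= N)%nat -> 0 < r N < 1 /\ r N * G1 (L N) (r N) = INR N) ->
  let a := fun N : nat => r N * G1 (L N) (r N) + r N ^ 2 * G2 (L N) (r N) in
  (forall N, (N0 <= N)%nat -> (1 <= jN N <= N)%nat) ->
  Un_cv (fun N => INR (jN N) ^ 2 / a N) 0 ->
  forall eps, 0 < eps -> exists N1 : nat, forall N j : nat,
    (N1 <= N)%nat -> (j <= jN N)%nat ->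
    Rabs (H (L N) (N - j)%nat * r N ^ (N - j) * sqrt (2 * PI * a N)
          / exp (G (L N) (r N)) - 1) < eps.

Proof.
  intros hd htheta hschwartz hphi0 hphi1 hmean hcov hpsi1 hpsi hW hG hG1 hG2 hH hreg L hr a hj ha.
  assert (dens := schwartz_regular_density d phi hd hschwartz hphi0 hphi1).
  assert (orb : orbit d phi (fun j => psi (S j))) by (intros j x; apply (hpsi (S j) x); lia).
  assert (hWc := weight_ge_center d theta phi psi W htheta dens hpsi1 orb hW).
  assert (hW0 := weight_ge0 d theta phi psi W htheta dens hpsi1 orb hW).
  destruct (weight_upper d theta phi psi W htheta dens hpsi1 orb hW) as (C & hC & hWu).
  assert (LLL := local_limit_lower d phi dens cov hmean hcov psi hpsi1 orb).
  (* Any positive local limit constant serves the lower bound on the weights; the sharp planar one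
     enters through [planar_center_lower]. *)
  destruct (gaussian_sums_ge_some d phi cov dens hcov) as (gam & hgam & hgs).
  destruct (LLL gam (gam / 2) hgs ltac:(lra)) as (j0' & hj0').
  pose (c1 := gam / 2). assert (hc1 : 0 < c1) by (unfold c1; lra). fold c1 in hj0'.
  pose (j0 := Nat.max 1 j0'). assert (hj0 : (1 <= j0)%nat) by (unfold j0; lia).
  assert (hpsl : forall j, (j0 <= j)%nat -> c1 <= sqrt (INR j) ^ d * psi j (vzero d)).
  { intros j h. apply hj0'. unfold j0 in h. lia. }
  assert (vol := scale_cv_infty d theta psi cov rho hreg).
  destruct (regime_cases d theta psi cov rho hreg) as ((rho0 & Na & hrho0 & hrho) & cases).
  (* A volume above [4 ^ d] forces [L >= 4], the range of the upper bound on the weights. *)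
  destruct (cv_infty_ge _ (Rmax 1 (4 ^ d + 1)) vol) as (Nb & hvol).
  pose (N1 := Nat.max 1 (Nat.max N0 (Nat.max Na Nb))).
  assert (n1 : (1 <= N1)%nat) by (unfold N1; lia).
  assert (n0 : forall N, (N1 <= N)%nat -> (N0 <= N)%nat) by (unfold N1; intros; lia).
  assert (hrho' : forall N, (N1 <= N)%nat -> rho0 <= rho N) by (unfold N1; intros; apply hrho; lia).
  assert (hvol' : forall N, (N1 <= N)%nat -> 0 < INR N / rho N /\ 4 ^ d < INR N / rho N).
  { intros N h. assert (V := hvol N ltac:(unfold N1 in h; lia)).
    generalize (Rmax_l 1 (4 ^ d + 1)) (Rmax_r 1 (4 ^ d + 1)). lra. }
  assert (hLp : forall N, (N1 <= N)%nat -> L N ^ d = INR N / rho N).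
  { intros N h. apply Rpower_root_pow; auto. now apply hvol'. }
  assert (Lpos : forall N, 0 < L N) by (intros N; apply exp_pos).
  assert (hL4 : forall N, (N1 <= N)%nat -> 4 <= L N).
  { intros N h. left. apply (pow_le_inv _ _ d); [left; apply Lpos |]. rewrite hLp by auto. now apply hvol'. }
  assert (r01 : forall N, (N1 <= N)%nat -> 0 < r N < 1) by (intros N h; apply hr; auto).
  pose (W' := fun N => W (L N)).
  assert (sm : forall N, (N1 <= N)%nat -> ex_series (fun n => Rabs (INR n * lam (W' N) (r N) n))).
  { intros N h. apply (lam_summable (W' N) (G (L N)) (r N) (r01 N h)). intros z. now apply hG. }
  assert (mn : forall N, (N1 <= N)%nat -> INR N = Series (fun n => INR n * lam (W' N) (r N) n)).
  { intros N h. rewrite <- (proj2 (hr N (n0 N h))).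
    apply (mean_series (W' N) (G (L N)) (G1 (L N)) (r N) (r01 N h)); intros z; [now apply hG | now apply hG1]. }
  assert (cc : forall N j, (N1 <= N)%nat -> (1 <= j)%nat -> theta * L N ^ d * psi j (vzero d) <= W' N j)
    by (intros; apply hWc; auto).
  assert (c0 : forall N j, (N1 <= N)%nat -> (1 <= j)%nat -> 0 <= W' N j) by (intros; apply hW0; auto).
  assert (cu : forall N j, (N1 <= N)%nat -> (1 <= j)%nat -> W' N j <= C * (1 + L N / sqrt (INR j)) ^ d)
    by (intros; apply hWu; auto).
  assert (growth : exists Mu N2, cutoff_growth d r Mu N2 /\ cv_infty (fun N => L N ^ d / sqrt (INR (cutoff (r N))) ^ d)).
  { destruct cases as [(d1 & h1) | [(d2 & alpha & h1 & h2) | (d3 & rs & rhoc & h1 & h2 & h3)]].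
    - exists 1, N1. split. { apply cutoff_growth_low; lia. }
      eapply (saddle_growth_1 d theta C rho0 psi W' rho r L N1) with (c1 := c1) (j1 := j0); auto.
    - exists 1, N1. split. { apply cutoff_growth_low; lia. }
      destruct (planar_center_lower d theta phi psi cov alpha) as (beta & j1 & b1 & b2 & b3); auto.
      eapply (saddle_growth_2 d theta rho0 psi W' rho r L N1) with (alpha := alpha) (beta := beta) (j1 := j1); auto.
    - destruct (cutoff_bounded_3 d theta rho0 psi W' rho r L N1) with (rs := rs) (rhoc := rhoc) as (lb & N2 & b1 & b2 & b3); auto.
      exists (sqrt lb ^ d), N2. eapply (saddle_growth_3 d rho r L N1); eauto. }
  destruct growth as (Mu & N2 & hMu & hA).
  destruct (weight_upper_cutoff d C W' r L N1) with (Mu := Mu) (N2 := N2) as (N3 & h3 & hWl); auto.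
  intros eps heps.
  apply (uniform_local_limit W' (fun N => G (L N)) (fun N => G1 (L N)) (fun N => G2 (L N)) (fun N => H (L N))
    r (fun N => L N ^ d) (fun N => cutoff (r N)) jN d (theta * c1) (C * 2 ^ d * (1 + Mu)) (rho0 / (rho0 + C * 2 ^ d)) j0 N3); auto.
  - apply Rdiv_lt_0_compat; auto. assert (0 <= C * 2 ^ d) by (apply Rmult_le_pos; [lra | apply pow_le; lra]). lra.
  - now apply Rmult_lt_0_compat.
  - intros N h. assert (h' : (N1 <= N)%nat) by lia. split; [split |].
    + apply (radius_lower d C rho0 W' rho r L N1); auto.
    + now apply r01.
    + split; [now apply pow_lt | now apply cutoff_bounds, r01].
  - intros N j h hj1. apply c0; lia.
  - intros N j h hj1. assert (h' : (N1 <= N)%nat) by lia.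
    apply Rle_trans with (theta * L N ^ d * psi j (vzero d) * sqrt (INR j) ^ d).
    + replace (theta * L N ^ d * psi j (vzero d) * sqrt (INR j) ^ d) with
        (theta * L N ^ d * (sqrt (INR j) ^ d * psi j (vzero d))) by ring.
      rewrite (Rmult_comm theta c1), Rmult_assoc, (Rmult_comm c1). apply Rmult_le_compat_l; auto.
      apply Rmult_le_pos; [lra | apply pow_le; generalize (Lpos N); lra].
    + apply Rmult_le_compat_r; [apply pow_le, sqrt_pos |]. apply cc; lia.
  - intros N z _. now apply hG.
  - intros N h. apply hr. apply n0. lia.
  - intros N h. apply hj. apply n0. lia.
Qed.
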